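(* Let $A$ be a real $d\times d$ matrix, $s>\frac12$, and let $a\in\Gamma_{0,s}^\infty(\mathbf R^{2d})$. Then $\operatorname{Op}_A(a)$ is continuous on $\Sigma_s(\mathbf R^d)$, and on $\Sigma_s'(\mathbf R^d)$.
   Context: $f\lesssim g$ means $f\le Cg$ with a constant $C>0$ independent of the variables and of the multi-indices involved. **Gelfand-Shilov spaces.** For $s,h>0$ let $\|f\|_{s,h}=\sup_{\alpha,\beta\in\mathbf N^n}\sup_x|x^\beta\partial^\alpha f(x)|/(h^{|\alpha+\beta|}(\alpha!\beta!)^s)$. $\mathcal S_s(\mathbf R^n)$ (resp. $\Sigma_s(\mathbf R^n)$) consists of all $f\in C^\infty(\mathbf R^n)$ with $\|f\|_{s,h}<\infty$ for some (resp. every) $h>0$, with the inductive (resp. projective) limit topology; $\mathcal S_s'$ and $\Sigma_s'$ are their duals. For $s>\frac12$: $\mathcal S_{1/2}\subseteq\Sigma_s\subseteq\Sigma_s'\subseteq\mathcal S_{1/2}'$. **Symbol class.** $\Gamma_{0,s}^\infty(\mathbf R^{2d})$ consists of all $a\in C^\infty(\mathbf R^{2d})$ for which there is $h>0$ such that for every $\varepsilon>0$: $|\partial^\alpha a(X)|\lesssim\varepsilon^{|\alpha|}(\alpha!)^se^{h|X|^{1/s}}$ for all $\alpha\in\mathbf N^{2d}$, $X\in\mathbf R^{2d}$. (It is contained in $\mathcal S_{1/2}'(\mathbf R^{2d})$.) **Pseudo-differential operators.** For $a\in\mathcal S_{1/2}(\mathbf R^{2d})$, $$(\operatorname{Op}_A(a)f)(x)=(2\pi)^{-d}\iint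 a(x-A(x-y),\xi)f(y)e^{i\langle x-y,\xi\rangle}\,dy\,d\xi,\quad f\in\mathcal S_{1/2}(\mathbf R^d).$$ For $a\in\mathcal S_{1/2}'(\mathbf R^{2d})$, $\operatorname{Op}_A(a)$ is the continuous operator from $\mathcal S_{1/2}(\mathbf R^d)$ to $\mathcal S_{1/2}'(\mathbf R^d)$ with distribution kernel $K_{A,a}(x,y)=(2\pi)^{-d/2}(\mathscr F_2^{-1}a)(x-A(x-y),x-y)$, where $\mathscr F_2$ is the partial Fourier transform in the second $\mathbf R^d$-variable and $\mathscr Ff(\xi)=(2\pi)^{-d/2}\int f(x)e^{-i\langle x,\xi\rangle}dx$. ''Continuous on $\mathcal X$'' means that $\operatorname{Op}_A(a)$, initially defined from $\mathcal S_{1/2}(\mathbf R^d)$ to $\mathcal S_{1/2}'(\mathbf R^d)$, extends uniquely to a continuous map from $\mathcal X$ to $\mathcal X$. *)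

(* Defs.v *)
From HB Require Import structures.
From mathcomp Require Import all_boot all_order all_algebra.
From mathcomp Require Import complex.
From mathcomp Require Import all_classical all_reals all_analysis.

Set Implicit Arguments.
Unset Strict Implicit.
Unset Printing Implicit Defensive.

Import Order.TTheory GRing.Theory Num.Theory.
Import numFieldNormedType.Exports.

Local Open Scope classical_set_scope.
Local Open Scope ring_scope.

(* Points of R^n are row vectors 'rV[R]_n, so that x |-> A x reads x *m A^T;
   points (x, xi) of R^(2d) have type 'rV[R]_(d + d). *)

HB.instance Definition _ (R : realType) := NormedModule.copy R[i] (R[i]^o).

Definition expi (R : realType) (t : R) : R[i] := Complex (cos t) (sin t).

Section lebesgue_tuple.
Variable R : realType.

Section cons.
Variables (n : nat) (mu : {sigma_finite_measure set (n.-tuple R) -> \bar R}).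

Definition tuple_cons (p : R * n.-tuple R) : n.+1.-tuple R :=
  [tuple of p.1 :: p.2].

Let tuple_uncons (t : n.+1.-tuple R) : R * n.-tuple R :=
  (thead t, [tuple of behead t]).

Lemma measurable_tuple_cons : measurable_fun setT tuple_cons.
Proof. by apply: measurable_cons; [exact: measurable_fst|exact: measurable_snd]. Qed.

Let measurable_tuple_uncons : measurable_fun setT tuple_uncons.
Proof.
apply/measurable_fun_pairP; split; first exact: measurable_tnth.
exact: measurable_behead.
Qed.

Let tuple_consK : cancel tuple_cons tuple_uncons.
Proof. by move=> [x t]; rewrite /tuple_uncons theadE; congr (_, _); exact/val_inj. Qed.

Definition lebesgue_cons : set (n.+1.-tuple R) -> \bar R :=
  pushforward (lebesgue_measure \x mu)%E tuple_cons.

Let lebesgue_cons0 : lebesgue_cons set0 = 0%E.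
Proof. by rewrite /lebesgue_cons /pushforward preimage_set0 measure0. Qed.

Let lebesgue_cons_ge0 A : (0 <= lebesgue_cons A)%E.
Proof. by rewrite /lebesgue_cons /pushforward; exact: measure_ge0. Qed.

Let lebesgue_cons_sigma_additive : semi_sigma_additive lebesgue_cons.
Proof.
move=> F mF tF mUF; rewrite /lebesgue_cons /pushforward preimage_bigcup.
have mcons A : measurable A -> measurable (tuple_cons @^-1` A).
  by move=> mA; rewrite -[X in measurable X]setTI; exact: measurable_tuple_cons.
apply: measure_semi_sigma_additive.
- by move=> i; exact: mcons.
- apply/trivIsetP => /= i j _ _ ij; rewrite -preimage_setI.
  by move/trivIsetP : tF => /(_ _ _ _ _ ij) ->//; rewrite preimage_set0.
- by rewrite -preimage_bigcup; exact: mcons.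
Qed.

HB.instance Definition _ := isMeasure.Build _ _ _ lebesgue_cons
  lebesgue_cons0 lebesgue_cons_ge0 lebesgue_cons_sigma_additive.

Let lebesgue_cons_sigma_finite : sigma_finite setT lebesgue_cons.
Proof.
have /sigma_finiteP[F [TF ndF Foo]] := sigma_finiteT (@lebesgue_measure R).
have /sigma_finiteP[G [TG ndG Goo]] := sigma_finiteT mu.
exists (fun k => tuple_uncons @^-1` (F k `*` G k)).
  rewrite -preimage_bigcup; apply/esym; rewrite -(preimage_setT tuple_uncons).
  congr (_ @^-1` _); rewrite -setXTT TF TG predeqE => -[x y]; split.
    by move=> [k _ []/= ? ?]; split; exists k.
  move=> [/= [k _ Fkx] [l _ Gly]]; exists (maxn k l) => //; split.
  - by move: x Fkx; exact/subsetPset/ndF/leq_maxl.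
  - by move: y Gly; exact/subsetPset/ndG/leq_maxr.
move=> k; have [mF Fk] := Foo k; have [mG Gk] := Goo k; split.
  rewrite -[X in measurable X]setTI; apply: measurable_tuple_uncons => //.
  exact: measurableX.
rewrite /lebesgue_cons /pushforward -comp_preimage.
rewrite (_ : tuple_uncons \o tuple_cons = id); last exact/funext.
by rewrite preimage_id product_measure1E// lte_mul_pinfty// ge0_fin_numE.
Qed.

HB.instance Definition _ := Measure_isSigmaFinite.Build _ _ _ lebesgue_cons
  lebesgue_cons_sigma_finite.

End cons.

(* Lebesgue measure on R^n, as the n-fold product of lebesgue_measure. *)
Fixpoint lebesgue_tuple (n : nat) :
    {sigma_finite_measure set (n.-tuple R) -> \bar R} :=
  match n with
  | 0 => \d_([tuple] : 0.-tuple R)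
  | m.+1 => lebesgue_cons (lebesgue_tuple m)
  end.

End lebesgue_tuple.

Section multi_index_calculus.
Variables (R : realType) (n : nat).
Implicit Types (u v : 'rV[R]_n -> R) (f g : 'rV[R]_n -> R[i]).
Implicit Types (s h : R) (c : R[i]) (al be : 'I_n -> nat) (x : 'rV[R]_n).

Definition integral_rV f : R[i] :=
  let int u := (\int[lebesgue_tuple R n]_(t in setT) u (\row_i tnth t i))%R in
  Complex (int (@complex.Re R \o f)) (int (@complex.Im R \o f)).

Definition dotrV (x y : 'rV[R]_n) : R := \sum_j x 0 j * y 0 j.

Definition enorm x : R := Num.sqrt (dotrV x x).

Definition basis_rV (j : 'I_n) : 'rV[R]_n := delta_mx 0 j.

(* partials [:: j1; ...; jk] u = d_j1 ... d_jk u *)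
Definition partials (js : seq 'I_n) u : 'rV[R]_n -> R :=
  foldr (fun j v x => 'D_(basis_rV j) v x) u js.

(* C^oo: all iterated partial derivatives, in any order, exist and are
   continuous. *)
Definition smooth_real u := forall js : seq 'I_n,
  continuous (partials js u) /\
  forall j x, derivable (partials js u) x (basis_rV j).

Definition smooth f :=
  smooth_real (@complex.Re R \o f) /\ smooth_real (@complex.Im R \o f).

Definition mlength al : nat := (\sum_j al j)%N.

Definition mfact al : nat := (\prod_j (al j)`!)%N.

Definition mpow be x : R := \prod_j x 0 j ^+ be j.

Definition mderiv_real al u : 'rV[R]_n -> R :=
  partials (flatten [seq nseq (al j) j | j <- enum 'I_n]) u.

Definition mderiv al f x : R[i] :=
  Complex (mderiv_real al (@complex.Re R \o f) x)
          (mderiv_real al (@complex.Im R \o f) x).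

Definition gs_norm (s h : R) f : \bar R :=
  ereal_sup [set y | exists al be x,
    y = (Normc.normc ((mpow be x)%:C%C * mderiv al f x) /
         (h ^+ (mlength al + mlength be) *
          (mfact al * mfact be)%:R `^ s))%:E].

Lemma partials_lin js a u v : smooth_real u -> smooth_real v ->
  partials js (a *: u + v) = a *: partials js u + partials js v.
Proof.
move=> su sv; elim: js => //= j js ->; apply/funext => x.
have [_ du] := su js; have [_ dv] := sv js.
by rewrite deriveD ?deriveZ //; exact: derivableZ.
Qed.

Lemma smooth_real_lin a u v : smooth_real u -> smooth_real v ->
  smooth_real (a *: u + v).
Proof.
move=> su sv js; rewrite partials_lin //.
have [cu du] := su js; have [cv dv] := sv js; split.
  by move=> x; apply: continuousD; [exact: cvgZl_tmp (cu x)|exact: cv].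
by move=> j x; apply: derivableD => //; exact: derivableZ.
Qed.

Lemma Re_lin c f g : @complex.Re R \o (c *: f + g) =
  complex.Re c *: (@complex.Re R \o f) +
    ((- complex.Im c) *: (@complex.Im R \o f) + (@complex.Re R \o g)).
Proof.
apply/funext => x /=; rewrite !fctE /=.
case: c (f x) (g x) => [a b] [p q] [r t] /=.
by rewrite /GRing.scale /= mulNr addrA.
Qed.

Lemma Im_lin c f g : @complex.Im R \o (c *: f + g) =
  complex.Re c *: (@complex.Im R \o f) +
    (complex.Im c *: (@complex.Re R \o f) + (@complex.Im R \o g)).
Proof.
apply/funext => x /=; rewrite !fctE /=.
case: c (f x) (g x) => [a b] [p q] [r t] /=.
by rewrite /GRing.scale /= addrA.
Qed.

Lemma smooth_lin c f g : smooth f -> smooth g -> smooth (c *: f + g).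
Proof.
move=> [rf mf] [rg mg]; split.
  by rewrite Re_lin; do 2 apply: smooth_real_lin => //.
by rewrite Im_lin; do 2 apply: smooth_real_lin => //.
Qed.

Lemma mderiv_lin al c f g : smooth f -> smooth g ->
  mderiv al (c *: f + g) = c *: mderiv al f + mderiv al g.
Proof.
move=> [rf mf] [rg mg]; apply/funext => x.
rewrite /mderiv Re_lin Im_lin /mderiv_real !partials_lin //;
  try exact: smooth_real_lin.
rewrite !fctE /= /mderiv; case: c => a b; rewrite /GRing.scale /= addrA addrA.
by rewrite mulNr.
Qed.

Lemma smooth0 : smooth 0.
Proof.
suff s0 : smooth_real 0 by split.
move=> js.
have -> : partials js 0 = 0.
  elim: js => //= j js ->; apply/funext => x.
  exact: derive_cst.
split=> [|j x]; first exact: cst_continuous.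
exact: derivable_cst.
Qed.


Let gs_term s h f al be x : R :=
  Normc.normc ((mpow be x)%:C%C * mderiv al f x) /
  (h ^+ (mlength al + mlength be) * (mfact al * mfact be)%:R `^ s).

Let gs_norm_ub s h f al be x : ((gs_term s h f al be x)%:E <= gs_norm s h f)%E.
Proof. by apply: ereal_sup_ubound; exists al, be, x. Qed.

Let normc_ge0 (z : R[i]) : 0 <= Normc.normc z.
Proof. by case: z => a b /=; exact: sqrtr_ge0. Qed.

Let den_ge0 (s h : R) (al be : 'I_n -> nat) : 0 <= h ->
  0 <= h ^+ (mlength al + mlength be) * (mfact al * mfact be)%:R `^ s.
Proof. by move=> h0; rewrite mulr_ge0 ?exprn_ge0 ?powR_ge0. Qed.

Lemma gs_norm_ge0 s h f : 0 <= h -> (0 <= gs_norm s h f)%E.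
Proof.
move=> h0; apply: le_trans (gs_norm_ub s h f (fun=> 0%N) (fun=> 0%N) 0).
by rewrite lee_fin divr_ge0 ?den_ge0.
Qed.

Lemma gs_norm_lin s h c f g : 0 <= h -> smooth f -> smooth g ->
  (gs_norm s h (c *: f + g)%R <=
   (Normc.normc c)%:E * gs_norm s h f + gs_norm s h g)%E.
Proof.
move=> h0 sf sg; apply: ge_ereal_sup => _ [al] [be] [x] ->.
rewrite mderiv_lin //.
apply: (@le_trans _ _ ((Normc.normc c)%:E * (gs_term s h f al be x)%:E +
  (gs_term s h g al be x)%:E)%E); last first.
  by apply: leeD => //; apply: lee_wpmul2l => //; rewrite lee_fin.
rewrite -EFinM -EFinD lee_fin /gs_term mulrA -mulrDl.
apply: ler_wpM2r; first by rewrite invr_ge0 den_ge0.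
set m := (mpow be x)%:C%C.
have -> : m * (c *: mderiv al f + mderiv al g) x =
    c * (m * mderiv al f x) + m * mderiv al g x.
  by rewrite mulrCA -mulrDr.
by rewrite -Normc.normcM; exact: le_normcD.
Qed.

Lemma gs_normD s h f g : 0 <= h -> smooth f -> smooth g ->
  (gs_norm s h (f + g)%R <= gs_norm s h f + gs_norm s h g)%E.
Proof.
move=> h0 sf sg; have := gs_norm_lin s 1 h0 sf sg.
by rewrite scale1r Normc.normc1 mul1e.
Qed.

Lemma gs_norm0 s h : gs_norm s h 0 = 0%E.
Proof.
apply/eqP; rewrite eq_le; apply/andP; split.
  apply: ge_ereal_sup => _ [al] [be] [x] ->.
  have -> : mderiv al 0 x = 0.
    have := mderiv_lin al (- 1) smooth0 smooth0.
    by rewrite scaler0 addr0 scaleN1r addNr => ->.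
  by rewrite mulr0 Normc.normc0 mul0r.
apply: le_trans (gs_norm_ub s h 0 (fun=> 0%N) (fun=> 0%N) 0).
rewrite lee_fin /gs_term divr_ge0 //.
rewrite mulr_ge0 ?powR_ge0//.
by rewrite /mlength big1 // addn0 expr0.
Qed.

Lemma gs_norm_le s h1 h2 f : 0 < h1 -> h1 <= h2 ->
  (gs_norm s h2 f <= gs_norm s h1 f)%E.
Proof.
move=> h0 h12; apply: ge_ereal_sup => _ [al] [be] [x] ->.
apply: le_trans (gs_norm_ub s h1 f al be x).
have h20 := lt_le_trans h0 h12.
have F0 : 0 < (mfact al * mfact be)%:R :> R.
  by rewrite ltr0n muln_gt0 !prodn_gt0 // => ?; rewrite fact_gt0.
rewrite lee_fin /gs_term ler_wpM2l // lef_pV2 ?posrE ?mulr_gt0 ?exprn_gt0 ?powR_gt0 //.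
by rewrite ler_pM2r ?powR_gt0 // lerXn2r // nnegrE ltW.
Qed.

End multi_index_calculus.

Section spaces.
Variables (R : realType) (s : R) (n : nat).

(* GS and Sigma are the spaces S_s(R^n) and Sigma_s(R^n). *)
Definition GS : set ('rV[R]_n -> R[i]) :=
  [set f | smooth f /\ exists2 h, 0 < h & (gs_norm s h f < +oo)%E].

Definition Sigma : {pred 'rV[R]_n -> R[i]} :=
  [pred f | `[< smooth f /\ forall h, 0 < h -> (gs_norm s h f < +oo)%E >]].

Lemma Sigma_submod_closed : submod_closed Sigma.
Proof.
split=> [|c f g /asboolP[sf ff] /asboolP[sg fg]]; apply/asboolP; split.
- exact: smooth0.
- by move=> h h0; rewrite gs_norm0 ltry.
- exact: smooth_lin.
move=> h h0; apply: le_lt_trans (gs_norm_lin s c (ltW h0) sf sg) _.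
rewrite lte_add_pinfty ?fg //.
rewrite lte_mul_pinfty ?ff //.
by rewrite lee_fin; case: (c) => a b; exact: sqrtr_ge0.
Qed.

HB.instance Definition _ :=
  GRing.isSubmodClosed.Build R[i] ('rV[R]_n -> R[i]) Sigma Sigma_submod_closed.

Record SigmaType := MkSigma {
  Sigma_fun :> 'rV[R]_n -> R[i] ;
  _ : Sigma_fun \in Sigma }.

HB.instance Definition _ := [isSub for Sigma_fun].
HB.instance Definition _ := [Choice of SigmaType by <:].
HB.instance Definition _ := [SubChoice_isSubLmodule of SigmaType by <:].

Let Sigma_smooth (f : SigmaType) : smooth f.
Proof. by case: f => f /= /asboolP[]. Qed.

Let Sigma_fin (f : SigmaType) h : 0 < h -> gs_norm s h f \is a fin_num.
Proof.
move=> h0; rewrite ge0_fin_numE ?gs_norm_ge0 ?ltW //.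
by case: f => f /= /asboolP[_]; exact.
Qed.

(* Projective limit topology: the norms gs_norm s h decrease with h
   (gs_norm_le), so the balls of the single norms form a base. *)
Definition Sigma_nbhs (f : SigmaType) : set_system SigmaType :=
  filter_from [set p : R * R | 0 < p.1 /\ 0 < p.2]
    (fun p => [set g | (gs_norm s p.1 (g - f)%R < p.2%:E)%E]).

HB.instance Definition _ := hasNbhs.Build SigmaType Sigma_nbhs.

Let Sigma_nbhs_filter (f : SigmaType) : ProperFilter (nbhs f).
Proof.
apply: filter_from_proper; last first.
  by move=> [h e] /= [h0 e0]; exists f => /=; rewrite subrr gs_norm0 lte_fin.
apply: filter_from_filter; first by exists (1, 1) => /=.
move=> [h e] [k d] /= [h0 e0] [k0 d0]; exists (Num.min h k, Num.min e d) => /=.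
  by rewrite !lt_min h0 k0 e0 d0.
have m0 : 0 < Num.min h k by rewrite lt_min h0 k0.
move=> g /= gfe; split; apply: le_lt_trans (lt_le_trans gfe _).
- by apply: gs_norm_le => //; rewrite ge_min lexx.
- by rewrite lee_fin ge_min lexx.
- by apply: gs_norm_le => //; rewrite ge_min lexx orbT.
- by rewrite lee_fin ge_min lexx orbT.
Qed.

Let Sigma_nbhs_singleton (f : SigmaType) (A : set SigmaType) : nbhs f A -> A f.
Proof.
by move=> [[h e] /= [h0 e0]]; apply => /=; rewrite subrr gs_norm0 lte_fin.
Qed.

Let Sigma_nbhs_nbhs (f : SigmaType) (A : set SigmaType) :
  nbhs f A -> nbhs f (nbhs^~ A).
Proof.
move=> [[h e] /= [h0 e0] heA]; exists (h, e) => //= g /= gfe.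
have gfin : gs_norm s h (g - f)%R \is a fin_num := Sigma_fin (g - f : SigmaType) h0.
exists (h, e - fine (gs_norm s h (g - f)%R)) => /=.
  by split => //; rewrite subr_gt0 -lte_fin fineK.
move=> k /= kgd; apply: heA => /=.
have -> : Sigma_fun k - Sigma_fun f = (Sigma_fun k - g) + (Sigma_fun g - f).
  by rewrite addrA subrK.
apply: le_lt_trans (gs_normD s (ltW h0) (Sigma_smooth (k - g : SigmaType))
  (Sigma_smooth (g - f : SigmaType))) _.
by rewrite -(fineK gfin) -lteBrDr.
Qed.

HB.instance Definition _ := Nbhs_isNbhsTopological.Build SigmaType
  Sigma_nbhs_filter Sigma_nbhs_singleton Sigma_nbhs_nbhs.

End spaces.

Section strong_dual.
Variables (R : realType) (E : preTopologicalLmodType R[i]).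

(* von Neumann boundedness: B is absorbed by every neighborhood of 0 *)
Definition vn_bounded (B : set E) := forall U : set E, nbhs 0 U ->
  exists2 r : R, 0 < r & forall c : R[i], r <= Normc.normc c ->
    B `<=` [set c *: x | x in U].

Definition cont_functional : {pred E -> R[i]} :=
  [pred u | `[< (forall c x y, u (c *: x + y) = c * u x + u y) /\
                continuous (u : E -> R[i]) >]].

Lemma cont_functional_submod_closed : submod_closed cont_functional.
Proof.
split=> [|c u v /asboolP[lu cu] /asboolP[lv cv]]; apply/asboolP; split.
- by move=> c x y /=; rewrite mulr0 addr0.
- by move=> x; exact: cst_continuous.
- move=> a x y; rewrite !fctE lu lv /GRing.scale /= !mulrDr mulrCA.
  by rewrite -!addrA; congr (_ + _); rewrite addrCA.
by move=> x; apply: cvgD; [exact: cvgZl_tmp (cu x)|exact: cv].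
Qed.

HB.instance Definition _ := GRing.isSubmodClosed.Build R[i] (E -> R[i])
  cont_functional cont_functional_submod_closed.

Record dual := MkDual {
  dual_fun :> E -> R[i] ;
  _ : dual_fun \in cont_functional }.

HB.instance Definition _ := [isSub for dual_fun].
HB.instance Definition _ := [Choice of dual by <:].
HB.instance Definition _ := [SubChoice_isSubLmodule of dual by <:].

(* Strong topology: uniform convergence on bounded sets *)
HB.instance Definition _ := Topological.copy dual
  (initial_topology (dual_fun : dual -> {family vn_bounded, E -> R[i]})).

End strong_dual.

Section symbols.
Variables (R : realType) (n : nat).

Definition Gamma0_infty (s : R) (a : 'rV[R]_n -> R[i]) : Prop :=
  smooth a /\
  exists2 h : R, 0 < h & forall e : R, 0 < e ->
    exists2 C : R, 0 < C & forall (al : 'I_n -> nat) (X : 'rV[R]_n),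
      Normc.normc (mderiv al a X) <=
      C * (e ^+ mlength al * (mfact al)%:R `^ s *
           expR (h * enorm X `^ s^-1)).

(* Elements of S_(1/2)'(R^n) are represented by functionals on all functions
   R^n -> C; only their values on S_(1/2)(R^n) are meaningful. *)
Definition functional := ('rV[R]_n -> R[i]) -> R[i].

Definition pairing (f : 'rV[R]_n -> R[i]) : functional :=
  fun phi => integral_rV (fun x => f x * phi x).

(* <u o M, phi> = |det M|^-1 <u, phi o M^-1>, for M invertible *)
Definition pullback (M : 'M[R]_n) (u : functional) : functional :=
  fun phi => (`|\det M|^-1)%:C%C * u (fun X => phi (X *m invmx M)).

End symbols.

Section pseudo_differential_operators.
Variables (R : realType) (d : nat).

Definition pi_factor : R[i] := ((2 * pi) `^ (- (d%:R / 2)))%:C%C.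

Definition F2_inv (phi : 'rV[R]_(d + d) -> R[i]) : 'rV[R]_(d + d) -> R[i] :=
  fun X => pi_factor *
    integral_rV (fun xi : 'rV[R]_d =>
      phi (row_mx (lsubmx X) xi) * expi (dotrV (rsubmx X) xi)).

Definition F2_inv_dist (u : functional R (d + d)) : functional R (d + d) :=
  fun phi => u (F2_inv phi).

(* the matrix of (x, y) |-> (x - A (x - y), x - y), see mul_kernel_mx *)
Definition kernel_mx (A : 'M[R]_d) : 'M[R]_(d + d) :=
  block_mx (1%:M - A^T) 1%:M A^T (- 1%:M).

Lemma mul_kernel_mx (A : 'M[R]_d) (x y : 'rV[R]_d) :
  row_mx x y *m kernel_mx A = row_mx (x - (x - y) *m A^T) (x - y).
Proof.
rewrite mul_row_block mulmxBr !mulmx1 mulmxN mulmx1 mulmxBl.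
by rewrite opprB addrA addrAC.
Qed.

Lemma kernel_mx_unit (A : 'M[R]_d) : kernel_mx A \in unitmx.
Proof.
have /mulmx1_unit[] // :
  kernel_mx A *m block_mx 1%:M 1%:M A^T (A^T - 1%:M) = 1%:M.
rewrite mulmx_block !mulmx1 !mul1mx !mulNmx !mul1mx [RHS]scalar_mx_block.
congr block_mx; first by rewrite subrK.
- by rewrite addrA subrK subrr.
- by rewrite subrr.
- by rewrite opprB addrCA subrr addr0.
Qed.

Definition kernel_dist (A : 'M[R]_d) (a : functional R (d + d)) :
    functional R (d + d) :=
  fun Phi => pi_factor * pullback (kernel_mx A) (F2_inv_dist a) Phi.

(* <Op_A(a) f, g> = <K_(A,a), g (x) f> *)
Definition Op (A : 'M[R]_d) (a : functional R (d + d)) (f : 'rV[R]_d -> R[i]) :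
    functional R d :=
  fun g => kernel_dist A a (fun Z => g (lsubmx Z) * f (rsubmx Z)).

End pseudo_differential_operators.

Section extensions.
Variables (R : realType) (s : R) (d : nat).
Variable P : ('rV[R]_d -> R[i]) -> functional R d.

Local Notation S12 := (GS (2^-1 : R) (n := d)).
Local Notation Sig := (SigmaType s d).

(* T f = P f in S_(1/2)', for f in S_(1/2), a subspace of Sigma_s if s > 1/2 *)
Definition extends_to_Sigma (T : Sig -> Sig) : Prop :=
  forall f : Sig, S12 f -> forall g, S12 g -> pairing (T f) g = P f g.

(* Same, with f in S_(1/2) identified with the element u of Sigma_s' it
   defines. *)
Definition extends_to_dual (T : dual Sig -> dual Sig) : Prop :=
  forall f, S12 f ->
  forall u : dual Sig, (forall phi : Sig, u phi = pairing f phi) ->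
  forall g : Sig, S12 g -> T u g = P f g.

End extensions.

Definition extends_uniquely (R : realType) (E : preTopologicalLmodType R[i])
    (extends : (E -> E) -> Prop) : Prop :=
  exists T : {linear E -> E},
    [/\ continuous T, extends T &
        forall T' : E -> E, continuous T' -> extends T' -> T' =1 T].

Definition continuous_on_Sigma (R : realType) (s : R) (d : nat)
    (P : ('rV[R]_d -> R[i]) -> functional R d) : Prop :=
  extends_uniquely (extends_to_Sigma (s := s) P).

Definition continuous_on_Sigma_dual (R : realType) (s : R) (d : nat)
    (P : ('rV[R]_d -> R[i]) -> functional R d) : Prop :=
  extends_uniquely (extends_to_dual (s := s) P).

(* Main.v *)
(** Gelfand-Shilov bounds are rewritten as bounds |w f(x)| <= C h^|w| (|w|!)^s
    over words w in the operators d/dx_i and x_j, which for s > 1/2 absorb the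
    commutators [d/dx_j, x_j] = 1. In this form such bounds pass through products
    and partial Fourier transforms, also with a weight exp(q |x|^(1/s)). As f in
    Sigma_s decays faster than every exp(- q |y|^(1/s)), multiplication by f(y)
    tames the growth of the amplitude a(x - A(x - y), xi) in y; the partial
    Fourier transform in y then decays equally fast in xi, which tames the growth
    in xi, and the Fourier transform in xi gives Op_A(a) f with the seminorm
    estimates. The transposed operator has the same shape, with x and y exchanged
    and the opposite phase, so its adjoint is the extension to Sigma_s'.

    Uniqueness is density of S_(1/2) in Sigma_s and in the strong dual. Both follow
    from operators K of finite rank, with Gaussian times polynomial factors, such
    that |phi - K phi|_h <= eps |phi|_h': first approximate phi by
    exp(- |nu x|^2) times its convolution with a Gaussian of width mu, then expand
    the factor exp(2 <x, y> / mu^2) of the kernel in its Taylor series. *)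

Require Import Defs.
From HB Require Import structures.
From mathcomp Require Import all_boot all_order all_algebra.
From mathcomp Require Import complex.
From mathcomp Require Import all_classical all_reals all_analysis.
From mathcomp Require Import measurable_realfun.
From mathcomp Require Import ring lra.
Set Implicit Arguments.
Unset Strict Implicit.
Unset Printing Implicit Defensive.
Import Order.TTheory GRing.Theory Num.Theory.
Import numFieldNormedType.Exports.
Local Open Scope classical_set_scope.
Local Open Scope ring_scope.

(** * Partial derivatives of smooth functions *)

Section partial_calculus.
Variables (R : realType) (n : nat).
Implicit Types (u : 'rV[R]_n -> R) (x y v : 'rV[R]_n).

Local Notation e_ j := (basis_rV R j).

(** Words are preferred to multi-indices because a letter applied to f gives a function of the same
    class with the offset [p] raised by one; every estimate is then an induction on a word. Each
    step multiplies h by a constant. This is harmless, since the symbol and Sigma_s have bounds for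
    every h, and the decay rate obtained from h tends to infinity as h tends to 0; the growth rate q
    of the symbol does not depend on h. The integral over x, xi, y together need not converge
    absolutely. Only the integration in y produces decay in xi, and this fixes the order of
    integration in every Fubini argument. In the density part the cutoff is there because the
    convolution kernel does not decay along x = y. With it the quadratic form in the exponent is
    negative definite, and the room left makes the Taylor remainders decay geometrically. In the
    bound on phi - K phi, h' is fixed before eps, so the bound is uniform on bounded sets: for a
    functional u, the functionals u o K tend to u in the strong dual, and each is given by a
    function in S_(1/2). *)

Lemma line_quotient u x v (s : R) :
  (fun h : R => h^-1 *: (((fun t : R => u (x + t *: v)) \o shift s) (h *: 1)
     - u (x + s *: v))) =
  (fun h => h^-1 *: ((u \o shift (x + s *: v)) (h *: v) - u (x + s *: v))).
Proof.
apply/funext => h; congr (_ *: (u _ - _)) => /=.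
by rewrite [h *: 1]mulr1 scalerDl addrCA.
Qed.

Lemma line_derivable u x v (s : R) :
  derivable (fun t : R => u (x + t *: v)) s 1 = derivable u (x + s *: v) v.
Proof. by rewrite /derivable line_quotient. Qed.

Lemma line_derive u x v (s : R) :
  'D_1 (fun t : R => u (x + t *: v)) s = 'D_v u (x + s *: v).
Proof. by rewrite /derive line_quotient. Qed.

Lemma mvt_line u x v (t : R) : (forall s : R, derivable u (x + s *: v) v) ->
  exists2 c, `|c| <= `|t| & u (x + t *: v) - u x = t * 'D_v u (x + c *: v).
Proof.
move=> du; pose f s := u (x + s *: v).
have df (s : R) : is_derive s 1 f ('D_v u (x + s *: v)).
  by rewrite -line_derive; apply: derivableP; rewrite line_derivable.
have cf : continuous f.
  by move=> s; apply: differentiable_continuous; apply/derivable1_diffP; case: (df s).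
have [t0|t0] := leP 0 t.
  have [|c] := MVT_segment t0 (fun s _ => df s).
    exact: continuous_subspaceT.
  rewrite in_itv /= => /andP[c0 ct].
  rewrite /f scale0r addr0 subr0 mulrC => ->; exists c => //.
  by rewrite !ger0_norm.
have [|c] := MVT_segment (ltW t0) (fun s _ => df s).
  exact: continuous_subspaceT.
rewrite in_itv /= => /andP[ct c0].
rewrite /f scale0r addr0 sub0r => h; exists c.
  by rewrite !ler0_norm ?lerN2 // ltW.
by apply: oppr_inj; rewrite opprB h mulrN mulrC.
Qed.

Definition interp x y (k : nat) : 'rV[R]_n :=
  \row_i if (i < k)%N then y 0 i else x 0 i.

Lemma interpS x y (k : 'I_n) :
  interp x y k.+1 = interp x y k + (y 0 k - x 0 k) *: e_ k.
Proof.
apply/rowP => i; rewrite /basis_rV !mxE ltnS leq_eqVlt eqxx /=.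
have [->|ik] := eqVneq i k; first by rewrite eqxx ltnn mulr1 addrC subrK.
by rewrite mulr0 addr0 (inj_eq val_inj) (negbTE ik).
Qed.

(* One mean value theorem for each edge of a path from x to y along the axes. *)
Lemma mvt_box u x y : (forall j z, derivable u z (e_ j)) ->
  exists2 p : 'I_n -> 'rV[R]_n,
    forall k i, `|p k 0 i - x 0 i| <= `|y 0 i - x 0 i| &
    u y - u x = \sum_k (y 0 k - x 0 k) * 'D_(e_ k) u (p k).
Proof.
move=> du.
have step (k : 'I_n) : exists q : 'rV[R]_n,
    (forall i, `|q 0 i - x 0 i| <= `|y 0 i - x 0 i|) /\
    u (interp x y k.+1) - u (interp x y k) = (y 0 k - x 0 k) * 'D_(e_ k) u q.
  have [c cle ce] := @mvt_line u (interp x y k) (e_ k) (y 0 k - x 0 k)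
    (fun s => du k _).
  exists (interp x y k + c *: e_ k); split; last by rewrite interpS ce.
  move=> i; rewrite /basis_rV !mxE eqxx /=.
  have [->|ik] := eqVneq i k.
    by rewrite ltnn mulr1 addrAC subrr add0r.
  by rewrite mulr0 addr0; case: ifP => // _; rewrite subrr normr0.
exists (fun k => projT1 (cid (step k))) => [k i|].
  by have [] := projT2 (cid (step k)).
have tele : \sum_(k < n) (u (interp x y k.+1) - u (interp x y k)) = u y - u x.
  rewrite -(big_mkord xpredT (fun k => u (interp x y k.+1) - u (interp x y k))).
  rewrite telescope_sumr // /interp; congr (u _ - u _); apply/rowP => i;
  by rewrite !mxE // ltn_ord.
rewrite -tele; apply: eq_bigr => k _.
by have [] := projT2 (cid (step k)).
Qed.

Lemma ball_rowP x (e : R) y : 0 < e ->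
  (forall i, `|y 0 i - x 0 i| < e) -> ball x e y.
Proof.
move=> e0 h; rewrite -ball_normE /= [ltLHS]/Num.Def.normr/= mx_normrE.
apply/bigmax_ltP; split=> // -[i j] _ /=.
by rewrite !mxE ord1 distrC.
Qed.

Lemma row_norm_coord x i : `|x 0 i| <= `|x|.
Proof.
rewrite [leRHS]/Num.Def.normr/= mx_normrE.
by apply/bigmax_geP; right; exists (0, i).
Qed.

(** [smooth] speaks of coordinate directions only; this gives all directions. The points of
    [mvt_box] lie within |h| |v| of x, so continuity of the partial derivatives at x gives the
    limit. *)
Lemma dir_derive u x v : (forall j z, derivable u z (e_ j)) ->
  (forall j, {for x, continuous ('D_(e_ j) u)}) ->
  is_derive x v u (\sum_j v 0 j * 'D_(e_ j) u x).
Proof.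
move=> du cu.
set l := (X in is_derive _ _ _ X).
suff h : h^-1 *: (u (h *: v + x) - u x) @[h --> 0^'] --> l.
  apply: DeriveDef; last exact/cvg_lim.
  by apply/cvg_ex; exists l.
have key : forall h : R, exists p : 'I_n -> 'rV[R]_n,
    (forall k i, `|p k 0 i - x 0 i| <= `|h| * `|v|) /\
    (h != 0 -> h^-1 *: (u (h *: v + x) - u x) = \sum_k v 0 k * 'D_(e_ k) u (p k)).
  move=> h; have [p p1 p2] := mvt_box x (h *: v + x) du.
  exists p; split=> [k i|h0].
    apply: le_trans (p1 k i) _; rewrite !mxE addrK normrM ler_wpM2l //.
    exact: row_norm_coord.
  rewrite p2 scaler_sumr; apply: eq_bigr => k _.
  by rewrite !mxE addrK /GRing.scale /= !mulrA mulVf // mul1r.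
pose p h := projT1 (cid (key h)).
have pP h := projT2 (cid (key h)).
apply: (@cvg_trans _ (\sum_k v 0 k * 'D_(e_ k) u (p h k) @[h --> 0^'])).
  apply: near_eq_cvg; near=> h; symmetry.
  have [_ ->] := pP h => //.
  by near: h; exact: nbhs_dnbhs_neq.
rewrite /l; apply: cvg_big => [|k _]; first exact: add_continuous.
apply: cvgMl_tmp.
apply: (@cvg_comp _ _ _ (p ^~ k) ('D_(e_ k) u) _ (nbhs x)); last exact: cu.
apply/cvg_ballP => e e0.
have d0 : 0 < e / (`|v| + 1) by rewrite divr_gt0 // ltr_wpDl.
near=> h; apply: ball_rowP => // i; have [h1 _] := pP h.
apply: le_lt_trans (h1 k i) _.
apply: (@le_lt_trans _ _ (`|h| * (`|v| + 1))); first by rewrite ler_wpM2l // lerDl.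
rewrite -ltr_pdivlMr; last by rewrite ltr_wpDl.
by near: h; exact: dnbhs0_lt.
Unshelve. all: by end_near.
Qed.

(** By [mvt_box], |u(y) - u(x)| is at most n B times the largest |y_i - x_i|. This will give
    continuity of parameter integrals from mere local bounds on their derivatives. *)
Lemma locally_bounded_partials_continuous u x :
  (forall j z, derivable u z (e_ j)) ->
  (exists2 B : R, 0 <= B & \forall z \near x, forall j, `|'D_(e_ j) u z| <= B) ->
  {for x, continuous u}.
Proof.
move=> du [B B0 /nbhs_ballP[d /= d0 dB]].
rewrite /continuous_at; apply/(cvgrPdist_lt (F := nbhs x)) => e e0.
have N0 : 0 < n%:R * B + 1 by rewrite ltr_wpDl // mulr_ge0.
apply/nbhs_ballP; exists (Num.min d (e / (n%:R * B + 1))) => /=.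
  by rewrite lt_min d0 divr_gt0.
move=> y yd.
have yi i : `|y 0 i - x 0 i| < Num.min d (e / (n%:R * B + 1)).
  move: yd; rewrite -ball_normE /= => yd; rewrite distrC.
  by apply: le_lt_trans yd; have := row_norm_coord (x - y) i; rewrite !mxE.
have [p p1 p2] := mvt_box x y du.
rewrite distrC p2; apply: le_lt_trans (ler_norm_sum _ _ _) _.
apply: (@le_lt_trans _ _ (\sum_(k < n) (e / (n%:R * B + 1)) * B)).
  apply: ler_sum => k _; rewrite normrM ler_pM //.
    by apply: ltW; apply: lt_le_trans (yi k) _; rewrite ge_min lexx orbT.
  apply: dB; apply: ball_rowP => // i; apply: le_lt_trans (p1 k i) _.
  by apply: lt_le_trans (yi i) _; rewrite ge_min lexx.
rewrite sumr_const card_ord -[ltLHS]mulr_natl.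
have -> : n%:R * (e / (n%:R * B + 1) * B) = e * (n%:R * B / (n%:R * B + 1)).
  by ring.
by rewrite gtr_pMr // ltr_pdivrMr // mul1r ltrDl.
Qed.

End partial_calculus.

(** * Functions of class C^k and smoothness *)

Section smooth_classes.
Variables (R : realType) (n : nat).
Implicit Types (u v : 'rV[R]_n -> R) (x y : 'rV[R]_n).

Local Notation e_ j := (basis_rV R j).

(** Derivatives are peeled off next to the function, whereas [partials] adds them at the outside;
    this order suits inductions in which u is replaced by its partial derivatives. *)
Fixpoint Ck k u : Prop :=
  if k is k'.+1 then
    [/\ continuous u, forall j x, derivable u x (e_ j) &
        forall j, Ck k' ('D_(e_ j) u)]
  else continuous u.

Lemma partials_rcons js j u : partials (rcons js j) u = partials js ('D_(e_ j) u).
Proof. by rewrite /partials foldr_rcons. Qed.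

Lemma CkS k u : Ck k.+1 u -> Ck k u.
Proof.
elim: k u => [u []//|k IH u [cu du Cu]]; split=> // j.
exact: IH.
Qed.

Lemma Ck_le k l u : (k <= l)%N -> Ck l u -> Ck k u.
Proof.
move=> /subnK <-; elim: (l - k)%N => // m IH; rewrite addSn => /CkS; exact: IH.
Qed.

Lemma smooth_realP u : smooth_real u <-> forall k, Ck k u.
Proof.
split=> [su k|Cu js].
  suff h : forall js, Ck k (partials js u) by exact: (h [::]).
  elim: k => [js|k IH js]; first by have [] := su js.
  have [c d] := su js; split=> // j; exact: (IH (j :: js)).
elim/last_ind: js u Cu => [|js j IH] u Cu.
  by have [c d _] := Cu 1%N.
rewrite partials_rcons; apply: IH => k; have [_ _ h] := Cu k.+1; exact: h.
Qed.

Lemma smooth_real_derive u j : smooth_real u -> smooth_real ('D_(e_ j) u).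
Proof. by move/smooth_realP=> su; apply/smooth_realP => k; have [_ _ h] := su k.+1; exact: h. Qed.

Lemma smooth_real_continuous u : smooth_real u -> continuous u.
Proof. by move=> su; have [c d] := su [::]; exact: c. Qed.

Lemma smooth_real_derivable u j x : smooth_real u -> derivable u x (e_ j).
Proof. by move=> su; have [c d] := su [::]; exact: d. Qed.

Lemma smooth_real_dir u w x : smooth_real u ->
  is_derive x w u (\sum_j w 0 j * 'D_(e_ j) u x).
Proof.
move=> su; apply: dir_derive => [j z|j]; first exact: smooth_real_derivable.
exact/smooth_real_continuous/smooth_real_derive.
Qed.

Lemma CkD k u v : Ck k u -> Ck k v -> Ck k (u + v).
Proof.
elim: k u v => [|k IH] u v.
  by move=> cu cv x; apply: continuousD; [exact: cu|exact: cv].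
move=> [cu du Cu] [cv dv Cv]; split.
- by move=> x; apply: continuousD; [exact: cu|exact: cv].
- by move=> j x; exact: derivableD.
move=> j; have -> : 'D_(e_ j) (u + v) = 'D_(e_ j) u + 'D_(e_ j) v.
  by apply/funext => x; rewrite deriveD.
by apply: IH; [exact: Cu|exact: Cv].
Qed.

Lemma CkM k u v : Ck k u -> Ck k v -> Ck k (u * v).
Proof.
elim: k u v => [|k IH] u v.
  by move=> cu cv x; apply: continuousM; [exact: cu|exact: cv].
move=> hu hv; have [[cu du Cu] [cv dv Cv]] := (hu, hv); split.
- by move=> x; apply: continuousM; [exact: cu|exact: cv].
- by move=> j x; exact: derivableM.
move=> j.
have -> : 'D_(e_ j) (u * v) = u * 'D_(e_ j) v + v * 'D_(e_ j) u.
  by apply/funext => x; rewrite deriveM.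
by apply: CkD; apply: IH; [exact: CkS|exact: Cv|exact: CkS|exact: Cu].
Qed.

Lemma Ck_cst k c : Ck k (fun=> c).
Proof.
elim: k c => [|k IH] c; first exact: (@cst_continuous _ _ c).
split=> [|j x|j]; [exact: (@cst_continuous _ _ c)|exact: (derivable_cst c)|].
have -> : 'D_(e_ j) (fun _ : 'rV[R]_n => c) = fun=> 0.
  by apply/funext => x; exact: (derive_cst c).
exact: IH.
Qed.

Lemma is_derive_coord i x w : is_derive x w (fun y => y 0 i) (w 0 i).
Proof.
have df := @differentiable_coord R 1 n x 0 i.
split; first exact: diff_derivable.
rewrite deriveE //.
have @f : {linear 'rV[R]_n -> R}.
  by exists (fun N : 'rV[R]_n => N 0 i); do 2![eexists]; do ?[constructor];
     rewrite ?mxE// => ? *; rewrite ?mxE//; move=> ?; rewrite !mxE.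
by rewrite (_ : (fun y : 'rV[R]_n => y 0 i) = f) // diff_lin //; exact/coord_continuous.
Qed.

Lemma Ck_coord k i : Ck k (fun x => x 0 i).
Proof.
have c : continuous (fun x : 'rV[R]_n => x 0 i) by exact: coord_continuous.
case: k => // k; split=> // [j x|j].
  by case: (is_derive_coord i x (e_ j)).
rewrite (_ : 'D_(e_ j) _ = fun=> (e_ j) 0 i); first exact: Ck_cst.
by apply/funext => x; case: (is_derive_coord i x (e_ j)).
Qed.

End smooth_classes.

(** * Chain rule, linear substitutions and symmetry of mixed derivatives *)

Section calculus_closure.
Variables (R : realType).

Local Notation e_ j := (basis_rV R j).

Lemma is_derive_line n (u : 'rV[R]_n -> R) x v (d : R) :
  is_derive (0 : R) (1 : R) (fun t : R => u (x + t *: v)) d <-> is_derive x v u d.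
Proof.
split=> -[d1 d2]; split.
- by move: d1; rewrite line_derivable scale0r addr0.
- by move: d2; rewrite line_derive scale0r addr0.
- by rewrite line_derivable scale0r addr0.
- by rewrite line_derive scale0r addr0.
Qed.

Lemma is_derive_comp1 n (u : 'rV[R]_n -> R) x v (d : R) (phi : R -> R) (c : R) :
  is_derive x v u d -> is_derive (u x) (1 : R) phi c ->
  is_derive x v (phi \o u) (c * d).
Proof.
move=> /is_derive_line ud pd; apply/is_derive_line.
have pd' : is_derive ((fun t : R => u (x + t *: v)) 0) (1 : R) phi c.
  by rewrite scale0r addr0.
have := @is_derive1_comp _ phi (fun t : R => u (x + t *: v)) 0 _ _ pd' ud.
by rewrite mulrC.
Qed.

(** The family [phi] is closed under differentiation up to constants, so the induction on k changes
    only the index. It serves for cosine and sine, exchanged by [negb], and for the Taylor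
    remainders of exp, with [predn]. *)
Lemma Ck_comp1 n (I : Type) (phi : I -> R -> R) (c : I -> R) (tau : I -> I) :
  (forall i (t : R), is_derive t (1 : R) (phi i) (c i * phi (tau i) t)) ->
  forall k i (u : 'rV[R]_n -> R), Ck k u -> Ck k (phi i \o u).
Proof.
move=> dphi.
have cphi i : continuous (phi i).
  move=> t; apply: differentiable_continuous; apply/derivable1_diffP.
  by case: (dphi i t).
elim=> [i u cu x|k IH i u Cu].
  by apply: continuous_comp; [exact: cu|exact: cphi].
have [cu du Du] := Cu.
have dd j x : is_derive x (e_ j) (phi i \o u)
    (c i * phi (tau i) (u x) * 'D_(e_ j) u x).
  exact: (is_derive_comp1 (derivableP (du j x)) (dphi i (u x))).
split=> [x|j x|j].
- by apply: continuous_comp; [exact: cu|exact: cphi].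
- by case: (dd j x).
have -> : 'D_(e_ j) (phi i \o u) = (fun=> c i) * (phi (tau i) \o u) * 'D_(e_ j) u.
  by apply/funext => x; case: (dd j x).
apply: CkM; last exact: Du.
apply: CkM; [exact: Ck_cst|apply: IH; exact: CkS].
Qed.

Lemma mulmx_line n m (L : 'M[R]_(n, m)) (x v : 'rV[R]_n) (t : R) :
  (x + t *: v) *m L = x *m L + t *: (v *m L).
Proof. by rewrite mulmxDl scalemxAl. Qed.

Lemma is_derive_mulmx n m (L : 'M[R]_(n, m)) (u : 'rV[R]_m -> R) x v (d : R) :
  is_derive (x *m L) (v *m L) u d -> is_derive x v (fun y => u (y *m L)) d.
Proof.
move/is_derive_line => h; apply/is_derive_line.
by under eq_fun do rewrite mulmx_line.
Qed.

Lemma basis_mulmx n m (L : 'M[R]_(n, m)) j i : (e_ j *m L) 0 i = L j i.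
Proof.
rewrite /basis_rV mxE (bigD1 j) //= mxE !eqxx mul1r big1 ?addr0 // => k kj.
by rewrite mxE (negbTE kj) andbF mul0r.
Qed.

Lemma mulmx_continuous n m (L : 'M[R]_(n, m)) : continuous (fun x : 'rV[R]_n => x *m L).
Proof.
move=> x; rewrite /continuous_at; apply/(cvg_ballP (F := nbhs x)) => e e0.
have N0 : 0 < n%:R * `|L| + 1 by rewrite ltr_wpDl // mulr_ge0.
apply/nbhs_ballP; exists (e / (n%:R * `|L| + 1)) => /=; first by rewrite divr_gt0.
move=> y; rewrite -ball_normE /= => xy; apply: ball_rowP => // i.
have -> : (y *m L) 0 i - (x *m L) 0 i = \sum_j (y - x) 0 j * L j i.
  rewrite !mxE -sumrB; apply: eq_bigr => j _; rewrite !mxE; ring.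
apply: le_lt_trans (ler_norm_sum _ _ _) _.
apply: (@le_lt_trans _ _ (\sum_(j < n) `|x - y| * `|L|)).
  apply: ler_sum => j _; rewrite normrM ler_pM //.
    by rewrite distrC; exact: row_norm_coord.
  rewrite [leRHS]/Num.Def.normr/= mx_normrE.
  by apply/bigmax_geP; right; exists (j, i).
rewrite sumr_const card_ord -[ltLHS]mulr_natl mulrCA.
apply: (@le_lt_trans _ _ (`|x - y| * (n%:R * `|L| + 1))).
  by rewrite ler_wpM2l // lerDl.
by rewrite -ltr_pdivlMr.
Qed.

Lemma derive_mulmx n m (L : 'M[R]_(n, m)) (u : 'rV[R]_m -> R) j :
  Ck 1 u ->
  'D_(e_ j) (fun y => u (y *m L)) = \sum_i (fun x => L j i * 'D_(e_ i) u (x *m L)).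
Proof.
move=> [cu du Du]; apply/funext => x; rewrite fct_sumE.
have h : is_derive (x *m L) (e_ j *m L) u
    (\sum_i (e_ j *m L) 0 i * 'D_(e_ i) u (x *m L)).
  by apply: dir_derive => // i; exact: Du.
case: (is_derive_mulmx h) => _ ->; apply: eq_bigr => i _.
by rewrite basis_mulmx.
Qed.

Lemma Ck_sum n k (I : Type) (r : seq I) (F : I -> 'rV[R]_n -> R) :
  (forall i, Ck k (F i)) -> Ck k (\sum_(i <- r) F i).
Proof.
move=> CF; elim: r => [|i r IH]; first by rewrite big_nil; exact: (@Ck_cst R n k 0).
by rewrite big_cons; exact: CkD.
Qed.

Lemma Ck_mulmx n m (L : 'M[R]_(n, m)) k (u : 'rV[R]_m -> R) :
  Ck k u -> Ck k (fun x => u (x *m L)).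
Proof.
elim: k u => [|k IH] u Cu.
  by move=> x; exact: (continuous_comp (@mulmx_continuous _ _ L x) (Cu (x *m L))).
have [cu du Du] := Cu.
have C1 : Ck 1 u by exact: Ck_le Cu.
split=> [x|j x|j].
- exact: (continuous_comp (@mulmx_continuous _ _ L x) (cu (x *m L))).
- have h : is_derive (x *m L) (e_ j *m L) u
      (\sum_i (e_ j *m L) 0 i * 'D_(e_ i) u (x *m L)).
    by apply: dir_derive => // i; have [_ _ h] := C1; exact: h.
  by case: (is_derive_mulmx h).
rewrite derive_mulmx //; apply: Ck_sum => i.
apply: (@CkM _ _ _ (fun=> L j i) (fun x => 'D_(e_ i) u (x *m L))).
  exact: Ck_cst.
exact: (IH _ (Du i)).
Qed.

Lemma derivable_shift n (u : 'rV[R]_n -> R) (w v : 'rV[R]_n) z :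
  derivable u (z + w) v -> is_derive z v (fun y => u (y + w)) ('D_v u (z + w)).
Proof.
move=> /derivableP/is_derive_line h; apply/is_derive_line.
by under eq_fun do rewrite addrAC.
Qed.

(** The mean value theorem in direction i, applied to the difference in direction j, and then once
    more in direction j. *)
Lemma second_difference n (u : 'rV[R]_n -> R) (x : 'rV[R]_n) i j (h : R) : Ck 2 u ->
  exists p : 'rV[R]_n, (forall k, `|p 0 k - x 0 k| <= `|h| + `|h|) /\
   (u (x + h *: e_ i + h *: e_ j) - u (x + h *: e_ i)) -
   (u (x + h *: e_ j) - u x) = h * (h * 'D_(e_ j) ('D_(e_ i) u) p).
Proof.
move=> [cu du Du]; pose g := (fun z => u (z + h *: e_ j)) - u.
have dg z : is_derive z (e_ i) g ('D_(e_ i) u (z + h *: e_ j) - 'D_(e_ i) u z).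
  by apply: is_deriveB; [exact: derivable_shift|exact: derivableP].
have [c cle] := @mvt_line _ _ g x (e_ i) h (fun s => @ex_derive _ _ _ _ _ _ _ (dg _)).
have [_ Dd _] := Du i.
have [c' cle'] := @mvt_line _ _ ('D_(e_ i) u) (x + c *: e_ i) (e_ j) h
  (fun s => Dd _ _).
case: (dg (x + c *: e_ i)) => _ -> -> h1.
exists (x + c *: e_ i + c' *: e_ j); split; last exact: h1.
move=> k; rewrite /basis_rV !mxE -[x 0 k + _ + _]addrA addrAC subrr add0r.
apply: le_trans (ler_normD _ _) _; rewrite !normrM lerD //.
  by apply: le_trans cle; rewrite ler_piMr // ; case: (_ && _); rewrite ?normr1 ?normr0.
by apply: le_trans cle'; rewrite ler_piMr // ; case: (_ && _); rewrite ?normr1 ?normr0.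
Qed.

Lemma scaled_difference_inj (a b c d A B h : R) : h != 0 ->
  (a - b) - (c - d) = h * (h * A) -> (a - c) - (b - d) = h * (h * B) -> A = B.
Proof.
move=> h0 e1 e2; apply: (mulfI h0); apply: (mulfI h0).
by rewrite -e1 -e2; ring.
Qed.

Lemma dist_half_trans (A B C e : R) :
  `|A - C| < e / 2 -> `|B - C| < e / 2 -> `|A - B| <= e.
Proof.
move=> h1 h2; have -> : A - B = (A - C) - (B - C) by ring.
apply: le_trans (ler_normB _ _) _; lra.
Qed.

(** The second difference is symmetric in i and j, so the two mixed derivatives agree at two points
    near x; continuity brings both points to x. *)
Lemma derive_swap n (u : 'rV[R]_n -> R) i j : Ck 2 u ->
  'D_(e_ j) ('D_(e_ i) u) = 'D_(e_ i) ('D_(e_ j) u).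
Proof.
move=> Cu; have [cu du Du] := Cu; apply/funext => x.
have cont k l : continuous ('D_(e_ k) ('D_(e_ l) u)).
  by have [_ _ h] := Du l; exact: h.
apply/eqP; rewrite -subr_eq0 -normr_le0; apply/ler_addgt0Pl => e e0; rewrite addr0.
have e2 : 0 < e / 2 by rewrite divr_gt0.
have near_e k l : exists2 d : R, 0 < d & forall p : 'rV[R]_n,
    (forall i, `|p 0 i - x 0 i| < d) ->
    `|'D_(e_ k) ('D_(e_ l) u) x - 'D_(e_ k) ('D_(e_ l) u) p| < e / 2.
  have : nbhs x (fun p => `|'D_(e_ k) ('D_(e_ l) u) x - 'D_(e_ k) ('D_(e_ l) u) p| < e / 2).
    exact: (proj1 (cvgrPdist_lt (F := nbhs x) _ _) (cont k l x) _ e2).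
  move=> /nbhs_ballP[d /= d0 hd].
  exists d => // p hp; apply: hd.
  exact: ball_rowP.
have [d1 d10 hd1] := near_e j i; have [d2 d20 hd2] := near_e i j.
pose h := Num.min d1 d2 / 3.
(* The mean value points are within 2h of x, so h is a third of the radius. *)
have h0 : 0 < h by rewrite divr_gt0 // lt_min d10.
have hh : `|h| + `|h| < Num.min d1 d2.
  by rewrite ger0_norm ?ltW // /h; have : 0 < Num.min d1 d2; [rewrite lt_min d10|lra].
have [p [p1 p2]] := second_difference x i j h Cu.
have [q [q1 q2]] := second_difference x j i h Cu.
have E : 'D_(e_ j) ('D_(e_ i) u) p = 'D_(e_ i) ('D_(e_ j) u) q.
  have q3 : (u (x + h *: e_ i + h *: e_ j) - u (x + h *: e_ j)) -
      (u (x + h *: e_ i) - u x) = h * (h * 'D_(e_ i) ('D_(e_ j) u) q).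
    by rewrite -q2 (addrAC x (h *: e_ j)).
  exact: scaled_difference_inj (lt0r_neq0 h0) p2 q3.
have hp : `|'D_(e_ j) ('D_(e_ i) u) x - 'D_(e_ j) ('D_(e_ i) u) p| < e / 2.
  apply: hd1 => k; apply: le_lt_trans (p1 k) _; apply: lt_le_trans hh _.
  by rewrite ge_min lexx.
have hq : `|'D_(e_ i) ('D_(e_ j) u) x - 'D_(e_ i) ('D_(e_ j) u) q| < e / 2.
  apply: hd2 => k; apply: le_lt_trans (q1 k) _; apply: lt_le_trans hh _.
  by rewrite ge_min lexx orbT.
move: hq; rewrite -E => hq.
exact: dist_half_trans hp hq.
Qed.

End calculus_closure.

(** * Complex-valued functions and words of operators *)

Section complex_calculus.
Variables (R : realType).
Implicit Types (c : R[i]).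

Local Notation e_ j := (basis_rV R j).
Local Notation normc := (@Normc.normc R).

Lemma normc_ge0 c : 0 <= normc c.
Proof. by case: c => a b; exact: sqrtr_ge0. Qed.

Lemma normcR (a : R) : normc a%:C%C = `|a|.
Proof. by rewrite /Normc.normc /= expr0n /= addr0 sqrtr_sqr. Qed.

Lemma ler_normcD c1 c2 : normc (c1 + c2) <= normc c1 + normc c2.
Proof. exact: le_normcD. Qed.

Lemma normc_sum I (r : seq I) (P : pred I) (F : I -> R[i]) :
  normc (\sum_(i <- r | P i) F i) <= \sum_(i <- r | P i) normc (F i).
Proof.
elim/big_ind2: _ => //; first by rewrite Normc.normc0.
by move=> x1 x2 y1 y2 h1 h2; apply: le_trans (ler_normcD _ _) _; exact: lerD.
Qed.

Lemma normc_Re_le c : `|complex.Re c| <= normc c.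
Proof.
case: c => a b /=; rewrite -sqrtr_sqr ler_sqrt ?lerDl ?sqr_ge0 //.
by rewrite addr_ge0 // sqr_ge0.
Qed.

Lemma normc_Im_le c : `|complex.Im c| <= normc c.
Proof.
case: c => a b /=; rewrite -sqrtr_sqr ler_sqrt ?lerDr ?sqr_ge0 //.
by rewrite addr_ge0 // sqr_ge0.
Qed.

Lemma normc_le_ReIm c : normc c <= `|complex.Re c| + `|complex.Im c|.
Proof.
case: c => a b /=; rewrite -[leRHS]ger0_norm ?addr_ge0 // -sqrtr_sqr.
rewrite ler_sqrt ?sqr_ge0 // sqrrD !real_normK ?num_real //.
by rewrite addrAC lerDl mulrn_wge0 // mulr_ge0.
Qed.

Lemma normc_expi (t : R) : normc (expi t) = 1.
Proof. by rewrite /expi /= cos2Dsin2 sqrtr1. Qed.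

Section fixed_dim.
Variable n : nat.
Implicit Types (f g : 'rV[R]_n -> R[i]) (x : 'rV[R]_n).

Definition CkC k f := Ck k (@complex.Re R \o f) /\ Ck k (@complex.Im R \o f).

Lemma smoothP f : smooth f <-> forall k, CkC k f.
Proof.
split=> [[/smooth_realP a /smooth_realP b] k|h]; first by split.
by split; apply/smooth_realP => k; have [] := h k.
Qed.

Definition cD (j : 'I_n) f x : R[i] :=
  Complex ('D_(e_ j) (@complex.Re R \o f) x) ('D_(e_ j) (@complex.Im R \o f) x).

Lemma smooth_cD j f : smooth f -> smooth (cD j f).
Proof. by case=> a b; split; exact: smooth_real_derive. Qed.

Lemma CkCD k f g : CkC k f -> CkC k g -> CkC k (f + g).
Proof.
move=> [a b] [a' b'].
split; [rewrite (_ : _ \o _ = (@complex.Re R \o f) + (@complex.Re R \o g))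
       |rewrite (_ : _ \o _ = (@complex.Im R \o f) + (@complex.Im R \o g))];
try exact: CkD; by apply/funext => x; rewrite /= !fctE /=; case: (f x) (g x) => ? ? [].
Qed.

(** The difference is written with a constant factor -1 because the classes [Ck] are known to be
    closed under sums and products. *)
Lemma Re_mulE f g : @complex.Re R \o (f * g) =
  (@complex.Re R \o f) * (@complex.Re R \o g) +
  (fun=> -1) * ((@complex.Im R \o f) * (@complex.Im R \o g)).
Proof.
by apply/funext => x; rewrite /= !fctE /= mulN1r; case: (f x) (g x) => ? ? [].
Qed.

Lemma Im_mulE f g : @complex.Im R \o (f * g) =
  (@complex.Re R \o f) * (@complex.Im R \o g) +
  (@complex.Im R \o f) * (@complex.Re R \o g).
Proof.
by apply/funext => x; rewrite /= !fctE /=; case: (f x) (g x) => ? ? [].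
Qed.

Lemma CkCM k f g : CkC k f -> CkC k g -> CkC k (f * g).
Proof.
move=> [a b] [a' b']; split; [rewrite Re_mulE|rewrite Im_mulE].
  by apply: CkD; [exact: CkM|apply: CkM; [exact: Ck_cst|exact: CkM]].
by apply: CkD; exact: CkM.
Qed.

Lemma CkC_cst k c : CkC k (fun=> c).
Proof. by split; exact: Ck_cst. Qed.

Lemma CkC_real k (u : 'rV[R]_n -> R) : Ck k u -> CkC k (fun x => (u x)%:C%C).
Proof. by split=> //; exact: Ck_cst. Qed.

Lemma smooth_D f g : smooth f -> smooth g -> smooth (f + g).
Proof. by move=> /smoothP a /smoothP b; apply/smoothP => k; exact: CkCD. Qed.

Lemma smooth_M f g : smooth f -> smooth g -> smooth (f * g).
Proof. by move=> /smoothP a /smoothP b; apply/smoothP => k; exact: CkCM. Qed.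

Lemma smooth_cst c : smooth (fun _ : 'rV[R]_n => c).
Proof. by apply/smoothP => k; exact: CkC_cst. Qed.

Lemma smooth_coord j : smooth (fun x => (x 0 j)%:C%C).
Proof. by apply/smoothP => k; apply: CkC_real; exact: Ck_coord. Qed.

Lemma smooth_sum I (r : seq I) (F : I -> 'rV[R]_n -> R[i]) :
  (forall i, smooth (F i)) -> smooth (\sum_(i <- r) F i).
Proof.
move=> sF; elim: r => [|i r IH]; first by rewrite big_nil; exact: smooth0.
by rewrite big_cons; apply: smooth_D; [exact: sF|exact: IH].
Qed.

Lemma smooth_continuous f : smooth f ->
  continuous (@complex.Re R \o f) /\ continuous (@complex.Im R \o f).
Proof. by case=> a b; split; exact: smooth_real_continuous. Qed.

Lemma cD_cst c j : cD j (fun _ : 'rV[R]_n => c) = 0.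
Proof.
by apply/funext => x; rewrite /cD (derive_cst (complex.Re c)) (derive_cst (complex.Im c)).
Qed.

Lemma cD_coord i j : cD j (fun x => (x 0 i)%:C%C) = fun=> (i == j)%:R.
Proof.
apply/funext => x; rewrite /cD.
have -> : @complex.Im R \o (fun x : 'rV[R]_n => (x 0 i)%:C%C) = fun=> 0 by [].
rewrite (derive_cst (0 : R)).
have [_ ->] := is_derive_coord i x (e_ j).
by rewrite /basis_rV mxE eqxx /=; case: (i == j).
Qed.

Lemma cD_D j f g : smooth f -> smooth g -> cD j (f + g) = cD j f + cD j g.
Proof.
move=> [a b] [a' b']; apply/funext => x; rewrite /cD.
have -> : @complex.Re R \o (f + g) = (@complex.Re R \o f) + (@complex.Re R \o g).
  by apply/funext => y; rewrite /= !fctE /=; case: (f y) (g y) => ? ? [].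
have -> : @complex.Im R \o (f + g) = (@complex.Im R \o f) + (@complex.Im R \o g).
  by apply/funext => y; rewrite /= !fctE /=; case: (f y) (g y) => ? ? [].
by rewrite !deriveD //; apply: smooth_real_derivable.
Qed.

Lemma derive_M_re (p q p' q' : 'rV[R]_n -> R) x (v : 'rV[R]_n) :
  derivable p x v -> derivable q x v -> derivable p' x v -> derivable q' x v ->
  'D_v (p * p' + (fun=> -1) * (q * q')) x =
  ('D_v p x * p' x - 'D_v q x * q' x) + (p x * 'D_v p' x - q x * 'D_v q' x).
Proof.
move=> dp dq dp' dq'.
have d1 := derivableM dp dp'; have d2 := derivableM dq dq'.
have d3 := derivableM (derivable_cst (-1 : R) x v) d2.
rewrite (deriveD d1 d3) (deriveM dp dp') (deriveM (derivable_cst (-1 : R) x v) d2).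
rewrite (deriveM dq dq') (derive_cst (-1 : R)) scaler0 addr0 scaleN1r.
rewrite /GRing.scale /=.
move: ('D_v p x) ('D_v q x) ('D_v p' x) ('D_v q' x) (p x) (q x) (p' x) (q' x).
by move=> *; ring.
Qed.

Lemma derive_M_im (p q p' q' : 'rV[R]_n -> R) x (v : 'rV[R]_n) :
  derivable p x v -> derivable q x v -> derivable p' x v -> derivable q' x v ->
  'D_v (p * q' + q * p') x =
  ('D_v p x * q' x + 'D_v q x * p' x) + (p x * 'D_v q' x + q x * 'D_v p' x).
Proof.
move=> dp dq dp' dq'.
have d1 := derivableM dp dq'; have d2 := derivableM dq dp'.
rewrite (deriveD d1 d2) (deriveM dp dq') (deriveM dq dp') /GRing.scale /=.
move: ('D_v p x) ('D_v q x) ('D_v p' x) ('D_v q' x) (p x) (q x) (p' x) (q' x).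
by move=> *; ring.
Qed.

Lemma cD_M j f g : smooth f -> smooth g -> cD j (f * g) = cD j f * g + f * cD j g.
Proof.
move=> [a b] [a' b']; apply/funext => x; rewrite /cD Re_mulE Im_mulE.
have d u z : smooth_real u -> derivable u z (e_ j) by exact: smooth_real_derivable.
rewrite (derive_M_re (d _ x a) (d _ x b) (d _ x a') (d _ x b')).
rewrite (derive_M_im (d _ x a) (d _ x b) (d _ x a') (d _ x b')).
rewrite !fctE /=.
by case: (f x) (g x) => [p q] [p' q'].
Qed.

Lemma cD_Z j c f : smooth f -> cD j ((fun=> c) * f) = (fun=> c) * cD j f.
Proof. by move=> sf; rewrite (cD_M j (smooth_cst c) sf) cD_cst mul0r add0r. Qed.

Lemma cD_swap i j f : smooth f -> cD i (cD j f) = cD j (cD i f).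
Proof.
move=> [/smooth_realP a /smooth_realP b]; apply/funext => x; rewrite /cD.
have e u : Ck 2 u -> 'D_(e_ i) ('D_(e_ j) u) x = 'D_(e_ j) ('D_(e_ i) u) x.
  by move=> Cu; have := derive_swap j i Cu => /(congr1 (@^~ x)).
exact: (congr2 (@Complex R) (e _ (a 2%N)) (e _ (b 2%N))).
Qed.

Definition cX (j : 'I_n) f x : R[i] := (x 0 j)%:C%C * f x.

Lemma cXE j f : cX j f = (fun x => (x 0 j)%:C%C) * f. Proof. by []. Qed.

Lemma smooth_cX j f : smooth f -> smooth (cX j f).
Proof. by move=> sf; rewrite cXE; exact: (smooth_M (smooth_coord j) sf). Qed.

Definition letter := ('I_n + 'I_n)%type.

Definition act (l : letter) f := match l with inl i => cD i f | inr j => cX j f end.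

(** The last letter of the word acts first: inductions run on the end of [w] and replace [f] by
    [act l f]. *)
Definition acts (w : seq letter) f := foldr act f w.

Lemma acts_rcons w l f : acts (rcons w l) f = acts w (act l f).
Proof. by rewrite /acts foldr_rcons. Qed.

Lemma acts_cat w1 w2 f : acts (w1 ++ w2) f = acts w1 (acts w2 f).
Proof. by rewrite /acts foldr_cat. Qed.

Lemma smooth_act l f : smooth f -> smooth (act l f).
Proof. by case: l => j; [exact: smooth_cD|exact: smooth_cX]. Qed.

Lemma smooth_acts w f : smooth f -> smooth (acts w f).
Proof. by move=> sf; elim: w => [//|l w IH]; exact: (smooth_act l IH). Qed.

Lemma act_D l f g : smooth f -> smooth g -> act l (f + g) = act l f + act l g.
Proof. by case: l => j sf sg; [exact: cD_D|rewrite /= !cXE mulrDr]. Qed.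

Lemma act_Z l c f : smooth f -> act l ((fun=> c) * f) = (fun=> c) * act l f.
Proof. by case: l => j sf; [exact: cD_Z|rewrite /= !cXE mulrCA]. Qed.

Lemma acts_D w f g : smooth f -> smooth g -> acts w (f + g) = acts w f + acts w g.
Proof.
move=> sf sg; elim: w => [//|l w IH].
by rewrite /= IH (act_D l (smooth_acts w sf) (smooth_acts w sg)).
Qed.

Lemma acts_Z w c f : smooth f -> acts w ((fun=> c) * f) = (fun=> c) * acts w f.
Proof. move=> sf; elim: w => [//|l w IH].
by rewrite /= IH (act_Z l c (smooth_acts w sf)). Qed.

Lemma acts_0 w : acts w 0 = 0.
Proof.
have := acts_Z w 0 (@smooth0 R n).
have -> : (fun=> 0 : R[i]) = (0 : 'rV[R]_n -> R[i]) by [].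
by rewrite !mul0r.
Qed.

Lemma acts_sum w I (r : seq I) (F : I -> 'rV[R]_n -> R[i]) :
  (forall i, smooth (F i)) -> acts w (\sum_(i <- r) F i) = \sum_(i <- r) acts w (F i).
Proof.
move=> sF; elim: r => [|i r IH]; first by rewrite !big_nil acts_0.
by rewrite !big_cons (acts_D w (sF i) (smooth_sum r sF)) IH.
Qed.

End fixed_dim.

Lemma smooth_mulmx n m (L : 'M[R]_(n, m)) (f : 'rV[R]_m -> R[i]) :
  smooth f -> smooth (fun x => f (x *m L)).
Proof.
move=> /smoothP sf; apply/smoothP => k; have [a b] := sf k.
by split; [have := Ck_mulmx L a|have := Ck_mulmx L b].
Qed.

Lemma Re_sum (I : Type) (r : seq I) (F : I -> R[i]) :
  complex.Re (\sum_(i <- r) F i) = \sum_(i <- r) complex.Re (F i).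
Proof. exact: raddf_sum. Qed.

Lemma Im_sum (I : Type) (r : seq I) (F : I -> R[i]) :
  complex.Im (\sum_(i <- r) F i) = \sum_(i <- r) complex.Im (F i).
Proof. exact: raddf_sum. Qed.

Lemma cD_mulmx n m (L : 'M[R]_(n, m)) (f : 'rV[R]_m -> R[i]) j : smooth f ->
  cD j (fun x => f (x *m L)) =
  \sum_i (fun=> (L j i)%:C%C) * (fun x => cD i f (x *m L)).
Proof.
move=> /smoothP sf; have [a b] := sf 1%N; apply/funext => x; rewrite fct_sumE /cD.
have := derive_mulmx L j b; have := derive_mulmx L j a.
move=> /(congr1 (@^~ x)) A /(congr1 (@^~ x)) B.
apply/eqP; rewrite eq_complex Re_sum Im_sum /=; apply/andP; split; apply/eqP.
  rewrite [LHS]A fct_sumE; apply: eq_bigr => i _.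
  by rewrite !fctE /= mul0r subr0.
rewrite [LHS]B fct_sumE; apply: eq_bigr => i _.
by rewrite !fctE /= mul0r addr0.
Qed.

End complex_calculus.

(** * Weighted bounds on words of derivations and multiplications *)

Local Opaque smooth.

Section word_bounds.
Variables (R : realType).
Local Notation normc := (@Normc.normc R).
Local Notation e_ j := (basis_rV R j).

Definition fs (s : R) (k : nat) : R := (k`!)%:R `^ s.

Lemma fs_gt0 s k : 0 < fs s k.
Proof. by rewrite powR_gt0 // ltr0n fact_gt0. Qed.

Lemma fs_ge0 s k : 0 <= fs s k.
Proof. exact/ltW/fs_gt0. Qed.

Lemma fs0 s : fs s 0 = 1.
Proof. by rewrite /fs fact0 powR1. Qed.

Lemma fsS s k : fs s k.+1 = (k.+1)%:R `^ s * fs s k.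
Proof. by rewrite /fs factS natrM powRM // ler0n. Qed.

Lemma fs_mul_le s m n : 0 <= s -> fs s m * fs s n <= fs s (m + n).
Proof.
move=> s0; rewrite /fs -powRM ?ler0n // -natrM.
apply: ge0_ler_powR => //; rewrite ?nnegrE ?ler0n // ler_nat.
rewrite -(@bin_fact (m + n) m) ?leq_addr // addKn leq_pmull //.
by rewrite bin_gt0 leq_addr.
Qed.

(** The binomial coefficient is at most 2^(m+n); such exponential factors are always absorbed into
    h. *)
Lemma fs_add_le s m n : 0 <= s ->
  fs s (m + n) <= 2 `^ s ^+ (m + n) * (fs s m * fs s n).
Proof.
move=> s0.
have -> : 2 `^ s ^+ (m + n) = (2 ^+ (m + n)) `^ s :> R.
  by rewrite -[LHS]powR_mulrn ?powR_ge0 // -powRrM mulrC powRrM powR_mulrn ?ler0n.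
rewrite -natrX /fs -powRM ?ler0n // -natrM -powRM ?ler0n // -natrM.
apply: ge0_ler_powR => //; rewrite ?nnegrE ?ler0n // ler_nat.
rewrite -(@bin_fact (m + n) m) ?leq_addr // addKn leq_mul2r.
apply/orP; right; rewrite -[2%N]/(1 + 1)%N expnDn.
have lt_m : (m < (m + n).+1)%N by rewrite ltnS leq_addr.
rewrite (bigD1 (Ordinal lt_m)) //= !exp1n !muln1; exact: leq_addr.
Qed.

Section fixed_dim.
Variable n : nat.
Implicit Types (f g : 'rV[R]_n -> R[i]) (x : 'rV[R]_n) (J : pred 'I_n)
  (rho : 'rV[R]_n -> R).

(* Words in the operators d/dx_i (inl i) and multiplication by x_j (inr j), the
   latter only for the coordinates j in J. *)
Definition okl J (l : letter n) := if l is inr j then J j else true.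

(* The offset p lets the derivatives of f keep the constants C and h of f. *)
Definition BW J s rho (C h : R) (p : nat) f := smooth f /\
  forall w, all (okl J) w -> forall x,
    normc (acts w f x) <= C * (h ^+ (size w + p) * fs s (size w + p)) * rho x.

Definition WB J s rho C h f := BW J s rho C h 0 f.

Lemma WBP J s rho C h f : WB J s rho C h f <-> smooth f /\
  forall w, all (okl J) w -> forall x,
    normc (acts w f x) <= C * (h ^+ size w * fs s (size w)) * rho x.
Proof.
by split=> -[sf h1]; split=> // w jw x; have := h1 w jw x; rewrite addn0.
Qed.

(** The letter passes from the word to the offset, with the same C and h. *)
Lemma BW_act J s rho C h p f l : okl J l ->
  BW J s rho C h p f -> BW J s rho C h p.+1 (act l f).
Proof.
move=> okl [sf hf]; split; first exact: smooth_act.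
move=> w jw x; rewrite -acts_rcons; have := hf (rcons w l).
by rewrite all_rcons okl jw size_rcons addSnnS; apply.
Qed.

Lemma BW_le J J' s rho rho' C C' h p f :
  (forall j, J' j -> J j) -> 0 <= h -> C <= C' -> 0 <= C ->
  (forall x, 0 <= rho x <= rho' x) ->
  BW J s rho C h p f -> BW J' s rho' C' h p f.
Proof.
move=> JJ h0 CC C0 rr [sf hf]; split=> // w jw x.
have /hf/(_ x) : all (okl J) w.
  by apply: sub_all jw => -[//|j]; exact: JJ.
move=> /le_trans; apply.
have /andP[r0 r1] := rr x.
have f0 : 0 <= h ^+ (size w + p) * fs s (size w + p).
  by rewrite mulr_ge0 ?exprn_ge0 ?fs_ge0.
by apply: ler_pM => //; [exact: mulr_ge0|exact: ler_wpM2r].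
Qed.

Lemma WB_D J s rho C C' h f g :
  WB J s rho C h f -> WB J s rho C' h g -> WB J s rho (C + C') h (f + g).
Proof.
move=> [sf hf] [sg hg]; split; first exact: smooth_D.
move=> w jw x; rewrite acts_D // mulrDl mulrDl.
apply: le_trans (ler_normcD _ _) _; apply: lerD; [exact: hf|exact: hg].
Qed.

Lemma WB_Z J s rho C h c f :
  WB J s rho C h f -> WB J s rho (normc c * C) h ((fun=> c) * f).
Proof.
move=> [sf hf]; split; first by apply: smooth_M; [exact: smooth_cst|].
move=> w jw x; rewrite (acts_Z w c sf) [X in normc X]/(c * acts w f x) Normc.normcM -!mulrA.
by rewrite ler_wpM2l ?normc_ge0 // !mulrA -(mulrA C); exact: hf.
Qed.

Lemma WB_hle J s rho C h h' f : 0 <= C -> 0 <= h <= h' -> (forall x, 0 <= rho x) ->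
  WB J s rho C h f -> WB J s rho C h' f.
Proof.
move=> C0 /andP[h0 hh] r0 [sf hf]; split=> // w jw x.
apply: le_trans (hf w jw x) _; rewrite ler_wpM2r // ler_wpM2l // ler_wpM2r ?fs_ge0 //.
by rewrite lerXn2r // nnegrE // (le_trans h0).
Qed.

(** Leibniz rule by induction on the end of the word: a derivation gives two terms, hence the factor
    2 per letter, while a coordinate goes to whichever factor admits it. The offsets [p] and [q]
    count the letters already given to f and g. *)
Lemma BW_mul J J1 J2 s rho1 rho2 C1 C2 h : 0 <= s -> 0 <= h ->
  0 <= C1 -> 0 <= C2 -> (forall x, 0 <= rho1 x) -> (forall x, 0 <= rho2 x) ->
  (forall j, J j -> J1 j || J2 j) ->
  forall w f g p q, BW J1 s rho1 C1 h p f -> BW J2 s rho2 C2 h q g ->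
  all (okl J) w -> forall x,
  normc (acts w (f * g) x) <= (C1 * C2) * (2 ^+ size w * (h ^+ (size w + (p + q)) *
    fs s (size w + (p + q)))) * (rho1 x * rho2 x).
Proof.
move=> s0 h0 C10 C20 r1 r2 JJ; elim/last_ind => [|w l IH] f g p q bf bg.
  move=> _ x; have [sf hf] := bf; have [sg hg] := bg.
  rewrite /= expr0 mul1r !add0n [X in normc X]/(f x * g x) Normc.normcM.
  have {}hf := hf [::] isT x; have {}hg := hg [::] isT x.
  apply: le_trans (ler_pM (normc_ge0 _) (normc_ge0 _) hf hg) _.
  rewrite /= !add0n mulrACA (mulrACA C1) ler_wpM2r ?mulr_ge0 //.
  rewrite ler_wpM2l ?mulr_ge0 // mulrACA -exprD ler_wpM2l ?exprn_ge0 //.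
  exact: fs_mul_le.
rewrite all_rcons => /andP[jl jw] x; rewrite acts_rcons size_rcons.
have [sf hf] := bf; have [sg hg] := bg.
set B := (X in _ <= X).
have half f' g' p' q' : (p' + q' = (p + q).+1)%N ->
    BW J1 s rho1 C1 h p' f' -> BW J2 s rho2 C2 h q' g' ->
    normc (acts w (f' * g') x) <= B / 2.
  move=> pq bf' bg'; apply: le_trans (IH _ _ _ _ bf' bg' jw x) _.
  rewrite pq addnS /B addSn [2 ^+ _.+1]exprS.
  have E (a b c d : R) : a * (b * c) * d = a * (2 * b * c) * d / 2 by field.
  by rewrite [leLHS]E.
have B0 : 0 <= B by rewrite !mulr_ge0 ?exprn_ge0 ?fs_ge0.
have BB : B / 2 <= B by rewrite ler_pdivrMr // ler_peMr // ler1n.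
case: l jl => j jl /=.
  rewrite (cD_M j sf sg) (acts_D w (smooth_M (smooth_cD j sf) sg) (smooth_M sf (smooth_cD j sg))).
  apply: le_trans (ler_normcD _ _) _.
  rewrite [B]splitr; apply: lerD.
    exact: (half _ _ p.+1 q (addSn p q) (BW_act (l := inl j) isT bf) bg).
  exact: (half _ _ p q.+1 (addnS p q) bf (BW_act (l := inl j) isT bg)).
apply: le_trans BB; case/orP: (JJ j jl) => jj.
  rewrite [cX j _](_ : _ = cX j f * g); last by rewrite !cXE mulrA.
  exact: (half _ _ p.+1 q (addSn p q) (BW_act (l := inr j) jj bf) bg).
rewrite [cX j _](_ : _ = f * cX j g); last by rewrite !cXE mulrCA.
exact: (half _ _ p q.+1 (addnS p q) bf (BW_act (l := inr j) jj bg)).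
Qed.

Lemma WB_mul J J1 J2 s rho1 rho2 C1 C2 h f g : 0 <= s -> 0 <= h ->
  0 <= C1 -> 0 <= C2 -> (forall x, 0 <= rho1 x) -> (forall x, 0 <= rho2 x) ->
  (forall j, J j -> J1 j || J2 j) ->
  WB J1 s rho1 C1 h f -> WB J2 s rho2 C2 h g ->
  WB J s (fun x => rho1 x * rho2 x) (C1 * C2) (2 * h) (f * g).
Proof.
move=> s0 h0 C10 C20 r1 r2 JJ bf bg; apply/WBP; split.
  by apply: smooth_M; [case: bf|case: bg].
move=> w jw x; have := BW_mul s0 h0 C10 C20 r1 r2 JJ bf bg jw x.
by rewrite !addn0 exprMn !mulrA.
Qed.

End fixed_dim.

Section composition.
Variables (n m : nat) (L : 'M[R]_(n, m)) (K : 'M[R]_(m, n)).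
Variables (J : pred 'I_n) (J' : pred 'I_m) (Lam : R).
Hypothesis L0 : 0 <= Lam.
Hypothesis LL : forall j, \sum_i `|L j i| <= Lam.
Hypothesis LK : forall j, J j -> \sum_i `|K i j| <= Lam.
Hypothesis KJ : forall j i, J j -> K i j != 0 -> J' i.
Hypothesis LKE : forall j (x : 'rV[R]_n), J j -> x 0 j = \sum_i K i j * (x *m L) 0 i.

(** A derivation becomes a combination of derivations with a row of [L] as coefficients, a
    coordinate one of coordinates with a column of [K]. Both have total mass at most [Lam], which
    gives one factor [Lam] per letter. *)
Lemma BW_mulmx s (rho : 'rV[R]_m -> R) C h : 0 <= h -> 0 <= C -> (forall x, 0 <= rho x) ->
  forall w f p, BW J' s rho C h p f -> all (okl J) w -> forall x,
  normc (acts w (fun x => f (x *m L)) x) <=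
  C * (Lam ^+ size w * (h ^+ (size w + p) * fs s (size w + p))) * rho (x *m L).
Proof.
move=> h0 C0 r0; elim/last_ind => [|w l IH] f p bf.
  move=> _ x; have [sf hf] := bf; have := hf [::] isT (x *m L).
  by rewrite /= expr0 mul1r.
rewrite all_rcons => /andP[jl jw] x; rewrite acts_rcons size_rcons.
have [sf hf] := bf.
pose B := C * (Lam ^+ size w * (h ^+ (size w + p).+1 * fs s (size w + p).+1)) * rho (x *m L).
have B0 : 0 <= B by rewrite !mulr_ge0 ?exprn_ge0 ?fs_ge0.
have step (c : 'I_m -> R) (g : 'I_m -> 'rV[R]_m -> R[i]) :
    \sum_i `|c i| <= Lam -> (forall i, smooth (g i)) ->
    (forall i, c i != 0 -> BW J' s rho C h p.+1 (g i)) ->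
    normc (acts w (\sum_i (fun=> (c i)%:C%C) * (fun x => g i (x *m L))) x) <= Lam * B.
  move=> cL sg bg.
  have sgL i : smooth (fun x => g i (x *m L)) by exact: (smooth_mulmx L (sg i)).
  have sF i : smooth ((fun=> (c i)%:C%C) * (fun x => g i (x *m L))).
    exact: (smooth_M (smooth_cst _ _) (sgL i)).
  rewrite (acts_sum w _ sF) fct_sumE; apply: le_trans (normc_sum _ _ _) _.
  apply: (@le_trans _ _ (\sum_i `|c i| * B)); last first.
    by rewrite -mulr_suml ler_wpM2r.
  apply: ler_sum => i _; rewrite (acts_Z w _ (sgL i)).
  rewrite [X in normc X]/(_ * acts w _ x) Normc.normcM normcR.
  have [->|ci] := eqVneq (c i) 0; first by rewrite normr0 !mul0r.
  rewrite ler_wpM2l //; have := IH _ _ (bg i ci) jw x.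
  by rewrite addnS.
have -> : C * (Lam ^+ (size w).+1 * (h ^+ ((size w).+1 + p) * fs s ((size w).+1 + p))) *
    rho (x *m L) = Lam * B.
  by rewrite /B addSn exprS; ring.
case: l jl => j jl /=.
  rewrite cD_mulmx //; apply: (step (fun i => L j i) (fun i => cD i f)) => [|i|i _].
  - exact: LL.
  - exact: smooth_cD.
  - exact: (@BW_act _ _ _ _ _ _ _ _ (inl i)).
have -> : cX j (fun x => f (x *m L)) =
    \sum_i (fun=> (K i j)%:C%C) * (fun x => cX i f (x *m L)).
  apply/funext => y; rewrite fct_sumE /cX LKE // rmorph_sum mulr_suml.
  by apply: eq_bigr => i _; rewrite rmorphM -mulrA.
apply: (step (fun i => K i j) (fun i => cX i f)) => [|i|i Kij]; [exact: LK|exact: smooth_cX|].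
exact: (@BW_act _ _ _ _ _ _ _ _ (inr i) (KJ jl Kij)).
Qed.

Lemma WB_mulmx s (rho : 'rV[R]_m -> R) C h f : 0 <= h -> 0 <= C -> (forall x, 0 <= rho x) ->
  WB J' s rho C h f -> WB J s (fun x => rho (x *m L)) C (Lam * h) (fun x => f (x *m L)).
Proof.
move=> h0 C0 r0 bf; apply/WBP; split; first by apply: smooth_mulmx; case: bf.
move=> w jw x; have := BW_mulmx h0 C0 r0 bf jw x.
by rewrite addn0 exprMn !mulrA.
Qed.

End composition.

End word_bounds.

(** * Partial sums and Taylor remainders of the exponential *)

Section exponential_partial_sums.
Variable R : realType.

Definition exp_sum (N : nat) (x : R) : R := \sum_(k < N) x ^+ k / (k`!)%:R.

Lemma exp_sumE N (x : R) : exp_sum N x = series (exp_coeff x) N.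
Proof. by rewrite /exp_sum /series /= big_mkord /exp_coeff. Qed.

Lemma expR_le_sum (x B : R) : (forall N, exp_sum N x <= B) -> expR x <= B.
Proof.
move=> h; rewrite /expR; apply: limr_le; first exact: is_cvg_series_exp_coeff.
by near=> N; rewrite -exp_sumE.
Unshelve. all: by end_near. Qed.

Lemma exp_sum_le (x : R) N : 0 <= x -> exp_sum N x <= expR x.
Proof.
move=> x0; rewrite /expR; apply: limr_ge; first exact: is_cvg_series_exp_coeff.
near=> M; rewrite -exp_sumE /exp_sum.
have NM : (N <= M)%N by near: M; exact: nbhs_infty_ge.
rewrite -(big_mkord xpredT (fun k => x ^+ k / (k`!)%:R)).
rewrite -(big_mkord xpredT (fun k => x ^+ k / (k`!)%:R)).
rewrite [leRHS](big_cat_nat (leq0n N) NM) //= lerDl sumr_ge0 // => i _.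
by rewrite divr_ge0 ?exprn_ge0 ?ler0n.
Unshelve. all: by end_near. Qed.

Definition exp_rem (N : nat) (x : R) : R := expR x - exp_sum N x.

Lemma exp_rem0 (x : R) : exp_rem 0 x = expR x.
Proof. by rewrite /exp_rem /exp_sum big_ord0 subr0. Qed.

(** For k >= N the factor lam^(k - N) is at least 1, so the tail is at most lam^-N times the
    exponential series at lam |x|. A slightly larger exponent buys geometric decay in N. *)
Lemma exp_rem_le N (x lam : R) : 1 <= lam -> `|exp_rem N x| <= lam ^- N * expR (lam * `|x|).
Proof.
move=> l1; have l0 : 0 < lam by exact: lt_le_trans l1.
have key M : (N <= M)%N -> `|exp_sum M x - exp_sum N x| <= lam ^- N * expR (lam * `|x|).
  move=> NM; rewrite /exp_sum.
  rewrite -(big_mkord xpredT (fun k => x ^+ k / (k`!)%:R)).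
  rewrite -(big_mkord xpredT (fun k => x ^+ k / (k`!)%:R)).
  rewrite [X in X - _](big_cat_nat (leq0n N) NM) //= addrAC subrr add0r.
  rewrite ler_pdivlMl ?exprn_gt0 // -{1}(ger0_norm (ltW (exprn_gt0 N l0))) -normrM mulr_sumr.
  apply: le_trans (ler_norm_sum _ _ _) _.
  apply: le_trans (exp_sum_le M _); last by rewrite mulr_ge0 // ltW.
  rewrite /exp_sum -(big_mkord xpredT (fun k => (lam * `|x|) ^+ k / (k`!)%:R)).
  rewrite [leRHS](big_cat_nat (leq0n N) NM) //= -[leLHS]add0r lerD //.
    by apply: sumr_ge0 => i _; rewrite divr_ge0 ?exprn_ge0 ?ler0n // mulr_ge0 // ltW.
  rewrite big_nat_cond [leRHS]big_nat_cond; apply: ler_sum => i /andP[/andP[Ni iM] _].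
  rewrite mulrA normrM normrM normrX (ger0_norm (x := _^-1)) ?invr_ge0 ?ler0n //.
  rewrite ler_wpM2r ?invr_ge0 ?ler0n // exprMn normrX ler_wpM2r ?exprn_ge0 //.
  by rewrite ger0_norm ?exprn_ge0 ?ler_weXn2l // ltW.
have c : (fun M => `|exp_sum M x - exp_sum N x|) @ \oo --> `|exp_rem N x|.
  apply: cvg_norm; apply: cvgB; last exact: cvg_cst.
  have := @is_cvg_series_exp_coeff R x.
  rewrite (_ : (fun M => exp_sum M x) = series (exp_coeff x)) //.
  by apply/funext => M; rewrite exp_sumE.
rewrite -(cvg_lim _ c) //; apply: limr_le; first by apply/cvg_ex; eexists; exact: c.
by near=> M; apply: key; near: M; exact: nbhs_infty_ge.
Unshelve. all: by end_near. Qed.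

(** At N = 0 the remainder is exp, its own derivative, in agreement with [0.-1 = 0]. *)
Lemma exp_rem_derive N (x : R) : is_derive x (1 : R) (exp_rem N) (exp_rem N.-1 x).
Proof.
have d n : is_derive x (1 : R) (exp_sum n) (exp_sum n.-1 x).
  elim: n => [|n IH].
    have -> : exp_sum 0 = cst 0 by apply/funext => y; rewrite /exp_sum big_ord0.
    exact: is_derive_cst.
  have -> : exp_sum n.+1 = exp_sum n + (fun y => (n`!)%:R^-1 *: y ^+ n).
    apply/funext => y; rewrite /exp_sum big_ord_recr /= /GRing.add /=.
    by rewrite [X in _ + X = _]mulrC.
  have dn : is_derive x (1 : R) (fun y : R => (n`!)%:R^-1 *: y ^+ n)
      ((n`!)%:R^-1 *: (n%:R * x ^+ n.-1)).
    apply: is_deriveZ; case: (n) => [|m].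
      by rewrite mul0r (_ : (fun _ => _) = cst 1); [exact: is_derive_cst|].
    split; first exact: exprn_derivable.
    by have := @exp_derive R m.+1 x 1; rewrite /GRing.scale /= mulr1.
  case: n IH dn => [|n] IH dn /=.
    rewrite mul0r scaler0 in dn.
    rewrite -[exp_sum 0 x]addr0; exact: is_deriveD.
  have -> : exp_sum n.+1 x = exp_sum n x + (n.+1`!)%:R^-1 *: (n.+1%:R * x ^+ n).
    rewrite {1}/exp_sum big_ord_recr /=; congr (_ + _).
    rewrite /GRing.scale /= factS natrM invfM mulrACA mulVf ?pnatr_eq0 //.
    by rewrite mul1r mulrC.
  exact: is_deriveD.
exact: is_deriveB.
Qed.

End exponential_partial_sums.

(** * Exponential decay from moment bounds of Gevrey type *)

Section weights.
Variables (R : realType).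
Local Notation normc := (@Normc.normc R).

(** The power 1/s turns (k!)^s into k!. Summing the inequalities against c0^k / k! gives the
    exponential series on the left and a geometric series on the right; the power s then restores B
    and produces the factor 2^s. *)
Lemma gevrey_decay (s B C h t : R) : 0 < s -> 0 <= B -> 0 <= C -> 0 < h -> 0 <= t ->
  (forall k, t ^+ k * B <= C * (h ^+ k * fs s k)) ->
  B <= 2 `^ s * C * expR (- (s / (2 * h `^ s^-1) * t `^ s^-1)).
Proof.
move=> s0 B0 C0 h0 t0 H; pose p := s^-1.
have p0 : 0 < p by rewrite invr_gt0.
have hp0 : 0 < h `^ p by exact: powR_gt0.
(* This makes the ratio of the geometric series equal to 1/2. *)
pose c0 := (2 * h `^ p)^-1.
have c00 : 0 < c0 by rewrite invr_gt0 mulr_gt0.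
have ps (x : R) : 0 <= x -> (x `^ p) `^ s = x.
  by move=> x0; rewrite -powRrM mulVf ?powRr1 // gt_eqF.
have h0' := ltW h0; have c0' := ltW c00; have s0' := ltW s0; have p0' := ltW p0.
have H' k : (t `^ p) ^+ k * B `^ p <= C `^ p * ((h `^ p) ^+ k * (k`!)%:R).
  have e (x : R) : 0 <= x -> (x `^ p) ^+ k = (x ^+ k) `^ p.
    by move=> x0; rewrite -[LHS]powR_mulrn ?powR_ge0 // -powRrM mulrC powRrM powR_mulrn.
  rewrite !e // -powRM ?exprn_ge0 //.
  have -> : (k`!)%:R = fs s k `^ p :> R by rewrite /fs -powRrM mulfV ?gt_eqF // powRr1.
  rewrite -powRM ?exprn_ge0 ?fs_ge0 // -powRM ?mulr_ge0 ?exprn_ge0 ?fs_ge0 //.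
  apply: ge0_ler_powR; rewrite ?nnegrE ?mulr_ge0 ?exprn_ge0 ?fs_ge0 //.
have E : expR (c0 * t `^ p) * B `^ p <= 2 * C `^ p.
  have [Bp|Bp] := eqVneq (B `^ p) 0.
    by rewrite Bp mulr0 mulr_ge0 // powR_ge0.
  have Bp0 : 0 < B `^ p by rewrite lt_neqAle eq_sym Bp powR_ge0.
  rewrite -ler_pdivlMr //; apply: expR_le_sum => N.
  rewrite ler_pdivlMr // /exp_sum mulr_suml.
  apply: (@le_trans _ _ (\sum_(k < N) C `^ p * (2^-1) ^+ k)).
    apply: ler_sum => k _.
    have -> : (c0 * t `^ p) ^+ k / (k`!)%:R * B `^ p =
        c0 ^+ k / (k`!)%:R * ((t `^ p) ^+ k * B `^ p) by rewrite exprMn; ring.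
    apply: (@le_trans _ _ (c0 ^+ k / (k`!)%:R * (C `^ p * ((h `^ p) ^+ k * (k`!)%:R)))).
      by rewrite ler_wpM2l // divr_ge0 ?exprn_ge0 ?ler0n.
    rewrite le_eqVlt; apply/orP; left; apply/eqP.
    have -> : (2^-1 : R) ^+ k = c0 ^+ k * (h `^ p) ^+ k.
      by rewrite -exprMn /c0 invfM mulfVK // gt_eqF.
    by field; rewrite pnatr_eq0 -lt0n fact_gt0.
  rewrite -mulr_sumr mulrC ler_wpM2r ?powR_ge0 //.
  have -> : \sum_(k < N) (2^-1 : R) ^+ k = 2 - 2 * 2^-1 ^+ N.
    elim: N => [|N IH]; first by rewrite big_ord0 expr0 mulr1 subrr.
    by rewrite big_ord_recr /= IH exprS; field.
  by rewrite gerBl mulr_ge0 ?exprn_ge0 // invr_ge0.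
have : (expR (c0 * t `^ p) * B `^ p) `^ s <= (2 * C `^ p) `^ s.
  apply: ge0_ler_powR; rewrite ?nnegrE ?mulr_ge0 ?expR_ge0 ?powR_ge0 //.
rewrite (powRM s (expR_ge0 _) (powR_ge0 _ _)) (ps _ B0).
rewrite (powRM s (ler0n R 2) (powR_ge0 _ _)) (ps _ C0).
rewrite -expRM => F; rewrite expRN ler_pdivlMr ?expR_gt0 //.
rewrite mulrC; apply: le_trans F; rewrite ler_wpM2r // ler_expR.
by rewrite le_eqVlt; apply/orP; left; apply/eqP; rewrite /c0 -/p; ring.
Qed.

End weights.

(** * Conversion of coordinate letters into decay *)

Section absorption.
Variables (R : realType).
Local Notation normc := (@Normc.normc R).

Lemma acts_nseqX n (j : 'I_n) k f x :
  normc (acts (nseq k (inr j)) f x) = `|x 0 j| ^+ k * normc (f x).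
Proof.
elim: k => [|k IH]; first by rewrite expr0 mul1r.
by rewrite /= /cX Normc.normcM normcR IH mulrA exprS.
Qed.

Lemma ler1_2powR (s : R) : 0 <= s -> 1 <= 2 `^ s.
Proof. by move=> s0; rewrite -[leLHS](powRr0 2) ler_powR // ler1n. Qed.

(** A substitute for |x|^(1/s) that is additive over blocks of variables, so that the growth in x,
    xi and y can be cancelled separately. *)
Definition wt n (J : pred 'I_n) (s : R) (x : 'rV[R]_n) : R :=
  \sum_(j | J j) `|x 0 j| `^ s^-1.

Lemma wt_ge0 n (J : pred 'I_n) s x : 0 <= wt J s x.
Proof. by apply: sumr_ge0 => j _; exact: powR_ge0. Qed.

(** By [fs_add_le] a word put in front of [w] costs a factor 2^s in h; its letters are then free to
    be turned into decay. *)
Lemma WB_prefix n J s rho C h (f : 'rV[R]_n -> R[i]) k w v x :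
  0 <= s -> 0 <= h -> 0 <= C -> (forall x, 0 <= rho x) -> WB J s rho C h f ->
  all (okl J) w -> all (okl J) v -> size v = k ->
  normc (acts (v ++ w) f x) <=
  (C * ((2 `^ s * h) ^+ size w * fs s (size w)) * rho x) * ((2 `^ s * h) ^+ k * fs s k).
Proof.
move=> s0 h0 C0 r0 /WBP[sf hf] jw jv sv.
have /hf/(_ x) : all (okl J) (v ++ w) by rewrite all_cat jv jw.
move=> /le_trans; apply; rewrite size_cat sv.
have -> : C * ((2 `^ s * h) ^+ size w * fs s (size w)) * rho x * ((2 `^ s * h) ^+ k * fs s k) =
    C * ((2 `^ s * h) ^+ (k + size w) * (fs s k * fs s (size w))) * rho x.
  by rewrite exprD; ring.
rewrite ler_wpM2r // ler_wpM2l // exprMn -mulrA mulrCA ler_wpM2l ?exprn_ge0 //.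
exact: fs_add_le.
Qed.

(** The words x_j^k w bound |x_j|^k |w f(x)| for all k, which [gevrey_decay] turns into exponential
    decay. The rate grows like h^(-1/s), so any rate r is reached once h is small enough. *)
Lemma WB_absorb n (s r : R) : 0 < s -> 0 <= r -> exists2 h0 : R, 0 < h0 &
  forall h, 0 < h -> h <= h0 -> forall (J : pred 'I_n) rho C f,
    0 <= C -> (forall x, 0 <= rho x) -> WB J s rho C h f ->
    WB J s (fun x => rho x * expR (- (r * wt J s x))) (2 `^ s * C) (2 `^ s * h) f.
(* In [r'] the largest coordinate carries the weight of up to n coordinates; the summand 1 keeps the
   rate positive when r = 0. *)
Proof.
move=> s0 r0; pose r' := r * n.+1%:R + 1.
have s0' := ltW s0.
have r'0 : 0 < r' by rewrite ltr_wpDl // mulr_ge0.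
have s20 : 0 < 2 `^ s :> R by rewrite powR_gt0.
have a0 : 0 < s / (2 * r') by rewrite divr_gt0 // mulr_gt0.
(* This is the h for which the rate s / (2 (2^s h)^(1/s)) of [gevrey_decay] equals [r']. *)
exists ((s / (2 * r')) `^ s / 2 `^ s) => [|h h0 hh J rho C f C0 rho0 bf].
  by rewrite divr_gt0 // powR_gt0.
have h0' := ltW h0.
have sh0 : 0 < 2 `^ s * h by rewrite mulr_gt0.
have r'h : r' <= s / (2 * (2 `^ s * h) `^ s^-1).
  have p0 : 0 < (2 `^ s * h) `^ s^-1 by rewrite powR_gt0.
  rewrite ler_pdivlMr ?mulr_gt0 // mulrA -ler_pdivlMl ?mulr_gt0 //.
  have -> : (r' * 2)^-1 * s = ((s / (2 * r')) `^ s) `^ s^-1.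
    by rewrite -powRrM mulfV ?gt_eqF // powRr1 ?(ltW a0) // mulrC (mulrC r').
  apply: ge0_ler_powR; rewrite ?nnegrE ?invr_ge0 ?powR_ge0 //; first exact: ltW.
  by rewrite mulrC -ler_pdivlMr.
apply/WBP; split; first by case: bf.
move=> w jw x; set B := normc _.
have B0 : 0 <= B by exact: normc_ge0.
pose C' := C * ((2 `^ s * h) ^+ size w * fs s (size w)) * rho x.
have C'0 : 0 <= C' by rewrite !mulr_ge0 ?exprn_ge0 ?fs_ge0 // ltW.
have pre v : all (okl J) v ->
    normc (acts (v ++ w) f x) <= C' * ((2 `^ s * h) ^+ size v * fs s (size v)).
  by move=> jv; apply: (WB_prefix x s0' h0' C0 rho0 bf jw jv).
suff H : B <= 2 `^ s * C' * expR (- (r * wt J s x)).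
  by apply: le_trans H _; rewrite /C' le_eqVlt; apply/orP; left; apply/eqP; ring.
case: (pickP J) => [j0 Jj0|J0]; last first.
  rewrite /wt big_pred0 // mulr0 oppr0 expR0 mulr1.
  have := pre [::] isT; rewrite /= expr0 fs0 !mulr1 => /le_trans; apply.
  by rewrite ler_peMl // ler1_2powR.
case: (@arg_maxP _ _ _ j0 J (fun j => `|x 0 j|) Jj0) => j Jj jmax.
have H : B <= 2 `^ s * C' * expR (- (s / (2 * (2 `^ s * h) `^ s^-1) * `|x 0 j| `^ s^-1)).
  apply: gevrey_decay => // k; rewrite /B -acts_nseqX -acts_cat.
  have := pre (nseq k (inr j)); rewrite size_nseq; apply.
  by rewrite all_nseq /= Jj orbT.
apply: le_trans H _; apply: ler_wpM2l; first by rewrite mulr_ge0 // ltW.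
rewrite ler_expR lerN2.
apply: (@le_trans _ _ (r' * `|x 0 j| `^ s^-1)); last first.
  by rewrite ler_wpM2r // powR_ge0.
apply: (@le_trans _ _ (r * n.+1%:R * `|x 0 j| `^ s^-1)); last first.
  by rewrite ler_wpM2r ?powR_ge0 // lerDl.
rewrite -mulrA ler_wpM2l // /wt big_mkcond /=.
apply: (@le_trans _ _ (\sum_(i < n) `|x 0 j| `^ s^-1)).
  apply: ler_sum => i _; case: ifP => [Ji|_]; last exact: powR_ge0.
  by apply: ge0_ler_powR; rewrite ?nnegrE ?invr_ge0 //; exact: jmax.
rewrite sumr_const card_ord -[leLHS]mulr_natl ler_wpM2r ?powR_ge0 //.
by rewrite ler_nat.
Qed.

(** An integrable majorant that factors over the coordinates: sections of dominated functions are
    dominated, and its integral reduces to that of 1 / (1 + t^2). *)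
Definition dd m (y : 'rV[R]_m) : R := \prod_j (1 + y 0 j ^+ 2)^-1.

Lemma dd_ge0 m (y : 'rV[R]_m) : 0 <= dd y.
Proof. by apply: prodr_ge0 => j _; rewrite invr_ge0 addr_ge0 // sqr_ge0. Qed.

(** Each factor 1 + y_j^2 is at most twice the larger of 1 and max |y_j|^2, so the product is at
    most 2^m T with T the larger of 1 and max |y_j|^(2m). *)
Lemma dd_bound m (y : 'rV[R]_m) B A : 0 <= B -> B <= A ->
  (forall j, `|y 0 j| ^+ (2 * m) * B <= A) -> B <= 2 ^+ m * A * dd y.
Proof.
move=> B0 BA H.
have pos j : 0 < 1 + y 0 j ^+ 2 by rewrite ltr_wpDr // sqr_ge0.
have [T T0 [T1 T2]] : exists2 T : R, 0 <= T &
    \prod_j (1 + y 0 j ^+ 2) <= 2 ^+ m * T /\ T * B <= A.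
  have [j yj|small] := pickP (fun j => 1 < `|y 0 j|); last first.
    exists 1 => //; rewrite mul1r mulr1; split=> //.
    rewrite -[X in 2 ^+ X](card_ord m) -prodr_const; apply: ler_prod => j _.
    rewrite ltW //=; have := small j => /negbT; rewrite -leNgt => y1.
    by rewrite -[2]/(1 + 1) lerD2l -real_normK ?num_real // exprn_ile1.
  case: (@arg_maxP _ _ _ j xpredT (fun j => `|y 0 j|) isT) => i _ imax.
  have yi : 1 <= `|y 0 i| by apply: le_trans (ltW yj) _; exact: imax.
  exists (`|y 0 i| ^+ (2 * m)); rewrite ?exprn_ge0 //; split; last exact: H.
  rewrite exprM -exprMn -[X in _ ^+ X](card_ord m) -prodr_const.
  apply: ler_prod => k _; rewrite ltW //= mulrDl mul1r lerD //.
    by rewrite exprn_ege1.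
  by rewrite -real_normK ?num_real // lerXn2r ?nnegrE //; exact: imax.
rewrite /dd prodfV ler_pdivlMr ?prodr_gt0 //.
apply: (@le_trans _ _ (B * (2 ^+ m * T))); first by rewrite ler_wpM2l.
by rewrite mulrCA ler_wpM2l ?exprn_ge0 // mulrC.
Qed.

(** The constant that [dd_bound] yields when words of length 0 and 2m are put in front of a given
    word. *)
Definition ddK (s h : R) (m : nat) : R := 2 ^+ m * (1 + (2 `^ s * h) ^+ (2 * m) * fs s (2 * m)).

Lemma ddK_ge0 s h m : 0 <= h -> 0 <= ddK s h m.
Proof.
move=> h0; rewrite /ddK mulr_ge0 ?exprn_ge0 // addr_ge0 // mulr_ge0 ?fs_ge0 //.
by rewrite exprn_ge0 // mulr_ge0 // powR_ge0.
Qed.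

(** [iota] picks the variables that are to be integrated; their coordinate letters are turned into
    integrable decay. *)
Lemma WB_dd n m (iota : 'I_m -> 'I_n) (J : pred 'I_n) s rho C h (f : 'rV[R]_n -> R[i]) :
  0 <= s -> 0 <= h -> 0 <= C -> (forall x, 0 <= rho x) -> (forall j, J (iota j)) ->
  WB J s rho C h f ->
  WB J s (fun x => rho x * dd (\row_j x 0 (iota j))) (ddK s h m * C) (2 `^ s * h) f.
Proof.
move=> s0 h0 C0 r0 Ji bf; apply/WBP; split; first by case: bf.
move=> w jw x; pose C' := C * ((2 `^ s * h) ^+ size w * fs s (size w)) * rho x.
have sh0 : 0 <= 2 `^ s * h by rewrite mulr_ge0 // powR_ge0.
have C'0 : 0 <= C' by rewrite !mulr_ge0 ?exprn_ge0 ?fs_ge0.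
have pre v : all (okl J) v ->
    normc (acts (v ++ w) f x) <= C' * ((2 `^ s * h) ^+ size v * fs s (size v)).
  by move=> jv; apply: (WB_prefix x s0 h0 C0 r0 bf jw jv).
pose A := C' * (1 + (2 `^ s * h) ^+ (2 * m) * fs s (2 * m)).
have K0 : 0 <= (2 `^ s * h) ^+ (2 * m) * fs s (2 * m).
  by rewrite mulr_ge0 ?exprn_ge0 ?fs_ge0.
have := @dd_bound m (\row_j x 0 (iota j)) (normc (acts w f x)) A (normc_ge0 _).
have -> : 2 ^+ m * A * dd (\row_j x 0 (iota j)) =
    ddK s h m * C * ((2 `^ s * h) ^+ size w * fs s (size w)) *
    (rho x * dd (\row_j x 0 (iota j))).
  by rewrite /A /C' /ddK; ring.
apply.
  have := pre [::] isT; rewrite /= expr0 fs0 !mulr1 => /le_trans; apply.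
  by rewrite ler_peMr // lerDl.
move=> j; rewrite mxE -acts_nseqX -acts_cat.
apply: (@le_trans _ _ (C' * ((2 `^ s * h) ^+ (2 * m) * fs s (2 * m)))).
  have := pre (nseq (2 * m) (inr (iota j))); rewrite size_nseq; apply.
  by rewrite all_nseq /= Ji orbT.
by rewrite ler_wpM2l // lerDr.
Qed.

Lemma powR_sum_le n (p : R) (a : 'I_n -> R) : 0 < p -> (forall i, 0 <= a i) ->
  (\sum_i a i) `^ p <= n.+1%:R `^ p * \sum_i a i `^ p.
Proof.
move=> p0 a0; case: n a a0 => [|n] a a0.
  by rewrite !big_ord0 mulr0 powR0 // gt_eqF.
case: (@arg_maxP _ _ _ ord0 xpredT a isT) => i _ imax.
apply: (@le_trans _ _ ((n.+2%:R * a i) `^ p)).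
  apply: ge0_ler_powR; rewrite ?nnegrE ?(ltW p0) //.
  - by apply: sumr_ge0 => j _; exact: a0.
  - by rewrite mulr_ge0.
  apply: (@le_trans _ _ (\sum_(j < n.+1) a i)); first by apply: ler_sum => j _; exact: imax.
  by rewrite sumr_const card_ord -[leLHS]mulr_natl ler_wpM2r // ler_nat.
rewrite powRM // ler_wpM2l ?powR_ge0 // (bigD1 i) //= lerDl.
by apply: sumr_ge0 => j _; exact: powR_ge0.
Qed.

Lemma wt_mulmx n m (L : 'M[R]_(n, m)) s : 0 < s -> exists2 M, 0 <= M &
  forall x : 'rV[R]_n, wt xpredT s (x *m L) <= M * wt xpredT s x.
Proof.
move=> s0; have p0 : 0 < s^-1 by rewrite invr_gt0.
exists (\sum_i n.+1%:R `^ s^-1 * \sum_j `|L j i| `^ s^-1) => [|x].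
  by apply: sumr_ge0 => i _; rewrite mulr_ge0 ?powR_ge0 // sumr_ge0 // => j _; exact: powR_ge0.
rewrite {1}/wt mulr_suml; apply: ler_sum => i _.
apply: (@le_trans _ _ ((\sum_j `|x 0 j * L j i|) `^ s^-1)).
  apply: ge0_ler_powR; rewrite ?nnegrE ?(ltW p0) //.
    by rewrite sumr_ge0.
  by rewrite mxE ler_norm_sum.
apply: le_trans (powR_sum_le p0 _) _ => [j|]; first exact: normr_ge0.
rewrite -mulrA ler_wpM2l ?powR_ge0 // mulr_suml; apply: ler_sum => j _.
rewrite normrM powRM // mulrC ler_wpM2l ?powR_ge0 // /wt (bigD1 j) //= lerDl.
by apply: sumr_ge0 => k _; exact: powR_ge0.
Qed.

Lemma enorm_wt n s : 0 < s -> exists2 M, 0 <= M &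
  forall x : 'rV[R]_n, enorm x `^ s^-1 <= M * wt xpredT s x.
Proof.
move=> s0; have p0 : 0 < s^-1 by rewrite invr_gt0.
exists (n.+1%:R `^ s^-1) => [|x]; first exact: powR_ge0.
apply: le_trans (powR_sum_le p0 (fun j => normr_ge0 (x 0 j))).
apply: ge0_ler_powR; rewrite ?nnegrE ?(ltW p0) ?sqrtr_ge0 ?sumr_ge0 //.
rewrite -[leRHS]ger0_norm ?sumr_ge0 // -sqrtr_sqr ler_sqrt ?sqr_ge0 //.
rewrite /dotrV expr2 mulr_suml; apply: ler_sum => j _.
apply: le_trans (ler_norm _) _; rewrite normrM ler_wpM2l //.
by rewrite (bigD1 j) //= lerDl sumr_ge0.
Qed.

End absorption.

(** * Integrals over R^n *)

Section tuple_measure.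
Variable R : realType.
Local Notation mu n := (lebesgue_tuple R n).

Definition row_of n (t : n.-tuple R) : 'rV[R]_n := \row_i tnth t i.

(** An open set is the countable union of the boxes with rational centre and radius that it
    contains. *)
Lemma open_row_measurable n (U : set 'rV[R]_n) : open U ->
  measurable ((@row_of n) @^-1` U).
Proof.
move=> oU; pose box (q : n.-tuple rat * rat) : set (n.-tuple R) :=
  \bigcap_(i in [set: 'I_n]) ((fun t => tnth t i) @^-1`
    [set y : R | `|ratr (tnth q.1 i) - y| < ratr q.2]).
pose good (q : n.-tuple rat * rat) := box q `<=` (@row_of n) @^-1` U.
have -> : (@row_of n) @^-1` U = \bigcup_q (if `[< good q >] then box q else set0).
  apply/seteqP; split=> [t Ut|t [q _]]; last first.
    by case: ifP => // /asboolP gq bt; exact: gq.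
  have /nbhs_ballP[e /= e0 eU] : nbhs (row_of t) U by exact: open_nbhs_nbhs.
  have [r] : exists r : rat, (ratr r : R) \in `]0, e / 2[.
    by have /rat_in_itvoo[r hr] : (0 : R) < e / 2; [rewrite divr_gt0|exists r].
  rewrite in_itv /= => /andP[r0 re].
  have qi i : exists c : rat, `|ratr c - tnth t i| < ratr r :> R.
    have /rat_in_itvoo[c] : tnth t i - ratr r < tnth t i + ratr r :> R.
      by rewrite ltrBlDr -addrA ltrDl addr_gt0.
    rewrite in_itv /= => /andP[c1 c2]; exists c.
    by rewrite ltr_distl c1 c2.
  pose c := [tuple projT1 (cid (qi i)) | i < n].
  have bt : box (c, r) t.
    by move=> i _ /=; rewrite tnth_mktuple; exact: (projT2 (cid (qi i))).
  have g : good (c, r).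
    move=> y by_; apply: eU.
    rewrite -ball_normE /= [ltLHS]/Num.Def.normr/= mx_normrE.
    apply/bigmax_ltP; split=> // -[i0 i] _ /=; rewrite !mxE.
    have h1 := bt i I; have h2 := by_ i I; rewrite /= in h1 h2.
    have -> : tnth t i - tnth y i = (ratr (tnth c i) - tnth y i) - (ratr (tnth c i) - tnth t i).
      by rewrite opprB [RHS]addrC addrA subrK.
    apply: le_lt_trans (ler_normB _ _) _.
    rewrite (splitr e); apply: ltrD; exact: lt_trans re.
  by exists (c, r) => //; rewrite (introT (asboolP _) g).
apply: countable_bigcupT_measurable => [|q]; first exact: countableP.
case: ifP => // _; apply: fin_bigcap_measurable => [|i _]; first exact: finite_finset.
rewrite -[X in measurable X]setTI; apply: measurable_tnth => //.
have -> : [set y : R | `|ratr (tnth q.1 i) - y| < ratr q.2] =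
    ball (ratr (tnth q.1 i) : R) (ratr q.2) by rewrite -ball_normE.
by rewrite ball_itv; exact: measurable_itv.
Qed.

Lemma continuous_row_measurable n (u : 'rV[R]_n -> R) : continuous u ->
  measurable_fun setT (u \o @row_of n).
Proof.
move=> /continuousP cu; apply: (measurability _ (RGenOpens.measurableE R)).
move=> _ [_ [a [b ->] <-]]; rewrite setTI comp_preimage.
by apply: open_row_measurable; apply: cu; exact: interval_open.
Qed.

Definition affine_tuple n (v : 'I_n -> R) (e : R) (t : n.-tuple R) : n.-tuple R :=
  [tuple v i + e * tnth t i | i < n].

Lemma measurable_affine_tuple n v e : measurable_fun setT (@affine_tuple n v e).
Proof.
apply/measurable_fun_tnthP => i.
have -> : (fun t => tnth t i) \o affine_tuple v e = (fun y => v i + e * y) \o (fun t => tnth t i).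
  by apply/funext => t /=; rewrite tnth_mktuple.
apply: measurableT_comp; last exact: measurable_tnth.
by apply: measurable_funD => //; exact: measurable_funM.
Qed.

Lemma lebesgue_affine (v e : R) (A : set R) : `|e| = 1 -> measurable A ->
  lebesgue_measure ((fun y => v + e * y) @^-1` A) = lebesgue_measure A.
Proof.
move=> e1 mA.
have mtr (w : R) (B : set R) : measurable B ->
    lebesgue_measure ((fun y => w + y) @^-1` B) = lebesgue_measure B.
  move=> mB; have mw : measurable_fun setT (fun y : R => w + y : measurableTypeR R).
    exact: measurable_funD.
  apply/esym; apply: (@lebesgue_measure_unique R
    (pushforward lebesgue_measure (fun y : R => w + y : measurableTypeR R))) => //.
  move=> _ [[a b]] _ <-; rewrite /pushforward.
  rewrite [X in _ = lebesgue_measure X](_ : _ = `]a - w, b - w]%classic); last first.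
    by apply/seteqP; split=> y /=; rewrite !in_itv /= ltrBlDl lerBrDl.
  by rewrite !lebesgue_measure_itv /= !lte_fin ltrD2r -!EFinB opprB addrA subrK.
have [->|en1] : e = 1 \/ e = -1.
  have [e0|e0] := leP 0 e; first by left; rewrite -e1 ger0_norm.
  by right; rewrite -[LHS]opprK -e1 ltr0_norm.
  by under [X in X @^-1` _]eq_fun do rewrite mul1r; exact: mtr.
have -> : (fun y => v + e * y) @^-1` A = -%R @^-1` ((fun y => v + y) @^-1` A).
  by rewrite en1; apply/seteqP; split=> y /=; rewrite mulN1r.
rewrite -(mtr v A mA); apply: lebesgue_measureN.
rewrite -[X in measurable X]setTI; exact: measurable_funD.
Qed.

(** A measure on a product is determined by its values on rectangles, where the claim splits into
    one coordinate and the induction hypothesis. *)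
Lemma lebesgue_tuple_affine n (v : 'I_n -> R) (e : R) (A : set (n.-tuple R)) :
  `|e| = 1 -> measurable A -> mu n (affine_tuple v e @^-1` A) = mu n A.
Proof.
move=> e1; elim: n v A => [|n IH] v A mA.
  have -> : affine_tuple v e = id by apply/funext => t; rewrite [LHS]tuple0 [RHS]tuple0.
  by rewrite preimage_id.
have mc := @measurable_tuple_cons R n.
have mcA : measurable (@tuple_cons R n @^-1` A) by rewrite -[X in measurable X]setTI; exact: mc.
pose tau (p : measurableTypeR R * n.-tuple R) : measurableTypeR R * n.-tuple R :=
  (v ord0 + e * p.1, affine_tuple (fun i => v (lift ord0 i)) e p.2).
have m1 : measurable_fun setT (fun p : R * n.-tuple R => v ord0 + e * p.1).
  apply: (@measurableT_comp _ _ _ _ _ _ (fun y : R => v ord0 + e * y)).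
    by apply: measurable_funD => //; exact: measurable_funM.
  exact: measurable_fst.
have mtau : measurable_fun setT tau.
  apply/measurable_fun_pairP; split; first exact: m1.
  apply: (@measurableT_comp _ _ _ _ _ _ (affine_tuple (fun i => v (lift ord0 i)) e)).
    exact: measurable_affine_tuple.
  exact: measurable_snd.
have Ep p : affine_tuple v e (tuple_cons p) = tuple_cons (tau p).
  apply: eq_from_tnth => i; rewrite tnth_mktuple.
  case: (unliftP ord0 i) => [j ->|->]; first by rewrite !tnthS tnth_mktuple.
  by rewrite !tnth0.
have E : @tuple_cons R n @^-1` (affine_tuple v e @^-1` A) = tau @^-1` (@tuple_cons R n @^-1` A).
  by apply/seteqP; split=> p; rewrite /preimage /mkset Ep.
rewrite /= /lebesgue_cons /pushforward E.
apply: esym; apply: (@product_measure_unique _ _ _ _ R lebesgue_measure (mu n)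
  (pushforward (lebesgue_measure \x mu n)%E tau) _ _ mcA) => // B C mB mC.
pose B' := (fun y => v ord0 + e * y) @^-1` B.
pose C' := affine_tuple (fun i => v (lift ord0 i)) e @^-1` C.
change ((lebesgue_measure \x mu n)%E (B' `*` C') = (lebesgue_measure B * mu n C)%E).
have mf : measurable_fun setT (fun y : R => v ord0 + e * y).
  by apply: measurable_funD => //; exact: measurable_funM.
have mB' : measurable B' by rewrite -[X in measurable X]setTI; exact: mf.
have mC' : measurable C'.
  by rewrite -[X in measurable X]setTI /C'; exact: measurable_affine_tuple.
rewrite (product_measure1E lebesgue_measure (mu n) mB' mC').
congr (_ * _)%E; [exact: lebesgue_affine|exact: IH].
Qed.

Definition tuple_cat m n (p : m.-tuple R * n.-tuple R) : (m + n).-tuple R :=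
  [tuple of p.1 ++ p.2].

Lemma row_of_cat m n (x : m.-tuple R) (y : n.-tuple R) :
  row_of (tuple_cat (x, y)) = row_mx (row_of x) (row_of y).
Proof.
apply/rowP => i; rewrite !mxE; case: split_ordP => j ->; rewrite mxE.
  by rewrite tnth_lshift.
by rewrite tnth_rshift.
Qed.

Lemma measurable_tuple_cat m n : measurable_fun setT (@tuple_cat m n).
Proof.
apply/measurable_fun_tnthP => i; case: (split_ordP i) => j ->.
  have -> : (fun t => tnth t (lshift n j)) \o @tuple_cat m n =
      (fun t : m.-tuple R => tnth t j) \o fst.
    by apply/funext => -[x y] /=; rewrite tnth_lshift.
  by apply: measurableT_comp; [exact: measurable_tnth|exact: measurable_fst].
have -> : (fun t => tnth t (rshift m j)) \o @tuple_cat m n =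
    (fun t : n.-tuple R => tnth t j) \o snd.
  by apply/funext => -[x y] /=; rewrite tnth_rshift.
by apply: measurableT_comp; [exact: measurable_tnth|exact: measurable_snd].
Qed.

(** [lebesgue_tuple] adds one coordinate at a time at the front, so the induction is on the first
    block, with Tonelli for the added coordinate. *)
Lemma lebesgue_tuple_cat m n (A : set ((m + n).-tuple R)) : measurable A ->
  mu (m + n) A = (mu m \x mu n)%E (@tuple_cat m n @^-1` A).
Proof.
elim: m A => [|m IH] A mA.
  rewrite /= /product_measure1 integral_dirac //; last first.
    apply: measurable_fun_xsection; rewrite -[X in measurable X]setTI.
    exact: measurable_tuple_cat.
  rewrite diracT mul1e /=; congr (mu n _).
  have e0 (t : n.-tuple R) : @tuple_cat 0 n ([tuple], t) = t by exact/val_inj.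
  by apply/seteqP; split=> t; rewrite /xsection /mkset inE /preimage /mkset e0.
have mc := @measurable_tuple_cons R (m + n).
have mcA : measurable (@tuple_cons R (m + n) @^-1` A).
  by rewrite -[X in measurable X]setTI; exact: mc.
have mcatA : measurable (@tuple_cat m.+1 n @^-1` A).
  by rewrite -[X in measurable X]setTI; exact: measurable_tuple_cat.
pose phi x := mu n (xsection (@tuple_cat m.+1 n @^-1` A) x).
have mphi : measurable_fun setT phi by exact: measurable_fun_xsection.
have phi0 x : (0 <= phi x)%E by exact: measure_ge0.
transitivity (\int[lebesgue_measure]_t (\int[mu m]_x phi (tuple_cons (t, x))))%E; last first.
  rewrite -(@fubini_tonelli1 _ _ _ _ R lebesgue_measure (mu m) (phi \o @tuple_cons R m)).
  - pose tc : measurableTypeR R * m.-tuple R -> m.+1.-tuple R := @tuple_cons R m.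
    have mtc : measurable_fun setT tc by exact: measurable_tuple_cons.
    have := @ge0_integral_pushforward _ _ _ _ R tc mtc (lebesgue_measure \x mu m)%E
      setT phi measurableT mphi (fun y _ => phi0 y).
    by rewrite preimage_setT.
  - by apply: measurableT_comp => //; exact: measurable_tuple_cons.
  - by move=> p; exact: phi0.
rewrite /= /lebesgue_cons /pushforward /product_measure1.
apply: eq_integral => t _ /=.
rewrite IH; last exact: measurable_xsection.
rewrite /product_measure1; apply: eq_integral => x _ /=; rewrite /phi.
congr (mu n _); apply/seteqP; split=> y; rewrite /xsection /= !inE /= !inE /=;
by rewrite (_ : tuple_cat (tuple_cons (t, x), y) = tuple_cons (t, tuple_cat (x, y))) //;
  exact/val_inj.
Qed.

End tuple_measure.

(** * Real integrals, majorants and Fubini *)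

Section real_integral.
Variable R : realType.
Local Notation mu n := (lebesgue_tuple R n).

Definition intg n (u : 'rV[R]_n -> R) := (mu n).-integrable setT (EFin \o (u \o @row_of R n)).
Definition rint n (u : 'rV[R]_n -> R) : R := (\int[mu n]_t (u (row_of t)))%R.

Lemma integral_prod_tuple n (g : R -> R) : measurable_fun setT g -> (forall t, 0 <= g t) ->
  (\int[mu n]_t (\prod_i g (tnth t i))%:E = (\int[lebesgue_measure]_y (g y)%:E) ^+ n)%E.
Proof.
move=> mg g0; have mprod k : measurable_fun setT (fun t : k.-tuple R => (\prod_i g (tnth t i))%:E).
  apply/measurable_EFinP; apply: measurable_prod => i _.
  by apply: measurableT_comp => //; exact: measurable_tnth.
elim: n => [|n IH].
  rewrite /= integral_dirac //; last exact: mprod.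
  by rewrite diracT mul1e big_ord0.
have p0 k (t : k.-tuple R) : (0 <= (\prod_i g (tnth t i))%:E)%E.
  by rewrite lee_fin prodr_ge0.
pose tc : measurableTypeR R * n.-tuple R -> n.+1.-tuple R := @tuple_cons R n.
have mtc : measurable_fun setT tc by exact: measurable_tuple_cons.
have := @ge0_integral_pushforward _ _ _ _ R tc mtc (lebesgue_measure \x mu n)%E
  setT _ measurableT (mprod n.+1) (fun y _ => p0 _ y).
rewrite preimage_setT => H; transitivity (\int[lebesgue_measure \x mu n]_p (g p.1 * \prod_i g (tnth p.2 i))%:E)%E.
  rewrite -[LHS]/(\int[pushforward (lebesgue_measure \x mu n) tc]_t (\prod_i g (tnth t i))%:E)%E.
  rewrite H; apply: eq_integral => -[x t] _ /=.
  rewrite big_ord_recl tnth0; congr (_ * _)%:E.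
  by apply: eq_bigr => i _; rewrite tnthS.
have mg1 : measurable_fun setT (fun p : measurableTypeR R * n.-tuple R => g p.1).
  by apply: (@measurableT_comp _ _ _ _ _ _ g) => //; exact: measurable_fst.
have mg2 : measurable_fun setT
    (fun p : measurableTypeR R * n.-tuple R => \prod_i g (tnth p.2 i)).
  apply: (@measurableT_comp _ _ _ _ _ _ (fun t : n.-tuple R => \prod_i g (tnth t i))).
    by apply/measurable_EFinP; exact: mprod.
  exact: measurable_snd.
rewrite fubini_tonelli1; last 2 first.
- by apply/measurable_EFinP; exact: measurable_funM.
- by move=> p; rewrite lee_fin mulr_ge0 // prodr_ge0.
rewrite /fubini_F /=.
transitivity (\int[lebesgue_measure]_x ((g x)%:E *
    \int[mu n]_t (\prod_i g (tnth t i))%:E))%E.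
  apply: eq_integral => x _; under eq_integral do rewrite EFinM.
  apply: ge0_integralZl => //; [exact: mprod|by move=> t _; exact: p0|by rewrite lee_fin].
rewrite ge0_integralZr //.
- by rewrite IH; case: (n) => [|k] /=; rewrite ?mule1.
- by apply/measurable_EFinP.
- by move=> x _; rewrite lee_fin.
- by apply: integral_ge0 => x _.
Qed.

Definition dd1 (t : R) : R := (1 + t ^+ 2)^-1.

Lemma dd1_gt0 t : 0 < dd1 t.
Proof. by rewrite invr_gt0 ltr_wpDr // sqr_ge0. Qed.

Lemma continuous_dd1 : continuous dd1.
Proof. exact: continuous_oneDsqrV. Qed.

Lemma dd_row_of n (t : n.-tuple R) : dd (row_of t) = \prod_i dd1 (tnth t i).
Proof. by apply: eq_bigr => i _; rewrite mxE. Qed.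

Lemma intg_dd n : intg (@dd R n).
Proof.
have m1 : measurable_fun setT dd1 by apply: continuous_measurable_fun; exact: continuous_dd1.
have mdd : measurable_fun setT (fun t : n.-tuple R => (\prod_i dd1 (tnth t i))%:E).
  apply/measurable_EFinP; apply: measurable_prod => i _.
  by apply: measurableT_comp => //; exact: measurable_tnth.
rewrite /intg (_ : _ \o _ = fun t => (\prod_i dd1 (tnth t i))%:E); last first.
  by apply/funext => t; rewrite /= dd_row_of.
apply/integrableP; split=> //.
rewrite (eq_integral (fun t => (\prod_i dd1 (tnth t i))%:E)); last first.
  by move=> t _; rewrite gee0_abs // lee_fin prodr_ge0 // => i _; exact/ltW/dd1_gt0.
  rewrite (@integral_prod_tuple n dd1) //; last by move=> t; exact/ltW/dd1_gt0.
  rewrite (ge0_symfun_integralT (f := dd1)); last 3 first.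
  - by move=> t; exact/ltW/dd1_gt0.
  - exact: continuous_dd1.
  - by move=> t; rewrite /dd1 /= sqrrN.
  rewrite (_ : [set x | _] = `[0, +oo[%classic); last first.
    by apply/seteqP; split => x /=; rewrite in_itv /= andbT.
  rewrite (_ : (\int[_]_(x in _) _ = (pi / 2)%:E)%E); last exact: integral0y_oneDsqr.
  by rewrite -EFinM -EFin_expe ltry.
Qed.

(** Domination by a multiple of [dd] replaces integrability because it passes to every section, as
    the Fubini arguments need. *)
Definition RD n (u : 'rV[R]_n -> R) :=
  continuous u /\ exists A, forall x, `|u x| <= A * dd x.

Lemma RD_intg n (u : 'rV[R]_n -> R) : RD u -> intg u.
Proof.
move=> [cu [A uA]].
have iA : (mu n).-integrable setT (fun t => A%:E * (dd (row_of t))%:E)%E.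
  by apply: integrableZl => //; exact: intg_dd.
apply: le_integrable iA => //; first by apply/measurable_EFinP; exact: continuous_row_measurable.
move=> t _ /=; rewrite lee_fin; apply: le_trans (uA _) _; exact: ler_norm.
Qed.

Lemma rintE n (u : 'rV[R]_n -> R) : rint u = fine (\int[mu n]_t (u (row_of t))%:E)%E.
Proof. by []. Qed.

Lemma rint_fin n (u : 'rV[R]_n -> R) : RD u ->
  ((rint u)%:E = \int[mu n]_t (u (row_of t))%:E)%E.
Proof.
by move=> /RD_intg iu; rewrite rintE fineK //; exact: (integrable_fin_num _ iu).
Qed.

Lemma eq_rint n (u v : 'rV[R]_n -> R) : u =1 v -> rint u = rint v.
Proof. by move=> /funext ->. Qed.

Lemma rintD n (u v : 'rV[R]_n -> R) : RD u -> RD v ->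
  rint (fun x => u x + v x) = rint u + rint v.
Proof. by move=> /RD_intg iu /RD_intg iv; exact: (RintegralD _ iu iv). Qed.

Lemma rintZ n c (u : 'rV[R]_n -> R) : RD u -> rint (fun x => c * u x) = c * rint u.
Proof. by move=> /RD_intg iu; exact: (RintegralZl _ _ iu). Qed.

Definition Dn n : R := rint (@dd R n).

Lemma Dn_ge0 n : 0 <= Dn n.
Proof. by apply: Rintegral_ge0 => t _; exact: dd_ge0. Qed.

Lemma rint_le n (u : 'rV[R]_n -> R) A : RD u -> (forall x, `|u x| <= A * dd x) ->
  `|rint u| <= A * Dn n.
Proof.
move=> /RD_intg iu uA.
apply: le_trans (le_normr_Rintegral _ iu) _ => //.
have iA : (mu n).-integrable setT (fun t => A%:E * (dd (row_of t))%:E)%E.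
  by apply: integrableZl => //; exact: intg_dd.
rewrite /Dn /rint -(RintegralZl _ _ (intg_dd n)) //.
apply: le_Rintegral => // [|t _]; last exact: uA.
have := integrable_abse iu.
by congr integrable; apply/funext => t /=.
Qed.

Lemma RD_affine n (v : 'rV[R]_n) (e : R) (u : 'rV[R]_n -> R) : continuous u ->
  continuous (fun x : 'rV[R]_n => u (v + e *: x)).
Proof.
move=> cu x.
have cf : {for x, continuous (fun x : 'rV[R]_n => v + e *: x)}.
  apply: (@continuousD _ _ _ (fun _ : 'rV[R]_n => v)); first exact: (@cst_continuous _ _ v x).
  exact: (@cvgZl_tmp _ _ _ (nbhs x) _ e id x).
exact: (continuous_comp cf (cu _)).
Qed.

Lemma rint_affine n (v : 'rV[R]_n) (e : R) (u : 'rV[R]_n -> R) : `|e| = 1 ->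
  RD u -> rint (fun x : 'rV[R]_n => u (v + e *: x)) = rint u.
Proof.
move=> e1 du; have iu := RD_intg du; have [cu _] := du.
pose tau := @affine_tuple R n (fun i => v 0 i) e.
have mtau : measurable_fun setT tau by exact: measurable_affine_tuple.
have rowtau t : row_of (tau t) = v + e *: row_of t.
  by apply/rowP => i; rewrite !mxE tnth_mktuple.
have mu_ : measurable_fun setT (EFin \o (u \o @row_of R n)).
  by apply/measurable_EFinP; exact: continuous_row_measurable.
have eqm (g : n.-tuple R -> \bar R) :
    (\int[pushforward (mu n) tau]_t g t = \int[mu n]_t g t)%E.
  by apply: eq_measure_integral => A mA _; exact: lebesgue_tuple_affine.
rewrite /rint /Rintegral; congr fine.
rewrite -[RHS](eqm (EFin \o (u \o @row_of R n))).
rewrite integral_pushforward //.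
  by rewrite preimage_setT; apply: eq_integral => t _ /=; rewrite rowtau.
rewrite preimage_setT; apply/integrableP; split; first exact: measurableT_comp.
have /integrableP[_] := iu.
rewrite -(eqm (fun t => `|(EFin \o (u \o @row_of R n)) t|%E)).
rewrite ge0_integral_pushforward ?preimage_setT //.
by apply: measurableT_comp.
Qed.

Lemma dd_row_mx m n (x : 'rV[R]_m) (y : 'rV[R]_n) : dd (row_mx x y) = dd x * dd y.
Proof.
rewrite /dd big_split_ord /=; congr (_ * _); apply: eq_bigr => i _.
  by rewrite row_mxEl.
by rewrite row_mxEr.
Qed.

Lemma row_mx_continuousl m n (y : 'rV[R]_n) : continuous (fun x : 'rV[R]_m => row_mx x y).
Proof.
have -> : (fun x : 'rV[R]_m => row_mx x y) =
    (fun=> row_mx 0 y) \+ (fun x : 'rV[R]_m => x *m row_mx 1%:M 0).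
  by apply/funext => x /=; rewrite mul_mx_row mulmx1 mulmx0 add_row_mx add0r addr0.
move=> x; exact: (continuousD (@cst_continuous _ _ (row_mx 0 y) x)
  (@mulmx_continuous R m (m + n) _ x)).
Qed.

Lemma row_mx_continuousr m n (x : 'rV[R]_m) : continuous (fun y : 'rV[R]_n => row_mx x y).
Proof.
have -> : (fun y : 'rV[R]_n => row_mx x y) =
    (fun=> row_mx x 0) \+ (fun y : 'rV[R]_n => y *m row_mx 0 1%:M).
  by apply/funext => y /=; rewrite mul_mx_row mulmx1 mulmx0 add_row_mx add0r addr0.
move=> y; exact: (continuousD (@cst_continuous _ _ (row_mx x 0) y)
  (@mulmx_continuous R n (m + n) _ y)).
Qed.

Lemma RD_secl m n (F : 'rV[R]_(m + n) -> R) y : RD F -> RD (fun x => F (row_mx x y)).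
Proof.
move=> [cF [A FA]]; split.
  by move=> x; exact: (continuous_comp (@row_mx_continuousl m n y x) (cF _)).
exists (A * dd y) => x; apply: le_trans (FA _) _.
by rewrite dd_row_mx mulrAC mulrA.
Qed.

Lemma RD_secr m n (F : 'rV[R]_(m + n) -> R) x : RD F -> RD (fun y => F (row_mx x y)).
Proof.
move=> [cF [A FA]]; split.
  by move=> y; exact: (continuous_comp (@row_mx_continuousr m n x y) (cF _)).
exists (A * dd x) => y; apply: le_trans (FA _) _.
by rewrite dd_row_mx mulrA.
Qed.

Section fubini_row.
Variables (m n : nat) (F : 'rV[R]_(m + n) -> R).
Hypothesis dF : RD F.

Let f (p : m.-tuple R * n.-tuple R) : \bar R := (F (row_mx (row_of p.1) (row_of p.2)))%:E.

Let eqm (g : (m + n).-tuple R -> \bar R) :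
  (\int[pushforward (mu m \x mu n) (@tuple_cat R m n)]_t g t = \int[mu (m + n)]_t g t)%E.
Proof.
apply: eq_measure_integral; first exact: measurable_tuple_cat.
by move=> ? A mA _; exact: (esym (lebesgue_tuple_cat mA)).
Qed.

Let fE : f = (EFin \o (F \o @row_of R (m + n))) \o @tuple_cat R m n.
Proof. by apply/funext => -[x y]; rewrite /f /= row_of_cat. Qed.

Let mcat := @measurable_tuple_cat R m n.

Let mF : measurable_fun setT (EFin \o (F \o @row_of R (m + n))).
Proof. by apply/measurable_EFinP; apply: continuous_row_measurable; case: dF. Qed.

Let intf : (mu m \x mu n)%E.-integrable setT f.
Proof.
apply/integrableP; split; first by rewrite fE; exact: measurableT_comp.
have /integrableP[_] := RD_intg dF.
rewrite -(eqm (fun t => `|(EFin \o (F \o @row_of R (m + n))) t|%E)).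
rewrite ge0_integral_pushforward ?preimage_setT //; first by rewrite fE.
by apply: measurableT_comp.
Qed.

Let integralF : (\int[mu (m + n)]_t (F (row_of t))%:E = \int[mu m \x mu n]_p f p)%E.
Proof.
rewrite -(eqm (EFin \o (F \o @row_of R (m + n)))).
by rewrite integral_pushforward ?preimage_setT // ?fE // -?fE.
Qed.

Lemma rint_cat : rint F = rint (fun x => rint (fun y => F (row_mx x y))).
Proof.
rewrite [LHS]rintE integralF -(integral12_prod_meas1 intf) [RHS]rintE; congr fine.
by apply: eq_integral => x _; rewrite rint_fin //; exact: RD_secr.
Qed.

Lemma rint_catr : rint F = rint (fun y => rint (fun x => F (row_mx x y))).
Proof.
rewrite [LHS]rintE integralF -(integral21_prod_meas1 intf) [RHS]rintE; congr fine.
by apply: eq_integral => x _; rewrite rint_fin //; exact: RD_secl.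
Qed.

End fubini_row.

End real_integral.

(** * Complex integrals and differentiation under the integral *)

Section complex_integral.
Variable R : realType.
Local Notation normc := (@Normc.normc R).
Local Notation cint := (@integral_rV R _).
Local Notation e_ j := (basis_rV R j).

Lemma cintE n (f : 'rV[R]_n -> R[i]) :
  cint f = Complex (rint (@complex.Re R \o f)) (rint (@complex.Im R \o f)).
Proof. by []. Qed.

Definition CD n (f : 'rV[R]_n -> R[i]) :=
  [/\ continuous (@complex.Re R \o f), continuous (@complex.Im R \o f) &
      exists A, forall x, normc (f x) <= A * dd x].

Lemma CD_RD n (f : 'rV[R]_n -> R[i]) : CD f ->
  RD (@complex.Re R \o f) /\ RD (@complex.Im R \o f).
Proof.
move=> [c1 c2 [A fA]]; split; split=> //; exists A => x.
  exact: le_trans (normc_Re_le _) (fA x).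
exact: le_trans (normc_Im_le _) (fA x).
Qed.

Lemma eq_cint n (f g : 'rV[R]_n -> R[i]) : f =1 g -> cint f = cint g.
Proof. by move=> /funext ->. Qed.

Lemma CD_D n (f g : 'rV[R]_n -> R[i]) : CD f -> CD g -> CD (fun x => f x + g x).
Proof.
move=> [f1 f2 [A fA]] [g1 g2 [B gB]]; split; last first.
- exists (A + B) => x; rewrite mulrDl; apply: le_trans (ler_normcD _ _) _.
  by apply: lerD.
- rewrite (_ : _ \o _ = (@complex.Im R \o f) + (@complex.Im R \o g)).
    by move=> x; apply: continuousD; [exact: f2|exact: g2].
  by apply/funext => x; rewrite /= !fctE /=; case: (f x) (g x) => ? ? [].
- rewrite (_ : _ \o _ = (@complex.Re R \o f) + (@complex.Re R \o g)).
    by move=> x; apply: continuousD; [exact: f1|exact: g1].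
  by apply/funext => x; rewrite /= !fctE /=; case: (f x) (g x) => ? ? [].
Qed.

Lemma CD_M n (f g : 'rV[R]_n -> R[i]) (B : R) : CD f ->
  continuous (@complex.Re R \o g) -> continuous (@complex.Im R \o g) ->
  (forall x, normc (g x) <= B) -> CD (fun x => f x * g x).
Proof.
move=> [f1 f2 [A fA]] g1 g2 gB; split.
- rewrite (_ : _ \o _ = (@complex.Re R \o f) * (@complex.Re R \o g) -
    (@complex.Im R \o f) * (@complex.Im R \o g)).
    by move=> x; apply: continuousB; apply: continuousM;
      [exact: f1|exact: g1|exact: f2|exact: g2].
  by apply/funext => x; rewrite /= !fctE /=; case: (f x) (g x) => ? ? [].
- rewrite (_ : _ \o _ = (@complex.Re R \o f) * (@complex.Im R \o g) +
    (@complex.Im R \o f) * (@complex.Re R \o g)).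
    by move=> x; apply: continuousD; apply: continuousM;
      [exact: f1|exact: g2|exact: f2|exact: g1].
  by apply/funext => x; rewrite /= !fctE /=; case: (f x) (g x) => ? ? [].
exists (A * B) => x; rewrite Normc.normcM mulrAC.
apply: ler_pM (fA x) (gB x); exact: normc_ge0.
Qed.

Lemma CD_Z n c (f : 'rV[R]_n -> R[i]) : CD f -> CD (fun x => c * f x).
Proof.
move=> df; have : CD (fun x => f x * c).
  apply: (CD_M (B := normc c) df) => //.
    exact: (@cst_continuous _ _ (complex.Re c)).
  exact: (@cst_continuous _ _ (complex.Im c)).
by under eq_fun do rewrite mulrC.
Qed.

Lemma cint_D n (f g : 'rV[R]_n -> R[i]) : CD f -> CD g ->
  cint (fun x => f x + g x) = cint f + cint g.
Proof.
move=> /CD_RD[f1 f2] /CD_RD[g1 g2]; rewrite !cintE.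
apply/eqP; rewrite eq_complex /=; apply/andP; split; apply/eqP.
  rewrite -rintD //; apply: eq_rint => x /=; by case: (f x) (g x) => ? ? [].
rewrite -rintD //; apply: eq_rint => x /=; by case: (f x) (g x) => ? ? [].
Qed.

Lemma RD_Z n c (u : 'rV[R]_n -> R) : RD u -> RD (fun x => c * u x).
Proof.
move=> [cu [A uA]]; split.
  move=> x; apply: (@continuousM _ _ (fun=> c) u); last exact: cu.
  exact: (@cst_continuous _ _ c).
by exists (`|c| * A) => x; rewrite normrM -mulrA ler_wpM2l.
Qed.

Lemma cint_Z n c (f : 'rV[R]_n -> R[i]) : CD f -> cint (fun x => c * f x) = c * cint f.
Proof.
move=> /CD_RD[f1 f2]; rewrite !cintE; case: c => a b.
apply/eqP; rewrite eq_complex /=; apply/andP; split; apply/eqP.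
  rewrite -(rintZ a f1) -(mulNr b) -(rintZ (- b) f2) -rintD; try exact: RD_Z.
  by apply: eq_rint => x /=; case: (f x) => ? ? /=; rewrite mulNr.
rewrite -(rintZ a f2) -(rintZ b f1) -rintD; try exact: RD_Z.
by apply: eq_rint => x /=; case: (f x) => ? ? /=.
Qed.

(** Real and imaginary parts are estimated separately, hence the factor 2. *)
Lemma cint_le n (f : 'rV[R]_n -> R[i]) A : CD f ->
  (forall x, normc (f x) <= A * dd x) -> normc (cint f) <= 2 * A * Dn R n.
Proof.
move=> /CD_RD[f1 f2] fA; rewrite cintE; apply: le_trans (normc_le_ReIm _) _ => /=.
rewrite -mulrA mulrDl mul1r; apply: lerD; apply: rint_le => // x.
  exact: le_trans (normc_Re_le _) (fA x).
exact: le_trans (normc_Im_le _) (fA x).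
Qed.

Lemma cint_affine n (v : 'rV[R]_n) (e : R) (f : 'rV[R]_n -> R[i]) : `|e| = 1 ->
  CD f -> cint (fun x : 'rV[R]_n => f (v + e *: x)) = cint f.
Proof.
move=> e1 /CD_RD[f1 f2]; rewrite !cintE; congr Complex.
  exact: (rint_affine v e1 f1).
exact: (rint_affine v e1 f2).
Qed.

Lemma CD_secl m n (F : 'rV[R]_(m + n) -> R[i]) y : CD F -> CD (fun x => F (row_mx x y)).
Proof.
move=> dF; have [/(RD_secl y)[c1 _] /(RD_secl y)[c2 _]] := CD_RD dF; split=> //.
have [_ _ [A FA]] := dF.
by exists (A * dd y) => x; apply: le_trans (FA _) _; rewrite dd_row_mx mulrAC mulrA.
Qed.

Lemma CD_secr m n (F : 'rV[R]_(m + n) -> R[i]) x : CD F -> CD (fun y => F (row_mx x y)).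
Proof.
move=> dF; have [/(RD_secr x)[c1 _] /(RD_secr x)[c2 _]] := CD_RD dF; split=> //.
have [_ _ [A FA]] := dF.
by exists (A * dd x) => y; apply: le_trans (FA _) _; rewrite dd_row_mx mulrA.
Qed.

Lemma cint_cat m n (F : 'rV[R]_(m + n) -> R[i]) : CD F ->
  cint F = cint (fun x => cint (fun y => F (row_mx x y))).
Proof.
move=> /CD_RD[f1 f2]; rewrite !cintE; congr Complex; first exact: (rint_cat f1).
exact: (rint_cat f2).
Qed.

Lemma cint_catr m n (F : 'rV[R]_(m + n) -> R[i]) : CD F ->
  cint F = cint (fun y => cint (fun x => F (row_mx x y))).
Proof.
move=> /CD_RD[f1 f2]; rewrite !cintE; congr Complex; first exact: (rint_catr f1).
exact: (rint_catr f2).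
Qed.

Lemma smooth_CD n (f : 'rV[R]_n -> R[i]) A : smooth f ->
  (forall x, normc (f x) <= A * dd x) -> CD f.
Proof. by move=> /smooth_continuous[c1 c2] fA; split=> //; exists A. Qed.

Lemma row_mx_line m n (x : 'rV[R]_m) (y : 'rV[R]_n) i (t : R) :
  row_mx (x + t *: e_ i) y = row_mx x y + t *: e_ (lshift n i).
Proof.
apply/rowP => k; rewrite /basis_rV !mxE; case: split_ordP => j ->.
  by rewrite !mxE (inj_eq (@lshift_inj _ _)).
by rewrite eq_rlshift andbF mulr0 addr0.
Qed.

(** Domination is asked only near x, as the majorants may grow with the parameters. *)
Lemma diff_under_rint m n (u : 'rV[R]_(m + n) -> R) (x : 'rV[R]_m) i (A delta : R) : 0 < delta ->
  Ck 1 u ->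
  (forall z : 'rV[R]_m, (forall k, `|z 0 k - x 0 k| < delta) ->
     RD (fun y => u (row_mx z y)) /\
     forall y, `|'D_(e_ (lshift n i)) u (row_mx z y)| <= A * dd y) ->
  is_derive x (e_ i) (fun z : 'rV[R]_m => rint (fun y => u (row_mx z y)))
    (rint (fun y => 'D_(e_ (lshift n i)) u (row_mx x y))).
Proof.
move=> d0 [cu du Du] H; apply/is_derive_line.
pose f (t : R) (y : n.-tuple R) := u (row_mx (x + t *: e_ i) (row_of y)).
pose I : set R := `](- delta), delta[%classic.
have I0 : I 0 by rewrite /I /= in_itv /= oppr_lt0 d0.
have zt (t : R) : I t -> forall k, `|(x + t *: e_ i) 0 k - x 0 k| < delta.
  rewrite /I /= in_itv /= -ltr_norml => td k.
  rewrite /basis_rV !mxE addrAC subrr add0r; apply: le_lt_trans td.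
  by rewrite normrM ler_piMr // normr_nat lern1 leq_b1.
have fl (t : R) y : f t y = u (row_mx x (row_of y) + t *: e_ (lshift n i)).
  by rewrite /f row_mx_line.
have df (t : R) y : is_derive t (1 : R) (f ^~ y)
    ('D_(e_ (lshift n i)) u (row_mx (x + t *: e_ i) (row_of y))).
  rewrite (_ : f ^~ y = fun t => u (row_mx x (row_of y) + t *: e_ (lshift n i))); last first.
    by apply/funext => s; rewrite fl.
  rewrite row_mx_line; apply: DeriveDef; last by rewrite line_derive.
  by rewrite line_derivable.
have intf (t : R) : I t -> (lebesgue_tuple R n).-integrable setT (EFin \o f t).
  by move=> /zt/H[h _]; exact: (RD_intg h).
have d1 (t : R) y : I t -> setT y -> derivable (f ^~ y) t 1.
  by move=> _ _; have [h _] := df t y.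
have G0 (y : n.-tuple R) : 0 <= `|A| * dd (row_of y) by rewrite mulr_ge0 // dd_ge0.
have intG : (lebesgue_tuple R n).-integrable setT
    (EFin \o (fun y => `|A| * dd (row_of y))).
  have h : (lebesgue_tuple R n).-integrable setT
      (fun t => `|A|%:E * (dd (row_of t))%:E)%E.
    by apply: integrableZl => //; exact: intg_dd.
  exact: h.
have Gub (t : R) y : I t -> setT y -> `|partial1of2 f t y| <= `|A| * dd (row_of y).
  move=> /zt/H[_ h] _; rewrite partial1of2E.
  have [_ ->] := df t y; apply: le_trans (h _) _.
  by rewrite ler_wpM2r ?dd_ge0 // ler_norm.
have := @differentiation_under_integral R _ _ (lebesgue_tuple R n) f setT measurableT
  0 (- delta) delta I0 intf d1 _ G0 intG Gub.
have := @derivable_under_integral R _ _ (lebesgue_tuple R n) f setT measurableT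
  0 (- delta) delta I0 intf d1 _ G0 intG Gub.
rewrite derive1E => D1 D2; split; first exact: D1.
rewrite [LHS]D2; apply: eq_Rintegral => y _.
rewrite partial1of2E; have [_ ->] := df 0 y.
by rewrite scale0r addr0.
Qed.

Lemma dd_shift n (x y : 'rV[R]_n) : (forall k, `|x 0 k| <= 1) ->
  dd (x + y) <= 3 ^+ n * dd y.
Proof.
move=> x1; rewrite /dd -[X in _ ^+ X](card_ord n) -prodr_const -big_split /=.
apply: ler_prod => k _.
have p (t : R) : 0 < 1 + t ^+ 2 by rewrite ltr_wpDr // sqr_ge0.
rewrite invr_ge0 (ltW (p _)) /= mxE ler_pdivlMr // mulrC ler_pdivrMr //.
have : x 0 k ^+ 2 <= 1 by rewrite -real_normK ?num_real // exprn_ile1.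
have : 0 <= (x 0 k + (x 0 k + y 0 k)) ^+ 2 by rewrite sqr_ge0.
nra.
Qed.

(** The integral of v(z + y) in y does not depend on z; differentiating it under the integral sign
    at z = 0 gives the claim without boundary terms. *)
Lemma rint_derive0 n (v : 'rV[R]_n -> R) j : Ck 1 v -> RD v -> RD ('D_(e_ j) v) ->
  rint ('D_(e_ j) v) = 0.
Proof.
move=> Cv dv dDv; have [cv dfv Dv] := Cv.
pose L : 'M[R]_(n + n, n) := col_mx 1%:M 1%:M.
have EL (x y : 'rV[R]_n) : row_mx x y *m L = x + y by rewrite mul_row_col !mulmx1.
pose u (z : 'rV[R]_(n + n)) := v (z *m L).
have Cu : Ck 1 u by exact: Ck_mulmx.
have Du z : 'D_(e_ (lshift n j)) u z = 'D_(e_ j) v (z *m L).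
  rewrite [LHS](congr1 (@^~ z) (derive_mulmx L (lshift n j) Cv)) /= fct_sumE (bigD1 j) //= big1 => [|i ij].
    by rewrite /L col_mxEu mxE eqxx mul1r addr0.
  by rewrite /L col_mxEu mxE eq_sym (negbTE ij) mul0r.
have uE (z : 'rV[R]_n) : (fun y => u (row_mx z y)) = (fun y => v (z + 1 *: y)).
  by apply/funext => y; rewrite /u EL scale1r.
have cst_ : (fun z : 'rV[R]_n => rint (fun y => u (row_mx z y))) = fun=> rint v.
  by apply/funext => z; rewrite uE rint_affine // normr1.
have [_ [A vA]] := dDv; have [_ [B vB]] := dv.
have A0 : 0 <= A by have := le_trans (normr_ge0 _) (vA 0); rewrite pmulr_lge0 //;
  apply: prodr_gt0 => i _; rewrite invr_gt0 ltr_wpDr // sqr_ge0.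
have B0 : 0 <= B by have := le_trans (normr_ge0 _) (vB 0); rewrite pmulr_lge0 //;
  apply: prodr_gt0 => i _; rewrite invr_gt0 ltr_wpDr // sqr_ge0.
have := @diff_under_rint n n u 0 j (A * 3 ^+ n) 1 ltr01 Cu.
rewrite cst_.
case=> [z zk|_ E].
  have z1 k : `|z 0 k| <= 1 by have := ltW (zk k); rewrite mxE subr0.
  split=> [|y].
    rewrite uE; split; first exact: RD_affine.
    exists (B * 3 ^+ n) => y; rewrite scale1r; apply: le_trans (vB _) _.
    by rewrite -mulrA ler_wpM2l // dd_shift.
  by rewrite Du EL; apply: le_trans (vA _) _; rewrite -mulrA ler_wpM2l // dd_shift.
rewrite (derive_cst (rint v)) in E.
rewrite E; apply: eq_rint => y; by rewrite Du EL add0r.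
Qed.

End complex_integral.

(** * The partial Fourier transform *)

Section partial_fourier.
Variable R : realType.
Local Notation normc := (@Normc.normc R).
Local Notation cint := (@integral_rV R _).
Local Notation e_ j := (basis_rV R j).

Lemma Ck_shift n k (u : 'rV[R]_n -> R) (w : 'rV[R]_n) : Ck k u -> Ck k (fun y => u (y + w)).
Proof.
have cs : continuous (fun y : 'rV[R]_n => y + w).
  by move=> y; apply: (@continuousD _ _ _ id (fun=> w)); [exact: cvg_id|exact: (@cst_continuous _ _ w)].
elim: k u => [|k IH] u Cu.
  by move=> y; exact: (continuous_comp (cs y) (Cu (y + w))).
have [cu du Du] := Cu.
split=> [y|j y|j]; first exact: (continuous_comp (cs y) (cu (y + w))).
  by case: (derivable_shift (du j (y + w))).
have -> : 'D_(e_ j) (fun y => u (y + w)) = fun y => 'D_(e_ j) u (y + w).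
  by apply/funext => y; case: (derivable_shift (du j (y + w))).
exact: (IH _ (Du j)).
Qed.

Lemma row_mx_liner m n (x : 'rV[R]_m) (y : 'rV[R]_n) j (t : R) :
  row_mx x (y + t *: e_ j) = row_mx x y + t *: e_ (rshift m j).
Proof.
apply/rowP => k; rewrite /basis_rV !mxE; case: split_ordP => i ->.
  by rewrite eq_lrshift andbF mulr0 addr0.
by rewrite !mxE (inj_eq (@rshift_inj _ _)).
Qed.

Lemma derive_secr m n (u : 'rV[R]_(m + n) -> R) (x : 'rV[R]_m) j y :
  derivable u (row_mx x y) (e_ (rshift m j)) ->
  is_derive y (e_ j) (fun y => u (row_mx x y)) ('D_(e_ (rshift m j)) u (row_mx x y)).
Proof.
move=> /derivableP/is_derive_line h; apply/is_derive_line.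
by under eq_fun do rewrite row_mx_liner.
Qed.

Lemma Ck_secr m n k (u : 'rV[R]_(m + n) -> R) (x : 'rV[R]_m) :
  Ck k u -> Ck k (fun y => u (row_mx x y)).
Proof.
move=> /(Ck_shift (row_mx x 0))/(Ck_mulmx (row_mx 0 1%:M : 'M[R]_(n, m + n))).
rewrite (_ : (fun y => _) = fun y => u (row_mx x y)) //.
by apply/funext => y; rewrite mul_mx_row mulmx1 mulmx0 add_row_mx add0r addr0.
Qed.

Section under_integral.
Variables m n : nat.
Implicit Types f : 'rV[R]_(m + n) -> R[i].

Definition Int f (x : 'rV[R]_m) : R[i] := cint (fun y : 'rV[R]_n => f (row_mx x y)).

(** Domination that is locally uniform in the parameters, the form needed to differentiate under the
    integral. *)
Definition LD f := smooth f /\ forall x : 'rV[R]_m, exists2 delta : R, 0 < delta &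
  exists A, forall z : 'rV[R]_m, (forall k, `|z 0 k - x 0 k| < delta) ->
    forall y : 'rV[R]_n, normc (f (row_mx z y)) <= A * dd y.

Lemma LD_CD f x : LD f -> CD (fun y => f (row_mx x y)).
Proof.
move=> [sf /(_ x)[d d0 [A H]]].
have [c1 c2] := smooth_continuous sf.
split; last by exists A; apply: H => k; rewrite subrr normr0.
- by move=> y; exact: (continuous_comp (@row_mx_continuousr R m n x y) (c1 _)).
- by move=> y; exact: (continuous_comp (@row_mx_continuousr R m n x y) (c2 _)).
Qed.

Lemma Int_derive f x i : LD f -> LD (cD (lshift n i) f) ->
  is_derive x (e_ i) (@complex.Re R \o Int f) (complex.Re (Int (cD (lshift n i) f) x)) /\
  is_derive x (e_ i) (@complex.Im R \o Int f) (complex.Im (Int (cD (lshift n i) f) x)).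
Proof.
move=> lf ldf; have [sf _] := lf; have /smoothP/(_ 1%N)[C1 C2] := sf.
have [_ /(_ x)[d d0 [A H]]] := ldf.
split.
  apply: (@diff_under_rint R m n _ x i A d d0 C1) => z zd; split=> [|y].
    by have [] := CD_RD (LD_CD z lf).
  exact: le_trans (normc_Re_le _) (H z zd y).
apply: (@diff_under_rint R m n _ x i A d d0 C2) => z zd; split=> [|y].
  by have [] := CD_RD (LD_CD z lf).
exact: le_trans (normc_Im_le _) (H z zd y).
Qed.

Definition param_derivs (js : seq 'I_m) f := foldr (fun j g => cD (lshift n j) g) f js.

Lemma Int_bounded f (x : 'rV[R]_m) : LD f -> exists2 B : R, 0 <= B &
  \forall z \near x, normc (Int f z) <= B.
Proof.
move=> lf; have [_ /(_ x)[d d0 [A H]]] := lf.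
exists (`|2 * A * Dn R n|) => //; apply/nbhs_ballP; exists d => //= z.
rewrite -ball_normE /= => xz; apply: le_trans (ler_norm _).
apply: (cint_le (LD_CD z lf) (H z _)) => k; rewrite distrC; apply: le_lt_trans xz.
by have := row_norm_coord (x - z) k; rewrite !mxE.
Qed.

Lemma LD_all_bounded (F : 'I_m -> 'rV[R]_(m + n) -> R[i]) (x : 'rV[R]_m) : (forall i, LD (F i)) ->
  exists2 B : R, 0 <= B & \forall z \near x, forall i, normc (Int (F i) z) <= B.
Proof.
move=> lF; pose B i := projT1 (cid2 (Int_bounded x (lF i))).
have [B0 BP] : (forall i, 0 <= B i) /\
    (forall i, \forall z \near x, normc (Int (F i) z) <= B i).
  by split=> i; rewrite /B; case: cid2.
exists (\sum_i B i); first by apply: sumr_ge0 => i _.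
have : \forall z \near x, forall i, normc (Int (F i) z) <= B i.
  exact: (@filter_forall _ _ (fun i z => normc (Int (F i) z) <= B i) (nbhs x) _ BP).
apply: (@filterS _ (nbhs x)) => z H i; apply: le_trans (H i) _.
by rewrite (bigD1 i) //= lerDl sumr_ge0.
Qed.

(** The derivatives of the integral are integrals of the same kind, hence locally bounded, and this
    already gives continuity at each stage of the induction. *)
Lemma Int_CkC k f : (forall js, LD (param_derivs js f)) -> CkC k (Int f).
Proof.
elim: k f => [|k IH] f Hf.
all: have lf : LD f by exact: (Hf [::]).
all: have ldf i : LD (cD (lshift n i) f) by exact: (Hf [:: i]).
all: have dRe x i := (Int_derive x (i := i) lf (ldf i)).1.
all: have dIm x i := (Int_derive x (i := i) lf (ldf i)).2.
all: have cRe : continuous (@complex.Re R \o Int f).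
all: try (move=> x; apply: locally_bounded_partials_continuous;
  [by move=> j z; case: (dRe z j)
  |have [B B0 BP] := LD_all_bounded x ldf; exists B => //; apply: (@filterS _ (nbhs x)) BP => z Bz j;
   have [_ ->] := dRe z j; exact: le_trans (normc_Re_le _) (Bz j)]).
all: have cIm : continuous (@complex.Im R \o Int f).
all: try (move=> x; apply: locally_bounded_partials_continuous;
  [by move=> j z; case: (dIm z j)
  |have [B B0 BP] := LD_all_bounded x ldf; exists B => //; apply: (@filterS _ (nbhs x)) BP => z Bz j;
   have [_ ->] := dIm z j; exact: le_trans (normc_Im_le _) (Bz j)]).
- by split.
have HD i js : LD (param_derivs js (cD (lshift n i) f)).
  by have := Hf (rcons js i); rewrite /param_derivs foldr_rcons.
split.
  split=> [|j x|j]; [exact: cRe|by case: (dRe x j)|].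
  have -> : 'D_(e_ j) (@complex.Re R \o Int f) = @complex.Re R \o Int (cD (lshift n j) f).
    by apply/funext => x; case: (dRe x j).
  by have [] := IH _ (HD j).
split=> [|j x|j]; [exact: cIm|by case: (dIm x j)|].
have -> : 'D_(e_ j) (@complex.Im R \o Int f) = @complex.Im R \o Int (cD (lshift n j) f).
  by apply/funext => x; case: (dIm x j).
by have [] := IH _ (HD j).
Qed.

Lemma smooth_Int f : (forall js, LD (param_derivs js f)) -> smooth (Int f).
Proof. by move=> Hf; apply/smoothP => k; exact: Int_CkC. Qed.

Lemma cD_Int f i : (forall js, LD (param_derivs js f)) -> cD i (Int f) = Int (cD (lshift n i) f).
Proof.
move=> Hf; apply/funext => x.
have [[_ h1] [_ h2]] := Int_derive x (Hf [::]) (Hf [:: i]).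
by rewrite /cD h1 h2; case: (Int _ _).
Qed.

End under_integral.

Lemma expi_CkC n k (ph : 'rV[R]_n -> R) : Ck k ph -> CkC k (fun x => expi (ph x)).
Proof.
move=> Cph; pose phi (b : bool) : R -> R := if b then cos else sin.
have H := @Ck_comp1 R n bool phi (fun b => if b then -1 else 1) negb.
have d i (t : R) : is_derive t (1 : R) (phi i) ((if i then -1 else 1) * phi (~~ i) t).
  by case: i; rewrite /phi /= ?mul1r ?mulN1r; [exact: is_derive_cos|exact: is_derive_sin].
by split; [exact: (H d k true _ Cph)|exact: (H d k false _ Cph)].
Qed.

Lemma cD_expi n (ph : 'rV[R]_n -> R) j x (d : R) : is_derive x (e_ j) ph d ->
  cD j (fun x => expi (ph x)) x = Complex 0 d * expi (ph x).
Proof.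
move=> dph; rewrite /cD.
have [_ h1] := is_derive_comp1 dph (is_derive_cos (ph x)).
have [_ h2] := is_derive_comp1 dph (is_derive_sin (ph x)).
have -> : 'D_(e_ j) (@complex.Re R \o (fun x => expi (ph x))) x = - sin (ph x) * d by exact: h1.
have -> : 'D_(e_ j) (@complex.Im R \o (fun x => expi (ph x))) x = cos (ph x) * d by exact: h2.
by rewrite /expi; apply/eqP; rewrite eq_complex /=; apply/andP; split; apply/eqP; ring.
Qed.

Section transform.
Variables (m n : nat).
Implicit Types (G : 'rV[R]_(m + n) -> R[i]) (Z : 'rV[R]_(m + n + n)).

(** The kernel is exp(i <xi, y>), without normalizing constant. The frequencies take the places of
    the integrated variables, so functions on R^(m+n) go to functions on R^(m+n) and the transform
    can be iterated. *)
Definition FT G (X : 'rV[R]_(m + n)) : R[i] :=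
  cint (fun y : 'rV[R]_n => G (row_mx (lsubmx X) y) * expi (dotrV (rsubmx X) y)).

Definition phase (Z : 'rV[R]_(m + n + n)) : R := dotrV (rsubmx (lsubmx Z)) (rsubmx Z).

(** [Z] lists the parameters, the frequency and the integration variable. This matrix drops the
    frequency, so that the integrand [EG] becomes a smooth function of all three. *)
Definition projG : 'M[R]_(m + n + n, m + n) :=
  col_mx (col_mx (row_mx 1%:M 0) 0) (row_mx 0 1%:M).

Lemma projGE Z : Z *m projG = row_mx (lsubmx (lsubmx Z)) (rsubmx Z).
Proof.
rewrite -{1}(hsubmxK Z) -{1}(hsubmxK (lsubmx Z)) !mul_row_col !mul_mx_row !mulmx0 !mulmx1.
by rewrite addr0 add_row_mx addr0 add0r.
Qed.

Definition EG G (Z : 'rV[R]_(m + n + n)) : R[i] := G (Z *m projG) * expi (phase Z).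

Lemma EGE G : EG G = (fun Z => G (Z *m projG)) * (fun Z => expi (phase Z)).
Proof. by []. Qed.

Lemma FT_Int G : FT G = Int (EG G).
Proof.
apply/funext => X; apply: eq_cint => y.
by rewrite /EG projGE /phase !row_mxKl !row_mxKr.
Qed.

Lemma phase_derive Z k : is_derive Z (e_ k) phase
  (\sum_j (Z 0 (lshift n (rshift m j)) * (e_ k) 0 (rshift (m + n) j) +
           Z 0 (rshift (m + n) j) * (e_ k) 0 (lshift n (rshift m j)))).
Proof.
have -> : phase = \sum_j (fun Z : 'rV[R]_(m + n + n) =>
    Z 0 (lshift n (rshift m j)) * Z 0 (rshift (m + n) j)).
  by apply/funext => W; rewrite fct_sumE; apply: eq_bigr => j _; rewrite !mxE.
apply: is_derive_sum => j; apply: is_derive_eq.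
  by apply: is_deriveM; exact: is_derive_coord.
by [].
Qed.

Lemma smooth_phase : smooth (fun Z => expi (phase Z)).
Proof.
apply/smoothP => k; apply: expi_CkC.
have -> : phase = \sum_j ((fun Z : 'rV[R]_(m + n + n) => Z 0 (lshift n (rshift m j))) *
    (fun Z => Z 0 (rshift (m + n) j))).
  by apply/funext => W; rewrite fct_sumE; apply: eq_bigr => j _; rewrite !mxE.
by apply: Ck_sum => j; apply: CkM; exact: Ck_coord.
Qed.

Lemma smooth_EG G : smooth G -> smooth (EG G).
Proof.
by move=> sG; rewrite EGE; apply: smooth_M; [exact: smooth_mulmx|exact: smooth_phase].
Qed.

Lemma normc_EG G Z : normc (EG G Z) = normc (G (Z *m projG)).
Proof. by rewrite /EG Normc.normcM normc_expi mulr1. Qed.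

Lemma fintype_split_l p q (i : 'I_p) : fintype.split (lshift q i) = inl i.
Proof. exact: (unsplitK (inl i)). Qed.

Lemma fintype_split_r p q (i : 'I_q) : fintype.split (rshift p i) = inr i.
Proof. exact: (unsplitK (inr i)). Qed.

Lemma cD_projG G k : smooth G ->
  cD k (fun Z => G (Z *m projG)) = fun Z =>
    match fintype.split k with
    | inl k' => match fintype.split k' with inl i => cD (lshift n i) G (Z *m projG) | inr _ => 0 end
    | inr j => cD (rshift m j) G (Z *m projG) end.
Proof.
move=> sG; apply/funext => Z; rewrite (congr1 (@^~ Z) (cD_mulmx projG k sG)) /= fct_sumE.
rewrite /projG; case: (split_ordP k) => k' ->.
  case: (split_ordP k') => i ->.
    rewrite (bigD1 (lshift n i)) //= big1 => [|l li].
      by rewrite !col_mxEu row_mxEl mxE eqxx addr0 [LHS]mul1r.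
    rewrite !col_mxEu; case: (split_ordP l) li => l' -> li.
      rewrite row_mxEl mxE eq_sym -(inj_eq (@lshift_inj m n)) (negbTE li).
      exact: mul0r.
    by rewrite row_mxEr mxE; exact: mul0r.
  by rewrite big1 // => l _; rewrite col_mxEu col_mxEd mxE; exact: mul0r.
rewrite (bigD1 (rshift m k')) //= big1 => [|l li].
  by rewrite col_mxEd row_mxEr mxE eqxx addr0 [LHS]mul1r.
rewrite col_mxEd; case: (split_ordP l) li => l' -> li.
  by rewrite row_mxEl mxE; exact: mul0r.
rewrite row_mxEr mxE eq_sym -(inj_eq (@rshift_inj m n)) (negbTE li).
exact: mul0r.
Qed.

Lemma cD_EG G k Z : smooth G -> cD k (EG G) Z =
  cD k (fun Z => G (Z *m projG)) Z * expi (phase Z) +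
  Complex 0 (\sum_j (Z 0 (lshift n (rshift m j)) * (e_ k) 0 (rshift (m + n) j) +
           Z 0 (rshift (m + n) j) * (e_ k) 0 (lshift n (rshift m j)))) * EG G Z.
Proof.
move=> sG; rewrite EGE (cD_M k (smooth_mulmx projG sG) smooth_phase).
rewrite [LHS]/(_ * _ + _ * cD k (fun Z => expi (phase Z)) Z).
rewrite (cD_expi (phase_derive Z k)) /EG; congr (_ + _).
by rewrite mulrCA.
Qed.

Lemma cD_EG_par G i : smooth G ->
  cD (lshift n (lshift n i)) (EG G) = EG (cD (lshift n i) G).
Proof.
move=> sG; apply/funext => Z; rewrite cD_EG // cD_projG // !fintype_split_l.
rewrite big1 => [|j _]; last first.
  rewrite /basis_rV !mxE eq_rlshift (inj_eq (@lshift_inj _ _)) eq_rlshift.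
  by rewrite !andbF !mulr0 addr0.
by rewrite (_ : Complex 0 0 = 0) // mul0r addr0.
Qed.

Lemma cD_EG_freq G j : smooth G ->
  cD (lshift n (rshift m j)) (EG G) = (fun=> Complex 0 1) * EG (cX (rshift m j) G).
Proof.
move=> sG; apply/funext => Z; rewrite cD_EG // cD_projG // fintype_split_l fintype_split_r.
rewrite mul0r add0r (bigD1 j) //= big1 => [|l lj]; last first.
  rewrite /basis_rV !mxE eq_rlshift (inj_eq (@lshift_inj _ _)) (inj_eq (@rshift_inj _ _)).
  by rewrite (negbTE lj) !andbF !mulr0 addr0.
rewrite /basis_rV !mxE eq_rlshift !eqxx /= mulr0 mulr1 add0r addr0.
change (Complex 0 (Z 0 (rshift (m + n) j)) * (G (Z *m projG) * expi (phase Z)) =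
  Complex 0 1 * (((Z *m projG) 0 (rshift m j))%:C%C * G (Z *m projG) * expi (phase Z))).
rewrite [X in _ = _ * (X%:C%C * _ * _)](_ : _ = Z 0 (rshift (m + n) j)); last first.
  by rewrite projGE row_mxEr mxE.
rewrite -[X in _ = _ * X]mulrA [RHS]mulrA; congr (_ * _).
by apply/eqP; rewrite eq_complex /= !(mul0r, mulr0, mul1r, mulr1, add0r, addr0, subr0, subrr, oppr0) ?eqxx.
Qed.

Lemma cD_EG_var G j Z : smooth G ->
  cD (rshift (m + n) j) (EG G) Z = EG (cD (rshift m j) G) Z +
    Complex 0 1 * ((Z 0 (lshift n (rshift m j)))%:C%C * EG G Z).
Proof.
move=> sG; rewrite cD_EG // cD_projG // fintype_split_r; congr (_ + _).
rewrite (bigD1 j) //= big1 => [|l lj]; last first.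
  rewrite /basis_rV !mxE eq_lrshift (inj_eq (@rshift_inj _ _)).
  by rewrite (negbTE lj) !andbF !mulr0 addr0.
rewrite /basis_rV !mxE eq_lrshift !eqxx /= mulr0 mulr1 !addr0 [RHS]mulrA; congr (_ * _).
by apply/eqP; rewrite eq_complex /= !(mul0r, mulr0, mul1r, mulr1, add0r, addr0, subr0, subrr, oppr0) ?eqxx.
Qed.

End transform.

End partial_fourier.

(** * Word bounds for the partial Fourier transform *)

Section fourier_bounds.
Variables (R : realType) (m n : nat) (J : pred 'I_(m + n)).
Hypothesis HJ : forall j, J (rshift m j).
Local Notation normc := (@Normc.normc R).
Local Notation cint := (@integral_rV R _).
Local Notation e_ j := (basis_rV R j).
Implicit Types (G : 'rV[R]_(m + n) -> R[i]) (X : 'rV[R]_(m + n)).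

(* local boundedness *)
Definition LBd k (r : 'rV[R]_k -> R) := forall x : 'rV[R]_k,
  exists2 delta : R, 0 < delta & exists B, forall z : 'rV[R]_k,
    (forall i, `|z 0 i - x 0 i| < delta) -> r z <= B.

(** All admissible words applied to G are integrable in the last variables, locally uniformly in the
    others. The class is stable under letters, so differentiation under the integral and integration
    by parts can be repeated along a word. *)
Definition Gd G := smooth G /\ forall w, all (okl J) w ->
  exists2 r : 'rV[R]_m -> R, LBd r &
    forall X, normc (acts w G X) <= r (lsubmx X) * dd (rsubmx X).

Lemma Gd_act G l : okl J l -> Gd G -> Gd (act l G).
Proof.
move=> jl [sG HG]; split; first exact: smooth_act.
move=> w jw; have [|r rb H] := HG (rcons w l); first by rewrite all_rcons jl jw.
by exists r => // X; rewrite -acts_rcons.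
Qed.

Lemma Gd_LD G c : Gd G -> LD ((fun=> c) * EG G).
Proof.
move=> [sG HG]; split; first by apply: smooth_M; [exact: smooth_cst|exact: smooth_EG].
move=> x; have [r rb H] := HG [::] isT.
have [d d0 [B HB]] := rb (lsubmx x).
exists d => //; exists (normc c * B) => z zx y.
rewrite [X in normc X]/(c * EG G _) Normc.normcM normc_EG projGE !row_mxKl !row_mxKr -mulrA.
rewrite ler_wpM2l ?normc_ge0 //; have := H (row_mx (lsubmx z) y).
rewrite row_mxKl row_mxKr => /le_trans; apply; rewrite ler_wpM2r ?dd_ge0 //.
by apply: HB => i; have := zx (lshift n i); rewrite !mxE.
Qed.

(** The transform exchanges derivations and coordinates in the transformed variables and leaves
    those of the parameters alone. A word goes to a word of the same length, so the bounds keep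
    their form. *)
Definition dual_letter (l : letter (m + n)) : letter (m + n) :=
  match l with
  | inl k => match fintype.split k with inl i => inl (lshift n i) | inr j => inr (rshift m j) end
  | inr k => match fintype.split k with inl i => inr (lshift n i) | inr j => inl (rshift m j) end
  end.

Definition dual_unit (l : letter (m + n)) : R[i] :=
  match l with
  | inl k | inr k => if fintype.split k is inl _ then 1 else Complex 0 1
  end.

Lemma normc_dual_unit l : normc (dual_unit l) = 1.
Proof.
have i1 : normc (Complex 0 1) = 1 :> R by rewrite /= expr0n expr1n add0r sqrtr1.
by rewrite /dual_unit; case: l => k; case: fintype.split => _; rewrite ?i1 ?Normc.normc1.
Qed.

Lemma okl_dual l : okl J l -> okl J (dual_letter l).
Proof.
case: l => k /=; first by case: (split_ordP k) => j _ //=; rewrite HJ.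
by case: (split_ordP k) => j ->.
Qed.

(** A derivative of the integrand in a parameter or a frequency is again an integrand of this kind,
    up to a constant. *)
Lemma param_derivs_EG G js : Gd G -> exists c G', Gd G' /\ param_derivs js (EG G) = (fun=> c) * EG G'.
Proof.
move=> gG; elim: js => [|k js [c [G' [gG' E]]]].
  by exists 1, G; split=> //; apply/funext => Z; rewrite [RHS]mul1r.
have [sG' _] := gG'; have sE := smooth_EG sG'.
rewrite /= E (cD_Z _ c sE); case: (split_ordP k) => j ->.
  exists c, (act (inl (lshift n j)) G'); split; first exact: (Gd_act (l := inl _) isT gG').
  by rewrite cD_EG_par.
exists (c * Complex 0 1), (act (inr (rshift m j)) G'); split; first exact: (Gd_act (l := inr _) (HJ j) gG').
rewrite cD_EG_freq //; apply/funext => Z; exact: mulrA.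
Qed.

Lemma Gd_param_derivs G js : Gd G -> LD (param_derivs js (EG G)).
Proof. by move=> gG; have [c [G' [gG' ->]]] := param_derivs_EG js gG; exact: Gd_LD. Qed.

Lemma smooth_FT G : Gd G -> smooth (FT G).
Proof. by move=> gG; rewrite FT_Int; apply: smooth_Int => js; exact: Gd_param_derivs. Qed.

Lemma Gd_LD1 G : Gd G -> LD (EG G).
Proof. by move=> gG; exact: (Gd_param_derivs [::] gG). Qed.

Lemma Int_Z (f : 'rV[R]_(m + n + n) -> R[i]) c : LD f ->
  Int ((fun=> c) * f) = (fun=> c) * Int f.
Proof. by move=> lf; apply/funext => X; exact: (cint_Z c (LD_CD X lf)). Qed.

(** Integration by parts: the derivative of the whole integrand in y integrates to 0, and it is the
    sum of a term with the derivative of G and one with the derivative of the phase. *)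
Lemma Int_cD_var G j : Gd G -> Int (EG (cD (rshift m j) G)) = 
  (fun=> - Complex 0 1) * cX (rshift m j) (Int (EG G)).
Proof.
move=> gG; have [sG _] := gG; apply/funext => X.
have gD : Gd (act (inl (rshift m j)) G) by exact: (Gd_act (l := inl _) isT gG).
have d1 := LD_CD X (Gd_LD1 gD); have d2 := LD_CD X (Gd_LD1 gG).
pose v y := EG G (row_mx X y).
have dv y : cD j v y = cD (rshift (m + n) j) (EG G) (row_mx X y).
  have [r1 r2] := smooth_EG sG.
  have [_ h1] := derive_secr (smooth_real_derivable (j := rshift (m + n) j) (x := row_mx X y) r1).
  have [_ h2] := derive_secr (smooth_real_derivable (j := rshift (m + n) j) (x := row_mx X y) r2).
  exact: (congr2 (@Complex R) h1 h2).
have dvE y : cD j v y = EG (cD (rshift m j) G) (row_mx X y) +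
    (Complex 0 1 * (X 0 (rshift m j))%:C%C) * v y.
  by rewrite dv cD_EG_var // row_mxEl -mulrA.
have d3 := CD_Z (Complex 0 1 * (X 0 (rshift m j))%:C%C) d2.
have cv : CD (cD j v).
  by rewrite (funext dvE); exact: CD_D d1 d3.
have /smoothP/(_ 1%N)[C1 C2] := smooth_EG sG.
have v0 : cint (cD j v) = 0.
  have [q1 q2] := CD_RD cv; have [p1 p2] := CD_RD d2.
  rewrite cintE; congr Complex.
    by apply: (rint_derive0 (v := @complex.Re R \o v)) => //; exact: (Ck_secr X C1).
  by apply: (rint_derive0 (v := @complex.Im R \o v)) => //; exact: (Ck_secr X C2).
move: v0; rewrite (funext dvE) (cint_D d1 d3) (cint_Z _ d2) => /eqP.
rewrite addr_eq0 => /eqP E; apply: (etrans E).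
change (- (Complex 0 1 * (X 0 (rshift m j))%:C%C * cint v) =
  - Complex 0 1 * ((X 0 (rshift m j))%:C%C * cint v)).
by rewrite mulNr mulrA.
Qed.

Lemma act_FT G l : Gd G -> okl J l ->
  act l (FT G) = (fun=> dual_unit l) * FT (act (dual_letter l) G).
Proof.
move=> gG; have [sG _] := gG; rewrite !FT_Int; case: l => k jk /=.
  rewrite cD_Int; last by move=> js; exact: Gd_param_derivs.
  case: (split_ordP k) => j ->.
    by rewrite cD_EG_par //; apply/funext => X; rewrite [RHS]mul1r.
  rewrite cD_EG_freq // Int_Z //; apply: (@Gd_LD1 (act (inr (rshift m j)) G)).
  exact: (Gd_act (l := inr _) (HJ j) gG).
case: (split_ordP k) jk => j -> jk.
  apply/funext => X; rewrite [RHS]mul1r.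
  rewrite /cX /Int -(cint_Z _ (LD_CD X (Gd_LD1 gG))); apply: eq_cint => y.
  rewrite /EG projGE row_mxKl row_mxKr mulrA; congr (_ * _).
  by rewrite /act /cX row_mxEl mxE.
rewrite Int_cD_var // mulrA; apply/funext => X.
change (cX (rshift m j) (Int (EG G)) X =
  Complex 0 1 * - Complex 0 1 * cX (rshift m j) (Int (EG G)) X).
have -> : Complex 0 1 * - Complex 0 1 = 1 :> R[i].
  by apply/eqP; rewrite eq_complex /= !(mul0r, mulr0, mul1r, mulr1, add0r, addr0, subr0, subrr, oppr0, opprK, mulrN) ?eqxx.
by rewrite mul1r.
Qed.

Lemma acts_FT G w : Gd G -> all (okl J) w -> exists c w',
  [/\ normc c = 1, size w' = size w, all (okl J) w', Gd (acts w' G) &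
      acts w (FT G) = (fun=> c) * FT (acts w' G)].
Proof.
move=> gG; elim: w => [_|l w IH /= /andP[jl jw]].
  exists 1, [::]; split=> //; first exact: Normc.normc1.
  by apply/funext => X; rewrite [RHS]mul1r.
have [c [w' [c1 sw' jw' gw' E]]] := IH jw.
exists (c * dual_unit l), (dual_letter l :: w'); split.
- by rewrite Normc.normcM c1 normc_dual_unit mulr1.
- by rewrite /= sw'.
- by rewrite /= jw' okl_dual.
- exact: (Gd_act (okl_dual jl) gw').
rewrite E act_Z; last exact: smooth_FT.
rewrite (act_FT gw' jl); apply/funext => X; exact: mulrA.
Qed.

Lemma WB_word_dd s (r : 'rV[R]_m -> R) C h G : 0 <= s -> 0 <= h -> 0 <= C ->
  (forall x, 0 <= r x) -> WB J s (fun X => r (lsubmx X)) C h G ->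
  forall w X, all (okl J) w -> normc (acts w G X) <=
    ddK s h n * C * ((2 `^ s * h) ^+ size w * fs s (size w)) * r (lsubmx X) * dd (rsubmx X).
Proof.
move=> s0 h0 C0 r0 bG w X jw.
have r0' (Y : 'rV[R]_(m + n)) : 0 <= r (lsubmx Y) by exact: r0.
have /WBP[sG HG] := WB_dd s0 h0 C0 r0' HJ bG.
have ddE : dd (\row_j X 0 (rshift m j)) = dd (rsubmx X).
  by apply: eq_bigr => j _; rewrite !mxE.
by rewrite -mulrA -ddE; exact: HG.
Qed.

Let K_ge0 (s C h : R) k : 0 <= h -> 0 <= C ->
  0 <= ddK s h n * C * ((2 `^ s * h) ^+ k * fs s k).
Proof.
move=> h0 C0; have sh0 : 0 <= 2 `^ s * h by rewrite mulr_ge0 // powR_ge0.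
by apply: mulr_ge0; apply: mulr_ge0 => //; [exact: ddK_ge0|exact: exprn_ge0|exact: fs_ge0].
Qed.

Lemma WB_Gd s (r : 'rV[R]_m -> R) C h G : 0 <= s -> 0 <= h -> 0 <= C ->
  (forall x, 0 <= r x) -> LBd r -> WB J s (fun X => r (lsubmx X)) C h G -> Gd G.
Proof.
move=> s0 h0 C0 r0 rb bG; split=> [|w jw]; first by case: bG.
exists (fun x => ddK s h n * C * ((2 `^ s * h) ^+ size w * fs s (size w)) * r x).
  move=> x; have [d d0 [B HB]] := rb x; exists d => //.
  exists (ddK s h n * C * ((2 `^ s * h) ^+ size w * fs s (size w)) * B) => z zx.
  by apply: ler_wpM2l; [exact: K_ge0|exact: HB].
by move=> X; exact: WB_word_dd.
Qed.

(** The dual word has the same length as the given one; only the coordinate letters that buy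
    integrability in the n integrated variables enlarge the constants. *)
Lemma WB_FT s (r : 'rV[R]_m -> R) C h G : 0 <= s -> 0 <= h -> 0 <= C ->
  (forall x, 0 <= r x) -> LBd r -> WB J s (fun X => r (lsubmx X)) C h G ->
  WB J s (fun X => r (lsubmx X)) (2 * Dn R n * (ddK s h n * C)) (2 `^ s * h) (FT G).
Proof.
move=> s0 h0 C0 r0 rb bG; have gG := WB_Gd s0 h0 C0 r0 rb bG.
apply/WBP; split; first exact: smooth_FT.
move=> w jw X; have [c [w' [c1 sw' jw' gw' ->]]] := acts_FT gG jw.
rewrite [X in normc X]/(c * _) Normc.normcM c1 mul1r FT_Int.
have H := @cint_le _ _ _ (ddK s h n * C * ((2 `^ s * h) ^+ size w * fs s (size w)) *
  r (lsubmx X)) (LD_CD X (Gd_LD1 gw')).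
apply: le_trans (H _) _ => [y|].
  rewrite normc_EG projGE row_mxKl row_mxKr -sw'.
  have := WB_word_dd s0 h0 C0 r0 bG (row_mx (lsubmx X) y) jw'.
  by rewrite row_mxKl row_mxKr.
by rewrite le_eqVlt; apply/orP; left; apply/eqP; ring.
Qed.

End fourier_bounds.

(** * Gelfand-Shilov seminorms as weighted bounds *)

Section reordering.
Variables (R : realType) (n : nat).
Local Notation normc := (@Normc.normc R).
Implicit Types (f g : 'rV[R]_n -> R[i]) (x : 'rV[R]_n) (bs js : seq 'I_n).

Definition Ms bs : seq (letter n) := [seq inr j | j <- bs].
Definition Ds js : seq (letter n) := [seq inl j | j <- js].

(** One list for each occurrence of i in [bs]: the terms of the commutator of d/dx_i with the
    product of these coordinates. *)
Fixpoint dels (i : 'I_n) bs : seq (seq 'I_n) :=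
  if bs is b :: bs' then
    (if b == i then [:: bs'] else [::]) ++ [seq b :: c | c <- dels i bs']
  else [::].

Lemma size_dels i bs : (size (dels i bs) <= size bs)%N.
Proof.
elim: bs => //= b bs IH; rewrite size_cat size_map.
by case: (b == i) => /=; [rewrite add1n ltnS|rewrite add0n; exact: leqW].
Qed.

Lemma dels_size i bs c : c \in dels i bs -> size bs = (size c).+1.
Proof.
elim: bs c => //= b bs IH c; rewrite mem_cat => /orP[|/mapP[c' /IH -> ->]] //.
by case: (b == i) => //=; rewrite inE => /eqP ->.
Qed.

Lemma cD_Ms i bs g : smooth g ->
  cD i (acts (Ms bs) g) = acts (Ms bs) (cD i g) + \sum_(c <- dels i bs) acts (Ms c) g.
Proof.
move=> sg; elim: bs => [|b bs IH] /=; first by rewrite big_nil addr0.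
have sMg : smooth (acts (Ms bs) g) by exact: smooth_acts.
rewrite cXE (cD_M i (smooth_coord R b) sMg) IH cD_coord big_cat big_map /=.
have -> : \sum_(c <- dels i bs) cX b (acts (Ms c) g) =
    (fun x => (x 0 b)%:C%C) * \sum_(c <- dels i bs) acts (Ms c) g.
  by rewrite mulr_sumr; apply: eq_bigr => c _.
rewrite mulrDr -cXE addrCA; congr (_ + _); congr (_ + _).
case: (b == i); last by rewrite big_nil; apply/funext => x; exact: mul0r.
by rewrite big_seq1; apply/funext => x; exact: mul1r.
Qed.

Section family.
Variables (T : Type) (E : T -> 'rV[R]_n -> R[i]) (lev : T -> nat) (kap : T -> R).
Variables (rule : 'I_n -> T -> seq (R[i] * (seq 'I_n * T))) (q C : R) (B : nat -> R).
Hypothesis sE : forall t, smooth (E t).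
Hypothesis cDE : forall i t,
  cD i (E t) = \sum_(r <- rule i t) (fun=> r.1) * acts (Ms r.2.1) (E r.2.2).
Hypothesis rule_kap : forall i t, \sum_(r <- rule i t) normc r.1 * kap r.2.2 <= q * kap t.
Hypothesis rule_lev : forall i t,
  all (fun r => (size r.2.1 + lev r.2.2 == (lev t).+1)%N) (rule i t).
Hypothesis q0 : 0 <= q.
Hypothesis C0 : 0 <= C.
Hypothesis kap0 : forall t, 0 <= kap t.
Hypothesis B0 : forall k, 0 <= B k.
Hypothesis BS : forall k, k.+1%:R * B k <= B k.+2.
Hypothesis EB : forall bs t x,
  normc (acts (Ms bs) (E t) x) <= C * kap t * B (size bs + lev t).

(** A derivation moved past the coordinates [bs] leaves at most N commutator terms, each two letters
    shorter, and [BS] absorbs the factor N; then [rule] expresses the derivative of [E t]. Hence a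
    factor 1 + q per letter. The family will consist of the iterated derivatives of one function,
    and later of Gaussian remainders. *)
Lemma family_word_bound w bs t x :
  normc (acts w (acts (Ms bs) (E t)) x) <=
  C * kap t * ((1 + q) ^+ size w * B (size w + (size bs + lev t))).
Proof.
have q1 : 1 <= 1 + q by rewrite lerDl.
have q10 : 0 <= 1 + q by exact: le_trans ler01 q1.
elim/last_ind: w bs t => [|w l IH] bs t.
  by rewrite expr0 mul1r; exact: EB.
rewrite acts_rcons size_rcons.
set N := (size w + (size bs + lev t))%N.
have -> : ((size w).+1 + (size bs + lev t) = N.+1)%N by [].
pose A := C * kap t * ((1 + q) ^+ size w * B N.+1).
have A0 : 0 <= A by rewrite !mulr_ge0 ?exprn_ge0.
have -> : C * kap t * ((1 + q) ^+ (size w).+1 * B N.+1) = A + q * A.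
  by rewrite /A exprS; ring.
case: l => i /=; last first.
  have := IH (i :: bs) t; rewrite /= addSn addnS -/N -/A => /le_trans; apply.
  by rewrite lerDl mulr_ge0.
rewrite (cD_Ms i bs (sE t)).
have s1 : smooth (acts (Ms bs) (cD i (E t))) by apply: smooth_acts; exact: smooth_cD.
have s2 : smooth (\sum_(c <- dels i bs) acts (Ms c) (E t)).
  by apply: smooth_sum => c; apply: smooth_acts; exact: sE.
rewrite (acts_D w s1 s2) addrC.
apply: le_trans (ler_normcD _ _) _; apply: lerD.
  have sc c : smooth (acts (Ms c) (E t)) by apply: smooth_acts; exact: sE.
  rewrite (acts_sum w _ sc) fct_sumE; apply: le_trans (normc_sum _ _ _) _.
  case: bs @N @A A0 s1 s2 => [|b bs'] N A A0 s1 s2; first by rewrite big_nil.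
  set bs := b :: bs'.
  apply: (@le_trans _ _ (\sum_(c <- dels i bs)
     C * kap t * ((1 + q) ^+ size w * B N.-1))).
    rewrite big_seq [leRHS]big_seq; apply: ler_sum => c /dels_size sbc.
    apply: le_trans (IH c t) _; rewrite /N /= in sbc *.
    by rewrite !addnS /=; move: sbc => [<-].
  rewrite big_const_seq count_predT iter_addr_0 -[leLHS]mulr_natl.
  apply: (@le_trans _ _ (N%:R * (C * kap t * ((1 + q) ^+ size w * B N.-1)))).
    rewrite ler_wpM2r ?mulr_ge0 ?exprn_ge0 // ler_nat.
    apply: leq_trans (size_dels i bs) _.
    by rewrite /N addnA addnAC leq_addl.
  (* Commutator terms occur only when [bs] is not empty, so N is positive and [BS] applies at N -
     1. *)
  have N1 : N = N.-1.+1 by rewrite /N /= addnS.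
  rewrite /A mulrCA ler_wpM2l ?mulr_ge0 // mulrCA ler_wpM2l ?exprn_ge0 //.
  by rewrite {1 3}N1; exact: BS.
rewrite cDE.
have sF (r : R[i] * (seq 'I_n * T)) : smooth ((fun=> r.1) * acts (Ms r.2.1) (E r.2.2)).
  by apply: smooth_M; [exact: smooth_cst|apply: smooth_acts; exact: sE].
rewrite (acts_sum (Ms bs) _ sF) (acts_sum w _ (fun r => smooth_acts (Ms bs) (sF r))) fct_sumE.
apply: le_trans (normc_sum _ _ _) _.
apply: (@le_trans _ _ (\sum_(r <- rule i t) normc r.1 * kap r.2.2 *
    (C * ((1 + q) ^+ size w * B N.+1)))); last first.
  rewrite -mulr_suml; apply: (@le_trans _ _ (q * kap t * (C * ((1 + q) ^+ size w * B N.+1)))).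
    by rewrite ler_wpM2r // !mulr_ge0 ?exprn_ge0.
  by rewrite le_eqVlt; apply/orP; left; apply/eqP; rewrite /A; ring.
move: (rule_lev i t); elim: (rule i t) => [_|r rs IHr /= /andP[/eqP lr rl]].
  by rewrite !big_nil.
rewrite !big_cons; apply: lerD; last exact: IHr.
have sr : smooth (acts (Ms r.2.1) (E r.2.2)) by apply: smooth_acts; exact: sE.
rewrite (acts_Z (Ms bs) r.1 sr) (acts_Z w r.1 (smooth_acts (Ms bs) sr)).
rewrite [X in normc X]/(r.1 * _) Normc.normcM -(acts_cat (Ms bs)) -map_cat -!mulrA ler_wpM2l ?normc_ge0 //.
have := IH (bs ++ r.2.1) r.2.2; rewrite size_cat -addnA lr addnS addnS -/N.
by move=> /le_trans; apply; rewrite le_eqVlt; apply/orP; left; apply/eqP; ring.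
Qed.

End family.

Lemma acts_Ds_cons_mid s1 j s2 f : smooth f ->
  acts (Ds (s1 ++ j :: s2)) f = cD j (acts (Ds (s1 ++ s2)) f).
Proof.
move=> sf; elim: s1 => [//|i s1 /= ->].
exact: (cD_swap i j (smooth_acts (Ds (s1 ++ s2)) sf)).
Qed.

Lemma acts_Ds_perm js js' f : smooth f -> perm_eq js js' ->
  acts (Ds js) f = acts (Ds js') f.
Proof.
move=> sf; elim: js js' => [|j js IH] js' pjs.
  by have := perm_size pjs; case: js' pjs.
have jjs' : j \in js' by rewrite -(perm_mem pjs) mem_head.
move: pjs; case/splitPr: jjs' => s1 s2 pjs.
rewrite acts_Ds_cons_mid //= (IH (s1 ++ s2)) //.
by rewrite -(perm_cons j) (perm_trans pjs) // -cat1s perm_catCA.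
Qed.

Lemma acts_Ds_partials js f x : acts (Ds js) f x =
  Complex (partials js (@complex.Re R \o f) x) (partials js (@complex.Im R \o f) x).
Proof.
have -> : acts (Ds js) f = fun x =>
    Complex (partials js (@complex.Re R \o f) x) (partials js (@complex.Im R \o f) x).
  elim: js => [|j js IH] /=; first by apply/funext => y /=; case: (f y).
  by rewrite IH.
by [].
Qed.

Definition sorted_js (al : 'I_n -> nat) : seq 'I_n :=
  flatten [seq nseq (al j) j | j <- enum 'I_n].

Lemma mderivE al f x : mderiv al f x = acts (Ds (sorted_js al)) f x.
Proof. by rewrite acts_Ds_partials. Qed.

Lemma count_sorted_js al i : count_mem i (sorted_js al) = al i.
Proof.
rewrite /sorted_js count_flatten -map_comp sumnE big_map big_enum /=.
rewrite (bigD1 i) //= count_nseq /= eqxx mul1n big1 ?addn0 // => j ji.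
by rewrite count_nseq /= (negbTE ji) mul0n.
Qed.

Lemma perm_sorted_js js : perm_eq js (sorted_js (fun j => count_mem j js)).
Proof. by apply/allP => i _ /=; rewrite count_sorted_js. Qed.

Lemma size_sorted_js al : size (sorted_js al) = mlength al.
Proof.
rewrite /sorted_js size_flatten /shape -map_comp sumnE big_map big_enum /=.
by apply: eq_bigr => j _; rewrite size_nseq.
Qed.

Lemma mlength_count js : mlength (fun j => count_mem j js) = size js.
Proof. by rewrite -size_sorted_js; apply/esym/perm_size; exact: perm_sorted_js. Qed.

Lemma acts_Ms bs f x : acts (Ms bs) f x = (\prod_(j <- bs) x 0 j)%:C%C * f x.
Proof.
elim: bs => [|b bs IH] /=; first by rewrite big_nil mul1r.
by rewrite /cX IH big_cons rmorphM mulrA.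
Qed.

Lemma mpowE be x : mpow be x = \prod_(j <- sorted_js be) x 0 j.
Proof.
rewrite /sorted_js big_flatten big_map big_enum /=; apply: eq_bigr => j _.
by rewrite big_nseq -Monoid.iteropE.
Qed.

Lemma mpow_count bs x : mpow (fun j => count_mem j bs) x = \prod_(j <- bs) x 0 j.
Proof. by rewrite mpowE; apply/esym/perm_big; exact: perm_sorted_js. Qed.

Lemma fact_add_le p k : ((p + k)`! <= 2 ^ (p + k) * (p`! * k`!))%N.
Proof.
rewrite -(@bin_fact (p + k) p) ?leq_addr // addKn leq_mul2r; apply/orP; right.
rewrite -[2%N]/(1 + 1)%N expnDn.
have lt_p : (p < (p + k).+1)%N by rewrite ltnS leq_addr.
rewrite (bigD1 (Ordinal lt_p)) //= !exp1n !muln1; exact: leq_addr.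
Qed.

Lemma fact_mul_le p k : (p`! * k`! <= (p + k)`!)%N.
Proof.
rewrite -(@bin_fact (p + k) p) ?leq_addr // addKn leq_pmull //.
by rewrite bin_gt0 leq_addr.
Qed.

Lemma mfact_le (al : 'I_n -> nat) : (mfact al <= (mlength al)`!)%N.
Proof.
rewrite /mfact /mlength; elim/big_ind2: _ => // p q p' q' h h'.
by apply: leq_trans (fact_mul_le p p'); exact: leq_mul.
Qed.

Lemma mlength_fact_le (al : 'I_n -> nat) : ((mlength al)`! <= 2 ^ (n * mlength al) * mfact al)%N.
Proof.
have -> : mlength al = (\sum_(j <- enum 'I_n) al j)%N by rewrite big_enum.
have -> : mfact al = (\prod_(j <- enum 'I_n) (al j)`!)%N by rewrite big_enum.
rewrite -[n in (2 ^ (n * _))%N](size_enum_ord n).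
elim: (enum 'I_n) => [|j r IH]; first by rewrite !big_nil.
rewrite !big_cons; apply: leq_trans (fact_add_le _ _) _.
set S := (\sum_(i <- r) al i)%N in IH *; set P := (\prod_(i <- r) (al i)`!)%N in IH *.
apply: (@leq_trans (2 ^ (al j + S) * ((al j)`! * (2 ^ (size r * S) * P)))).
  by rewrite leq_mul2l leq_mul2l IH !orbT.
rewrite (mulnCA (al j)`!) mulnA -expnD leq_mul2r leq_exp2l //.
by rewrite /= mulSn leq_add2l mulnDr leq_addl orbT.
Qed.

End reordering.

(** * Comparison of seminorms and word bounds *)

Section seminorms.
Variable R : realType.
Local Notation normc := (@Normc.normc R).

Lemma prod_eventually_le1 (u : nat -> R) n0 : (forall i, 0 <= u i) ->
  (forall i, (n0 <= i)%N -> u i <= 1) ->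
  exists2 K : R, 1 <= K & forall N, \prod_(i < N) u i <= K.
Proof.
move=> u0 u1; pose Q N := \prod_(i < N) Num.max 1 (u i).
have m1 i : 1 <= Num.max 1 (u i) by rewrite le_max lexx.
have Q1 N : 1 <= Q N.
  elim: N => [|N IH]; first by rewrite /Q big_ord0.
  by rewrite /Q big_ord_recr /= mulr_ege1.
have Qle N k : Q N <= Q (N + k)%N.
  elim: k => [|k IH]; first by rewrite addn0.
  apply: le_trans IH _; rewrite addnS /Q big_ord_recr /= ler_peMr //.
  exact: le_trans ler01 (Q1 _).
have Qc k : Q (n0 + k)%N = Q n0.
  elim: k => [|k IH]; first by rewrite addn0.
  rewrite addnS /Q big_ord_recr /= -/(Q _) IH.
  by rewrite max_l ?mulr1 // u1 // leq_addr.
exists (Q n0) => // N; apply: (@le_trans _ _ (Q N)).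
  by apply: ler_prod => i _; rewrite u0 le_max lexx orbT.
by apply: le_trans (Qle N n0) _; rewrite addnC Qc.
Qed.

Lemma powR_nat_large (p c : R) : 0 < p ->
  exists n0 : nat, forall i, (n0 <= i)%N -> c <= i.+1%:R `^ p.
Proof.
move=> p0; pose c' := Num.max c 0.
have c'0 : 0 <= c' by rewrite le_max lexx orbT.
exists (Num.truncn (c' `^ p^-1)) => i ni.
apply: (@le_trans _ _ c'); first by rewrite le_max lexx.
have -> : c' = (c' `^ p^-1) `^ p by rewrite -powRrM mulVf ?gt_eqF // powRr1.
apply: ge0_ler_powR; rewrite ?nnegrE ?powR_ge0 ?ler0n //; first exact: ltW.
apply/ltW; apply: lt_le_trans (truncnS_gt _) _.
by rewrite ler_nat ltnS.
Qed.

Lemma fs_prod s N : fs s N = \prod_(i < N) i.+1%:R `^ s :> R.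
Proof.
elim: N => [|N IH]; first by rewrite fs0 big_ord0.
by rewrite fsS IH big_ord_recr /= mulrC.
Qed.

(** The ratios r / (i+1)^sg are at most 1 from some i on, so their products stay bounded. *)
Lemma exp_le_fs (r sg : R) : 0 <= r -> 0 < sg ->
  exists2 K, 1 <= K & forall N, r ^+ N <= K * fs sg N.
Proof.
move=> r0 s0; have [n0 Hn] := powR_nat_large r s0.
have p0 i : 0 < i.+1%:R `^ sg :> R by rewrite powR_gt0 // ltr0n.
have [i|i ni|K K1 HK] := @prod_eventually_le1 (fun i => r / i.+1%:R `^ sg) n0.
- by rewrite divr_ge0 // ltW.
- by rewrite ler_pdivrMr // mul1r Hn.
exists K => // N; rewrite -ler_pdivrMr ?fs_gt0 //.
apply: le_trans (HK N); rewrite fs_prod -prodfV.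
rewrite big_split /= ler_wpM2r //.
  by apply: prodr_ge0 => i _; rewrite invr_ge0 ltW.
by rewrite prodr_const card_ord.
Qed.

(** Here s > 1/2 enters. The ratios of B are the larger of g (i+1)^s and sqrt(i+1). Two consecutive
    ones have product at least k + 1, which pays for the commutators; and the first expression is
    the larger from some i on, so B stays comparable to g^N (N!)^s. *)
Lemma admissible_weight (s g : R) : 2^-1 < s -> 0 < g -> exists B : nat -> R,
  [/\ forall k, 0 <= B k, forall k, k.+1%:R * B k <= B k.+2,
      forall N, g ^+ N * fs s N <= B N &
      exists2 K, 1 <= K & forall N, B N <= K * (g ^+ N * fs s N)].
Proof.
move=> hs g0; pose c i := Num.max (g * i.+1%:R `^ s) (Num.sqrt i.+1%:R).
have p0 i : 0 < i.+1%:R `^ s :> R by rewrite powR_gt0 // ltr0n.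
have c0 i : 0 <= c i by rewrite le_max sqrtr_ge0 orbT.
have E N : g ^+ N * fs s N = \prod_(i < N) (g * i.+1%:R `^ s).
  by rewrite big_split /= prodr_const card_ord fs_prod.
have B0 k : 0 <= \prod_(i < k) c i by exact: prodr_ge0.
exists (fun N => \prod_(i < N) c i); split=> [//|k|N|].
- rewrite !big_ord_recr /= -mulrA [leLHS]mulrC; apply: ler_wpM2l; first exact: B0.
  apply: (@le_trans _ _ (Num.sqrt k.+1%:R * Num.sqrt k.+1%:R)).
    by rewrite -expr2 sqr_sqrtr.
  have sq : Num.sqrt k.+1%:R <= Num.sqrt k.+2%:R :> R by rewrite ler_sqrt ?ler_nat.
  apply: ler_pM; rewrite ?sqrtr_ge0 //; first by rewrite le_max lexx orbT.
  by rewrite le_max sq orbT.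
- rewrite E; apply: ler_prod => i _; rewrite le_max lexx andbT.
  by rewrite mulr_ge0 // ltW.
have sp : 0 < s - 2^-1 by rewrite subr_gt0.
have [n0 Hn] := powR_nat_large g^-1 sp.
have q0 i : 0 < g * i.+1%:R `^ s by rewrite mulr_gt0.
have [i|i ni|K K1 HK] := @prod_eventually_le1 (fun i => c i / (g * i.+1%:R `^ s)) n0.
- by rewrite divr_ge0 // ltW.
- rewrite ler_pdivrMr // mul1r ge_max lexx /=.
  have -> : s = 2^-1 + (s - 2^-1) by rewrite addrC subrK.
  rewrite powRD; last by rewrite pnatr_eq0 implybT.
  rewrite powR12_sqrt // mulrCA ler_peMr ?sqrtr_ge0 //.
  by rewrite -ler_pdivrMl // mulr1 Hn.
exists K => // N; rewrite -ler_pdivrMr; last by rewrite E prodr_gt0.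
by rewrite E -prodf_div; exact: HK.
Qed.

Section fixed_dim.
Variable n : nat.
Implicit Types (f : 'rV[R]_n -> R[i]) (x : 'rV[R]_n).

Lemma mfact_gt0 (al : 'I_n -> nat) : (0 < mfact al)%N.
Proof. by apply: prodn_gt0 => j; exact: fact_gt0. Qed.

Lemma gs_norm_leP s h f C : 0 < h -> (gs_norm s h f <= C%:E)%E <->
  forall al be x, normc ((mpow be x)%:C%C * mderiv al f x) <=
    C * (h ^+ (mlength al + mlength be) * (mfact al * mfact be)%:R `^ s).
Proof.
move=> h0; have d0 (al be : 'I_n -> nat) :
    0 < h ^+ (mlength al + mlength be) * (mfact al * mfact be)%:R `^ s.
  by rewrite mulr_gt0 ?exprn_gt0 // powR_gt0 // ltr0n muln_gt0 !mfact_gt0.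
split=> [H al be x|H].
  rewrite -ler_pdivrMr // -lee_fin; apply: le_trans H.
  by apply: ereal_sup_ubound; exists al, be, x.
apply: ge_ereal_sup => _ [al [be [x ->]]].
by rewrite lee_fin ler_pdivrMr.
Qed.

(** The seminorms bound the ordered words x^be d^al, and [family_word_bound] reorders all others.
    The family consists of the iterated derivatives of f, with q = 1, hence [2 * g]. *)
Lemma gs_norm_WB s g : 2^-1 < s -> 0 < g -> exists2 K, 1 <= K &
  forall f C, 0 <= C -> smooth f -> (gs_norm s g f <= C%:E)%E ->
    WB xpredT s (fun=> 1) (K * C) (2 * g) f.
Proof.
move=> hs g0; have [B [B0 BS Bl [K K1 Bu]]] := admissible_weight hs g0.
have s0 : 0 <= s by apply: le_trans (ltW hs); rewrite invr_ge0.
exists K => // f C C0 sf /(gs_norm_leP s f C g0) H.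
pose rule (i : 'I_n) (js : seq 'I_n) := [:: (1 : R[i], ([::] : seq 'I_n, i :: js))].
have key := @family_word_bound R n (seq 'I_n) (fun js => acts (Ds js) f) size (fun=> 1)
  rule 1 C B (fun js => smooth_acts (Ds js) sf).
apply/WBP; split=> // w _ x.
have := key _ _ _ ler01 C0 (fun=> ler01) B0 BS _ w [::] [::] x.
rewrite !mulr1 /= addn0 => /(_ _ _ _ _)/le_trans; apply.
- by move=> i js; rewrite big_seq1 /=; apply/funext => y; rewrite [RHS]mul1r.
- by move=> i t; rewrite big_seq1 mulr1 Normc.normc1.
- by move=> i t; rewrite /= eqxx.
- move=> bs js y; rewrite acts_Ms.
  have := H (fun j => count_mem j js) (fun j => count_mem j bs) y.
  rewrite mpow_count mderivE !mlength_count (acts_Ds_perm sf (perm_sorted_js js)).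
  move=> /le_trans; apply; rewrite ler_wpM2l //; apply: le_trans (Bl _).
  rewrite addnC; apply: ler_wpM2l; first exact: (exprn_ge0 _ (ltW g0)).
  apply: ge0_ler_powR; rewrite ?nnegrE ?ler0n // ler_nat.
  apply: leq_trans (fact_mul_le _ _); rewrite mulnC; apply: leq_mul.
    by rewrite -[X in (_ <= X`!)%N](mlength_count bs) mfact_le.
  by rewrite -[X in (_ <= X`!)%N](mlength_count js) mfact_le.
have -> : K * C * ((2 * g) ^+ size w * fs s (size w)) =
    C * (2 ^+ size w * (K * (g ^+ size w * fs s (size w)))) by rewrite exprMn; ring.
rewrite addn0; apply: ler_wpM2l => //; rewrite -[1 + 1]/(2 : R).
by apply: ler_wpM2l; [rewrite exprn_ge0|exact: Bu].
Qed.

(** Multinomial coefficients are exponential in the length, so passing from (|al| + |be|)! to al!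
    be! changes only h. *)
Lemma fs_mfact_le s (al be : 'I_n -> nat) : 0 <= s ->
  fs s (mlength al + mlength be) <=
  ((2 `^ s) ^+ n.+1) ^+ (mlength al + mlength be) * (mfact al * mfact be)%:R `^ s :> R.
Proof.
move=> s0; have -> : ((2 `^ s) ^+ n.+1) ^+ (mlength al + mlength be) =
    (2 ^ (n.+1 * (mlength al + mlength be)))%:R `^ s :> R.
  rewrite -exprM -powR_mulrn ?powR_ge0 // -powRrM mulrC powRrM powR_mulrn ?ler0n //.
  by rewrite natrX.
rewrite -powRM ?ler0n // -natrM; apply: ge0_ler_powR; rewrite ?nnegrE ?ler0n // ler_nat.
apply: leq_trans (fact_add_le _ _) _.
rewrite mulSn (expnD _ (mlength al + mlength be) (n * _)) -[leqRHS]mulnA leq_mul2l; apply/orP; right.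
rewrite mulnDr expnD mulnACA; apply: leq_mul; exact: mlength_fact_le.
Qed.

Lemma WB_gs_norm s C h f : 0 <= s -> 0 <= C -> 0 < h -> WB xpredT s (fun=> 1) C h f ->
  (gs_norm s ((2 `^ s) ^+ n.+1 * h) f <= C%:E)%E.
Proof.
move=> s0 C0 h0 /WBP[sf H].
have M0 : 0 < (2 `^ s) ^+ n.+1 :> R by rewrite exprn_gt0 // powR_gt0.
apply/gs_norm_leP; first exact: mulr_gt0.
move=> al be x; have := H (Ms (sorted_js be) ++ Ds (sorted_js al)) _ x.
rewrite acts_cat acts_Ms mpowE mderivE size_cat !size_map !size_sorted_js mulr1.
move=> /(_ _)/le_trans; apply.
  by apply/allP; case.
rewrite ler_wpM2l // [X in _ <= X * _]exprMn mulrAC (addnC (mlength be)) mulrC.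
by apply: ler_wpM2r; [exact: (exprn_ge0 _ (ltW h0))|exact: fs_mfact_le].
Qed.

(** Any geometric factor (h / h')^N is absorbed by (N!)^(s - 1/2). *)
Lemma WB_half J s rho h h' : 2^-1 < s -> 0 < h -> 0 < h' -> exists2 K, 1 <= K &
  forall f C, 0 <= C -> (forall x, 0 <= rho x) ->
  WB J 2^-1 rho C h f -> WB J s rho (K * C) h' f.
Proof.
move=> hs h0 h'0; have sp : 0 < s - 2^-1 by rewrite subr_gt0.
have [K K1 HK] := exp_le_fs (ltW (divr_gt0 h0 h'0)) sp.
exists K => // f C C0 r0 /WBP[sf H]; apply/WBP; split=> // w jw x.
apply: le_trans (H w jw x) _; rewrite ler_wpM2r //.
rewrite [leRHS](_ : _ = C * (K * (h' ^+ size w * fs s (size w)))); last by ring.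
rewrite ler_wpM2l //.
have -> : fs s (size w) = fs 2^-1 (size w) * fs (s - 2^-1) (size w) :> R.
  by rewrite /fs -powRD ?subrKC // pnatr_eq0 -lt0n fact_gt0 implybT.
have := HK (size w); rewrite expr_div_n ler_pdivrMr ?exprn_gt0 // => h1.
rewrite mulrC; have := ler_wpM2l (fs_ge0 2^-1 (size w)) h1.
by move=> /le_trans; apply; rewrite le_eqVlt; apply/orP; left; apply/eqP; ring.
Qed.

Lemma GS_half_Sigma s f : 2^-1 < s -> GS (2^-1) f -> f \in @Sigma R s n.
Proof.
move=> hs [sf [h h0 fh]]; apply/asboolP; split=> // h' h'0.
have sp : 0 < s - 2^-1 by rewrite subr_gt0.
pose M : R := (2 `^ (s - 2^-1)) ^+ n.+1.
have M0 : 0 < M by rewrite exprn_gt0 // powR_gt0.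
have r0 : 0 <= h / h' * M by rewrite ltW // mulr_gt0 // divr_gt0.
have [K K1 HK] := exp_le_fs r0 sp.
have [C C0 HC] : exists2 C, 0 <= C & (gs_norm 2^-1 h f <= C%:E)%E.
  exists (fine (gs_norm 2^-1 h f)); first by rewrite fine_ge0 // gs_norm_ge0 // ltW.
  by rewrite fineK // ge0_fin_numE // gs_norm_ge0 // ltW.
apply: (@le_lt_trans _ _ (C * K)%:E); last exact: ltry.
apply/gs_norm_leP => // al be x; move/gs_norm_leP: HC => /(_ h0 al be x)/le_trans; apply.
rewrite -mulrA ler_wpM2l //.
set N := (mlength al + mlength be)%N; set F := (mfact al * mfact be)%:R : R.
have F0 : 0 < F by rewrite ltr0n muln_gt0 !mfact_gt0.
have -> : F `^ s = F `^ 2^-1 * F `^ (s - 2^-1).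
  by rewrite -powRD; [rewrite subrKC|rewrite (gt_eqF F0) implybT].
have fsF : fs (s - 2^-1) N <= M ^+ N * F `^ (s - 2^-1) by exact: (fs_mfact_le al be (ltW sp)).
have : h ^+ N <= K * h' ^+ N * F `^ (s - 2^-1).
  have MN : 0 < M ^+ N by rewrite exprn_gt0.
  have h'N : 0 < h' ^+ N by rewrite exprn_gt0.
  have := HK N; rewrite exprMn expr_div_n => h1.
  have h2 : h ^+ N / h' ^+ N * M ^+ N <= K * (M ^+ N * F `^ (s - 2^-1)).
    by apply: le_trans h1 _; rewrite ler_wpM2l // (le_trans ler01).
  move: h2; rewrite [leRHS]mulrCA mulrC ler_pM2l // ler_pdivrMr //.
  by rewrite mulrAC.
move=> /(ler_wpM2r (powR_ge0 F 2^-1))/le_trans; apply.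
by rewrite le_eqVlt; apply/orP; left; apply/eqP; ring.
Qed.

Lemma Sigma_WB s f h : 2^-1 < s -> f \in @Sigma R s n -> 0 < h ->
  exists2 C, 0 <= C & WB xpredT s (fun=> 1) C h f.
Proof.
move=> hs /asboolP[sf ff] h0; have h20 : 0 < h / 2 by rewrite divr_gt0.
have [K K1 HK] := gs_norm_WB hs h20.
have C0 : 0 <= fine (gs_norm s (h / 2) f) by rewrite fine_ge0 // gs_norm_ge0 // ltW.
exists (K * fine (gs_norm s (h / 2) f)); first by rewrite mulr_ge0 // (le_trans ler01).
have h2E : 2 * (h / 2) = h by rewrite mulrC divfK.
have := HK f _ C0 sf; rewrite h2E; apply; rewrite fineK // ge0_fin_numE; last by rewrite gs_norm_ge0 // ltW.
exact: ff.
Qed.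

Lemma WB_Sigma s f : 0 <= s -> smooth f ->
  (forall h, 0 < h -> exists2 C, 0 <= C & WB xpredT s (fun=> 1) C h f) -> f \in @Sigma R s n.
Proof.
move=> s0 sf H; apply/asboolP; split=> // h h0.
have M0 : 0 < (2 `^ s) ^+ n.+1 :> R by rewrite exprn_gt0 // powR_gt0.
have [C C0 HC] := H (h / (2 `^ s) ^+ n.+1) (divr_gt0 h0 M0).
have := WB_gs_norm s0 C0 (divr_gt0 h0 M0) HC.
by rewrite mulrC divfK ?gt_eqF // => /le_lt_trans; apply; exact: ltry.
Qed.

Lemma WB_GS_half C h f : 0 <= C -> 0 < h -> WB xpredT 2^-1 (fun=> 1) C h f -> GS 2^-1 f.
Proof.
move=> C0 h0 bf; have [sf _] := bf; split=> //.
have s0 : 0 <= 2^-1 :> R by rewrite invr_ge0.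
exists ((2 `^ 2^-1) ^+ n.+1 * h); first by rewrite mulr_gt0 // exprn_gt0 // powR_gt0.
by apply: le_lt_trans (WB_gs_norm s0 C0 h0 bf) _; exact: ltry.
Qed.

Lemma Gamma0_WB s (a : 'rV[R]_n -> R[i]) : 0 < s -> Gamma0_infty s a ->
  exists2 q : R, 0 <= q & forall h, 0 < h -> exists2 C, 0 <= C &
    WB pred0 s (fun X => expR (q * wt xpredT s X)) C h a.
Proof.
move=> s0 [sa [h0 h00 Ha]]; have [M M0 HM] := @enorm_wt R n s s0.
exists (h0 * M); first by rewrite mulr_ge0 // ltW.
move=> h hp; have [C C0 HC] := Ha h hp; exists C; first exact: ltW.
apply/WBP; split=> // w jw X.
have [js ->] : exists js, w = Ds js.
  elim: w jw => [_|[i|i] w IH //= /IH[js ->]]; first by exists [::].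
  by exists (i :: js).
have := HC (fun j => count_mem j js) X.
rewrite mderivE mlength_count -(acts_Ds_perm sa (perm_sorted_js js)) size_map.
move=> /le_trans; apply; rewrite -!mulrA; apply: ler_wpM2l; first exact: ltW.
apply: ler_wpM2l; first exact: (exprn_ge0 _ (ltW hp)).
apply: ler_pM; rewrite ?powR_ge0 ?expR_ge0 //.
  apply: ge0_ler_powR; rewrite ?nnegrE ?ler0n //; first exact: ltW.
  by rewrite ler_nat -[X in (_ <= X`!)%N](mlength_count js) mfact_le.
by rewrite ler_expR; apply: ler_wpM2l; [exact: ltW|exact: HM].
Qed.

End fixed_dim.
End seminorms.

(** * Growth weights and Sigma_s in terms of words *)

Section weights.
Variable R : realType.
Local Notation normc := (@Normc.normc R).

Definition rvars m n : pred 'I_(m + n) :=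
  fun k => if fintype.split k is inr _ then true else false.

Lemma rvars_rshift m n (j : 'I_n) : rvars (rshift m j).
Proof. by rewrite /rvars fintype_split_r. Qed.

Lemma rvars_lshift m n (i : 'I_m) : rvars (lshift n i) = false.
Proof. by rewrite /rvars fintype_split_l. Qed.

Lemma rvarsP m n (k : 'I_(m + n)) : rvars k -> exists j, k = rshift m j.
Proof. by case: (split_ordP k) => j ->; rewrite ?rvars_lshift //; exists j. Qed.

Lemma wt_cat m n s (Z : 'rV[R]_(m + n)) :
  wt xpredT s Z = wt xpredT s (lsubmx Z) + wt xpredT s (rsubmx Z).
Proof.
rewrite /wt big_split_ord /=; congr (_ + _); apply: eq_bigr => i _; by rewrite !mxE.
Qed.

Lemma wt_rvars m n s (Z : 'rV[R]_(m + n)) : wt (@rvars m n) s Z = wt xpredT s (rsubmx Z).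
Proof.
rewrite /wt big_split_ord /= big1 ?add0r => [|i]; last by rewrite rvars_lshift.
by apply: eq_big => [j|j _]; rewrite ?rvars_rshift // !mxE.
Qed.

Lemma wt_sign n s (t : R) (x : 'rV[R]_n) : `|t| = 1 -> wt xpredT s (t *: x) = wt xpredT s x.
Proof. by move=> t1; apply: eq_bigr => j _; rewrite mxE normrM t1 mul1r. Qed.

Lemma wt_LBd n s q : 0 <= q -> 0 < s -> LBd (fun x : 'rV[R]_n => expR (q * wt xpredT s x)).
Proof.
move=> q0 s0 x; exists 1 => //.
exists (expR (q * \sum_j (`|x 0 j| + 1) `^ s^-1)) => z zx.
rewrite ler_expR; apply: ler_wpM2l => //; apply: ler_sum => j _.
apply: ge0_ler_powR; rewrite ?nnegrE ?normr_ge0 ?addr_ge0 ?invr_ge0 ?(ltW s0) //.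
rewrite -lerBlDl; apply: le_trans (ltW (zx j)); exact: lerB_dist.
Qed.

(** With u = t^(1/s), t^N = u^(s N) is at most (1 + u)^k for an integer k above s N, and this is k!
    times one term of the exponential series at 1 + u. *)
Lemma exp_le_expR_root (s : R) N : 0 < s -> exists2 A : R, 1 <= A &
  forall t, 0 <= t -> t ^+ N <= A * expR (t `^ s^-1).
Proof.
move=> s0; pose r := s * N%:R; pose k := (Num.truncn r).+1.
have r0 : 0 <= r by rewrite mulr_ge0 // ltW.
have fe0 : 0 <= k`!%:R * expR 1 :> R by rewrite mulr_ge0 ?expR_ge0.
exists (1 + k`!%:R * expR 1) => [|t t0]; first by rewrite lerDl.
set u := t `^ s^-1; have u0 : 0 <= u by exact: powR_ge0.
have u1 : 1 <= 1 + u by rewrite lerDl.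
have tE : t = u `^ s by rewrite /u -powRrM mulVf ?gt_eqF // powRr1.
have -> : t ^+ N = u `^ r by rewrite [in LHS]tE /r powRrM (powR_mulrn _ (powR_ge0 u s)).
apply: (@le_trans _ _ ((1 + u) `^ r)).
  by apply: ge0_ler_powR; rewrite ?nnegrE ?addr_ge0 // lerDr.
apply: (@le_trans _ _ ((1 + u) `^ k%:R)).
  by apply: ler_powR => //; apply/ltW; exact: truncnS_gt.
rewrite powR_mulrn ?addr_ge0 //.
have /(_ (1 + u) k.+1 (addr_ge0 ler01 u0)) := @exp_sum_le R.
rewrite /exp_sum big_ord_recr /= => h1.
have h2 : (1 + u) ^+ k / k`!%:R <= expR (1 + u).
  apply: le_trans h1; rewrite lerDr; apply: sumr_ge0 => i _.
  by rewrite divr_ge0 ?exprn_ge0 ?addr_ge0.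
move: h2; rewrite ler_pdivrMr ?ltr0n ?fact_gt0 // => /le_trans; apply.
rewrite expRD mulrAC [expR 1 * _]mulrC; apply: ler_wpM2r; first exact: expR_ge0.
by rewrite lerDr.
Qed.

Lemma expR_wt_dd n s : 0 < s -> exists2 K : R, 0 <= K &
  forall x : 'rV[R]_n, expR (- wt xpredT s x) <= K * dd x.
Proof.
move=> s0; have [A A1 key] := @exp_le_expR_root s (2 * n) s0.
exists (2 ^+ n * A); first by rewrite mulr_ge0 ?exprn_ge0 // (le_trans ler01).
move=> x; apply: dd_bound; first exact: expR_ge0.
  apply: le_trans A1; rewrite expR_le1 oppr_le0; exact: wt_ge0.
move=> j; apply: (@le_trans _ _ (A * expR (`|x 0 j| `^ s^-1) * expR (- wt xpredT s x))).
  apply: ler_wpM2r; [exact: expR_ge0|exact: key].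
rewrite -mulrA ler_piMr ?(le_trans ler01) // -expRD expR_le1 subr_le0.
rewrite /wt (bigD1 j) //= lerDl; apply: sumr_ge0 => i _; exact: powR_ge0.
Qed.

Lemma decay_CD n s (F : 'rV[R]_n -> R[i]) C : 0 < s -> 0 <= C -> smooth F ->
  (forall x, normc (F x) <= C * expR (- wt xpredT s x)) -> CD F.
Proof.
move=> s0 C0 sF HF; have [K K0 HK] := @expR_wt_dd n s s0.
apply: (@smooth_CD _ _ _ (C * K)) => // x; apply: le_trans (HF x) _.
by rewrite -mulrA ler_wpM2l.
Qed.

Lemma WB_rho n J s rho rho' C h (f : 'rV[R]_n -> R[i]) : 0 <= h -> 0 <= C ->
  (forall x, 0 <= rho x <= rho' x) -> WB J s rho C h f -> WB J s rho' C h f.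
Proof. by move=> h0 C0 rr; exact: BW_le. Qed.

(** For s > 1/2 this describes Sigma_s, by [Sigma_WB] and [WB_Sigma]. *)
Definition SWB n s (f : 'rV[R]_n -> R[i]) := forall h, 0 < h -> exists2 C, 0 <= C &
  WB xpredT s (fun=> 1) C h f.

Lemma SWB_smooth n s (f : 'rV[R]_n -> R[i]) : SWB s f -> smooth f.
Proof. by move=> /(_ 1 ltr01)[C _ []]. Qed.

Lemma SWB_decay n s r (f : 'rV[R]_n -> R[i]) : 0 < s -> 0 <= r -> SWB s f ->
  exists2 C, 0 <= C & forall x, normc (f x) <= C * expR (- (r * wt xpredT s x)).
Proof.
move=> s0 r0 Hf; have [h0 h00 H0] := @WB_absorb R n s r s0 r0.
have [C C0 HC] := Hf h0 h00.
have [_ H] := H0 h0 h00 (lexx _) xpredT _ _ _ C0 (fun=> ler01) HC.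
exists (2 `^ s * C); first by rewrite mulr_ge0 // powR_ge0.
by move=> x; have := H [::] isT x; rewrite /= addn0 expr0 fs0 !mulr1 mul1r.
Qed.

Lemma FT_lin m n (J : pred 'I_(m + n)) (G G' : 'rV[R]_(m + n) -> R[i]) (c : R[i]) :
  (forall j, J (rshift m j)) -> Gd J G -> Gd J G' ->
  FT ((fun=> c) * G + G') = (fun=> c) * FT G + FT G'.
Proof.
move=> HJ gG gG'; apply/funext => X; rewrite [RHS]/(c * FT G X + FT G' X).
rewrite !FT_Int.
have d1 := LD_CD X (Gd_LD1 HJ gG); have d2 := LD_CD X (Gd_LD1 HJ gG').
transitivity (c * integral_rV (fun y => EG G (row_mx X y)) + integral_rV (fun y => EG G' (row_mx X y))); last by [].
rewrite -(cint_Z c d1) -(cint_D (CD_Z c d1) d2).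
by apply: eq_cint => y; rewrite /EG mulrA -mulrDl.
Qed.

End weights.

(** * The operator and its kernel *)

Section tame.
Variable R : realType.

(** Continuity between projective limits: each output parameter h is controlled by an input
    parameter h', linearly in the constant. Relations are used so that the intermediate spaces may
    have other weights and letters. *)
Definition tame (T U : Type) (A : R -> R -> T -> Prop) (B : R -> R -> U -> Prop)
    (Phi : T -> U) := forall h, 0 < h -> exists h' K,
  [/\ 0 < h', 0 <= K & forall f C, 0 <= C -> A C h' f -> B (K * C) h (Phi f)].

Lemma tame_comp T U V A B D (Phi : T -> U) (Psi : U -> V) :
  tame A B Phi -> tame B D Psi -> tame A D (Psi \o Phi).
Proof.
move=> h1 h2 h h0; have [h' [K [h'0 K0 HK]]] := h2 h h0.
have [h'' [K' [h''0 K'0 HK']]] := h1 h' h'0.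
exists h'', (K * K'); split=> // [|f C C0 Af]; first exact: mulr_ge0.
by rewrite -mulrA; apply: HK; [exact: mulr_ge0|exact: HK'].
Qed.

(** Bounds get weaker as h grows, so it is enough to treat small h, with output parameter M h. *)
Lemma tame_small (T U : Type) (A : R -> R -> T -> Prop) (B : R -> R -> U -> Prop)
    (Phi : T -> U) (h0 M : R) : 0 < h0 -> 0 < M ->
  (forall C h h' g, 0 <= C -> 0 <= h <= h' -> B C h g -> B C h' g) ->
  (forall h, 0 < h -> h <= h0 -> exists2 K, 0 <= K & forall f C, 0 <= C ->
     A C h f -> B (K * C) (M * h) (Phi f)) -> tame A B Phi.
Proof.
move=> h00 M0 Bh H h hp.
have hm0 : 0 < Num.min h0 (h / M) by rewrite lt_min h00 divr_gt0.
have [|K K0 HK] := H _ hm0; first by rewrite ge_min lexx.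
exists (Num.min h0 (h / M)), K; split=> // f C C0 Af.
apply: (Bh _ (M * Num.min h0 (h / M))); [exact: mulr_ge0| |exact: HK].
rewrite mulr_ge0 ?(ltW M0) ?(ltW hm0) //= mulrC -ler_pdivlMr //.
by rewrite ge_min lexx orbT.
Qed.

Lemma tame_WB n m J J' s rho rho' (Phi : ('rV[R]_n -> R[i]) -> ('rV[R]_m -> R[i])) (h0 M : R) :
  0 < h0 -> 0 < M -> (forall x, 0 <= rho' x) ->
  (forall h, 0 < h -> h <= h0 -> exists2 K, 0 <= K & forall f C, 0 <= C ->
     WB J s rho C h f -> WB J' s rho' (K * C) (M * h) (Phi f)) ->
  tame (WB J s rho) (WB J' s rho') Phi.
Proof.
by move=> h00 M0 r0 H; apply: (tame_small h00 M0 _ H) => C h h' g C0 hh; exact: WB_hle.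
Qed.

Lemma sum_scalar_norm n (t : R) (j : 'I_n) : \sum_i `|(t%:M : 'M[R]_n) j i| = `|t|.
Proof.
rewrite (bigD1 j) //= big1 ?addr0 => [|i ij]; first by rewrite mxE eqxx mulr1n.
by rewrite mxE eq_sym (negbTE ij) mulr0n normr0.
Qed.

Lemma sum_scalar_normC n (t : R) (j : 'I_n) : \sum_i `|(t%:M : 'M[R]_n) i j| = `|t|.
Proof.
rewrite -(sum_scalar_norm t j); apply: eq_bigr => i _; by rewrite !mxE eq_sym.
Qed.

Lemma sum_scalar_mul n (t : R) (x : 'I_n -> R) j : \sum_i (t%:M : 'M[R]_n) i j * x i = t * x j.
Proof.
rewrite (bigD1 j) //= big1 ?addr0 => [|i ij]; first by rewrite mxE eqxx mulr1n.
by rewrite mxE (negbTE ij) mulr0n mul0r.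
Qed.

Lemma rsubE m n (Z : 'rV[R]_(m + n)) : Z *m (col_mx 0 1%:M : 'M[R]_(m + n, n)) = rsubmx Z.
Proof. by rewrite -{1}(hsubmxK Z) mul_row_col mulmx0 add0r mulmx1. Qed.

Lemma lsubE m n (Z : 'rV[R]_(m + n)) : Z *m (col_mx 1%:M 0 : 'M[R]_(m + n, m)) = lsubmx Z.
Proof. by rewrite -{1}(hsubmxK Z) mul_row_col mulmx0 addr0 mulmx1. Qed.

End tame.

(** * The operator as an iterated Fourier integral *)

Section operator.
Variables (R : realType) (d : nat) (s q sg : R).
Variables (b : 'rV[R]_(d + d + d) -> R[i]) (c : R[i]).
Hypotheses (s0 : 0 < s) (q0 : 0 <= q) (sg2 : sg * sg = 1).
Hypothesis Hb : forall h, 0 < h -> exists2 C, 0 <= C &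
  WB pred0 s (fun Z => expR (q * wt xpredT s Z)) C h b.
Local Notation normc := (@Normc.normc R).
Local Notation cint := (@integral_rV R _).
Local Notation J2 := (@rvars (d + d) d).
Local Notation J1 := (@rvars d d).
Implicit Types f g : 'rV[R]_d -> R[i].

Let P : 'M[R]_(d + d + d, d) := col_mx 0 1%:M.
(** The phase sg <x - y, xi> is split: [N1] evaluates the transform in y at the frequency - sg xi,
    and [N2] the transform in xi at the frequency sg x. *)
Let N1 : 'M[R]_(d + d, d + d + d) := row_mx 1%:M (col_mx 0 ((- sg)%:M)).
Let N2 : 'M[R]_(d, d + d) := row_mx 1%:M sg%:M.

(* op_full f (x) is c times the iterated integral of
   b(x, xi, y) f(y) exp(i sg <x - y, xi>), first in y and then in xi. *)
Definition op_mul f := b * (fun Z => f (Z *m P)).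
Definition op_half f (X : 'rV[R]_(d + d)) := FT (op_mul f) (X *m N1).
Definition op_full f := (fun=> c) * (fun x => FT (op_half f) (x *m N2)).

Let N1E (X : 'rV[R]_(d + d)) : X *m N1 = row_mx X (- sg *: rsubmx X).
Proof.
rewrite mul_mx_row mulmx1; congr row_mx.
by rewrite -{1}(hsubmxK X) mul_row_col mulmx0 add0r mul_mx_scalar.
Qed.

Let N2E (x : 'rV[R]_d) : x *m N2 = row_mx x (sg *: x).
Proof. by rewrite mul_mx_row mulmx1 mul_mx_scalar. Qed.

Let sg1 : `|sg| = 1.
Proof.
have : `|sg| ^+ 2 = 1 by rewrite -normrX expr2 sg2 normr1.
by move=> /eqP; rewrite sqrf_eq1 => /orP[/eqP //|/eqP h]; have := normr_ge0 sg; rewrite h oppr_ge0 ler10.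
Qed.

Let nsg1 : `|- sg| = 1. Proof. by rewrite normrN. Qed.

Let rho2 (X : 'rV[R]_(d + d)) := expR (q * wt xpredT s X).
Let rho1 (x : 'rV[R]_d) := expR (q * wt xpredT s x).

Let S0 : 0 < 2 `^ s :> R. Proof. exact: powR_gt0. Qed.
Let one0 (n : nat) (x : 'rV[R]_n) : 0 <= (1 : R). Proof. exact: ler01. Qed.

(** Absorption gives f the decay exp(- q wt(y)), which cancels the y-part of the growth of b.
    Coordinate letters in y fall on f, as b admits derivations only. *)
Lemma tame_op_mul : tame (WB xpredT s (fun=> 1)) (WB J2 s (fun Z => rho2 (lsubmx Z))) op_mul.
Proof.
have [h0 h00 H0] := @WB_absorb R d s q s0 q0.
have M0 : 0 < 2 * 2 `^ s :> R by rewrite mulr_gt0.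
apply: (tame_WB h00 M0) => [Z|h hp hh]; first exact: expR_ge0.
 have hS : 0 < 2 `^ s * h by exact: mulr_gt0.
have [Cb Cb0 bb] := Hb hS.
exists (Cb * 2 `^ s) => [|f C C0 bf]; first by rewrite mulr_ge0 // ltW.
have b1 := H0 h hp hh _ _ _ _ C0 (@one0 _) bf.
have SC0 : 0 <= 2 `^ s * C by rewrite mulr_ge0 // ltW.
have b2 : WB J2 s (fun Z => 1 * expR (- (q * wt xpredT s (Z *m P)))) (2 `^ s * C) (2 `^ s * h)
    (fun Z => f (Z *m P)).
  rewrite -[X in WB _ _ _ _ X]mul1r.
  apply: (WB_mulmx (K := P^T) (J' := xpredT) _ _ _ _ _ (ltW hS) SC0 _ b1) => //.
  - move=> j; case: (split_ordP j) => k ->.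
      by rewrite big1 // => i _; rewrite col_mxEu mxE normr0.
    by under eq_bigr do rewrite col_mxEd; rewrite sum_scalar_norm normr1.
  - move=> j /rvarsP[k ->].
    by under eq_bigr do rewrite mxE col_mxEd; rewrite sum_scalar_norm normr1.
  - move=> j x /rvarsP[k ->]; rewrite rsubE.
    under eq_bigr do rewrite mxE col_mxEd.
    have := sum_scalar_mul 1 (fun i => rsubmx x 0 i) k; rewrite mul1r [in RHS]mxE => <-.
    by apply: eq_bigr => i _; rewrite !mxE eq_sym.
rewrite -!mulrA; apply: (WB_rho _ _ _ (WB_mul (J1 := pred0) (J2 := J2) (ltW s0) (ltW hS) Cb0 SC0 _ _ _ bb b2)).
- by rewrite mulr_ge0 // ltW.
- exact: mulr_ge0.
- move=> Z; rewrite mulr_ge0 ?mulr_ge0 ?expR_ge0 //= mul1r -expRD /rho2 ler_expR.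
  by rewrite wt_cat rsubE mulrDr addrK.
- by move=> Z; exact: expR_ge0.
- by move=> Z; rewrite mulr_ge0 // expR_ge0.
- by move=> j ->; rewrite orbT.
Qed.

(** Absorption in the frequency gives decay that, at the frequency - sg xi, cancels the growth in
    xi; growth in x is left. The coordinates xi_j are recovered from the frequency. *)
Lemma tame_restrict1 : tame (WB J2 s (fun Z => rho2 (lsubmx Z))) (WB J1 s (fun X => rho1 (lsubmx X)))
  (fun G X => G (X *m N1)).
Proof.
have [h0 h00 H0] := @WB_absorb R (d + d + d) s q s0 q0.
have M0 : 0 < 2 * 2 `^ s :> R by rewrite mulr_gt0.
apply: (tame_WB h00 M0) => [Z|h hp hh]; first exact: expR_ge0.
 have hS : 0 < 2 `^ s * h by exact: mulr_gt0.
exists (2 `^ s) => [|G C C0 bG]; first exact: ltW.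
have SC0 : 0 <= 2 `^ s * C by rewrite mulr_ge0 // ltW.
have r0 (Z : 'rV[R]_(d + d + d)) : 0 <= rho2 (lsubmx Z) by exact: expR_ge0.
have b1 := H0 h hp hh J2 _ _ _ C0 r0 bG.
pose K : 'M[R]_(d + d + d, d + d) := col_mx 0 (row_mx 0 (- sg)%:M).
rewrite -mulrA; apply: (WB_rho _ _ _ (WB_mulmx (L := N1) (K := K) (J := J1) (J' := J2) (Lam := 2) _ _ _ _ _ (ltW hS) SC0 _ b1)) => //.
- by rewrite mulr_ge0 // ltW.
- move=> X; rewrite mulr_ge0 ?expR_ge0 //= /rho2 /rho1 -expRD ler_expR wt_rvars N1E row_mxKl row_mxKr.
  by rewrite wt_sign // wt_cat mulrDr addrK.
- move=> j; rewrite big_split_ord /=.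
  under eq_bigr do rewrite row_mxEl.
  under [X in _ + X]eq_bigr do rewrite row_mxEr.
  rewrite sum_scalar_norm normr1 -[leRHS]/(1 + 1); apply: lerD => //.
  case: (split_ordP j) => k ->.
    by rewrite big1 // => i _; rewrite col_mxEu mxE normr0.
  by under eq_bigr do rewrite col_mxEd; rewrite sum_scalar_norm nsg1.
- move=> j /rvarsP[k ->]; rewrite big_split_ord /= big1 => [|i _]; last first.
    by rewrite col_mxEu mxE normr0.
  under eq_bigr do rewrite col_mxEd row_mxEr.
  by rewrite sum_scalar_normC nsg1 add0r ler1n.
- move=> j i _; case: (split_ordP i) => k ->; last by rewrite rvars_rshift.
  by rewrite col_mxEu mxE eqxx.
- move=> j x /rvarsP[k ->]; rewrite big_split_ord /= big1 => [|i _]; last first.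
    by rewrite col_mxEu mxE mul0r.
  under eq_bigr do rewrite col_mxEd row_mxEr N1E row_mxEr.
  rewrite (sum_scalar_mul (- sg) (fun i => (- sg *: rsubmx x) 0 i)) add0r.
  by rewrite !mxE mulrA mulrNN sg2 mul1r.
- by move=> x; rewrite mulr_ge0 // expR_ge0.
Qed.

(** The same cancellation, at the frequency sg x against the growth in x. As x is recovered from the
    frequency, all coordinate letters are available again. *)
Lemma tame_restrict2 : tame (WB J1 s (fun X => rho1 (lsubmx X))) (WB xpredT s (fun=> 1))
  (fun G x => G (x *m N2)).
Proof.
have [h0 h00 H0] := @WB_absorb R (d + d) s q s0 q0.
have M0 : 0 < 2 * 2 `^ s :> R by rewrite mulr_gt0.
apply: (tame_WB h00 M0) => [//|h hp hh].
 have hS : 0 < 2 `^ s * h by exact: mulr_gt0.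
exists (2 `^ s) => [|G C C0 bG]; first exact: ltW.
have SC0 : 0 <= 2 `^ s * C by rewrite mulr_ge0 // ltW.
have r0 (Z : 'rV[R]_(d + d)) : 0 <= rho1 (lsubmx Z) by exact: expR_ge0.
have b1 := H0 h hp hh J1 _ _ _ C0 r0 bG.
pose K : 'M[R]_(d + d, d) := col_mx 0 sg%:M.
rewrite -mulrA; apply: (WB_rho _ _ _ (WB_mulmx (L := N2) (K := K) (J := xpredT) (J' := J1) (Lam := 2) _ _ _ _ _ (ltW hS) SC0 _ b1)) => //.
- by rewrite mulr_ge0 // ltW.
- move=> x; rewrite mulr_ge0 ?expR_ge0 //= /rho1 -expRD wt_rvars N2E row_mxKl row_mxKr.
  by rewrite wt_sign // subrr expR0.
- move=> j; rewrite big_split_ord /=.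
  under eq_bigr do rewrite row_mxEl.
  under [X in _ + X]eq_bigr do rewrite row_mxEr.
  by rewrite !sum_scalar_norm normr1 sg1.
- move=> j _; rewrite big_split_ord /= big1 => [|i _]; last first.
    by rewrite col_mxEu mxE normr0.
  under eq_bigr do rewrite col_mxEd.
  by rewrite sum_scalar_normC sg1 add0r ler1n.
- move=> j i _; case: (split_ordP i) => k ->; last by rewrite rvars_rshift.
  by rewrite col_mxEu mxE eqxx.
- move=> j x _; rewrite big_split_ord /= big1 => [|i _]; last first.
    by rewrite col_mxEu mxE mul0r.
  under eq_bigr do rewrite col_mxEd N2E row_mxEr.
  by rewrite (sum_scalar_mul sg (fun i => (sg *: x) 0 i)) add0r mxE mulrA sg2 mul1r.
- by move=> x; rewrite mulr_ge0 // expR_ge0.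
Qed.

Lemma tame_FT m n (r : 'rV[R]_m -> R) : (forall x, 0 <= r x) -> LBd r ->
  tame (WB (@rvars m n) s (fun X => r (lsubmx X))) (WB (@rvars m n) s (fun X => r (lsubmx X)))
    (@FT R m n).
Proof.
move=> r0 rb; apply: (tame_WB ltr01 S0) => [X|h hp _]; first exact: r0.
exists (2 * Dn R n * ddK s h n) => [|G C C0 bG].
  have k0 : 0 <= ddK s h n by apply: ddK_ge0; exact: ltW.
  by apply: mulr_ge0 => //; apply: mulr_ge0 => //; exact: Dn_ge0.
have := WB_FT (@rvars_rshift m n) (ltW s0) (ltW hp) C0 r0 rb bG.
by rewrite !mulrA.
Qed.

Lemma tame_op_half : tame (WB xpredT s (fun=> 1)) (WB J1 s (fun X => rho1 (lsubmx X))) op_half.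
Proof.
have r0 (X : 'rV[R]_(d + d)) : 0 <= rho2 X by exact: expR_ge0.
have t1 := tame_comp tame_op_mul (@tame_FT (d + d) d rho2 r0 (wt_LBd q0 s0)).
exact: (tame_comp t1 tame_restrict1).
Qed.

Lemma tame_op_full : tame (WB xpredT s (fun=> 1)) (WB xpredT s (fun=> 1)) op_full.
Proof.
have r0 (X : 'rV[R]_d) : 0 <= rho1 X by exact: expR_ge0.
have t1 := tame_comp tame_op_half (@tame_FT d d rho1 r0 (wt_LBd q0 s0)).
have t2 := tame_comp t1 tame_restrict2 => h hp.
have [h' [K [h'0 K0 HK]]] := t2 h hp.
exists h', (normc c * K); split=> // [|f C C0 bf]; first by rewrite mulr_ge0 ?normc_ge0.
by rewrite -mulrA; apply: WB_Z; exact: HK.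
Qed.

Lemma Gd_op_mul f : SWB s f -> Gd J2 (op_mul f).
Proof.
move=> Hf; have [h' [K [h'0 K0 HK]]] := tame_op_mul ltr01.
have [C C0 HC] := Hf h' h'0.
apply: (@WB_Gd _ _ _ _ (@rvars_rshift _ _) s rho2 (K * C) 1 _ (ltW s0) ler01) => //.
- exact: mulr_ge0.
- by move=> x; exact: expR_ge0.
- exact: wt_LBd.
- exact: HK.
Qed.

Lemma Gd_op_half f : SWB s f -> Gd J1 (op_half f).
Proof.
move=> Hf; have [h' [K [h'0 K0 HK]]] := tame_op_half ltr01.
have [C C0 HC] := Hf h' h'0.
apply: (@WB_Gd _ _ _ _ (@rvars_rshift _ _) s rho1 (K * C) 1 _ (ltW s0) ler01) => //.
- exact: mulr_ge0.
- by move=> x; exact: expR_ge0.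
- exact: wt_LBd.
- exact: HK.
Qed.

Lemma op_full_lin f g (k : R[i]) : SWB s f -> SWB s g ->
  op_full ((fun=> k) * f + g) = (fun=> k) * op_full f + op_full g.
Proof.
move=> Hf Hg.
have e1 : op_mul ((fun=> k) * f + g) = (fun=> k) * op_mul f + op_mul g.
  apply/funext => Z; transitivity (b Z * (k * f (Z *m P) + g (Z *m P))); first by [].
  by rewrite mulrDr mulrCA.
have e2 : op_half ((fun=> k) * f + g) = (fun=> k) * op_half f + op_half g.
  apply/funext => X; rewrite {1}/op_half e1.
  by rewrite (FT_lin k (@rvars_rshift _ _) (Gd_op_mul Hf) (Gd_op_mul Hg)).
apply/funext => x; rewrite {1}/op_full e2.
rewrite (FT_lin k (@rvars_rshift _ _) (Gd_op_half Hf) (Gd_op_half Hg)).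
transitivity (c * (k * FT (op_half f) (x *m N2) + FT (op_half g) (x *m N2))); first by [].
by rewrite mulrDr mulrCA.
Qed.

End operator.

(** * Pairings as integrals over x, y and then xi *)

Section kernels.
Variables (R : realType) (d : nat) (s : R).
Hypothesis s0 : 0 < s.
Local Notation normc := (@Normc.normc R).
Local Notation cint := (@integral_rV R _).
Implicit Types (f g : 'rV[R]_d -> R[i]) (b : 'rV[R]_(d + d + d) -> R[i]) (xi : 'rV[R]_d).

Lemma expiD (x y : R) : expi (x + y) = expi x * expi y.
Proof. by rewrite /expi cosD sinD; congr Complex; rewrite addrC. Qed.

Lemma dotrVDl n (x y z : 'rV[R]_n) : dotrV (x + y) z = dotrV x z + dotrV y z.
Proof. by rewrite /dotrV -big_split; apply: eq_bigr => j _; rewrite mxE mulrDl. Qed.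

Lemma dotrVZl n (t : R) (x z : 'rV[R]_n) : dotrV (t *: x) z = t * dotrV x z.
Proof. by rewrite /dotrV mulr_sumr; apply: eq_bigr => j _; rewrite mxE mulrA. Qed.

Lemma dotrVC n (x z : 'rV[R]_n) : dotrV x z = dotrV z x.
Proof. by apply: eq_bigr => j _; rewrite mulrC. Qed.

Lemma smooth_shift n (w : 'rV[R]_n) (f : 'rV[R]_n -> R[i]) :
  smooth f -> smooth (fun x => f (x + w)).
Proof.
move=> /smoothP sf; apply/smoothP => k; have [c1 c2] := sf k.
by split; [have := Ck_shift w c1|have := Ck_shift w c2].
Qed.

Lemma smooth_expi_dot n (t : R) (xi : 'rV[R]_n) : smooth (fun x => expi (t * dotrV x xi)).
Proof.
apply/smoothP => k; apply: expi_CkC.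
have -> : (fun x => t * dotrV x xi) =
    (fun=> t) * \sum_j ((fun x : 'rV[R]_n => x 0 j) * (fun=> xi 0 j)).
  by apply/funext => x; rewrite [RHS]/(t * _) fct_sumE.
apply: CkM; first exact: Ck_cst.
by apply: Ck_sum => j; apply: CkM; [exact: Ck_coord|exact: Ck_cst].
Qed.

(** The integrand in (x, y) at a fixed frequency. The decay of f and g makes it integrable in (x,
    y), but gives nothing in xi, so xi stays the outermost variable. Both the operator and its
    transpose are brought to this form. *)
Definition ker (sg : R) b f g xi (Z : 'rV[R]_(d + d)) : R[i] :=
  b (row_mx (row_mx (lsubmx Z) xi) (rsubmx Z)) *
  (g (lsubmx Z) * f (rsubmx Z) * expi (sg * dotrV (lsubmx Z - rsubmx Z) xi)).

Lemma smooth_ker sg b f g xi : smooth b -> smooth f -> smooth g -> smooth (ker sg b f g xi).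
Proof.
move=> sb sf sg'.
pose L : 'M[R]_(d + d, d + d + d) := row_mx (row_mx (col_mx 1%:M 0) 0) (col_mx 0 1%:M).
pose w : 'rV[R]_(d + d + d) := row_mx (row_mx 0 xi) 0.
have -> : ker sg b f g xi = (fun Z => b (Z *m L + w)) *
   ((fun Z => g (Z *m (col_mx 1%:M 0 : 'M[R]_(d + d, d)))) *
    (fun Z => f (Z *m (col_mx 0 1%:M : 'M[R]_(d + d, d)))) *
    (fun Z => expi (sg * dotrV (Z *m (col_mx 1%:M (- 1%:M) : 'M[R]_(d + d, d))) xi))).
  apply/funext => Z; rewrite /ker.
  have -> : lsubmx Z - rsubmx Z = Z *m (col_mx 1%:M (- 1%:M) : 'M[R]_(d + d, d)).
    by rewrite -{3}(hsubmxK Z) mul_row_col mulmx1 mulmxN mulmx1.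
  have -> : row_mx (row_mx (lsubmx Z) xi) (rsubmx Z) = Z *m L + w.
    by rewrite !mul_mx_row lsubE rsubE mulmx0 !add_row_mx add0r !addr0.
  by rewrite -lsubE -rsubE.
apply: smooth_M; first exact: (smooth_mulmx L (smooth_shift w sb)).
apply: smooth_M; last exact: (smooth_mulmx _ (smooth_expi_dot sg xi)).
by apply: smooth_M; exact: smooth_mulmx.
Qed.

Section bounded_symbol.
Variables (b : 'rV[R]_(d + d + d) -> R[i]) (q Cb : R).
Hypotheses (sb : smooth b) (q0 : 0 <= q) (Cb0 : 0 <= Cb).
Hypothesis bB : forall Z, normc (b Z) <= Cb * expR (q * wt xpredT s Z).

(** Of the decay rate q + r of f and g, the part q cancels the growth of b in x and y. *)
Lemma ker_bound sg f g xi r : 0 <= r -> SWB s f -> SWB s g ->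
  exists2 C, 0 <= C & forall Z, normc (ker sg b f g xi Z) <= C * expR (- (r * wt xpredT s Z)).
Proof.
move=> r0 Hf Hg; have qr : 0 <= q + r by exact: addr_ge0.
have [Cf Cf0 HCf] := SWB_decay s0 qr Hf.
have [Cg Cg0 HCg] := SWB_decay s0 qr Hg.
exists (Cb * expR (q * wt xpredT s xi) * (Cg * Cf)) => [|Z].
  by rewrite !mulr_ge0 // expR_ge0.
rewrite /ker !Normc.normcM normc_expi mulr1.
have h1 := bB (row_mx (row_mx (lsubmx Z) xi) (rsubmx Z)).
have h2 := HCg (lsubmx Z); have h3 := HCf (rsubmx Z).
apply: le_trans (ler_pM (normc_ge0 _) (mulr_ge0 (normc_ge0 _) (normc_ge0 _)) h1
  (ler_pM (normc_ge0 _) (normc_ge0 _) h2 h3)) _.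
rewrite wt_cat row_mxKl row_mxKr wt_cat row_mxKl row_mxKr (wt_cat _ Z).
set wl := wt xpredT s (lsubmx Z); set wr := wt xpredT s (rsubmx Z); set wx := wt xpredT s xi.
have -> : expR (q * (wl + wx + wr)) = expR (q * wx) * (expR (q * wl) * expR (q * wr)).
  by rewrite -!expRD; congr expR; ring.
have -> : expR (- (r * (wl + wr))) = expR (q * wl) * expR (q * wr) *
    (expR (- ((q + r) * wl)) * expR (- ((q + r) * wr))).
  by rewrite -!expRD; congr expR; ring.
move: (expR _) (expR (q * wl)) (expR (q * wr)) (expR (- ((q + r) * wl))) => Ex El Er Gl.
move: (expR _) => Gr.
by rewrite le_eqVlt; apply/orP; left; apply/eqP; ring.
Qed.

Lemma ker_CD sg f g xi (N N' : 'M[R]_(d + d)) : N *m N' = 1%:M -> SWB s f -> SWB s g ->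
  CD (fun Z => ker sg b f g xi (Z *m N)).
Proof.
move=> NN Hf Hg; have [M M0 HM] := wt_mulmx N' s0.
have [C C0 HC] := ker_bound sg xi M0 Hf Hg.
apply: (decay_CD s0 C0).
  apply: smooth_mulmx; apply: smooth_ker => //; [exact: SWB_smooth Hf|exact: SWB_smooth Hg].
move=> Z; apply: le_trans (HC _) _; apply: ler_wpM2l => //.
rewrite ler_expR lerN2; apply: le_trans (HM (Z *m N)).
by rewrite -mulmxA NN mulmx1.
Qed.

Lemma ker_CD1 sg f g xi : SWB s f -> SWB s g -> CD (ker sg b f g xi).
Proof.
move=> Hf Hg; have := ker_CD sg xi (mulmx1 1%:M : 1%:M *m 1%:M = 1%:M) Hf Hg.
by under eq_fun do rewrite mulmx1.
Qed.

End bounded_symbol.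

Definition swap_mx : 'M[R]_(d + d + d) :=
  col_mx (col_mx (row_mx 0 1%:M) (row_mx (row_mx 0 1%:M) 0)) (row_mx (row_mx 1%:M 0) 0).

Lemma swap_mxE (x xi y : 'rV[R]_d) :
  row_mx (row_mx x xi) y *m swap_mx = row_mx (row_mx y xi) x.
Proof.
rewrite /swap_mx !mul_row_col !mul_mx_row !mulmx0 !mulmx1.
by rewrite !(add_row_mx, addr0, add0r).
Qed.

Lemma ker_swap sg b f g xi (x y : 'rV[R]_d) :
  ker (- sg) (fun Z => b (Z *m swap_mx)) g f xi (row_mx y x) = ker sg b f g xi (row_mx x y).
Proof.
rewrite /ker !row_mxKl !row_mxKr swap_mxE (mulrC (f y)); congr (_ * (_ * expi _)).
by rewrite mulNr -mulrN; congr (_ * _); rewrite -[RHS]mul1r -[1]opprK mulNr -dotrVZl scaleN1r opprB.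
Qed.

Section pairing_identity.
Variables (b : 'rV[R]_(d + d + d) -> R[i]) (q sg : R) (c : R[i]).
Hypotheses (q0 : 0 <= q) (sg2 : sg * sg = 1).
Hypothesis Hb : forall h, 0 < h -> exists2 C, 0 <= C &
  WB pred0 s (fun Z => expR (q * wt xpredT s Z)) C h b.

Lemma symbol_growth : smooth b /\ exists2 Cb, 0 <= Cb &
  forall Z, normc (b Z) <= Cb * expR (q * wt xpredT s Z).
Proof.
have [Cb Cb0 /WBP[sb H]] := Hb ltr01; split=> //; exists Cb => // Z.
by have := H [::] isT Z; rewrite /= expr0 fs0 !mulr1.
Qed.

(** The function Q of (x, xi) is integrable: [op_half] has already been integrated in y and decays
    in xi, and the decay of g beats the growth in x. Fubini puts xi outside, and only then the
    integral in y is unfolded. *)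
Lemma pairing_op_full f g : SWB s f -> SWB s g ->
  pairing (op_full sg b c f) g = c * cint (fun xi => cint (ker sg b f g xi)).
Proof.
move=> Hf Hg; have [sb [Cb Cb0 bB]] := symbol_growth.
have g2 := Gd_op_mul s0 q0 Hb Hf; have g1 := Gd_op_half s0 q0 sg2 Hb Hf.
have [sH _] := g1.
pose M : 'M[R]_(d + d, d + d + d) :=
  row_mx (row_mx (col_mx 1%:M 0) (col_mx sg%:M 0)) (col_mx 0 1%:M).
have ME (X : 'rV[R]_(d + d)) : X *m M = row_mx (row_mx (lsubmx X) (sg *: lsubmx X)) (rsubmx X).
  rewrite !mul_mx_row lsubE rsubE; congr (row_mx (row_mx _ _) _).
  by rewrite -{1}(hsubmxK X) mul_row_col mulmx0 addr0 mul_mx_scalar.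
pose Q X := EG (op_half sg b f) (X *m M) * g (lsubmx X).
have dQ : CD Q.
  have [h' [K [h'0 K0 HK]]] := tame_op_half s0 q0 sg2 Hb ltr01.
  have [C C0 HC] := Hf h' h'0.
  have bh := HK f C C0 HC.
  (* The rate q cancels the growth of [op_half] in x; the additional 1 gives integrability. *)
  have [Cg Cg0 HCg] := SWB_decay s0 (addr_ge0 q0 ler01) Hg.
  have [D D0 HD] := @expR_wt_dd R d s s0.
  have r0 (x : 'rV[R]_d) : 0 <= expR (q * wt xpredT s x) by exact: expR_ge0.
  have H := WB_word_dd (@rvars_rshift d d) (ltW s0) ler01 (mulr_ge0 K0 C0) r0 bh.
  pose A := ddK s 1 d * (K * C) * ((2 `^ s * 1) ^+ 0 * fs s 0).
  have A0 : 0 <= A.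
    by rewrite /A expr0 fs0 !mulr1; apply: mulr_ge0; [exact: ddK_ge0|exact: mulr_ge0].
  apply: (@smooth_CD _ _ _ (A * (Cg * D))).
    apply: smooth_M; first exact: (smooth_mulmx M (smooth_EG sH)).
    under eq_fun do rewrite -lsubE.
    exact: (smooth_mulmx _ (SWB_smooth Hg)).
  move=> X; rewrite /Q Normc.normcM normc_EG projGE ME !row_mxKl row_mxKr hsubmxK.
  apply: le_trans (ler_pM (normc_ge0 _) (normc_ge0 _) (H [::] X isT) (HCg (lsubmx X))) _.
  have ddX : dd X = dd (lsubmx X) * dd (rsubmx X) by rewrite -dd_row_mx hsubmxK.
  rewrite ddX -[X in X * expR (q * _) * _ * _ <= _]/A.
  have -> : expR (- ((q + 1) * wt xpredT s (lsubmx X))) =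
      expR (- (q * wt xpredT s (lsubmx X))) * expR (- wt xpredT s (lsubmx X)).
    by rewrite -expRD; congr expR; ring.
  apply: (@le_trans _ _ (A * dd (rsubmx X) * Cg * expR (- wt xpredT s (lsubmx X)))).
    rewrite le_eqVlt; apply/orP; left; apply/eqP.
    have e1 : expR (q * wt xpredT s (lsubmx X)) * expR (- (q * wt xpredT s (lsubmx X))) = 1.
      by rewrite -expRD subrr expR0.
    rewrite -[RHS]mul1r -e1; move: (expR _) (expR (- (q * _))) (expR _) (dd _) => E1 E2 E3 E4.
    by ring.
  have := ler_wpM2l (mulr_ge0 (mulr_ge0 A0 (dd_ge0 (rsubmx X))) Cg0) (HD (lsubmx X)).
  move=> /le_trans; apply; rewrite le_eqVlt; apply/orP; left; apply/eqP.
  by move: (dd _) (dd _) => E1 E2; ring.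
transitivity (cint (fun X => c * Q X)).
  rewrite (cint_cat (CD_Z c dQ)); apply: eq_cint => x.
  have dx : CD (fun xi => Q (row_mx x xi)) by exact: CD_secr.
  rewrite (cint_Z c dx).
  transitivity (c * (FT (op_half sg b f) (x *m row_mx 1%:M sg%:M) * g x)).
    by rewrite mulrA.
  congr (_ * _).
  rewrite FT_Int mulrC.
  have dE := LD_CD (x *m row_mx 1%:M sg%:M) (Gd_LD1 (@rvars_rshift d d) g1).
  rewrite -(cint_Z (g x) dE); apply: eq_cint => xi.
  by rewrite /Q ME !row_mxKl row_mxKr mul_mx_row mulmx1 mul_mx_scalar mulrC.
rewrite (cint_Z c dQ) (cint_catr dQ); congr (_ * _); apply: eq_cint => xi.
rewrite (cint_cat (ker_CD1 sb q0 Cb0 bB sg xi Hf Hg)); apply: eq_cint => x.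
rewrite /Q /EG ME projGE /phase !row_mxKl !row_mxKr {1}/op_half FT_Int.
have dE := LD_CD (row_mx x xi *m row_mx 1%:M (col_mx 0 (- sg)%:M)) (Gd_LD1 (@rvars_rshift (d + d) d) g2).
rewrite -mulrA mulrC -(cint_Z _ dE); apply: eq_cint => y.
rewrite /EG projGE /phase !row_mxKl !row_mxKr mul_mx_row mulmx1 !row_mxKl !row_mxKr.
rewrite mul_row_col mulmx0 add0r mul_mx_scalar /op_mul.
rewrite mulrfctE rsubE row_mxKr /ker !row_mxKl !row_mxKr.
have -> : sg * dotrV (x - y) xi = dotrV (sg *: x) xi + dotrV (- sg *: xi) y.
  by rewrite dotrVDl -[- y]scaleN1r !dotrVZl (dotrVC y); ring.
by rewrite expiD; ring.
Qed.

End pairing_identity.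

Lemma cint_ker_swap sg b q Cb f g xi : smooth b -> 0 <= q -> 0 <= Cb ->
  (forall Z, normc (b Z) <= Cb * expR (q * wt xpredT s Z)) -> SWB s f -> SWB s g ->
  cint (ker (- sg) (fun Z => b (Z *m swap_mx)) g f xi) = cint (ker sg b f g xi).
Proof.
move=> sb q0 Cb0 bB Hf Hg.
have sb' : smooth (fun Z => b (Z *m swap_mx)) by exact: smooth_mulmx.
have bB' Z : normc (b (Z *m swap_mx)) <= Cb * expR (q * wt xpredT s Z).
  have -> : wt xpredT s Z = wt xpredT s (Z *m swap_mx).
    have ZE : Z = row_mx (row_mx (lsubmx (lsubmx Z)) (rsubmx (lsubmx Z))) (rsubmx Z).
      by rewrite !hsubmxK.
    rewrite [in RHS]ZE swap_mxE !wt_cat !row_mxKl !row_mxKr.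
    by move: (wt _ _ _) (wt _ _ _) (wt _ _ _) => u v w; ring.
  exact: bB.
rewrite (cint_catr (ker_CD1 sb' q0 Cb0 bB' (- sg) xi Hg Hf)).
rewrite (cint_cat (ker_CD1 sb q0 Cb0 bB sg xi Hf Hg)).
by apply: eq_cint => x; apply: eq_cint => y; exact: ker_swap.
Qed.

End kernels.

(** * Linear substitutions and tensor products *)

Section linear_change.
Variables (R : realType) (s : R).
Hypothesis s0 : 0 < s.
Local Notation normc := (@Normc.normc R).

(** Dominates every row sum and every column sum, the two masses that enter the cost of a linear
    substitution. *)
Definition mx_size m n (L : 'M[R]_(m, n)) : R := \sum_j \sum_i `|L j i|.

Lemma mx_size_ge0 m n (L : 'M[R]_(m, n)) : 0 <= mx_size L.
Proof. by apply: sumr_ge0 => j _; apply: sumr_ge0. Qed.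

Lemma row_le_mx_size m n (L : 'M[R]_(m, n)) j : \sum_i `|L j i| <= mx_size L.
Proof.
rewrite /mx_size (bigD1 j) //= lerDl; apply: sumr_ge0 => k _; exact: sumr_ge0.
Qed.

Lemma col_le_mx_size m n (L : 'M[R]_(m, n)) i : \sum_j `|L j i| <= mx_size L.
Proof.
by rewrite /mx_size; apply: ler_sum => j _; rewrite (bigD1 i) //= lerDl; apply: sumr_ge0.
Qed.

(** With [pred0] no coordinates have to be recovered, so L may be any matrix and K = 0 serves. The
    division of h by [Lam] compensates the loss per letter. *)
Lemma symbol_mulmx m n (L : 'M[R]_(m, n)) (a : 'rV[R]_n -> R[i]) q : 0 <= q ->
  (forall h, 0 < h -> exists2 C, 0 <= C & WB pred0 s (fun X => expR (q * wt xpredT s X)) C h a) ->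
  exists2 q', 0 <= q' & forall h, 0 < h -> exists2 C, 0 <= C &
    WB pred0 s (fun Z => expR (q' * wt xpredT s Z)) C h (fun Z => a (Z *m L)).
Proof.
move=> q0 Ha; have [M M0 HM] := wt_mulmx L s0.
exists (q * M) => [|h h0]; first exact: mulr_ge0.
pose Lam := mx_size L + 1.
have L0 : 0 < Lam by rewrite ltr_wpDl ?mx_size_ge0.
have hL0 : 0 < h / Lam by exact: divr_gt0.
have [C C0 HC] := Ha _ hL0; exists C => //.
have r0 (x : 'rV[R]_n) : 0 <= expR (q * wt xpredT s x) by exact: expR_ge0.
have LL j : \sum_i `|L j i| <= Lam.
  by apply: le_trans (row_le_mx_size L j) _; rewrite lerDl.
have := WB_mulmx (K := 0) (J := pred0) (J' := pred0) (ltW L0) LL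
  (fun j (h : false) => False_ind _ (notF h)) (fun j i (h : false) _ => False_ind _ (notF h))
  (fun j x (h : false) => False_ind _ (notF h)) (ltW hL0) C0 r0 HC.
have -> : Lam * (h / Lam) = h by rewrite mulrC divfK // gt_eqF.
apply: WB_rho; [exact: ltW|exact: C0|] => x.
rewrite expR_ge0 /= ler_expR -mulrA; apply: ler_wpM2l => //; exact: HM.
Qed.

Definition inv_size m n (N : 'M[R]_(m, n)) (N' : 'M[R]_(n, m)) : R := mx_size N + mx_size N' + 1.

Lemma inv_size_gt0 m n (N : 'M[R]_(m, n)) (N' : 'M[R]_(n, m)) : 0 < inv_size N N'.
Proof. by rewrite ltr_wpDl // addr_ge0 // mx_size_ge0. Qed.

Lemma WB_inv_mulmx m n (N : 'M[R]_(m, n)) (N' : 'M[R]_(n, m)) C h (f : 'rV[R]_n -> R[i]) :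
  N *m N' = 1%:M -> 0 <= h -> 0 <= C -> WB xpredT s (fun=> 1) C h f ->
  WB xpredT s (fun=> 1) C (inv_size N N' * h) (fun x => f (x *m N)).
Proof.
move=> NN h0 C0 bf.
have LL j : \sum_i `|N j i| <= inv_size N N'.
  by apply: le_trans (row_le_mx_size N j) _; rewrite /inv_size -addrA lerDl addr_ge0 // mx_size_ge0.
have LK j : \sum_i `|N' i j| <= inv_size N N'.
  apply: le_trans (col_le_mx_size N' j) _.
  by rewrite /inv_size addrAC addrC lerDl addr_ge0 // mx_size_ge0.
have LKE j (x : 'rV[R]_m) : x 0 j = \sum_i N' i j * (x *m N) 0 i.
  rewrite -[in LHS](mulmx1 x) -NN mulmxA [LHS]mxE; apply: eq_bigr => i _; exact: mulrC.
exact: (WB_mulmx (K := N') (J := xpredT) (J' := xpredT) (ltW (inv_size_gt0 N N')) LL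
  (fun j _ => LK j) (fun j i _ _ => isT) (fun j x _ => LKE j x) h0 C0 (fun=> ler01) bf).
Qed.

Lemma SWB_mulmx m n (N : 'M[R]_(m, n)) (N' : 'M[R]_(n, m)) (f : 'rV[R]_n -> R[i]) :
  N *m N' = 1%:M -> SWB s f -> SWB s (fun x => f (x *m N)).
Proof.
move=> NN Hf h h0; have L0 := inv_size_gt0 N N'.
have hL0 : 0 < h / inv_size N N' by exact: divr_gt0.
have [C C0 HC] := Hf _ hL0; exists C => //.
have := WB_inv_mulmx NN (ltW hL0) C0 HC.
by have -> : inv_size N N' * (h / inv_size N N') = h by rewrite mulrC divfK // gt_eqF.
Qed.

Lemma WB_rsub m n rho C h (f : 'rV[R]_n -> R[i]) : 0 <= h -> 0 <= C -> (forall x, 0 <= rho x) ->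
  WB xpredT s rho C h f -> WB (@rvars m n) s (fun Z => rho (rsubmx Z)) C h (fun Z => f (rsubmx Z)).
Proof.
move=> h0 C0 r0 bf; pose P : 'M[R]_(m + n, n) := col_mx 0 1%:M.
rewrite -[X in WB _ _ _ _ X]mul1r.
under eq_fun do rewrite -rsubE; under [X in WB _ _ _ _ _ X]eq_fun do rewrite -rsubE.
apply: (WB_mulmx (L := P) (K := P^T) (J' := xpredT) _ _ _ _ _ h0 C0 r0 bf) => //.
- move=> j; case: (split_ordP j) => k ->.
    by rewrite big1 // => i _; rewrite col_mxEu mxE normr0.
  by under eq_bigr do rewrite col_mxEd; rewrite sum_scalar_norm normr1.
- move=> j /rvarsP[k ->].
  by under eq_bigr do rewrite mxE col_mxEd; rewrite sum_scalar_norm normr1.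
- move=> j x /rvarsP[k ->]; rewrite rsubE.
  under eq_bigr do rewrite mxE col_mxEd.
  have := sum_scalar_mul 1 (fun i => rsubmx x 0 i) k; rewrite mul1r [in RHS]mxE => <-.
  by apply: eq_bigr => i _; rewrite !mxE eq_sym.
Qed.

Lemma WB_lsub m n rho C h (f : 'rV[R]_m -> R[i]) : 0 <= h -> 0 <= C -> (forall x, 0 <= rho x) ->
  WB xpredT s rho C h f ->
  WB (fun j => ~~ @rvars m n j) s (fun Z => rho (lsubmx Z)) C h (fun Z => f (lsubmx Z)).
Proof.
move=> h0 C0 r0 bf; pose P : 'M[R]_(m + n, m) := col_mx 1%:M 0.
have lP j : ~~ @rvars m n j -> exists k, j = lshift n k.
  by case: (split_ordP j) => k ->; [exists k|rewrite rvars_rshift].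
rewrite -[X in WB _ _ _ _ X]mul1r.
have -> : (fun Z : 'rV[R]_(m + n) => f (lsubmx Z)) = fun Z => f (Z *m P).
  by apply/funext => Z; rewrite lsubE.
have -> : (fun Z : 'rV[R]_(m + n) => rho (lsubmx Z)) = fun Z => rho (Z *m P).
  by apply/funext => Z; rewrite lsubE.
apply: (WB_mulmx (L := P) (K := P^T) (J' := xpredT) _ _ _ _ _ h0 C0 r0 bf) => //.
- move=> j; case: (split_ordP j) => k ->; last first.
    by rewrite big1 // => i _; rewrite col_mxEd mxE normr0.
  by under eq_bigr do rewrite col_mxEu; rewrite sum_scalar_norm normr1.
- move=> j /lP[k ->].
  by under eq_bigr do rewrite mxE col_mxEu; rewrite sum_scalar_norm normr1.
- move=> j x /lP[k ->]; rewrite lsubE.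
  under eq_bigr do rewrite mxE col_mxEu.
  have := sum_scalar_mul 1 (fun i => lsubmx x 0 i) k; rewrite mul1r [in RHS]mxE => <-.
  by apply: eq_bigr => i _; rewrite !mxE eq_sym.
Qed.

Definition tensor m n (g : 'rV[R]_m -> R[i]) (f : 'rV[R]_n -> R[i]) : 'rV[R]_(m + n) -> R[i] :=
  (fun Z => g (lsubmx Z)) * (fun Z => f (rsubmx Z)).

Lemma WB_tensor m n (g : 'rV[R]_m -> R[i]) (f : 'rV[R]_n -> R[i]) Cg Cf h :
  0 <= h -> 0 <= Cg -> 0 <= Cf -> WB xpredT s (fun=> 1) Cg h g -> WB xpredT s (fun=> 1) Cf h f ->
  WB xpredT s (fun=> 1) (Cg * Cf) (2 * h) (tensor g f).
Proof.
move=> h0 Cg0 Cf0 HCg HCf.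
have bg := WB_lsub n h0 Cg0 (fun=> ler01) HCg.
have bf := WB_rsub m h0 Cf0 (fun=> ler01) HCf.
have := WB_mul (J := xpredT) (ltW s0) h0 Cg0 Cf0 (fun=> ler01) (fun=> ler01) _ bg bf.
have -> : (fun _ : 'rV[R]_(m + n) => 1 * 1 : R) = fun=> 1 by apply/funext => ?; rewrite mulr1.
by apply => j _; exact: orNb.
Qed.

Lemma SWB_tensor m n (g : 'rV[R]_m -> R[i]) (f : 'rV[R]_n -> R[i]) : SWB s g -> SWB s f ->
  SWB s (tensor g f).
Proof.
move=> Hg Hf h h0; have h20 : 0 < h / 2 by exact: divr_gt0.
have [Cg Cg0 HCg] := Hg _ h20; have [Cf Cf0 HCf] := Hf _ h20.
exists (Cg * Cf); first exact: mulr_ge0.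
have := WB_tensor (ltW h20) Cg0 Cf0 HCg HCf.
by have -> : 2 * (h / 2) = h by rewrite mulrC divfK.
Qed.

Lemma SWB_WB_FT m n (Psi : 'rV[R]_(m + n) -> R[i]) : SWB s Psi ->
  Gd xpredT Psi /\ SWB s (FT Psi).
Proof.
move=> HP.
have b1 : LBd (fun _ : 'rV[R]_m => 1 : R) by move=> x; exists 1 => //; exists 1.
split.
  have [C C0 HC] := HP 1 ltr01.
  exact: (WB_Gd (J := xpredT) (fun=> isT) (ltW s0) ler01 C0 (fun=> ler01) b1 HC).
move=> h h0; have S0 : 0 < 2 `^ s :> R by exact: powR_gt0.
have hS0 : 0 < h / 2 `^ s by exact: divr_gt0.
have [C C0 HC] := HP _ hS0.
exists (2 * Dn R n * (ddK s (h / 2 `^ s) n * C)).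
  have k0 : 0 <= ddK s (h / 2 `^ s) n by apply: ddK_ge0; exact: ltW.
  by apply: mulr_ge0; [apply: mulr_ge0 => //; exact: Dn_ge0|exact: mulr_ge0].
have := WB_FT (J := xpredT) (fun=> isT) (ltW s0) (ltW hS0) C0 (fun=> ler01) b1 HC.
by have -> : 2 `^ s * (h / 2 `^ s) = h by rewrite mulrC divfK // gt_eqF.
Qed.

End linear_change.

(** * From the distribution kernel to the iterated integral *)

Section Op_integral.
Variables (R : realType) (d : nat) (s : R) (A : 'M[R]_d) (a : 'rV[R]_(d + d) -> R[i]).
Hypothesis s0 : 0 < s.
Local Notation normc := (@Normc.normc R).
Local Notation cint := (@integral_rV R _).

Definition symbol_mx : 'M[R]_(d + d + d, d + d) :=
  row_mx (col_mx (col_mx (1%:M - A^T) 0) A^T) (col_mx (col_mx 0 1%:M) 0).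

Lemma symbol_mxE (x xi y : 'rV[R]_d) :
  row_mx (row_mx x xi) y *m symbol_mx = row_mx (x - (x - y) *m A^T) xi.
Proof.
rewrite mul_mx_row !mul_row_col !mulmx0 !mulmx1 add0r !addr0; congr row_mx.
by rewrite mulmxBr mulmx1 mulmxBl opprB addrA addrAC.
Qed.

Lemma det_kernel_mx : `|\det (kernel_mx A)| = 1.
Proof.
have -> : kernel_mx A = block_mx 1%:M 1%:M 0 (- 1%:M) *m block_mx 1%:M 0 (- A^T) 1%:M.
  by rewrite mulmx_block !(mulmx1, mul1mx, mul0mx, mulNmx, mulmxN, mulmx0, opprK, add0r, addr0).
rewrite det_mulmx det_ublock det_lblock !det1 !mul1r mulr1.
by rewrite -scaleN1r detZ det1 mulr1 normrX normrN1 expr1n.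
Qed.

Lemma mul_inv_kernel_mx (u z : 'rV[R]_d) :
  row_mx u z *m invmx (kernel_mx A) = row_mx (u + z *m A^T) (u + z *m A^T - z).
Proof.
have := mul_kernel_mx A (u + z *m A^T) (u + z *m A^T - z).
have e (x y : 'rV[R]_d) : x - (x - y) = y by rewrite opprB addrCA subrr addr0.
rewrite e addrK => h.
by rewrite -h -mulmxA mulmxV ?mulmx1 // kernel_mx_unit.
Qed.

Let b (Z : 'rV[R]_(d + d + d)) := a (Z *m symbol_mx).

Variable q : R.
Hypothesis q0 : 0 <= q.
Hypothesis Hb : forall h, 0 < h -> exists2 C, 0 <= C &
  WB pred0 s (fun Z => expR (q * wt xpredT s Z)) C h b.
Hypothesis sa : smooth a.
Variables (qa Ca : R).
Hypotheses (qa0 : 0 <= qa) (Ca0 : 0 <= Ca).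
Hypothesis aB : forall X, normc (a X) <= Ca * expR (qa * wt xpredT s X).

(** The symbol a may grow, but the transform of Psi decays, as Psi satisfies Sigma_s bounds on
    R^(2d); so Fubini can move xi outside. For fixed xi the inverse kernel map takes (u, z) to (u +
    A z, u + A z - z), and a translation in u followed by a reflection in z turns this into (x, y)
    without Jacobian factor. One [pi_factor] comes from the kernel, the other from the inverse
    transform. *)
Lemma Op_kernel f g : SWB s f -> SWB s g ->
  Op A (pairing a) f g =
  pi_factor R d * pi_factor R d * cint (fun xi => cint (ker 1 b f g xi)).
Proof.
move=> Hf Hg; have [sb [Cb Cb0 bB]] := symbol_growth Hb.
pose Psi (X : 'rV[R]_(d + d)) :=
  g (lsubmx (X *m invmx (kernel_mx A))) * f (rsubmx (X *m invmx (kernel_mx A))).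
have KV : invmx (kernel_mx A) *m kernel_mx A = 1%:M by rewrite mulVmx ?kernel_mx_unit.
have HPsi : SWB s Psi := SWB_mulmx KV (SWB_tensor s0 Hg Hf).
have [gP HFT] := SWB_WB_FT s0 HPsi.
have dF : CD (fun X => a X * FT Psi X).
  have [C C0 HC] := SWB_decay s0 (addr_ge0 qa0 ler01) HFT.
  apply: (decay_CD s0 (mulr_ge0 Ca0 C0) (smooth_M sa (SWB_smooth HFT))).
  move=> X; rewrite Normc.normcM; apply: le_trans (ler_pM (normc_ge0 _) (normc_ge0 _) (aB X) (HC X)) _.
  rewrite mulrACA; apply: ler_wpM2l; first exact: mulr_ge0.
  by rewrite -expRD ler_expR mulrDl mul1r opprD addrA subrr add0r.
transitivity (pi_factor R d * (pi_factor R d * cint (fun X => a X * FT Psi X))).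
  rewrite /Op /kernel_dist /pullback det_kernel_mx invr1 mul1r; congr (_ * _).
  by rewrite -(cint_Z _ dF); apply: eq_cint => X; rewrite mulrCA.
rewrite mulrA; congr (_ * _); rewrite (cint_catr dF); apply: eq_cint => xi.
pose k := ker 1 b f g xi.
have dk : CD k by exact: (ker_CD1 s0 sb q0 Cb0 bB).
have dk1 : CD (fun Z => k (Z *m invmx (kernel_mx A))).
  exact: (ker_CD s0 sb q0 Cb0 bB 1 xi KV Hf Hg).
(* The involution (x, z) to (x, x - z), the stage between (u, z) and (x, y). *)
pose E : 'M[R]_(d + d) := block_mx 1%:M 1%:M 0 (- 1%:M).
have EE : E *m E = 1%:M.
  rewrite /E mulmx_block !(mulmx1, mul1mx, mul0mx, mulNmx, mulmxN, mulmx0, opprK, oppr0, add0r, addr0).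
  by rewrite subrr -scalar_mx_block.
have EX (x z : 'rV[R]_d) : row_mx x z *m E = row_mx x (x - z).
  by rewrite mul_row_block !mulmx1 mulmx0 addr0 mulmxN mulmx1.
have dk2 : CD (fun Z => k (Z *m E)) by exact: (ker_CD s0 sb q0 Cb0 bB 1 xi EE Hf Hg).
transitivity (cint (fun u => cint (fun z => k (row_mx u z *m invmx (kernel_mx A))))).
  apply: eq_cint => u.
  have dE := LD_CD (row_mx u xi) (Gd_LD1 (J := xpredT) (fun=> isT) gP).
  rewrite FT_Int -(cint_Z (a (row_mx u xi)) dE); apply: eq_cint => z.
  rewrite /EG projGE /phase !row_mxKl !row_mxKr /Psi /k /ker /b symbol_mxE.
  rewrite mul_inv_kernel_mx !row_mxKl !row_mxKr mul1r.
  have e (x y : 'rV[R]_d) : x - (x - y) = y by rewrite opprB addrCA subrr addr0.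
  rewrite !e addrK.
  by rewrite (dotrVC xi).
rewrite -(cint_cat dk1) (cint_catr dk1).
transitivity (cint (fun z => cint (fun x => k (row_mx x z *m E)))).
  apply: eq_cint => z.
  have dz : CD (fun u => k (row_mx u z *m invmx (kernel_mx A))) by exact: (CD_secl z dk1).
  rewrite -(cint_affine (- (z *m A^T)) (normr1 R) dz); apply: eq_cint => x.
  by rewrite mul_inv_kernel_mx scale1r EX [- _ + x]addrC subrK.
rewrite -(cint_catr dk2) (cint_cat dk2) (cint_cat dk); apply: eq_cint => x.
have dx : CD (fun y => k (row_mx x y)) by exact: (CD_secr x dk).
rewrite -(cint_affine x (normrN1 R) dx); apply: eq_cint => z.
by rewrite EX scaleN1r.
Qed.

End Op_integral.

Section Op_operator.
Variables (R : realType) (d : nat) (s : R) (A : 'M[R]_d) (a : 'rV[R]_(d + d) -> R[i]).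
Hypotheses (s0 : 0 < s) (Ga : Gamma0_infty s a).
Implicit Types f g : 'rV[R]_d -> R[i].

Definition Op_fun f : 'rV[R]_d -> R[i] :=
  op_full 1 (fun Z => a (Z *m symbol_mx A)) (pi_factor R d * pi_factor R d) f.

Definition Op_transpose f : 'rV[R]_d -> R[i] :=
  op_full (- 1) (fun Z => a (Z *m swap_mx R d *m symbol_mx A))
    (pi_factor R d * pi_factor R d) f.

Lemma Op_symbol_bounds : exists2 q, 0 <= q & forall h, 0 < h -> exists2 C, 0 <= C &
  WB pred0 s (fun Z => expR (q * wt xpredT s Z)) C h (fun Z => a (Z *m symbol_mx A)).
Proof. by have [q q0 H] := Gamma0_WB s0 Ga; exact: (symbol_mulmx s0 (symbol_mx A) q0 H). Qed.

Lemma Op_transpose_bounds : exists2 q, 0 <= q & forall h, 0 < h -> exists2 C, 0 <= C &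
  WB pred0 s (fun Z => expR (q * wt xpredT s Z)) C h (fun Z => a (Z *m swap_mx R d *m symbol_mx A)).
Proof. by have [q q0 H] := Op_symbol_bounds; exact: (symbol_mulmx s0 (swap_mx R d) q0 H). Qed.

Lemma Op_funE f g : SWB s f -> SWB s g -> Op A (pairing a) f g = pairing (Op_fun f) g.
Proof.
move=> Hf Hg; have [q q0 Hb] := Op_symbol_bounds.
have [qa qa0 Ha] := Gamma0_WB s0 Ga.
have [Ca Ca0 /WBP[sa H]] := Ha 1 ltr01.
have aB X : Normc.normc (a X) <= Ca * expR (qa * wt xpredT s X).
  by have := H [::] isT X; rewrite /= expr0 fs0 !mulr1.
apply: etrans (Op_kernel s0 q0 Hb sa qa0 Ca0 aB Hf Hg) _; apply: esym.
exact: (pairing_op_full s0 _ q0 (mulr1 1) Hb Hf Hg).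
Qed.

Lemma Op_transposeE f g : SWB s f -> SWB s g ->
  pairing (Op_fun f) g = pairing (Op_transpose g) f.
Proof.
move=> Hf Hg; have [q q0 Hb] := Op_symbol_bounds; have [q' q'0 Hb'] := Op_transpose_bounds.
have n1 : - 1 * - 1 = 1 :> R by rewrite mulrNN mulr1.
apply: etrans (pairing_op_full s0 _ q0 (mulr1 1) Hb Hf Hg) _.
apply: etrans _ (esym (pairing_op_full s0 _ q'0 n1 Hb' Hg Hf)).
have [sb [Cb Cb0 bB]] := symbol_growth Hb.
have E xi := cint_ker_swap s0 1 xi sb q0 Cb0 bB Hf Hg.
by rewrite -(eq_cint E).
Qed.

End Op_operator.

(** * Approximation by finite-rank operators *)

Section scaling.
Variable R : realType.
Local Notation mu := (@lebesgue_tuple R).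

Lemma lebesgue_scale (v e : R) (A : set R) : 0 < e -> measurable A ->
  (e%:E * lebesgue_measure ((fun y : R => v + e * y)%R @^-1` A) = lebesgue_measure A)%E.
Proof.
move=> e0 mA.
have me : measurable_fun setT (fun y : R => v + e * y : measurableTypeR R).
  by apply: measurable_funD => //; exact: measurable_funM.
rewrite -{1}(gtr0_norm e0); apply/esym; apply: (@lebesgue_measure_unique R
  (mscale (`|e|)%:nng (pushforward lebesgue_measure (fun y : R => v + e * y : measurableTypeR R)))) => //.
move=> _ [[a b]] _ <-; rewrite /mscale /pushforward /=.
rewrite [X in _ = (_ * lebesgue_measure X)%E](_ : _ = `](a - v) / e, (b - v) / e]%classic); last first.
  apply/seteqP; split=> y /=; rewrite !in_itv /= ltr_pdivrMr // ler_pdivlMr //;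
    by rewrite ltrBlDl lerBrDl (mulrC y).
rewrite !lebesgue_measure_itv /= !lte_fin ltr_pM2r ?invr_gt0 // ltrD2r.
case: ifP => _; last by rewrite mule0.
rewrite -!EFinB -EFinM gtr0_norm // -mulrBl mulrC divfK ?gt_eqF //.
by rewrite opprB addrA subrK.
Qed.

Lemma lebesgue_tuple_scale n (v : 'I_n -> R) (e : R) (A : set (n.-tuple R)) :
  0 < e -> measurable A -> ((e ^+ n)%:E * mu n (affine_tuple v e @^-1` A) = mu n A)%E.
Proof.
move=> e0; elim: n v A => [|n IH] v A mA.
  have -> : affine_tuple v e = id by apply/funext => t; rewrite [LHS]tuple0 [RHS]tuple0.
  by rewrite preimage_id expr0 mul1e.
have mc := @measurable_tuple_cons R n.
have mcA : measurable (@tuple_cons R n @^-1` A) by rewrite -[X in measurable X]setTI; exact: mc.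
pose tau (p : measurableTypeR R * n.-tuple R) : measurableTypeR R * n.-tuple R :=
  (v ord0 + e * p.1, affine_tuple (fun i => v (lift ord0 i)) e p.2).
have m1 : measurable_fun setT (fun p : R * n.-tuple R => v ord0 + e * p.1).
  apply: (@measurableT_comp _ _ _ _ _ _ (fun y : R => v ord0 + e * y)).
    by apply: measurable_funD => //; exact: measurable_funM.
  exact: measurable_fst.
have mtau : measurable_fun setT tau.
  apply/measurable_fun_pairP; split; first exact: m1.
  apply: (@measurableT_comp _ _ _ _ _ _ (affine_tuple (fun i => v (lift ord0 i)) e)).
    exact: measurable_affine_tuple.
  exact: measurable_snd.
have Ep p : affine_tuple v e (tuple_cons p) = tuple_cons (tau p).
  apply: eq_from_tnth => i; rewrite tnth_mktuple.
  case: (unliftP ord0 i) => [j ->|->]; first by rewrite !tnthS tnth_mktuple.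
  by rewrite !tnth0.
have E : @tuple_cons R n @^-1` (affine_tuple v e @^-1` A) = tau @^-1` (@tuple_cons R n @^-1` A).
  by apply/seteqP; split=> p; rewrite /preimage /mkset Ep.
rewrite /= /lebesgue_cons /pushforward E -{1}(gtr0_norm e0) -normrX.
apply: esym; apply: (@product_measure_unique _ _ _ _ R lebesgue_measure (mu n)
  (mscale (`|e ^+ n.+1|)%:nng (pushforward (lebesgue_measure \x mu n)%E tau)) _ _ mcA) => // B C mB mC.
pose B' := (fun y => v ord0 + e * y) @^-1` B.
pose C' := affine_tuple (fun i => v (lift ord0 i)) e @^-1` C.
change ((`|e ^+ n.+1|)%:E * (lebesgue_measure \x mu n)%E (B' `*` C') = (lebesgue_measure B * mu n C)%E)%E.
have mf : measurable_fun setT (fun y : R => v ord0 + e * y).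
  by apply: measurable_funD => //; exact: measurable_funM.
have mB' : measurable B' by rewrite -[X in measurable X]setTI; exact: mf.
have mC' : measurable C'.
  by rewrite -[X in measurable X]setTI /C'; exact: measurable_affine_tuple.
rewrite (product_measure1E lebesgue_measure (mu n) mB' mC').
rewrite -(lebesgue_scale (v ord0) e0 mB) -(IH (fun i => v (lift ord0 i)) C mC).
by rewrite normrX gtr0_norm // exprS EFinM muleACA.
Qed.

(** The change of variables is first shown for nonnegative functions and then applied to the
    positive and negative parts. *)
Lemma rint_scale n (v : 'rV[R]_n) (e : R) (u : 'rV[R]_n -> R) : 0 < e -> RD u ->
  e ^+ n * rint (fun x : 'rV[R]_n => u (v + e *: x)) = rint u.
Proof.
move=> e0 du; have iu := RD_intg du; have [cu _] := du.
pose tau := @affine_tuple R n (fun i => v 0 i) e.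
have mtau : measurable_fun setT tau by exact: measurable_affine_tuple.
have rowtau t : row_of (tau t) = v + e *: row_of t.
  by apply/rowP => i; rewrite !mxE tnth_mktuple.
pose U := EFin \o (u \o @row_of R n).
have mU : measurable_fun setT U.
  by apply/measurable_EFinP; exact: continuous_row_measurable.
pose k := e ^+ n; have k0 : 0 < k by rewrite exprn_gt0.
pose kn := NngNum (ltW k0).
have eqm (g : n.-tuple R -> \bar R) : measurable_fun setT g -> (forall t, 0 <= g t)%E ->
    (\int[mu n]_t g t = k%:E * \int[mu n]_t g (tau t))%E.
  move=> mg g0; have E1 : (\int[mu n]_t g t = \int[mscale kn (pushforward (mu n) tau)]_t g t)%E.
    move=> mt; apply: eq_measure_integral => A mA _.
    exact: (esym (lebesgue_tuple_scale (fun i => v 0 i) e0 mA)).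
  rewrite (E1 mtau) ge0_integral_mscale //=.
  by rewrite ge0_integral_pushforward ?preimage_setT.
have p1 := integrable_pos_fin_num measurableT iu.
have p2 := integrable_neg_fin_num measurableT iu.
have pc (V : n.-tuple R -> \bar R) : ((V \o tau)^\+ = V^\+ \o tau)%E by rewrite funepos_comp.
have nc (V : n.-tuple R -> \bar R) : ((V \o tau)^\- = V^\- \o tau)%E by rewrite funeneg_comp.
have e1 : (\int[mu n]_t U^\+ t = k%:E * \int[mu n]_t (U \o tau)^\+ t)%E.
  apply: etrans (eqm (U^\+)%E _ (funepos_ge0 U)) _; first exact: measurable_funepos.
  by rewrite (pc U).
have e2 : (\int[mu n]_t U^\- t = k%:E * \int[mu n]_t (U \o tau)^\- t)%E.
  apply: etrans (eqm (U^\-)%E _ (funeneg_ge0 U)) _; first exact: measurable_funeneg.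
  by rewrite (nc U).
have fin (I : \bar R) : (k%:E * I)%E \is a fin_num -> I \is a fin_num.
  by case: I => [r| |] //; rewrite ?gt0_muley ?gt0_muleNy ?lte_fin.
have f1 := fin _ (etrans (congr1 _ (esym e1)) p1).
have f2 := fin _ (etrans (congr1 _ (esym e2)) p2).
have -> : rint (fun x : 'rV[R]_n => u (v + e *: x)) = fine (\int[mu n]_t (U \o tau) t)%E.
  by rewrite /rint /Rintegral; congr fine; apply: eq_integral => t _; rewrite -rowtau.
have -> : rint u = fine (\int[mu n]_t U t)%E by [].
rewrite [X in _ = fine X]integralE [X in _ * fine X]integralE e1 e2.
move: f1 f2; move: (\int[mu n]_t (U \o tau)^\+ t)%E (\int[mu n]_t (U \o tau)^\- t)%E.
by move=> [p| |] [q| |] //= _ _; rewrite -/k mulrBr.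
Qed.

Lemma cint_scale n (v : 'rV[R]_n) (e : R) (f : 'rV[R]_n -> R[i]) : 0 < e -> CD f ->
  (e ^+ n)%:C%C * integral_rV (fun x : 'rV[R]_n => f (v + e *: x)) = integral_rV f.
Proof.
move=> e0 /CD_RD[f1 f2]; rewrite !cintE -(rint_scale v e0 f1) -(rint_scale v e0 f2).
apply/eqP; rewrite eq_complex /= !mul0r subr0 addr0; apply/andP; split; apply/eqP; congr (_ * _).
Qed.

End scaling.

(** * Small perturbations of linear substitutions *)

Section perturbation.
Variables (R : realType) (s : R) (n m : nat).
Variables (L0 B : 'M[R]_(n, m)) (K0 B' : 'M[R]_(m, n)).
Local Notation normc := (@Normc.normc R).
Implicit Types (Psi : 'rV[R]_m -> R[i]) (mu : R).

Let L mu := L0 + mu *: B.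
Let K mu := K0 + mu *: B'.

Hypothesis LK : forall mu, `|mu| <= 1 -> L mu *m K mu = 1%:M.

(** For |mu| <= 1 this is at least the size of both [L mu] and [K mu], and it is at least 1. *)
Definition pert_size : R := mx_size L0 + mx_size B + mx_size K0 + mx_size B' + 1.
Local Notation Lam := pert_size.

Let sz0 := @mx_size_ge0 R.

Let Lam_ge1 : 1 <= Lam.
Proof. by rewrite lerDr !addr_ge0. Qed.

Let Lam_ge0 : 0 <= Lam. Proof. exact: le_trans ler01 Lam_ge1. Qed.

Let mx_size_pert p q (X Y : 'M[R]_(p, q)) mu : `|mu| <= 1 ->
  mx_size (X + mu *: Y) <= mx_size X + mx_size Y.
Proof.
move=> m1; rewrite /mx_size -big_split /=; apply: ler_sum => j _.
rewrite -big_split /=; apply: ler_sum => i _; rewrite !mxE.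
apply: le_trans (ler_normD _ _) _; rewrite lerD2l normrM.
by apply: ler_piMl.
Qed.

Let mx_size_L mu : `|mu| <= 1 -> mx_size (L mu) <= Lam.
Proof.
move=> m1; apply: le_trans (mx_size_pert L0 B m1) _.
have := sz0 K0; have := sz0 B'; rewrite /pert_size; lra.
Qed.

Let mx_size_K mu : `|mu| <= 1 -> mx_size (K mu) <= Lam.
Proof.
move=> m1; apply: le_trans (mx_size_pert K0 B' m1) _.
have := sz0 L0; have := sz0 B; rewrite /pert_size; lra.
Qed.

Let coordK mu j (x : 'rV[R]_n) : `|mu| <= 1 -> x 0 j = \sum_i K mu i j * (x *m L mu) 0 i.
Proof.
move=> m1; rewrite -[in LHS](mulmx1 x) -(LK m1) mulmxA [LHS]mxE.
by apply: eq_bigr => i _; exact: mulrC.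
Qed.

Lemma BW_pert mu Psi C h p w x : `|mu| <= 1 -> 0 <= h -> 0 <= C ->
  BW xpredT s (fun=> 1) C h p Psi ->
  normc (acts w (fun x => Psi (x *m L mu)) x) <=
  C * (Lam ^+ size w * (h ^+ (size w + p) * fs s (size w + p))).
Proof.
move=> m1 h0 C0 bP.
have LL j : \sum_i `|L mu j i| <= Lam := le_trans (row_le_mx_size _ j) (mx_size_L m1).
have KK j : \sum_i `|K mu i j| <= Lam := le_trans (col_le_mx_size _ j) (mx_size_K m1).
have := @BW_mulmx R n m (L mu) (K mu) xpredT xpredT Lam Lam_ge0 LL (fun j _ => KK j)
  (fun _ _ _ _ => isT) (fun j x _ => coordK j x m1) s (fun=> 1) C h h0 C0 (fun=> ler01) w Psi p bP.
move=> /(_ _ x); rewrite mulr1; apply; by apply/allP; case.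
Qed.

Lemma WB_pert mu Psi C h : `|mu| <= 1 -> 0 <= h -> 0 <= C ->
  WB xpredT s (fun=> 1) C h Psi -> WB xpredT s (fun=> 1) C (Lam * h) (fun x => Psi (x *m L mu)).
Proof.
move=> m1 h0 C0 bP; apply/WBP; split; first by apply: smooth_mulmx; case: bP.
move=> w _ x; have := BW_pert w x m1 h0 C0 bP.
by rewrite addn0 mulr1 exprMn !mulrA.
Qed.

Definition pert_diff mu Psi : 'rV[R]_n -> R[i] :=
  (fun x => Psi (x *m L mu)) + (fun=> -1) * (fun x => Psi (x *m L0)).

Lemma smooth_pert_diff mu Psi : smooth Psi -> smooth (pert_diff mu Psi).
Proof.
move=> sP; apply: smooth_D; first exact: smooth_mulmx.
by apply: smooth_M; [exact: smooth_cst|exact: smooth_mulmx].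
Qed.

Let L_0 : L 0 = L0. Proof. by rewrite /L scale0r addr0. Qed.
Let K_0 : K 0 = K0. Proof. by rewrite /K scale0r addr0. Qed.

(** A letter acts on the perturbed term with coefficients c0 + mu c1 and on the unperturbed one with
    c0: the c0 part is again a difference of the same kind, the rest carries a factor mu. *)
Lemma pert_diff_act mu Psi l : `|mu| <= 1 -> smooth Psi -> exists (c0 c1 : 'I_m -> R) (g : 'I_m -> letter m),
  [/\ \sum_i `|c0 i| <= Lam, \sum_i `|c1 i| <= Lam &
   act l (pert_diff mu Psi) =
   \sum_i ((fun=> (c0 i)%:C%C) * pert_diff mu (act (g i) Psi) +
           (fun=> (mu * c1 i)%:C%C) * (fun x => act (g i) Psi (x *m L mu)))].
Proof.
move=> m1 sP.
have sL nu : smooth (fun x => Psi (x *m L nu)) by exact: smooth_mulmx.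
have sL0 : smooth (fun x => Psi (x *m L0)) by exact: smooth_mulmx.
have E1 : act l (pert_diff mu Psi) = act l (fun x => Psi (x *m L mu)) +
    (fun=> -1) * act l (fun x => Psi (x *m L0)).
  rewrite /pert_diff (act_D l (sL mu) (smooth_M (smooth_cst _ (-1)) sL0)).
  by rewrite (act_Z l (-1) sL0).
have step (c0 c1 : 'I_m -> R) (g : 'I_m -> letter m) :
    act l (fun x => Psi (x *m L mu)) =
      \sum_i (fun=> (c0 i + mu * c1 i)%:C%C) * (fun x => act (g i) Psi (x *m L mu)) ->
    act l (fun x => Psi (x *m L0)) =
      \sum_i (fun=> (c0 i)%:C%C) * (fun x => act (g i) Psi (x *m L0)) ->
   act l (pert_diff mu Psi) =
   \sum_i ((fun=> (c0 i)%:C%C) * pert_diff mu (act (g i) Psi) +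
           (fun=> (mu * c1 i)%:C%C) * (fun x => act (g i) Psi (x *m L mu))).
  rewrite E1 => -> ->; rewrite mulr_sumr -big_split; apply: eq_bigr => i _.
  apply/funext => x; rewrite rmorphD /=.
  transitivity (((c0 i)%:C%C + (mu * c1 i)%:C%C) * act (g i) Psi (x *m L mu) +
    -1 * ((c0 i)%:C%C * act (g i) Psi (x *m L0))); first by [].
  transitivity ((c0 i)%:C%C * (act (g i) Psi (x *m L mu) + -1 * act (g i) Psi (x *m L0)) +
    (mu * c1 i)%:C%C * act (g i) Psi (x *m L mu)); last by [].
  ring.
case: l E1 step => j E1 step.
  exists (fun i => L0 j i), (fun i => B j i), (fun i => inl i); split.
  - by apply: le_trans (row_le_mx_size _ j) _; have := sz0 B; have := sz0 K0;
      have := sz0 B'; rewrite /pert_size; lra.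
  - by apply: le_trans (row_le_mx_size _ j) _; have := sz0 L0; have := sz0 K0;
      have := sz0 B'; rewrite /pert_size; lra.
  apply: step; rewrite /act cD_mulmx //; apply: eq_bigr => i _.
  by rewrite !mxE.
have cK nu : `|nu| <= 1 -> cX j (fun x => Psi (x *m L nu)) =
    \sum_i (fun=> (K nu i j)%:C%C) * (fun x => cX i Psi (x *m L nu)).
  move=> n1; apply/funext => x; rewrite fct_sumE /cX (coordK j x n1) rmorph_sum mulr_suml.
  by apply: eq_bigr => i _; rewrite rmorphM -mulrA.
exists (fun i => K0 i j), (fun i => B' i j), (fun i => inr i); split.
- by apply: le_trans (col_le_mx_size _ j) _; have := sz0 B; have := sz0 L0;
    have := sz0 B'; rewrite /pert_size; lra.
- by apply: le_trans (col_le_mx_size _ j) _; have := sz0 L0; have := sz0 K0;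
    have := sz0 B; rewrite /pert_size; lra.
apply: step; first by rewrite /act (cK mu m1); apply: eq_bigr => i _; rewrite !mxE.
have := cK 0; rewrite normr0 L_0 K_0; apply; exact: ler01.
Qed.

Let mx_size_mul p q r (X : 'M[R]_(p, q)) (Y : 'M[R]_(q, r)) :
  mx_size (X *m Y) <= mx_size X * mx_size Y.
Proof.
rewrite /mx_size mulr_suml; apply: ler_sum => j _.
apply: (@le_trans _ _ (\sum_i \sum_l `|X j l| * `|Y l i|)).
  apply: ler_sum => i _; rewrite mxE; apply: le_trans (ler_norm_sum _ _ _) _.
  by apply: ler_sum => l _; rewrite normrM.
rewrite exchange_big mulr_suml /=; apply: ler_sum => l _.
rewrite -mulr_sumr; apply: ler_wpM2l => //; exact: (row_le_mx_size Y l).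
Qed.

(** Mean value theorem along nu -> x L(nu). The derivative in the direction x B carries a factor
    linear in x, but x = y K(c) at the point y = x L(c). So the growth consists of coordinates of y,
    and each y_l d_i Psi(y) is a word of length two. *)
Let pert_line mu Psi C h p x (u : 'rV[R]_m -> R) : `|mu| <= 1 -> 0 <= h -> 0 <= C ->
  BW xpredT s (fun=> 1) C h p Psi -> smooth_real u ->
  (forall i y, `|'D_(basis_rV R i) u y| <= normc (cD i Psi y)) ->
  `|u (x *m L mu) - u (x *m L0)| <= `|mu| * (Lam * Lam * (C * (h ^+ (2 + p) * fs s (2 + p)))).
Proof.
move=> m1 h0 C0 [sP bP] su uP; pose v := x *m B.
have LE nu : x *m L nu = x *m L0 + nu *: v by rewrite /L mulmxDr -scalemxAr.
have dv y : is_derive y v u (\sum_j v 0 j * 'D_(basis_rV R j) u y).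
  exact: smooth_real_dir.
have [c cm] := @mvt_line R m u (x *m L0) v mu (fun t => @ex_derive _ _ _ _ _ _ _ (dv _)).
rewrite -!LE => ->; rewrite normrM; apply: ler_wpM2l => //.
have c1 : `|c| <= 1 by exact: le_trans m1.
rewrite (@derive_val _ _ _ _ _ _ _ (dv _)); set y := x *m L c.
have vE : v = y *m (K c *m B) by rewrite /y mulmxA -(mulmxA x) LK // mulmx1.
set W := K c *m B in vE; set Q := C * _.
have Q0 : 0 <= Q by rewrite mulr_ge0 // mulr_ge0 ?exprn_ge0 ?fs_ge0.
apply: le_trans (ler_norm_sum _ _ _) _.
apply: (@le_trans _ _ (\sum_i \sum_l `|W l i| * Q)).
  apply: ler_sum => i _; rewrite normrM {1}vE mxE.
  apply: le_trans (ler_wpM2r _ (ler_norm_sum _ _ _)) _ => //.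
  rewrite mulr_suml; apply: ler_sum => l _; rewrite normrM mulrAC mulrC.
  apply: ler_wpM2l => //; apply: le_trans (ler_wpM2l _ (uP i y)) _ => //.
  have := bP [:: inr l; inl i] isT y.
  have E : acts [:: inr l; inl i] Psi y = (y 0 l)%:C%C * cD i Psi y by [].
  by rewrite E Normc.normcM normcR mulr1.
rewrite exchange_big /=; under eq_bigr do rewrite -mulr_suml.
rewrite -mulr_suml; apply: ler_wpM2r => //.
apply: le_trans (mx_size_mul _ _) _; apply: ler_pM => //; first exact: mx_size_K.
by have := sz0 L0; have := sz0 K0; have := sz0 B'; rewrite /pert_size; lra.
Qed.

Lemma pert_word h k : 0 <= h -> forall p, exists2 c, 0 <= c &
  forall w Psi C mu x, size w = k -> `|mu| <= 1 -> 0 <= C ->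
  BW xpredT s (fun=> 1) C h p Psi -> normc (acts w (pert_diff mu Psi) x) <= `|mu| * (c * C).
Proof.
move=> h0; have H0 j : 0 <= h ^+ j * fs s j by rewrite mulr_ge0 ?exprn_ge0 ?fs_ge0.
elim: k => [|k IH] p.
  exists (2 * (Lam * Lam * (h ^+ (2 + p) * fs s (2 + p)))).
    by apply: mulr_ge0 => //; apply: mulr_ge0 => //; exact: mulr_ge0.
  move=> w Psi C mu x /size0nil -> m1 C0 bP; have [sP _] := bP.
  have sR : smooth_real (@complex.Re R \o Psi).
    by apply/smooth_realP => k; have /smoothP/(_ k)[] := sP.
  have sI : smooth_real (@complex.Im R \o Psi).
    by apply/smooth_realP => k; have /smoothP/(_ k)[] := sP.
  have hR := pert_line x m1 h0 C0 bP sR (fun i y => normc_Re_le (cD i Psi y)).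
  have hI := pert_line x m1 h0 C0 bP sI (fun i y => normc_Im_le (cD i Psi y)).
  have e : acts [::] (pert_diff mu Psi) x = Psi (x *m L mu) - Psi (x *m L0).
    by rewrite /= /pert_diff !(mulrfctE, addrfctE) mulN1r.
  rewrite e; apply: le_trans (normc_le_ReIm _) _.
  have -> : complex.Re (Psi (x *m L mu) - Psi (x *m L0)) =
      complex.Re (Psi (x *m L mu)) - complex.Re (Psi (x *m L0)) by case: (Psi _) (Psi _) => ? ? [].
  have -> : complex.Im (Psi (x *m L mu) - Psi (x *m L0)) =
      complex.Im (Psi (x *m L mu)) - complex.Im (Psi (x *m L0)) by case: (Psi _) (Psi _) => ? ? [].
  apply: le_trans (lerD hR hI) _; rewrite le_eqVlt; apply/orP; left; apply/eqP; ring.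
have [c c0 Hc] := IH p.+1.
pose Q := Lam ^+ k * (h ^+ (k + p.+1) * fs s (k + p.+1)).
have Q0 : 0 <= Q by rewrite mulr_ge0 ?exprn_ge0.
exists (Lam * c + Lam * Q); first by rewrite addr_ge0 // mulr_ge0.
move=> w; case/lastP: w => [//|w l] Psi C mu x; rewrite size_rcons => -[sw] m1 C0 bP.
have [sP _] := bP; rewrite acts_rcons.
have [a0 [a1 [g [h1 h2 ->]]]] := pert_diff_act l m1 sP.
have sg i : smooth (act (g i) Psi) by exact: smooth_act.
have sd i : smooth (pert_diff mu (act (g i) Psi)) by exact: smooth_pert_diff.
have sl i : smooth (fun x => act (g i) Psi (x *m L mu)) by exact: (smooth_mulmx (L mu) (sg i)).
have sA i : smooth ((fun=> (a0 i)%:C%C) * pert_diff mu (act (g i) Psi)).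
  exact: (smooth_M (smooth_cst _ _) (sd i)).
have sB i : smooth ((fun=> (mu * a1 i)%:C%C) * (fun x => act (g i) Psi (x *m L mu))).
  exact: (smooth_M (smooth_cst _ _) (sl i)).
rewrite (acts_sum w _ (fun i => smooth_D (sA i) (sB i))) fct_sumE.
apply: le_trans (normc_sum _ _ _) _.
apply: (@le_trans _ _ (\sum_i (`|a0 i| * (`|mu| * (c * C)) + `|a1 i| * (`|mu| * (Q * C))))).
  apply: ler_sum => i _; rewrite (acts_D w (sA i) (sB i)) (acts_Z w _ (sd i)) (acts_Z w _ (sl i)).
  have bg : BW xpredT s (fun=> 1) C h p.+1 (act (g i) Psi).
    by apply: BW_act => //; case: (g i).
  rewrite !(mulrfctE, addrfctE); apply: le_trans (ler_normcD _ _) _.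
  rewrite !Normc.normcM !normcR; apply: lerD.
    by apply: ler_wpM2l => //; exact: Hc.
  rewrite normrM -mulrA mulrCA; apply: ler_wpM2l => //; apply: ler_wpM2l => //.
  by have := BW_pert w x m1 h0 C0 bg; rewrite sw -/Q mulrC.
rewrite big_split /= -!mulr_suml.
have E : `|mu| * ((Lam * c + Lam * Q) * C) = Lam * (`|mu| * (c * C)) + Lam * (`|mu| * (Q * C)).
  by ring.
by rewrite E; apply: lerD; apply: ler_wpM2r => //; rewrite mulr_ge0 // mulr_ge0.
Qed.

(** In long words the two terms are bounded separately, and doubling h gains 2^-k at length k. The
    finitely many lengths that remain are small with mu by [pert_word]. *)
Lemma pert_small h eps : 0 < h -> 0 < eps -> exists2 mu0, 0 < mu0 &
  forall mu, `|mu| <= mu0 -> `|mu| <= 1 -> forall Psi C, 0 <= C ->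
  WB xpredT s (fun=> 1) C h Psi -> WB xpredT s (fun=> 1) (eps * C) (2 * (Lam * h)) (pert_diff mu Psi).
Proof.
move=> hp ep; pose h' := 2 * (Lam * h).
have Lam0 : 0 < Lam by exact: lt_le_trans Lam_ge1.
have Lh0 : 0 < Lam * h by exact: mulr_gt0.
have h'0 : 0 < h' by exact: mulr_gt0.
(* From the length n0 on, the gain from doubling h is at least 2 / eps, where 2 counts the terms of
   the difference. *)
have [n0 Hn0] : exists n0, 2 <= eps * 2 ^+ n0.
  exists (Num.truncn (2 / eps)).+1; rewrite -ler_pdivrMl // mulrC.
  apply/ltW; apply: lt_le_trans (truncnS_gt _) _; rewrite -natrX ler_nat.
  exact/ltnW/ltn_expl.
pose c k := projT1 (cid2 (pert_word k (ltW hp) 0)).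
have [c0 Hc] : (forall k, 0 <= c k) /\ forall k w Psi C mu x, size w = k -> `|mu| <= 1 -> 0 <= C ->
    BW xpredT s (fun=> 1) C h 0 Psi -> normc (acts w (pert_diff mu Psi) x) <= `|mu| * (c k * C).
  by split=> k; rewrite /c; case: cid2.
have d0 k : 0 < h' ^+ k * fs s k by rewrite mulr_gt0 ?exprn_gt0 ?fs_gt0.
(* Collects the constants of all lengths below n0; the summand 1 keeps D positive. *)
pose D := 1 + \sum_(k < n0) c k / (h' ^+ k * fs s k).
have D1 : 1 <= D by rewrite lerDl; apply: sumr_ge0 => k _; rewrite divr_ge0 // ltW.
have D0 : 0 < D by exact: lt_le_trans D1.
exists (eps / D) => [|mu mD m1 Psi C C0 bP]; first exact: divr_gt0.
apply/WBP; split; first by apply: smooth_pert_diff; case: bP.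
move=> w _ x; rewrite mulr1 -/h'; have [wn|nw] := ltnP (size w) n0.
  apply: le_trans (Hc _ w Psi C mu x erefl m1 C0 bP) _.
  apply: (@le_trans _ _ (eps / D * (c (size w) * C))).
    by apply: ler_wpM2r => //; exact: mulr_ge0.
  rewrite -!mulrA; apply: ler_wpM2l; first exact: ltW.
  rewrite mulrA [leRHS]mulrC; apply: ler_wpM2r => //.
  rewrite ler_pdivrMl // -ler_pdivrMr //.
  rewrite /D (bigD1 (Ordinal wn)) //= addrCA lerDl addr_ge0 // sumr_ge0 // => k _.
  by rewrite divr_ge0 // ltW.
have sP : smooth Psi by case: bP.
have s1 : smooth (fun x => Psi (x *m L mu)) by exact: smooth_mulmx.
have s2 : smooth (fun x => Psi (x *m L0)) by exact: smooth_mulmx.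
rewrite /pert_diff (acts_D w s1 (smooth_M (smooth_cst _ (-1)) s2)) (acts_Z w (-1) s2).
rewrite !(mulrfctE, addrfctE) mulN1r.
have N1 (z : R[i]) : normc (- z) = normc z by case: z => a b /=; rewrite !sqrrN.
apply: le_trans (ler_normcD _ _) _; rewrite N1.
have b1 := BW_pert w x m1 (ltW hp) C0 bP.
have m0 : `|0 : R| <= 1 by rewrite normr0.
have b2 := BW_pert w x m0 (ltW hp) C0 bP; rewrite L_0 in b2.
apply: le_trans (lerD b1 b2) _; rewrite addn0 /h'.
set k := size w in nw *.
have -> : C * (Lam ^+ k * (h ^+ k * fs s k)) + C * (Lam ^+ k * (h ^+ k * fs s k)) =
    2 * (C * ((Lam * h) ^+ k * fs s k)) by rewrite exprMn; ring.
have -> : eps * C * ((2 * (Lam * h)) ^+ k * fs s k) =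
    (eps * 2 ^+ k) * (C * ((Lam * h) ^+ k * fs s k)) by rewrite (exprMn k 2); ring.
apply: ler_wpM2r.
  by rewrite mulr_ge0 // mulr_ge0 ?fs_ge0 // exprn_ge0 // ltW.
apply: le_trans Hn0 _; apply: ler_wpM2l; first exact: ltW.
by apply: ler_weXn2l => //; exact: ler1n.
Qed.

End perturbation.

(** * Gaussians and Gaussian Taylor remainders *)

Section gaussian.
Variables (R : realType) (n : nat).
Local Notation normc := (@Normc.normc R).
Local Notation e_ j := (basis_rV R j).
Implicit Types (x : 'rV[R]_n) (W Q : 'M[R]_n).

Definition qform W x : R := \sum_j \sum_l W j l * (x 0 j * x 0 l).

Let qformE W : qform W =
  \sum_j \sum_l (fun=> W j l) * ((fun x => x 0 j) * (fun x => x 0 l)).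
Proof.
by apply/funext => x; rewrite fct_sumE; apply: eq_bigr => j _; rewrite fct_sumE.
Qed.

Lemma Ck_qform k W : Ck k (qform W).
Proof.
rewrite qformE; apply: Ck_sum => j; apply: Ck_sum => l.
by apply: CkM; [exact: Ck_cst|apply: CkM; exact: Ck_coord].
Qed.

Lemma is_derive_qform W x k : (forall i j, W i j = W j i) ->
  is_derive x (e_ k) (qform W) (2 * \sum_l W l k * x 0 l).
Proof.
move=> sW; rewrite qformE.
have d j l : is_derive x (e_ k) ((fun=> W j l) * ((fun x => x 0 j) * (fun x => x 0 l)))
    (W j l * (x 0 j * (l == k)%:R + x 0 l * (j == k)%:R)).
  have -> : (fun=> W j l) * ((fun x => x 0 j) * (fun x => x 0 l)) =
      W j l *: ((fun x : 'rV[R]_n => x 0 j) * (fun x => x 0 l)) by [].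
  apply: is_derive_eq.
    by apply: is_deriveZ; apply: is_deriveM; exact: is_derive_coord.
  by rewrite /basis_rV !mxE !eqxx.
have D : is_derive x (e_ k) (\sum_j \sum_l (fun=> W j l) * ((fun x => x 0 j) * (fun x => x 0 l)))
    (\sum_j \sum_l W j l * (x 0 j * (l == k)%:R + x 0 l * (j == k)%:R)).
  by apply: is_derive_sum => j; apply: is_derive_sum => l.
apply: (is_derive_eq D).
transitivity (\sum_j W j k * x 0 j + \sum_l W k l * x 0 l).
  transitivity (\sum_j (\sum_l W j l * (x 0 j * (l == k)%:R) + \sum_l W j l * (x 0 l * (j == k)%:R))).
    by apply: eq_bigr => j _; rewrite -big_split; apply: eq_bigr => l _; rewrite mulrDr.
  rewrite big_split /=; congr (_ + _).
    apply: eq_bigr => j _; rewrite (bigD1 k) //= big1 ?addr0 => [|l /negbTE ->].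
      by rewrite eqxx mulr1.
    by rewrite !mulr0.
  rewrite (bigD1 k) //= [X in _ + X]big1 ?addr0 => [|j /negbTE ->].
    by apply: eq_bigr => l _; rewrite eqxx mulr1.
  by rewrite big1 // => l _; rewrite !mulr0.
rewrite mulrDl !mul1r; congr (_ + _); by apply: eq_bigr => l _; rewrite sW.
Qed.

Definition exq W N x : R[i] := (exp_rem N (qform W x))%:C%C.

Lemma smooth_exq W N : smooth (exq W N).
Proof.
apply/smoothP => k; apply: CkC_real.
have := @Ck_comp1 R n nat (@exp_rem R) (fun=> 1) predn.
move=> /(_ _ k N (qform W) (Ck_qform k W)); apply => i t.
by rewrite mul1r; exact: exp_rem_derive.
Qed.

Lemma cD_real j (u : 'rV[R]_n -> R) x d : is_derive x (e_ j) u d ->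
  cD j (fun y => (u y)%:C%C) x = d%:C%C.
Proof.
move=> du; rewrite /cD.
have -> : @complex.Re R \o (fun y => (u y)%:C%C) = u by [].
have -> : @complex.Im R \o (fun y => (u y)%:C%C) = fun=> 0 by [].
by rewrite derive_val (derive_cst (0 : R)).
Qed.

Lemma cD_exq W N k : (forall i j, W i j = W j i) ->
  cD k (exq W N) = \sum_l (fun=> (2 * W l k)%:C%C) * cX l (exq W N.-1).
Proof.
move=> sW; apply/funext => x.
have dW := is_derive_comp1 (is_derive_qform x k sW) (exp_rem_derive N (qform W x)).
rewrite [LHS](cD_real dW) fct_sumE mulrCA mulr_sumr mulr_sumr rmorph_sum.
apply: eq_bigr => l _; rewrite mulrfctE /cX /exq -!rmorphM; congr (_ %:C%C).
by ring.
Qed.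

(** exp(Q) times the Taylor remainder of order N of exp(W); N = 0 gives exp(Q + W). *)
Definition gaussq Q W N : 'rV[R]_n -> R[i] := exq Q 0 * exq W N.

Lemma smooth_gaussq Q W N : smooth (gaussq Q W N).
Proof. by apply: smooth_M; exact: smooth_exq. Qed.

Lemma cD_gaussq Q W N k : (forall i j, Q i j = Q j i) -> (forall i j, W i j = W j i) ->
  cD k (gaussq Q W N) = \sum_l (fun=> (2 * Q l k)%:C%C) * cX l (gaussq Q W N) +
    \sum_l (fun=> (2 * W l k)%:C%C) * cX l (gaussq Q W N.-1).
Proof.
move=> sQ sW; rewrite /gaussq (cD_M k (smooth_exq Q 0) (smooth_exq W N)) !cD_exq //=.
congr (_ + _); rewrite ?mulr_suml ?mulr_sumr; apply: eq_bigr => l _; apply/funext => x.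
  transitivity ((2 * Q l k)%:C%C * ((x 0 l)%:C%C * exq Q 0 x) * exq W N x); first by [].
  transitivity ((2 * Q l k)%:C%C * ((x 0 l)%:C%C * (exq Q 0 x * exq W N x))); last by [].
  by rewrite !mulrA.
transitivity (exq Q 0 x * ((2 * W l k)%:C%C * ((x 0 l)%:C%C * exq W N.-1 x))); first by [].
transitivity ((2 * W l k)%:C%C * ((x 0 l)%:C%C * (exq Q 0 x * exq W N.-1 x))); last by [].
by rewrite mulrCA (mulrCA (exq Q 0 x)).
Qed.

Section bounds.
Variables (Q W : 'M[R]_n) (lam b : R).
Hypotheses (sQ : forall i j, Q i j = Q j i) (sW : forall i j, W i j = W j i).
Hypotheses (lam1 : 1 <= lam) (b0 : 0 < b).
Hypothesis QW : forall x, qform Q x + lam * `|qform W x| <= - (b * dotrV x x).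

Let dot_ge0 x : 0 <= dotrV x x.
Proof. by apply: sumr_ge0 => j _; rewrite -expr2 sqr_ge0. Qed.

Let gaussq_le N x : normc (gaussq Q W N x) <= lam ^- N * expR (- (b * dotrV x x)).
Proof.
have E : gaussq Q W N x = (exp_rem 0 (qform Q x) * exp_rem N (qform W x))%:C%C by rewrite rmorphM.
rewrite E normcR normrM exp_rem0 ger0_norm ?expR_ge0 //.
apply: le_trans (ler_wpM2l (expR_ge0 _) (exp_rem_le N (qform W x) lam1)) _.
rewrite mulrCA -expRD ler_wpM2l ?ler_expR //.
by rewrite invr_ge0 exprn_ge0 // (le_trans ler01).
Qed.

(** Chosen so that c >= 1 and c^2 >= 1 / (2b), as the squared inequality in [pow_gauss] requires. *)
Let c : R := 1 + (2 * b)^-1.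

Let b20 : 0 < 2 * b. Proof. exact: mulr_gt0. Qed.
Let c1 : 1 <= c. Proof. by rewrite lerDl invr_ge0 ltW. Qed.
Let c0 : 0 <= c. Proof. exact: le_trans ler01 c1. Qed.

Let fs_half k : fs 2^-1 k = Num.sqrt (k`!)%:R :> R.
Proof. by rewrite /fs powR12_sqrt // ler0n. Qed.

(** After squaring, the k-th term of the exponential series at 2 b |x|^2 is compared with the whole
    series. *)
Let pow_gauss k x : enorm x ^+ k * expR (- (b * dotrV x x)) <= c ^+ k * fs 2^-1 k.
Proof.
have e0 : 0 <= enorm x by exact: sqrtr_ge0.
rewrite -ler_sqr ?nnegrE; last 2 first.
- by rewrite mulr_ge0 ?expR_ge0 // exprn_ge0.
- by rewrite mulr_ge0 ?fs_ge0 // exprn_ge0.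
rewrite !exprMn fs_half sqr_sqrtr ?ler0n // -!exprM ![(k * 2)%N]mulnC !exprM.
rewrite /enorm sqr_sqrtr // -expRM_natr.
set D := dotrV x x; have D0 : 0 <= D by exact: dot_ge0.
have := @exp_sum_le R (2 * b * D) k.+1 (mulr_ge0 (ltW b20) D0).
rewrite /exp_sum big_ord_recr /= => h1.
have h2 : (2 * b * D) ^+ k / k`!%:R <= expR (2 * b * D).
  apply: le_trans h1; rewrite lerDr; apply: sumr_ge0 => i _.
  by rewrite divr_ge0 ?exprn_ge0 // mulr_ge0 // ltW.
have -> : expR (- (b * D) * 2) = (expR (2 * b * D))^-1.
  by rewrite -expRN; congr expR; ring.
rewrite ler_pdivrMr ?expR_gt0 // mulrC -mulrA.
have h3 : (2 * b) ^- k <= (c ^+ 2) ^+ k.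
  rewrite -exprVn; apply: lerXn2r; rewrite ?nnegrE ?invr_ge0 ?(ltW b20) ?exprn_ge0 //.
  apply: (@le_trans _ _ c); first by rewrite /c lerDr.
  by rewrite expr2 ler_peMr.
have bk0 : 0 < (2 * b) ^+ k by rewrite exprn_gt0.
move: h2; rewrite exprMn ler_pdivrMr ?ltr0n ?fact_gt0 // -ler_pdivlMl // => /le_trans; apply.
have -> : expR (2 * b * D) = expR (2 * (b * D)) by rewrite mulrA.
move: (expR _) (expR_ge0 (2 * (b * D))) => E E0.
have -> : (2 * b) ^- k * (E * k`!%:R) = E * ((2 * b) ^- k * k`!%:R) by rewrite mulrCA.
apply: ler_wpM2l => //; apply: ler_wpM2r => //.
Qed.

Let coord_enorm x j : `|x 0 j| <= enorm x.
Proof.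
rewrite -sqrtr_sqr /enorm ler_sqrt ?dot_ge0 // /dotrV (bigD1 j) //= expr2 lerDl.
by apply: sumr_ge0 => i _; rewrite -expr2 sqr_ge0.
Qed.

Let prod_enorm (bs : seq 'I_n) x : `|\prod_(j <- bs) x 0 j| <= enorm x ^+ size bs.
Proof.
elim: bs => [|j bs IH]; first by rewrite big_nil normr1.
by rewrite big_cons normrM exprS; apply: ler_pM.
Qed.

(** A derivation multiplies by coordinates, with coefficients from 2Q and 2W, and lowers N by at
    most one. So one h serves for every N, and the constant decays like lam^-N. *)
Lemma gaussq_WB : exists C h, [/\ 0 <= C, 0 < h &
  forall N, WB xpredT 2^-1 (fun=> 1) (C * lam ^- N) h (gaussq Q W N)].
Proof.
have lam0 : 0 < lam by exact: lt_le_trans lam1.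
(* The factor lam in the second summand pays for the passage from N to N - 1. *)
pose q := 2 * mx_size Q + 2 * lam * mx_size W.
have q0 : 0 <= q by rewrite addr_ge0 // mulr_ge0 ?mx_size_ge0 // mulr_ge0 // ltW.
pose rule (i : 'I_n) (N : nat) : seq (R[i] * (seq 'I_n * nat)) :=
  [seq ((2 * Q l i)%:C%C, ([:: l], N)) | l <- index_enum 'I_n] ++
  [seq ((2 * W l i)%:C%C, ([:: l], N.-1)) | l <- index_enum 'I_n].
have q1 : 0 < 1 + q by rewrite ltr_wpDr.
have cp : 0 < c by exact: lt_le_trans c1.
have cq : 0 < (1 + q) * c by rewrite mulr_gt0.
exists 1, ((1 + q) * c); split=> // N; apply/WBP; split; first exact: smooth_gaussq.
move=> w _ x.
have key := @family_word_bound R n nat (gaussq Q W) (fun=> 0%N) (fun N => lam ^- N) rule q 1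
  (fun k => c ^+ k * fs 2^-1 k) (smooth_gaussq Q W).
have l0 k : 0 <= lam ^- k by rewrite invr_ge0 exprn_ge0 // ltW.
have B0 k : 0 <= c ^+ k * fs 2^-1 k by rewrite mulr_ge0 ?fs_ge0 // exprn_ge0.
have := key _ _ _ q0 ler01 l0 B0 _ _ w [::] N x; rewrite /= addn0 !mul1r => H.
rewrite mulr1; apply: le_trans (H _ _ _ _ _) _ => {H}.
- move=> i t; rewrite cD_gaussq // big_cat !big_map /=; congr (_ + _).
- have nr (t : R) : normc (2 * t)%:C%C = 2 * `|t| by rewrite normcR normrM ger0_norm.
  move=> i t; rewrite big_cat !big_map mulrDl; apply: lerD.
    rewrite (eq_bigr (fun l => 2 * `|Q l i| * lam ^- t)); last by move=> l _; rewrite -nr.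
    rewrite -mulr_suml; apply: ler_wpM2r => //.
    rewrite -mulr_sumr; apply: ler_wpM2l => //; exact: col_le_mx_size.
  rewrite (eq_bigr (fun l => 2 * `|W l i| * lam ^- t.-1)); last by move=> l _; rewrite -nr.
  rewrite -mulr_suml.
  have lt1 : lam ^- t.-1 <= lam * lam ^- t.
    case: t => [|t] /=; first by rewrite expr0 invr1 mulr1.
    by rewrite exprS invfM mulrA divff ?gt_eqF // mul1r.
  rewrite -mulr_sumr; apply: le_trans (ler_wpM2l _ lt1) _.
    by rewrite mulr_ge0 // sumr_ge0.
  rewrite mulrA; apply: ler_wpM2r => //; rewrite mulrAC; apply: ler_wpM2l.
    by rewrite mulr_ge0 // ltW.
  exact: col_le_mx_size.
- by move=> i t; rewrite all_cat !all_map; apply/andP; split; apply/allP.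
(* At the exponent 1/2 the commutators are still affordable: sqrt((k+1)(k+2)) >= k+1. *)
- move=> k; rewrite !fsS mulrCA.
  have -> : c ^+ k.+2 * (k.+2%:R `^ 2^-1 * (k.+1%:R `^ 2^-1 * fs 2^-1 k)) =
      c ^+ k.+2 * (k.+2%:R `^ 2^-1 * k.+1%:R `^ 2^-1 * fs 2^-1 k) by rewrite !mulrA.
  apply: ler_pM; rewrite ?exprn_ge0 ?mulr_ge0 ?fs_ge0 //.
    by apply: ler_weXn2l => //; rewrite ltnW.
  apply: ler_wpM2r; first exact: fs_ge0.
  rewrite -{1}[k.+1%:R]sqr_sqrtr ?ler0n // expr2 !powR12_sqrt ?ler0n //.
  by apply: ler_wpM2r; rewrite ?sqrtr_ge0 // ler_sqrt ?ler_nat.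
- move=> bs t y; rewrite acts_Ms Normc.normcM normcR addn0 mul1r.
  apply: le_trans (ler_pM _ _ (prod_enorm bs y) (gaussq_le t y)) _ => //; first exact: normc_ge0.
  by rewrite mulrCA; apply: ler_wpM2l.
by rewrite addn0 exprMn !mulrA.
Qed.

End bounds.

Definition gauss (a : R) x : R[i] := (expR (- (a * dotrV x x)))%:C%C.

Lemma qform_scalar (t : R) x : qform t%:M x = t * dotrV x x.
Proof.
rewrite /qform /dotrV mulr_sumr; apply: eq_bigr => j _.
rewrite (bigD1 j) //= big1 ?addr0 => [|l lj]; first by rewrite mxE eqxx mulr1n.
by rewrite mxE eq_sym (negbTE lj) mulr0n mul0r.
Qed.

(** The case W = 0, N = 0 of [gaussq_WB]. *)
Lemma gauss_WB (a : R) : 0 < a -> exists C h, [/\ 0 <= C, 0 < h &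
  WB xpredT 2^-1 (fun=> 1) C h (gauss a)].
Proof.
move=> a0.
have sc (t : R) i j : (t%:M : 'M[R]_n) i j = (t%:M : 'M[R]_n) j i by rewrite !mxE eq_sym.
have QW x : qform (- a)%:M x + 1 * `|qform 0%:M x| <= - (a * dotrV x x).
  by rewrite !qform_scalar mul0r normr0 mulr0 addr0 mulNr.
have [C [h [C0 h0 H]]] := gaussq_WB (sc (- a)) (sc 0) (lexx 1) a0 QW.
exists C, h; split=> //; have := H 0%N; rewrite expr0 invr1 mulr1.
have -> : gaussq (- a)%:M 0%:M 0 = gauss a; last by [].
apply/funext => x; rewrite /gauss -mulNr -qform_scalar.
transitivity (exq (- a)%:M 0 x * exq 0%:M 0 x); first by [].
by rewrite /exq !exp_rem0 qform_scalar mul0r expR0 mulr1.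
Qed.

Lemma cint_gauss : integral_rV (gauss 1) = (Num.sqrt pi ^+ n)%:C%C.
Proof.
rewrite cintE; congr Complex.
  rewrite rintE.
  have -> : (fun t : n.-tuple R => ((@complex.Re R \o gauss 1) (row_of t))%:E) =
      fun t => (\prod_i gauss_fun (tnth t i))%:E.
    apply/funext => t; congr EFin; rewrite /= mul1r /dotrV -sumrN expR_sum.
    by apply: eq_bigr => i _; rewrite /row_of !mxE.
  rewrite integral_prod_tuple; [|exact: measurable_gauss_fun|exact: gauss_fun_ge0].
  by rewrite integralT_gauss -EFin_expe.
transitivity (rint (fun _ : 'rV[R]_n => 0 : R)); first by apply: eq_rint => x.
by rewrite /rint /Rintegral; under eq_integral do rewrite /=; rewrite integral0.
Qed.

End gaussian.

(** * S_(1/2) and finite-rank kernels *)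

Section gevrey_half.
Variables (R : realType) (s : R).
Hypothesis hs : 2^-1 < s.

Let s0 : 0 < s. Proof. by apply: lt_trans hs; rewrite invr_gt0. Qed.

(** S_(1/2) in terms of words: bounds for one h, which at every exponent s > 1/2 become bounds for
    all h. *)
Definition Shalf n (f : 'rV[R]_n -> R[i]) := exists C h,
  [/\ 0 <= C, 0 < h & WB xpredT 2^-1 (fun=> 1) C h f].

Lemma Shalf_SWB n (f : 'rV[R]_n -> R[i]) : Shalf f -> SWB s f.
Proof.
move=> [C [h [C0 h0 bf]]] h' h'0.
have [K K1 HK] := @WB_half R n xpredT s (fun=> 1) h h' hs h0 h'0.
exists (K * C); first by rewrite mulr_ge0 // (le_trans ler01).
exact: HK.
Qed.

Lemma Shalf_GS n (f : 'rV[R]_n -> R[i]) : Shalf f -> GS 2^-1 f.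
Proof. by move=> [C [h [C0 h0 bf]]]; exact: WB_GS_half bf. Qed.

Lemma Shalf_cX n (f : 'rV[R]_n -> R[i]) j : Shalf f -> Shalf (cX j f).
Proof.
move=> [C [h [C0 h0 bf]]]; pose S : R := 2 `^ 2^-1.
have S0 : 0 < S by rewrite powR_gt0.
have hh : 0 <= 2^-1 :> R by rewrite invr_ge0.
exists (C * (S * h)), (S * h); split; first by rewrite mulr_ge0 // mulr_ge0 // ltW.
  exact: mulr_gt0.
have [sf Hf] := BW_act (l := inr j) isT bf; apply/WBP; split; first exact: sf.
move=> w jw x; apply: le_trans (Hf w jw x) _.
rewrite !mulr1 -mulrA; apply: ler_wpM2l => //.
rewrite addn1 [S * h * _]mulrA -exprS exprMn mulrAC [leRHS]mulrC mulrA.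
have fs1 : fs 2^-1 1 = 1 :> R by rewrite /fs -[X in X `^ _]/(1 : R) powR1.
have := fs_add_le (size w) 1 hh; rewrite addn1 fs1 mulr1 -/S => h1.
rewrite -mulrA; apply: ler_wpM2l; [exact: (exprn_ge0 _ (ltW h0))|exact: h1].
Qed.

Lemma Shalf_D n (f g : 'rV[R]_n -> R[i]) : Shalf f -> Shalf g -> Shalf (f + g).
Proof.
move=> [C [h [C0 h0 bf]]] [C' [h' [C'0 h'0 bg]]].
have hm : 0 < Num.max h h' by rewrite lt_max h0.
exists (C + C'), (Num.max h h'); split=> //; first exact: addr_ge0.
by apply: WB_D; [apply: WB_hle bf|apply: WB_hle bg] => //;
  rewrite ?(ltW h0) ?(ltW h'0) le_max lexx ?orbT.
Qed.

Lemma Shalf_Z n c (f : 'rV[R]_n -> R[i]) : Shalf f -> Shalf ((fun=> c) * f).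
Proof.
move=> [C [h [C0 h0 bf]]]; exists (Normc.normc c * C), h; split=> //.
  by rewrite mulr_ge0 // normc_ge0.
exact: WB_Z.
Qed.

Lemma Shalf_0 n : Shalf (0 : 'rV[R]_n -> R[i]).
Proof.
exists 0, 1; split=> //; apply/WBP; split; first exact: smooth0.
by move=> w _ x; rewrite acts_0 [X in X <= _]Normc.normc0 !mul0r.
Qed.

Lemma Shalf_gauss n (a : R) : 0 < a -> Shalf (@gauss R n a).
Proof. exact: gauss_WB. Qed.

Lemma SWB_Z n c (f : 'rV[R]_n -> R[i]) : SWB s f -> SWB s ((fun=> c) * f).
Proof.
move=> Hf h h0; have [C C0 HC] := Hf h h0; exists (Normc.normc c * C); last exact: WB_Z.
by rewrite mulr_ge0 // normc_ge0.
Qed.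

Section finite_rank_kernels.
Variable d : nat.
Implicit Types (phi psi l : 'rV[R]_d -> R[i]) (k : 'rV[R]_(d + d) -> R[i]).

(** Finite sums of psi(x) l(y) with both factors in S_(1/2), so that the operator and its transpose
    both have values in S_(1/2). *)
Inductive finite_rank : ('rV[R]_(d + d) -> R[i]) -> Prop :=
| finite_rank0 : finite_rank 0
| finite_rankD psi l k : Shalf psi -> Shalf l -> finite_rank k -> finite_rank (tensor psi l + k).

Lemma finite_rank_add k k' : finite_rank k -> finite_rank k' -> finite_rank (k + k').
Proof.
move=> fk fk'; elim: fk => [|psi l k0 sp sl _ IH]; first by rewrite add0r.
by rewrite -addrA; exact: finite_rankD.
Qed.

Lemma finite_rank_tensor psi l : Shalf psi -> Shalf l -> finite_rank (tensor psi l).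
Proof. by move=> sp sl; rewrite -[tensor _ _]addr0; apply: finite_rankD => //; exact: finite_rank0. Qed.

Lemma finite_rank_Z c k : finite_rank k -> finite_rank ((fun=> c) * k).
Proof.
elim=> [|psi l k0 sp sl _ IH]; first by rewrite mulr0; exact: finite_rank0.
rewrite mulrDr; apply: finite_rank_add => //.
have -> : (fun=> c) * tensor psi l = tensor ((fun=> c) * psi) l.
  by apply/funext => Z; apply: mulrA.
by apply: finite_rank_tensor => //; exact: Shalf_Z.
Qed.

Lemma finite_rank_sum I (r : seq I) (F : I -> 'rV[R]_(d + d) -> R[i]) :
  (forall i, finite_rank (F i)) -> finite_rank (\sum_(i <- r) F i).
Proof.
move=> fF; elim: r => [|i r IH]; first by rewrite big_nil; exact: finite_rank0.
by rewrite big_cons; exact: finite_rank_add.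
Qed.

Lemma finite_rank_cX i j k : finite_rank k -> finite_rank (cX (lshift d i) (cX (rshift d j) k)).
Proof.
elim=> [|psi l k0 sp sl _ IH].
  have -> : cX (lshift d i) (cX (rshift d j) 0) = 0 :> ('rV[R]_(d + d) -> R[i]).
    by apply/funext => Z; rewrite /cX !mulr0.
  exact: finite_rank0.
have -> : cX (lshift d i) (cX (rshift d j) (tensor psi l + k0)) =
    tensor (cX i psi) (cX j l) + cX (lshift d i) (cX (rshift d j) k0).
  apply/funext => Z; rewrite /cX.
  transitivity ((Z 0 (lshift d i))%:C%C * ((Z 0 (rshift d j))%:C%C *
    (psi (lsubmx Z) * l (rsubmx Z) + k0 Z))); first by [].
  transitivity (((lsubmx Z) 0 i)%:C%C * psi (lsubmx Z) * (((rsubmx Z) 0 j)%:C%C * l (rsubmx Z)) +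
    (Z 0 (lshift d i))%:C%C * ((Z 0 (rshift d j))%:C%C * k0 Z)); last by [].
  rewrite !mxE; ring.
by apply: finite_rankD => //; exact: Shalf_cX.
Qed.

Lemma finite_rank_SWB k : finite_rank k -> SWB s k.
Proof.
elim=> [|psi l k0 sp sl _ IH]; first exact/Shalf_SWB/Shalf_0.
move=> h h0; have [C C0 HC] := SWB_tensor s0 (Shalf_SWB sp) (Shalf_SWB sl) h0.
have [C' C'0 HC'] := IH h h0.
by exists (C + C'); [exact: addr_ge0|exact: WB_D].
Qed.

Let resx : 'M[R]_(d, d + d) := row_mx 1%:M 0.

Let resxE (x : 'rV[R]_d) : x *m resx = row_mx x 0.
Proof. by rewrite mul_mx_row mulmx1 mulmx0. Qed.

Let resx_inv : resx *m (col_mx 1%:M 0 : 'M[R]_(d + d, d)) = 1%:M.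
Proof. by rewrite mul_row_col mulmx1 mulmx0 addr0. Qed.

Definition Kop k phi : 'rV[R]_d -> R[i] :=
  fun x => integral_rV (fun y => k (row_mx x y) * phi y).

Lemma SWB_bounded_CD n (k psi : 'rV[R]_n -> R[i]) B : SWB s k -> smooth psi ->
  (forall y, Normc.normc (psi y) <= B) -> CD (fun Z => k Z * psi Z).
Proof.
move=> Hk sp pB; have [C C0 HC] := SWB_decay s0 ler01 Hk.
have B0 : 0 <= B := le_trans (normc_ge0 _) (pB 0).
apply: (decay_CD s0 (mulr_ge0 C0 B0) (smooth_M (SWB_smooth Hk) sp)) => Z.
rewrite mulrfctE Normc.normcM mulrAC; apply: ler_pM; rewrite ?normc_ge0 //.
by have := HC Z; rewrite mul1r.
Qed.

Lemma Kop_CD k phi B x : SWB s k -> smooth phi -> (forall y, Normc.normc (phi y) <= B) ->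
  CD (fun y => k (row_mx x y) * phi y).
Proof.
move=> Hk sp pB.
have sr := smooth_mulmx (col_mx 0 1%:M : 'M[R]_(d + d, d)) sp.
have := CD_secr x (SWB_bounded_CD Hk sr (fun Z => pB _)).
by under eq_fun do rewrite rsubE row_mxKr.
Qed.

Lemma WB_bounded n C h (phi : 'rV[R]_n -> R[i]) : WB xpredT s (fun=> 1) C h phi ->
  forall y, Normc.normc (phi y) <= C.
Proof. by move=> /WBP[_ H] y; have := H [::] isT y; rewrite /= expr0 fs0 !mulr1. Qed.

Lemma Kop_add k k' phi C h : SWB s k -> SWB s k' -> WB xpredT s (fun=> 1) C h phi ->
  Kop (k + k') phi = Kop k phi + Kop k' phi.
Proof.
move=> Hk Hk' bp; have [sp _] := bp; have pB := WB_bounded bp; apply/funext => x.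
transitivity (Kop k phi x + Kop k' phi x); last by [].
rewrite /Kop -(cint_D (Kop_CD x Hk sp pB) (Kop_CD x Hk' sp pB)).
by apply: eq_cint => y; rewrite -mulrDl.
Qed.

Lemma Kop_Z c k phi C h : SWB s k -> WB xpredT s (fun=> 1) C h phi ->
  Kop ((fun=> c) * k) phi = (fun=> c) * Kop k phi.
Proof.
move=> Hk bp; have [sp _] := bp; have pB := WB_bounded bp; apply/funext => x.
transitivity (c * Kop k phi x); last by [].
rewrite /Kop -(cint_Z c (Kop_CD x Hk sp pB)).
by apply: eq_cint => y; rewrite mulrA.
Qed.

Lemma Kop_tensor psi l phi C h : Shalf l -> WB xpredT s (fun=> 1) C h phi ->
  Kop (tensor psi l) phi = (fun=> integral_rV (fun y => l y * phi y)) * psi.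
Proof.
move=> sl bp; have [sp _] := bp; have pB := WB_bounded bp; apply/funext => x.
transitivity (integral_rV (fun y => l y * phi y) * psi x); last by [].
have dl := SWB_bounded_CD (Shalf_SWB sl) sp pB.
rewrite mulrC /Kop -(cint_Z _ dl); apply: eq_cint => y.
by rewrite /tensor mulrfctE row_mxKl row_mxKr mulrA.
Qed.

(* Kop k phi (x) is the partial Fourier transform of k(x, y) phi(y) in y at frequency 0. *)
Lemma Kop_WB h : 0 < h -> exists2 h', 0 < h' & exists2 K, 0 <= K &
  forall k phi Ck C, 0 <= Ck -> 0 <= C -> WB xpredT s (fun=> 1) Ck h' k ->
    WB xpredT s (fun=> 1) C h' phi -> WB xpredT s (fun=> 1) (K * Ck * C) h (Kop k phi).
Proof.
move=> h0; pose S : R := 2 `^ s; have S0 : 0 < S by rewrite powR_gt0.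
pose I := inv_size resx (col_mx 1%:M 0 : 'M[R]_(d + d, d)).
have I0 : 0 < I by exact: inv_size_gt0.
pose h' := h / (I * (S * 2)).
have h'0 : 0 < h' by rewrite divr_gt0 // mulr_gt0 // mulr_gt0.
have D0 : 0 <= ddK s (2 * h') d by apply: ddK_ge0; rewrite mulr_ge0 // ltW.
exists h' => //; exists (2 * Dn R d * ddK s (2 * h') d).
  by rewrite mulr_ge0 // mulr_ge0 // Dn_ge0.
move=> k phi Ck C Ck0 C0 bk bp.
have bpr := WB_rsub d (ltW h'0) C0 (fun=> ler01) bp.
have := WB_mul (J := xpredT) (J1 := xpredT) (ltW s0) (ltW h'0) Ck0 C0 (fun=> ler01) (fun=> ler01) (fun _ _ => isT) bk bpr.
have -> : (fun _ : 'rV[R]_(d + d) => 1 * 1 : R) = fun=> 1 by apply/funext => ?; rewrite mulr1.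
move=> bG; have b1 : LBd (fun _ : 'rV[R]_d => 1 : R) by move=> x; exists 1 => //; exists 1.
have h20 : 0 <= 2 * h' by rewrite mulr_ge0 // ltW.
have bF := WB_FT (J := xpredT) (fun=> isT) (ltW s0) h20 (mulr_ge0 Ck0 C0) (fun=> ler01) b1 bG.
have Sh0 : 0 <= S * (2 * h') by rewrite mulr_ge0 // ltW.
have CC0 : 0 <= 2 * Dn R d * (ddK s (2 * h') d * (Ck * C)).
  by apply: mulr_ge0; [rewrite mulr_ge0 // Dn_ge0|rewrite mulr_ge0 // mulr_ge0].
have := WB_inv_mulmx resx_inv Sh0 CC0 bF.
have -> : inv_size resx (col_mx 1%:M 0 : 'M[R]_(d + d, d)) * (S * (2 * h')) = h.
  have -> : inv_size resx (col_mx 1%:M 0 : 'M[R]_(d + d, d)) * (S * (2 * h')) = h' * (I * (S * 2)).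
    by rewrite -/I; ring.
  by rewrite divfK // gt_eqF // mulr_gt0 // mulr_gt0.
rewrite !mulrA; congr (WB _ _ _ _ _ _); apply/funext => x; apply: eq_cint => y.
rewrite resxE row_mxKl row_mxKr mulrfctE row_mxKr.
have -> : dotrV (0 : 'rV[R]_d) y = 0 by rewrite /dotrV big1 // => j _; rewrite mxE mul0r.
have -> : expi (0 : R) = 1 by rewrite /expi cos0 sin0.
by rewrite mulr1.
Qed.

End finite_rank_kernels.
End gevrey_half.

(** * Cutoff, mollification and expansion of the Gaussian kernel *)

Section approximation.
Variables (R : realType) (s : R) (d : nat).
Hypothesis hs : 2^-1 < s.
Local Notation cint := (@integral_rV R _).
Implicit Types (phi : 'rV[R]_d -> R[i]) (k : 'rV[R]_(d + d) -> R[i]).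

Let s0 : 0 < s. Proof. by apply: lt_trans hs; rewrite invr_gt0. Qed.

Lemma WB_N n C h (f : 'rV[R]_n -> R[i]) : WB xpredT s (fun=> 1) C h f ->
  WB xpredT s (fun=> 1) C h ((fun=> -1) * f).
Proof.
move=> bf; have := WB_Z (-1) bf.
have N1 (z : R[i]) : Normc.normc (- z) = Normc.normc z by case: z => a b /=; rewrite !sqrrN.
by rewrite N1 Normc.normc1 mul1r.
Qed.

Definition Mop (nu : R) phi : 'rV[R]_d -> R[i] := fun x => gauss 1 (nu *: x) * phi x.

(** The map x -> (nu x, x) is a small perturbation of x -> (0, x), along which
    [tensor (gauss 1) phi] is phi, as the Gaussian is 1 at 0. The bound on the cutoff itself is
    there because the cutoff is later applied to the mollification error. *)
Lemma Mop_approx h : 0 < h -> exists2 h', 0 < h' & forall eps, 0 < eps -> exists2 nu, 0 < nu &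
  (exists2 K, 0 <= K & forall phi C, 0 <= C -> WB xpredT s (fun=> 1) C h' phi ->
     WB xpredT s (fun=> 1) (K * C) h (Mop nu phi)) /\
  (forall phi C, 0 <= C -> WB xpredT s (fun=> 1) C h' phi ->
     WB xpredT s (fun=> 1) (eps * C) h (Mop nu phi + (fun=> -1) * phi)).
Proof.
move=> h0.
pose L0 : 'M[R]_(d, d + d) := row_mx 0 1%:M; pose B : 'M[R]_(d, d + d) := row_mx 1%:M 0.
pose K0 : 'M[R]_(d + d, d) := col_mx 0 1%:M; pose B' : 'M[R]_(d + d, d) := 0.
have LK (mu : R) : `|mu| <= 1 -> (L0 + mu *: B) *m (K0 + mu *: B') = 1%:M.
  move=> _; rewrite scaler0 addr0 /L0 /B /K0 scale_row_mx add_row_mx mul_row_col.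
  by rewrite mulmx0 add0r scaler0 addr0 mulmx1.
pose Lam := pert_size L0 B K0 B'.
have Lam0 : 0 < Lam by rewrite /Lam /pert_size ltr_wpDl // !addr_ge0 // mx_size_ge0.
pose h' := h / (4 * Lam).
have h'0 : 0 < h' by rewrite divr_gt0 // mulr_gt0.
have h20 : 0 < 2 * h' by rewrite mulr_gt0.
have hE : 2 * (Lam * (2 * h')) = h.
  have -> : 2 * (Lam * (2 * h')) = h' * (4 * Lam) by ring.
  by rewrite divfK // gt_eqF // mulr_gt0.
exists h' => // eps eps0.
have [G G0 HG] := Shalf_SWB hs (@Shalf_gauss R d 1 ltr01) h'0.
have e'0 : 0 < eps / (G + 1) by rewrite divr_gt0 // ltr_wpDl.
have [mu0 mu00 Hmu] := pert_small s LK h20 e'0.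
pose nu := Num.min mu0 1.
have nu0 : 0 < nu by rewrite lt_min mu00 ltr01.
have n1 : `|nu| <= mu0 by rewrite gtr0_norm // ge_min lexx.
have n2 : `|nu| <= 1 by rewrite gtr0_norm // ge_min lexx orbT.
have ME phi x : Mop nu phi x = tensor (gauss 1) phi (x *m (L0 + nu *: B)).
  rewrite /tensor mulrfctE /L0 /B scale_row_mx add_row_mx mul_mx_row row_mxKl row_mxKr.
  by rewrite scaler0 addr0 mulmx1 add0r -scalemxAr mulmx1.
exists nu => //; split.
  exists G => // phi C C0 bp.
  have bt := WB_tensor s0 (ltW h'0) G0 C0 HG bp.
  have GC0 : 0 <= G * C by exact: mulr_ge0.
  have := WB_pert LK n2 (ltW h20) GC0 bt.
  have -> : (fun x => tensor (gauss 1) phi (x *m (L0 + nu *: B))) = Mop nu phi.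
    by apply/funext => x; rewrite ME.
  apply: WB_hle => //; rewrite mulr_ge0 ?(ltW Lam0) ?(ltW h20) //= -hE.
  have X0 : 0 <= Lam * (2 * h') by rewrite mulr_ge0 // ltW.
  by rewrite -/Lam; lra.
move=> phi C C0 bp.
have bt := WB_tensor s0 (ltW h'0) G0 C0 HG bp.
have GC0 : 0 <= G * C by exact: mulr_ge0.
have := Hmu nu n1 n2 _ _ GC0 bt; rewrite hE.
have -> : pert_diff L0 B nu (tensor (gauss 1) phi) = Mop nu phi + (fun=> -1) * phi.
  apply/funext => x; rewrite /pert_diff.
  transitivity (tensor (gauss 1) phi (x *m (L0 + nu *: B)) + -1 * tensor (gauss 1) phi (x *m L0)); first by [].
  transitivity (Mop nu phi x + -1 * phi x); last by [].
  rewrite ME; congr (_ + _ * _).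
  rewrite /tensor mulrfctE /L0 mul_mx_row row_mxKl row_mxKr mulmx0 mulmx1 /gauss.
  have -> : dotrV (0 : 'rV[R]_d) 0 = 0 by rewrite /dotrV big1 // => j _; rewrite mxE mul0r.
  by rewrite mulr0 oppr0 expR0 mul1r.
move=> bd; apply: (BW_le (C := eps / (G + 1) * (G * C))) bd => //.
- exact: ltW.
- rewrite mulrA; apply: ler_wpM2r => //; rewrite mulrAC ler_pdivrMr ?ltr_wpDl //.
  by apply: ler_wpM2l; [exact: ltW|rewrite lerDl].
- by apply: mulr_ge0 => //; exact: ltW.
- by move=> x; rewrite ler01 lexx.
Qed.

(** pi^(-d/2), which gives the Gaussian integral 1. *)
Let cG : R[i] := (Num.sqrt pi ^- d)%:C%C.
Let G := (fun=> cG) * @gauss R d 1.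

Let pi_gt0 : 0 < Num.sqrt pi :> R. Proof. by rewrite sqrtr_gt0 pi_gt0. Qed.

Let G_Shalf : Shalf G. Proof. by apply: Shalf_Z; exact: Shalf_gauss. Qed.

Let Lc (mu : R) : 'M[R]_(d + d) := 1%:M + mu *: block_mx 0 0 (- 1%:M) 0.

Let LcE mu (x z : 'rV[R]_d) : row_mx x z *m Lc mu = row_mx (x - mu *: z) z.
Proof.
rewrite /Lc mulmxDr mulmx1 -scalemxAr mul_row_block !mulmx0 !add0r mulmxN mulmx1.
by rewrite scale_row_mx add_row_mx scalerN scaler0 addr0.
Qed.

(** Convolution with a Gaussian of width mu after the substitution y = x - mu z. In this form mu = 0
    makes sense and gives phi, so that [pert_small] applies. *)
Definition Cop (mu : R) phi : 'rV[R]_d -> R[i] :=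
  fun x => cint (fun z => phi (x - mu *: z) * G z).

Let resx : 'M[R]_(d, d + d) := row_mx 1%:M 0.

Let resx_inv : resx *m (col_mx 1%:M 0 : 'M[R]_(d + d, d)) = 1%:M.
Proof. by rewrite mul_row_col mulmx1 mulmx0 addr0. Qed.

Let CopE mu phi x : FT (fun Z => tensor phi G (Z *m Lc mu)) (x *m resx) = Cop mu phi x.
Proof.
apply: eq_cint => z; rewrite mul_mx_row mulmx1 mulmx0 row_mxKl row_mxKr LcE.
rewrite /tensor mulrfctE row_mxKl row_mxKr.
have -> : dotrV (0 : 'rV[R]_d) z = 0 by rewrite /dotrV big1 // => j _; rewrite mxE mul0r.
have -> : expi (0 : R) = 1 by rewrite /expi cos0 sin0.
by rewrite mulr1.
Qed.

Let G_CD : CD (gauss 1 : 'rV[R]_d -> R[i]).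
Proof.
have Hg := Shalf_SWB hs (@Shalf_gauss R d 1 ltr01).
have [C C0 HC] := SWB_decay s0 ler01 Hg.
apply: (decay_CD s0 C0 (SWB_smooth Hg)) => x.
by have := HC x; rewrite mul1r.
Qed.

Let Cop0 phi x : Cop 0 phi x = phi x.
Proof.
transitivity (cint (fun z : 'rV[R]_d => phi x * cG * gauss 1 z)).
  by apply: eq_cint => z; rewrite scale0r subr0 mulrA.
rewrite (cint_Z _ G_CD) cint_gauss -mulrA -rmorphM mulVf ?mulr1 //.
by rewrite expf_neq0 // gt_eqF.
Qed.

Let pertC (mu : R) : `|mu| <= 1 ->
  ((1%:M : 'M[R]_(d + d)) + mu *: block_mx 0 0 (- 1%:M) 0) *m
  (1%:M + mu *: block_mx 0 0 1%:M 0) = 1%:M.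
Proof.
move=> _; rewrite mulmxDl !mulmxDr !mulmx1 !mul1mx -scalemxAl -scalemxAr mulmx_block.
rewrite !(mulmx0, mul0mx, addr0) -[block_mx 0 0 0 0]/(block_mx 0 0 0 0).
have -> : block_mx 0 0 (- 1%:M) 0 = - block_mx 0 0 1%:M 0 :> 'M[R]_(d + d).
  by rewrite opp_block_mx !oppr0.
by rewrite block_mx0 !scaler0 addr0 scalerN addrK.
Qed.

(** [Cop] is the transform at frequency 0 of a sheared tensor product, and the shear is a small
    perturbation of the identity. *)
Lemma Cop_approx h : 0 < h -> exists2 h', 0 < h' & forall eps, 0 < eps -> exists2 mu, 0 < mu &
  forall phi C, 0 <= C -> WB xpredT s (fun=> 1) C h' phi ->
    WB xpredT s (fun=> 1) (eps * C) h (Cop mu phi + (fun=> -1) * phi).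
Proof.
move=> h0; pose S : R := 2 `^ s; have S0 : 0 < S by rewrite powR_gt0.
pose I := inv_size resx (col_mx 1%:M 0 : 'M[R]_(d + d, d)).
have I0 : 0 < I by exact: inv_size_gt0.
pose Lam := pert_size (1%:M : 'M[R]_(d + d)) (block_mx 0 0 (- 1%:M) 0) 1%:M (block_mx 0 0 1%:M 0).
have Lam0 : 0 < Lam by rewrite /Lam /pert_size ltr_wpDl // !addr_ge0 // mx_size_ge0.
pose h' := h / (I * S * (4 * Lam)).
have h'0 : 0 < h' by rewrite divr_gt0 // !mulr_gt0.
have h20 : 0 < 2 * h' by rewrite mulr_gt0.
pose h3 := 2 * (Lam * (2 * h')).
have h30 : 0 < h3 by rewrite mulr_gt0 // mulr_gt0.
have hE : I * (S * h3) = h.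
  have -> : I * (S * h3) = h' * (I * S * (4 * Lam)) by rewrite /h3; ring.
  by rewrite divfK // gt_eqF // !mulr_gt0.
exists h' => // eps eps0.
have [g g0 Hg] := Shalf_SWB hs G_Shalf h'0.
pose D := 2 * Dn R d * ddK s h3 d.
have D0 : 0 <= D.
  by apply: mulr_ge0; [rewrite mulr_ge0 // Dn_ge0|apply: ddK_ge0; exact: ltW].
have e'0 : 0 < eps / (D * g + 1) by rewrite divr_gt0 // ltr_wpDl // mulr_ge0.
have [mu0 mu00 Hmu] := pert_small s pertC h20 e'0.
pose mu := Num.min mu0 1.
have nu0 : 0 < mu by rewrite lt_min mu00 ltr01.
have n1 : `|mu| <= mu0 by rewrite gtr0_norm // ge_min lexx.
have n2 : `|mu| <= 1 by rewrite gtr0_norm // ge_min lexx orbT.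
exists mu => // phi C C0 bp.
have bt := WB_tensor s0 (ltW h'0) C0 g0 bp Hg.
have gC0 : 0 <= C * g by exact: mulr_ge0.
have b1 : LBd (fun _ : 'rV[R]_d => 1 : R) by move=> x; exists 1 => //; exists 1.
have gd (nu : R) : `|nu| <= 1 -> Gd xpredT (fun Z => tensor phi G (Z *m Lc nu)).
  move=> m1; have bw := WB_pert pertC m1 (ltW h20) gC0 bt.
  have Lh0 : 0 <= Lam * (2 * h') by rewrite mulr_ge0 // ltW.
  exact: (WB_Gd (J := xpredT) (fun=> isT) (ltW s0) Lh0 gC0 (fun=> ler01) b1 bw).
have m0 : `|0 : R| <= 1 by rewrite normr0.
have bd := Hmu mu n1 n2 _ _ gC0 bt.
have ee0 : 0 <= eps / (D * g + 1) * (C * g) by apply: mulr_ge0 => //; exact: ltW.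
have bF := WB_FT (J := xpredT) (fun=> isT) (ltW s0) (ltW h30) ee0 (fun=> ler01) b1 bd.
have De0 : 0 <= 2 * Dn R d * (ddK s h3 d * (eps / (D * g + 1) * (C * g))).
  by rewrite mulrA; exact: mulr_ge0.
have Sh0 : 0 <= S * h3 by rewrite mulr_ge0 // ltW.
have := WB_inv_mulmx resx_inv Sh0 De0 bF; rewrite -/I hE.
have -> : (fun x => FT (pert_diff 1%:M (block_mx 0 0 (- 1%:M) 0) mu (tensor phi G)) (x *m resx)) =
    Cop mu phi + (fun=> -1) * phi.
  have -> : pert_diff 1%:M (block_mx 0 0 (- 1%:M) 0) mu (tensor phi G) =
      (fun=> -1) * (fun Z => tensor phi G (Z *m Lc 0)) + (fun Z => tensor phi G (Z *m Lc mu)).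
    by rewrite addrC /pert_diff /Lc scale0r addr0.
  rewrite (FT_lin (-1) (J := xpredT) (fun=> isT) (gd 0 m0) (gd mu n2)).
  apply/funext => x.
  transitivity (-1 * FT (fun Z => tensor phi G (Z *m Lc 0)) (x *m resx) +
    FT (fun Z => tensor phi G (Z *m Lc mu)) (x *m resx)); first by [].
  by rewrite addrC (CopE 0 phi x) (CopE mu phi x) (Cop0 phi x).
move=> bw; apply: (BW_le _ _ _ _ _ bw) => //.
- exact: ltW.
- rewrite mulrA -/D.
  have -> : D * (eps / (D * g + 1) * (C * g)) = (eps * (D * g) / (D * g + 1)) * C by ring.
  have Dg0 : 0 <= D * g by exact: mulr_ge0.
  have Dg1 : 0 < D * g + 1 by rewrite ltr_wpDl.
  apply: ler_wpM2r => //; rewrite ler_pdivrMr //.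
  by apply: ler_wpM2l; [exact: ltW|rewrite lerDl].
- by move=> x; rewrite ler01 lexx.
Qed.

Section kernel.
Variables (nu mu : R).
Hypotheses (nu0 : 0 < nu) (mu0 : 0 < mu).

Let kap : R := mu ^- 2.
Let del : R := nu ^+ 2.
Let kap0 : 0 < kap. Proof. by rewrite invr_gt0 exprn_gt0. Qed.
Let del0 : 0 < del. Proof. by rewrite exprn_gt0. Qed.

(* exp(- |nu x|^2 - |x - y|^2 / mu^2) = exp(Q) exp(W), where only W couples x and y. *)
Let Q : 'M[R]_(d + d) := block_mx (- (del + kap))%:M 0 0 (- kap)%:M.
Let W : 'M[R]_(d + d) := block_mx 0 kap%:M kap%:M 0.

Let Q_sym i j : Q i j = Q j i.
Proof.
have : Q^T = Q by rewrite /Q tr_block_mx !tr_scalar_mx !trmx0.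
by move=> /matrixP/(_ j i); rewrite mxE.
Qed.

Let W_sym i j : W i j = W j i.
Proof.
have : W^T = W by rewrite /W tr_block_mx !tr_scalar_mx !trmx0.
by move=> /matrixP/(_ j i); rewrite mxE.
Qed.

Let qform_dot (M : 'M[R]_(d + d)) Z : qform M Z = dotrV (Z *m M) Z.
Proof.
rewrite /dotrV /qform exchange_big /=; apply: eq_bigr => l _; rewrite mxE mulr_suml.
by apply: eq_bigr => j _; rewrite mulrCA mulrA.
Qed.

Let dot_row (a b c e : 'rV[R]_d) : dotrV (row_mx a b) (row_mx c e) = dotrV a c + dotrV b e.
Proof.
rewrite /dotrV big_split_ord /=; congr (_ + _); apply: eq_bigr => i _.
  by rewrite !row_mxEl.
by rewrite !row_mxEr.
Qed.

Let qformQ (x y : 'rV[R]_d) : qform Q (row_mx x y) = - (del + kap) * dotrV x x - kap * dotrV y y.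
Proof.
rewrite qform_dot mul_row_block !mulmx0 addr0 add0r !mul_mx_scalar dot_row !dotrVZl.
by rewrite [X in _ + X]mulNr.
Qed.

Let qformW (x y : 'rV[R]_d) : qform W (row_mx x y) = 2 * kap * dotrV x y.
Proof.
rewrite qform_dot mul_row_block !mulmx0 addr0 add0r !mul_mx_scalar dot_row !dotrVZl.
by rewrite (dotrVC y x); ring.
Qed.

Let dot_ge0 (x : 'rV[R]_d) : 0 <= dotrV x x.
Proof. by apply: sumr_ge0 => j _; rewrite -expr2 sqr_ge0. Qed.

(* With y = x - mu z the exponent is - |nu x|^2 - |z|^2. *)
Let gaussq_shift (x z : 'rV[R]_d) :
  gaussq Q W 0 (row_mx x (x - mu *: z)) = gauss 1 (nu *: x) * gauss 1 z.
Proof.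
rewrite /gaussq mulrfctE /exq /gauss -!rmorphM !exp_rem0 -!expRD; congr (expR _)%:C%C.
have dotN (a c : 'rV[R]_d) : dotrV (- a) c = - dotrV a c by rewrite -scaleN1r dotrVZl mulN1r.
have e1 : dotrV x (x - mu *: z) = dotrV x x - mu * dotrV x z.
  by rewrite dotrVC dotrVDl dotN dotrVZl (dotrVC z).
have e3 : dotrV (x - mu *: z) z = dotrV x z - mu * dotrV z z.
  by rewrite dotrVDl dotN dotrVZl.
have e2 : dotrV (x - mu *: z) (x - mu *: z) =
    dotrV x x - mu * dotrV x z - mu * (dotrV x z - mu * dotrV z z).
  by rewrite {1}dotrVDl dotN dotrVZl e1 (dotrVC z) e3.
have e4 : dotrV (nu *: x) (nu *: x) = nu * (nu * dotrV x x).
  by rewrite dotrVZl dotrVC dotrVZl.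
rewrite qformQ qformW e1 e2 e4.
have e : kap * (mu * mu) = 1 by rewrite /kap -expr2 mulVf // gt_eqF // exprn_gt0.
move: (dotrV x x) (dotrV x z) (dotrV z z) => X P Y.
have -> : - (1 * (nu * (nu * X))) + - (1 * Y) = - (1 * (nu * (nu * X))) - (kap * (mu * mu)) * Y.
  by rewrite e !mul1r.
by rewrite /del; ring.
Qed.

(** The substitution y = x - mu z turns the composition into an integral operator with Gaussian
    kernel; the scaling contributes mu^-d. *)
Lemma Mop_Cop_kernel C h phi : WB xpredT s (fun=> 1) C h phi -> SWB s (gaussq Q W 0) ->
  Mop nu (Cop mu phi) = Kop ((fun=> (mu ^- d)%:C%C * cG) * gaussq Q W 0) phi.
Proof.
move=> bp Hk; have [sp _] := bp; have pB := WB_bounded bp.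
rewrite (Kop_Z hs _ Hk bp); apply/funext => x.
transitivity ((mu ^- d)%:C%C * cG * Kop (gaussq Q W 0) phi x); last by [].
have df := Kop_CD hs x Hk sp pB; rewrite /Kop.
have df1 : CD (fun w : 'rV[R]_d => gaussq Q W 0 (row_mx x (x + -1 *: w)) * phi (x + -1 *: w)).
  pose E : 'M[R]_(d + d) := block_mx 1%:M 1%:M 0 (- 1%:M).
  have EE : E *m E = 1%:M.
    rewrite /E mulmx_block !(mulmx1, mul1mx, mul0mx, mulNmx, mulmxN, mulmx0, opprK, oppr0, add0r, addr0).
    by rewrite subrr -scalar_mx_block.
  have EX (w : 'rV[R]_d) : row_mx x w *m E = row_mx x (x + -1 *: w).
    by rewrite mul_row_block !mulmx1 mulmx0 addr0 mulmxN mulmx1 scaleN1r.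
  have sr := smooth_mulmx (E *m (col_mx 0 1%:M : 'M[R]_(d + d, d))) sp.
  have := CD_secr x (SWB_bounded_CD hs (SWB_mulmx EE Hk) sr (fun Z => pB _)).
  by under eq_fun do rewrite mulmxA EX rsubE row_mxKr.
rewrite -(cint_affine x (normrN1 R) df) -(cint_scale 0 mu0 df1).
have dz : CD (fun z : 'rV[R]_d => gauss 1 z * phi (x - mu *: z)).
  have sz : smooth (fun z : 'rV[R]_d => phi (x - mu *: z)).
    have -> : (fun z : 'rV[R]_d => phi (x - mu *: z)) = fun z => phi (z *m (- mu)%:M + x).
      by apply/funext => z; rewrite mul_mx_scalar scaleNr addrC.
    exact: (smooth_mulmx _ (smooth_shift x sp)).
  have [c1 c2] := smooth_continuous sz.
  exact: (CD_M G_CD c1 c2 (fun z => pB _)).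
have -> : cint (fun z : 'rV[R]_d => gaussq Q W 0 (row_mx x (x + -1 *: (0 + mu *: z))) *
    phi (x + -1 *: (0 + mu *: z))) = gauss 1 (nu *: x) * cint (fun z => gauss 1 z * phi (x - mu *: z)).
  rewrite -(cint_Z _ dz); apply: eq_cint => z.
  by rewrite add0r scaleN1r gaussq_shift mulrA.
have -> : Mop nu (Cop mu phi) x = gauss 1 (nu *: x) * (cG * cint (fun z => gauss 1 z * phi (x - mu *: z))).
  rewrite /Mop /Cop -(cint_Z cG dz); congr (_ * _); apply: eq_cint => z.
  by rewrite /G mulrfctE mulrC mulrA.
move: (cint _) (gauss 1 _) => I g.
have e : (mu ^- d)%:C%C * (mu ^+ d)%:C%C = 1 :> R[i].
  by rewrite -rmorphM mulVf // gt_eqF // exprn_gt0.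
transitivity ((mu ^- d)%:C%C * (mu ^+ d)%:C%C * (g * (cG * I))); first by rewrite e mul1r.
by move: (mu ^- d)%:C%C (mu ^+ d)%:C%C cG => a b c; ring.
Qed.

Let cM (a b : R) : (a * b)%:C%C = a%:C%C * b%:C%C :> R[i]. Proof. exact: rmorphM. Qed.

Let cS I (r : seq I) (F : I -> R) : (\sum_(i <- r) F i)%:C%C = \sum_(i <- r) (F i)%:C%C :> R[i].
Proof. exact: rmorph_sum. Qed.

(** Each power of <x, y> multiplies a product of two Gaussians by further terms x_j y_j, which keeps
    the rank finite. *)
Lemma finite_rank_gauss_sum N : finite_rank (exq Q 0 * (fun Z => (exp_sum N (qform W Z))%:C%C)).
Proof.
pose P m : 'rV[R]_(d + d) -> R[i] := exq Q 0 * (fun Z => (qform W Z ^+ m)%:C%C).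
have fP m : finite_rank (P m).
  elim: m => [|m IH].
    have -> : P 0%N = tensor (gauss (del + kap)) (gauss kap).
      apply/funext => Z; rewrite /P /tensor !mulrfctE expr0 mulr1 /exq exp_rem0 /gauss.
      rewrite -rmorphM -expRD -{1}(hsubmxK Z) qformQ; congr (expR _)%:C%C.
      by rewrite mulNr.
    by apply: finite_rank_tensor; apply: Shalf_gauss => //; exact: addr_gt0.
  have -> : P m.+1 = \sum_(j < d) (fun=> (2 * kap)%:C%C) * cX (lshift d j) (cX (rshift d j) (P m)).
    apply/funext => Z; rewrite fct_sumE /P mulrfctE exprS.
    rewrite -{2}(hsubmxK Z) qformW /dotrV mulr_sumr mulr_suml cS mulr_sumr.
    apply: eq_bigr => j _; rewrite mulrfctE /cX mulrfctE !cM !mxE.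
    move: (exq Q 0 Z) ((Z 0 (lshift d j))%:C%C) ((Z 0 (rshift d j))%:C%C) => u v w.
    by move: ((qform W Z ^+ m)%:C%C) (kap%:C%C) ((2 : R)%:C%C) => a b c; ring.
  by apply: finite_rank_sum => j; apply: finite_rank_Z; exact: finite_rank_cX.
have -> : exq Q 0 * (fun Z => (exp_sum N (qform W Z))%:C%C) =
    \sum_(m < N) (fun=> (m`!%:R^-1)%:C%C) * P m.
  apply/funext => Z; rewrite fct_sumE mulrfctE /exp_sum cS mulr_sumr.
  apply: eq_bigr => m _; rewrite cM.
  transitivity ((m`!%:R^-1)%:C%C * (exq Q 0 Z * (qform W Z ^+ m)%:C%C)); last by [].
  by move: (exq Q 0 Z) ((qform W Z ^+ m)%:C%C) ((m`!%:R^-1)%:C%C) => a b c; ring.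
by apply: finite_rank_sum => m; exact: finite_rank_Z.
Qed.

(** Q + |W| is already negative definite thanks to the term - |nu x|^2 of the cutoff, so there is
    room for a factor lam > 1. *)
Lemma gauss_kernel_bound : exists lam b, [/\ 1 < lam, 0 < b &
  forall Z, qform Q Z + lam * `|qform W Z| <= - (b * dotrV Z Z)].
Proof.
(* With eta at most 1 and at most del / (6 kap), the loss in the coefficient of |x|^2 is at most 5/6
   of del. Taking tau > lam as weight between |x|^2 and |y|^2 keeps a positive multiple of |y|^2. *)
pose eta := Num.min 1 (del / (6 * kap)).
have k6 : 0 < 6 * kap by rewrite mulr_gt0.
have eta0 : 0 < eta by rewrite lt_min ltr01 divr_gt0.
have eta1 : eta <= 1 by rewrite ge_min lexx.
have eta2 : 6 * kap * eta <= del by rewrite mulrC -ler_pdivlMr // ge_min lexx orbT.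
pose lam := 1 + eta; pose tau := 1 + 2 * eta.
have tau0 : 0 < tau by rewrite /tau; lra.
pose b := Num.min (del / 6) (kap * eta / tau).
have b0 : 0 < b by rewrite lt_min !divr_gt0 // mulr_gt0.
exists lam, b; split=> // [|Z]; first by rewrite /lam ltrDl.
rewrite -(hsubmxK Z); move: (lsubmx Z) (rsubmx Z) => x y.
rewrite qformQ qformW dot_row.
have kk : 0 <= 2 * kap by rewrite mulr_ge0 // ltW.
rewrite normrM (ger0_norm kk).
have xy : 2 * `|dotrV x y| <= tau * dotrV x x + tau^-1 * dotrV y y.
  apply: (@le_trans _ _ (\sum_j (tau * (x 0 j * x 0 j) + tau^-1 * (y 0 j * y 0 j)))); last first.
    by rewrite big_split /= -!mulr_sumr.
  apply: le_trans (ler_wpM2l _ (ler_norm_sum _ _ _)) _ => //.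
  rewrite mulr_sumr; apply: ler_sum => j _; rewrite normrM.
  have ti : tau * tau^-1 = 1 by rewrite divff // gt_eqF.
  have sq : 0 <= tau^-1 * (tau * `|x 0 j| - `|y 0 j|) ^+ 2.
    by rewrite mulr_ge0 ?sqr_ge0 // invr_ge0 ltW.
  have xx : x 0 j * x 0 j = `|x 0 j| ^+ 2 by rewrite real_normK ?num_real // expr2.
  have yy : y 0 j * y 0 j = `|y 0 j| ^+ 2 by rewrite real_normK ?num_real // expr2.
  rewrite xx yy -subr_ge0; apply: le_trans sq _; rewrite le_eqVlt; apply/orP; left; apply/eqP.
  move: (`|x 0 j|) (`|y 0 j|) => p q.
  have -> : tau^-1 * (tau * p - q) ^+ 2 = (tau * tau^-1) * tau * p ^+ 2 -
     2 * (tau * tau^-1) * (p * q) + tau^-1 * q ^+ 2 by ring.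
  by rewrite ti; ring.
have X0 := dot_ge0 x; have Y0 := dot_ge0 y.
move: (dotrV x x) (dotrV y y) (`|dotrV x y|) X0 Y0 xy => X Y P X0 Y0 xy.
have lk : 0 <= lam * kap by rewrite mulr_ge0 ?(ltW kap0) // /lam addr_ge0 // ltW.
have h1 : lam * (2 * kap * P) <= lam * kap * tau * X + lam * kap * tau^-1 * Y.
  have := ler_wpM2l lk xy.
  have -> : lam * kap * (2 * P) = lam * (2 * kap * P) by ring.
  by have -> : lam * kap * (tau * X + tau^-1 * Y) = lam * kap * tau * X + lam * kap * tau^-1 * Y by ring.
have b1 : b <= del + kap - lam * kap * tau.
  apply: (@le_trans _ _ (del / 6)); first by rewrite ge_min lexx.
  have -> : del + kap - lam * kap * tau = del - 3 * (kap * eta) - 2 * (kap * eta * eta).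
    by rewrite /lam /tau; ring.
  have e1 : kap * eta * eta <= kap * eta by rewrite ler_piMr // mulr_ge0 // ltW.
  lra.
have b2 : b <= kap - lam * kap * tau^-1.
  apply: (@le_trans _ _ (kap * eta / tau)); first by rewrite ge_min lexx orbT.
  have -> : kap - lam * kap * tau^-1 = kap * (tau - lam) / tau.
    by rewrite mulrBr mulrBl mulfK ?gt_eqF // (mulrC kap).
  by rewrite /tau /lam le_eqVlt; apply/orP; left; apply/eqP; congr (_ / _); ring.
have h2 := ler_wpM2r X0 b1; have h3 := ler_wpM2r Y0 b2.
apply: le_trans (lerD (lexx _) h1) _.
have -> : - (b * (X + Y)) = - (b * X) - b * Y by ring.
have -> : - (del + kap) * X - kap * Y + (lam * kap * tau * X + lam * kap / tau * Y) =
   - ((del + kap - lam * kap * tau) * X) - (kap - lam * kap / tau) * Y by ring.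
by apply: lerD; rewrite lerN2.
Qed.

(** By the Bernoulli inequality, lam^N >= 1 + N (lam - 1). *)
Lemma pow_lt_eps (lam A eps : R) : 1 < lam -> 0 < eps -> exists N, A * lam ^- N <= eps.
Proof.
move=> l1 e0; pose eta := lam - 1; have eta0 : 0 < eta by rewrite subr_gt0.
have B N : 1 + N%:R * eta <= lam ^+ N.
  elim: N => [|N IH]; first by rewrite mul0r addr0 expr0.
  have l0 : 0 <= lam by exact: ltW (lt_trans ltr01 l1).
  rewrite exprS; apply: le_trans (ler_wpM2l l0 IH).
  have -> : lam = 1 + eta by rewrite /eta addrC subrK.
  have -> : (1 + eta) * (1 + N%:R * eta) = 1 + N.+1%:R * eta + N%:R * (eta * eta).
    by rewrite -natr1; ring.
  by rewrite lerDl mulr_ge0 // mulr_ge0 // ltW.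
pose N := (Num.truncn (A / eps / eta)).+1.
have lN : 0 < lam ^+ N by rewrite exprn_gt0 // (lt_trans ltr01).
exists N; rewrite ler_pdivrMr // mulrC -ler_pdivrMr //.
apply: le_trans (B N); apply: (@le_trans _ _ (N%:R * eta)); last by rewrite lerDr.
by rewrite -ler_pdivrMr //; apply/ltW; exact: truncnS_gt.
Qed.

(** The Taylor polynomial of exp(W) of degree below N gives the finite-rank part; what is left is a
    constant times [gaussq Q W N]. *)
Lemma kernel_approx h' : 0 < h' -> SWB s (gaussq Q W 0) /\
  forall eps, 0 < eps -> exists k, [/\ finite_rank k,
    SWB s ((fun=> (mu ^- d)%:C%C * cG) * gaussq Q W 0 + (fun=> -1) * k) &
    WB xpredT s (fun=> 1) eps h' ((fun=> (mu ^- d)%:C%C * cG) * gaussq Q W 0 + (fun=> -1) * k)].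
Proof.
move=> h'0; have [lam [b [l1 b0 QW]]] := gauss_kernel_bound.
have [C [h [C0 h0 HN]]] := gaussq_WB Q_sym W_sym (ltW l1) b0 QW.
have lam0 : 0 < lam by exact: lt_trans ltr01 l1.
have SN N : Shalf (gaussq Q W N).
  exists (C * lam ^- N), h; split=> //.
  by rewrite mulr_ge0 // invr_ge0 exprn_ge0 // ltW.
split; first exact/Shalf_SWB/SN.
move=> eps eps0; set c := (mu ^- d)%:C%C * cG.
have [K K1 HK] := @WB_half R (d + d) xpredT s (fun=> 1) h h' hs h0 h'0.
have [N HN2] := pow_lt_eps (Normc.normc c * (K * C)) l1 eps0.
pose k := (fun=> c) * (exq Q 0 * (fun Z => (exp_sum N (qform W Z))%:C%C)).
have E : (fun=> c) * gaussq Q W 0 + (fun=> -1) * k = (fun=> c) * gaussq Q W N.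
  apply/funext => Z; rewrite /gaussq /k.
  transitivity (c * (exq Q 0 Z * exq W 0 Z) + -1 * (c * (exq Q 0 Z * (exp_sum N (qform W Z))%:C%C))); first by [].
  transitivity (c * (exq Q 0 Z * exq W N Z)); last by [].
  have -> : exq W N Z = exq W 0 Z - (exp_sum N (qform W Z))%:C%C.
    by rewrite /exq exp_rem0 /exp_rem rmorphB.
  by ring.
exists k; rewrite E; split.
- by apply: finite_rank_Z; exact: finite_rank_gauss_sum.
- exact/Shalf_SWB/Shalf_Z/SN.
have lN0 : 0 <= C * lam ^- N by rewrite mulr_ge0 // invr_ge0 exprn_ge0 // ltW.
have := WB_Z c (HK _ _ lN0 (fun=> ler01) (HN N)).
apply: BW_le => //; first exact: ltW.
- by apply: le_trans HN2; rewrite !mulrA.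
- by rewrite mulr_ge0 ?normc_ge0 // mulr_ge0 // (le_trans ler01).
- by move=> x; rewrite ler01 lexx.
Qed.

End kernel.

Lemma finite_rank_approx h : 0 < h -> exists2 h', 0 < h' & forall eps, 0 < eps ->
  exists2 k, finite_rank k & forall phi C, 0 <= C -> WB xpredT s (fun=> 1) C h' phi ->
    WB xpredT s (fun=> 1) (eps * C) h (phi + (fun=> -1) * Kop k phi).
Proof.
move=> h0; have [h1 h10 HM] := Mop_approx h0; have [h2 h20 HC] := Cop_approx h10.
have [h3 h30 [K K0 HK]] := Kop_WB hs d h0.
pose h' := Num.min h1 (Num.min h2 h3).
have h'0 : 0 < h' by rewrite !lt_min h10 h20 h30.
have r1 (x : 'rV[R]_d) : 0 <= (1 : R) by exact: ler01.
exists h' => // eps eps0; have e30 : 0 < eps / 3 by rewrite divr_gt0.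
have [nu nu0 [[KM KM0 HM1] HM2]] := HM _ e30.
(* The mollification error still passes through the cutoff, whose bound [KM] may depend on nu; so nu
   comes before mu. *)
have e40 : 0 < eps / 3 / (KM + 1) by rewrite divr_gt0 // ltr_wpDl.
have [mu mu0 HC1] := HC _ e40.
have e50 : 0 < eps / 3 / (K + 1) by rewrite divr_gt0 // ltr_wpDl.
have [Hg Hk] := kernel_approx nu0 mu0 h30.
have [k [fk Sk bk]] := Hk _ e50; exists k => // phi C C0 bp.
have b1 : WB xpredT s (fun=> 1) C h1 phi.
  by apply: WB_hle bp => //; rewrite (ltW h'0) ge_min lexx.
have b2 : WB xpredT s (fun=> 1) C h2 phi.
  by apply: WB_hle bp => //; rewrite (ltW h'0) !ge_min lexx !orbT.
have b3 : WB xpredT s (fun=> 1) C h3 phi.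
  by apply: WB_hle bp => //; rewrite (ltW h'0) !ge_min lexx !orbT.
have d1 := WB_N (HM2 phi C C0 b1).
have eC0 : 0 <= eps / 3 / (KM + 1) * C by rewrite mulr_ge0 // ltW.
have d2 := WB_N (HM1 _ _ eC0 (HC1 phi C C0 b2)).
have d3 := HK _ _ _ _ (ltW e50) C0 bk b3.
have := WB_D (WB_D d1 d2) d3.
have Sfk := finite_rank_SWB hs fk; have Sgk := SWB_Z ((mu ^- d)%:C%C * cG) Hg.
rewrite (Kop_add hs Sgk (SWB_Z (-1) Sfk) b3) (Kop_Z hs (-1) Sfk b3).
rewrite -(Mop_Cop_kernel mu0 b3 Hg).
(* phi - K phi splits into the cutoff error, the cutoff of the mollification error and the kernel
   error, each at most a third of eps. *)
have -> : (fun=> -1) * (Mop nu phi + (fun=> -1) * phi) +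
    (fun=> -1) * Mop nu (Cop mu phi + (fun=> -1) * phi) +
    (Mop nu (Cop mu phi) + (fun=> -1) * Kop k phi) = phi + (fun=> -1) * Kop k phi.
  apply/funext => x; pose g := gauss 1 (nu *: x).
  transitivity (-1 * (g * phi x + -1 * phi x) + -1 * (g * (Cop mu phi x + -1 * phi x)) +
    (g * Cop mu phi x + -1 * Kop k phi x)); first by [].
  transitivity (phi x + -1 * Kop k phi x); last by [].
  by move: g (Cop mu phi x) (Kop k phi x) => g a c; ring.
apply: BW_le => //; first exact: ltW.
- have f (X : R) : 0 <= X -> X * (eps / 3 / (X + 1)) <= eps / 3.
    move=> X0; have X1 : 0 < X + 1 by rewrite ltr_wpDl.
    rewrite mulrA ler_pdivrMr // mulrC; apply: ler_wpM2l; first exact: ltW.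
    by rewrite lerDl.
  have f1 := ler_wpM2r C0 (f _ KM0); have f2 := ler_wpM2r C0 (f _ K0).
  rewrite [KM * _]mulrA; apply: le_trans (lerD (lerD (lexx _) f1) f2) _.
  by rewrite le_eqVlt; apply/orP; left; apply/eqP; field.
- rewrite !addr_ge0 //; first by rewrite mulr_ge0 // ltW.
    exact: mulr_ge0.
  by apply: mulr_ge0 => //; apply: mulr_ge0 => //; exact: ltW.
- by move=> x; rewrite ler01 lexx.
Qed.

End approximation.

(** * The topologies of Sigma_s and of its dual *)

Section Sigma_seminorms.
Variables (R : realType) (s : R) (d : nat).
Hypothesis hs : 2^-1 < s.
Local Notation Sig := (SigmaType s d).
Implicit Types (f g phi psi : Sig) (h : R).

Let s0 : 0 < s. Proof. by apply: lt_trans hs; rewrite invr_gt0. Qed.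

Definition sn h f : R := fine (gs_norm s h f).

Lemma Sigma_SWB f : SWB s f.
Proof. by move=> h h0; apply: Sigma_WB => //; exact: valP f. Qed.

Lemma Sigma_smooth f : smooth f.
Proof. exact: SWB_smooth (Sigma_SWB f). Qed.

Lemma snE h f : 0 < h -> (sn h f)%:E = gs_norm s h f.
Proof.
move=> h0; rewrite /sn fineK // ge0_fin_numE ?gs_norm_ge0 ?ltW //.
by case: f => f /= /asboolP[_]; exact.
Qed.

Lemma sn_ge0 h f : 0 < h -> 0 <= sn h f.
Proof. by move=> h0; rewrite -lee_fin snE // gs_norm_ge0 // ltW. Qed.

Lemma sn_lin h c f g : 0 < h -> sn h (c *: f + g) <= Normc.normc c * sn h f + sn h g.
Proof.
move=> h0; rewrite -lee_fin EFinD EFinM !snE //.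
exact: (gs_norm_lin s c (ltW h0) (Sigma_smooth f) (Sigma_smooth g)).
Qed.

Lemma sn_0 h : sn h (0 : Sig) = 0.
Proof. by rewrite /sn (gs_norm0 d s h). Qed.

Lemma snZ h c f : 0 < h -> sn h (c *: f) <= Normc.normc c * sn h f.
Proof. by move=> h0; have := sn_lin c f 0 h0; rewrite !addr0 sn_0 addr0. Qed.

Lemma snD h f g : 0 < h -> sn h (f + g) <= sn h f + sn h g.
Proof. by move=> h0; have := sn_lin 1 f g h0; rewrite scale1r Normc.normc1 mul1r. Qed.

Lemma snB h f g : 0 < h -> sn h (f - g) = sn h (g - f).
Proof.
move=> h0; suff H f' g' : sn h (f' - g') <= sn h (g' - f') by apply/eqP; rewrite eq_le !H.
have := snZ (-1) (g' - f') h0; rewrite scaleN1r opprB.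
by rewrite normcN Normc.normc1 mul1r.
Qed.

Lemma nbhs_SigmaP f (A : set Sig) : nbhs f A <->
  exists h e, [/\ 0 < h, 0 < e & forall g, sn h (g - f) < e -> A g].
Proof.
split=> [[[h e] /= [h0 e0] H]|[h [e [h0 e0 H]]]].
  by exists h, e; split=> // g ge; apply: H; rewrite /= -[gs_norm _ _ _](snE (g - f) h0) lte_fin.
exists (h, e) => //= g ge; apply: H.
by rewrite -lte_fin (snE (g - f) h0).
Qed.

Lemma sn_WB h : 0 < h -> exists h' K, [/\ 0 < h', 0 <= K &
  forall f, WB xpredT s (fun=> 1) (K * sn h' f) h f].
Proof.
move=> h0; have h20 : 0 < h / 2 by exact: divr_gt0.
have [K K1 HK] := gs_norm_WB d hs h20; exists (h / 2), K; split=> // [|f].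
  exact: le_trans ler01 K1.
have := HK f _ (sn_ge0 f h20) (Sigma_smooth f); rewrite snE // => /(_ (lexx _)).
by have -> : 2 * (h / 2) = h by field.
Qed.

Lemma WB_sn h : 0 < h -> exists2 h', 0 < h' & forall f C, 0 <= C ->
  WB xpredT s (fun=> 1) C h' f -> sn h f <= C.
Proof.
move=> h0; pose M : R := (2 `^ s) ^+ d.+1.
have M0 : 0 < M by rewrite exprn_gt0 // powR_gt0.
have h'0 : 0 < h / M by rewrite divr_gt0.
exists (h / M) => // f C C0 bf; rewrite -lee_fin snE //.
have := WB_gs_norm (ltW s0) C0 h'0 bf; rewrite -/M.
by have -> : M * (h / M) = h by rewrite mulrC divfK // gt_eqF.
Qed.

Lemma sn_bounded h : 0 < h -> exists2 K, 0 <= K & forall f x, Normc.normc (f x) <= K * sn h f.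
Proof.
move=> h0; have [K K1 HK] := gs_norm_WB d hs h0; exists K => [|f x].
  exact: le_trans ler01 K1.
have := HK f _ (sn_ge0 f h0) (Sigma_smooth f); rewrite snE // => /(_ (lexx _)) b.
exact: WB_bounded b x.
Qed.

Lemma sn_eq0 h f : 0 < h -> sn h f <= 0 -> f = 0.
Proof.
move=> h0 f0; have [K K0 HK] := sn_bounded h0.
apply/val_inj/funext => x; apply: Normc.eq0_normc.
apply/eqP; rewrite eq_le normc_ge0 andbT; apply: le_trans (HK f x) _.
by rewrite mulr_ge0_le0.
Qed.

Lemma sn_lt_eq0 h f : 0 < h -> (forall e, 0 < e -> sn h f <= e) -> f = 0.
Proof.
move=> h0 H; apply: (sn_eq0 h0); apply/ler_addgt0Pl => e e0.
by rewrite addr0; exact: H.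
Qed.

Definition MkSig (f : 'rV[R]_d -> R[i]) (H : SWB s f) : Sig :=
  MkSigma (WB_Sigma (ltW s0) (SWB_smooth H) H).

Lemma tame_sn Phi (T : Sig -> Sig) :
  tame (WB xpredT s (fun=> 1)) (WB xpredT s (fun=> 1)) Phi ->
  (forall f, T f = Phi f :> ('rV[R]_d -> R[i])) ->
  forall h, 0 < h -> exists h' K, [/\ 0 < h', 0 <= K & forall f, sn h (T f) <= K * sn h' f].
Proof.
move=> tP TE h h0; have [h1 h10 H1] := WB_sn h0; have [h2 [K [h20 K0 H2]]] := tP _ h10.
have [h3 [K' [h30 K'0 H3]]] := sn_WB h20; exists h3, (K * K'); split=> // [|f].
  exact: mulr_ge0.
have e0 : 0 <= K' * sn h3 f by rewrite mulr_ge0 // sn_ge0.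
rewrite -mulrA; apply: H1; first exact: mulr_ge0.
by rewrite TE; exact: H2.
Qed.

Lemma sn_continuous (T : Sig -> Sig) : (forall f g, T (f - g) = T f - T g) ->
  (forall h, 0 < h -> exists h' K, [/\ 0 < h', 0 <= K & forall f, sn h (T f) <= K * sn h' f]) ->
  continuous T.
Proof.
move=> TB HT f A /nbhs_SigmaP[h [e [h0 e0 HA]]]; apply/nbhs_SigmaP.
have [h' [K [h'0 K0 HK]]] := HT h h0.
have K1 : 0 < K + 1 by rewrite ltr_wpDl.
exists h', (e / (K + 1)); split=> // [|g ge]; first exact: divr_gt0.
apply: HA; rewrite -TB; apply: le_lt_trans (HK _) _.
rewrite ltr_pdivlMr // in ge; apply: le_lt_trans ge.
by rewrite mulrC; apply: ler_wpM2l; [exact: sn_ge0|rewrite lerDl].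
Qed.

Lemma continuous_nbhs (T : Sig -> Sig) f (B : set Sig) :
  continuous T -> nbhs (T f) B -> nbhs f (T @^-1` B).
Proof. by move=> cT NB; have := cT f => /(_ B)/(_ NB). Qed.

Lemma pairingC n (f g : 'rV[R]_n -> R[i]) : pairing f g = pairing g f.
Proof. by rewrite /pairing; congr integral_rV; apply/funext => x; rewrite mulrC. Qed.

Lemma Kop_0 (phi : 'rV[R]_d -> R[i]) : SWB s phi -> Kop 0 phi = 0.
Proof.
move=> /(_ 1 ltr01)[C C0 bp]; have E : (fun=> 0) * 0 = 0 :> ('rV[R]_(d + d) -> R[i]) by exact: mulr0.
rewrite -[in LHS]E (Kop_Z hs 0 (finite_rank_SWB hs (finite_rank0 R d)) bp).
by apply/funext => x; rewrite mulrfctE mul0r.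
Qed.

Lemma Shalf_Kop k (phi : 'rV[R]_d -> R[i]) : finite_rank k -> SWB s phi -> Shalf (Kop k phi).
Proof.
move=> fk Hp; have [C C0 bp] := Hp 1 ltr01; elim: fk => [|psi l k0 sp sl fk IH].
  by rewrite Kop_0 //; exact: Shalf_0.
rewrite (Kop_add hs (SWB_tensor s0 (Shalf_SWB hs sp) (Shalf_SWB hs sl)) (finite_rank_SWB hs fk) bp).
rewrite (Kop_tensor hs psi sl bp); apply: Shalf_D => //; exact: Shalf_Z.
Qed.

Lemma finite_rank_approx_sn h : 0 < h -> exists2 h', 0 < h' & forall eps, 0 < eps ->
  exists2 k, finite_rank k & forall phi psi, Sigma_fun psi = Kop k phi -> sn h (phi - psi) <= eps * sn h' phi.
Proof.
move=> h0; have [h1 h10 H1] := WB_sn h0; have [h2 h20 H2] := finite_rank_approx d hs h10.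
have [h3 [K [h30 K0 H3]]] := sn_WB h20; exists h3 => // eps e0.
have K1 : 0 < K + 1 by rewrite ltr_wpDl.
have e'0 : 0 < eps / (K + 1) by exact: divr_gt0.
have [k fk Hk] := H2 _ e'0; exists k => // phi psi E.
have S0 := sn_ge0 phi h30.
have KS : 0 <= K * sn h3 phi by exact: mulr_ge0.
have := Hk _ _ KS (H3 phi) => b.
apply: (@le_trans _ _ (eps / (K + 1) * (K * sn h3 phi))).
  apply: H1; first by apply: mulr_ge0 => //; exact: ltW.
  have -> // : Sigma_fun (phi - psi) = Sigma_fun phi + (fun=> -1) * Kop k phi.
  rewrite -E; apply/funext => x.
  transitivity (phi x - psi x); first by [].
  transitivity (phi x + -1 * psi x); last by [].
  by rewrite mulN1r.
rewrite mulrA; apply: ler_wpM2r => //; rewrite mulrAC ler_pdivrMr //.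
by apply: ler_wpM2l; [exact: ltW|rewrite lerDl].
Qed.

(** If all pairings vanish, then so does K phi for each finite-rank K, by [Kop_tensor]; and K phi
    approximates phi. *)
Lemma pairing_separates phi : (forall g : 'rV[R]_d -> R[i], Shalf g -> pairing g phi = 0) -> phi = 0.
Proof.
move=> H; have [C C0 bp] := Sigma_SWB phi ltr01.
have K0 k : finite_rank k -> Kop k phi = 0.
  elim=> [|psi l k0 sp sl fk IH].
    exact: Kop_0 (Sigma_SWB phi).
  rewrite (Kop_add hs (SWB_tensor s0 (Shalf_SWB hs sp) (Shalf_SWB hs sl)) (finite_rank_SWB hs fk) bp).
  rewrite (Kop_tensor hs psi sl bp) IH addr0.
  have -> : integral_rV (fun y => l y * phi y) = 0 by exact: (H l sl).
  by apply/funext => x; rewrite mulrfctE mul0r.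
have [h' h'0 Hh] := finite_rank_approx_sn ltr01.
apply: (sn_lt_eq0 ltr01) => e e0; have S0 := sn_ge0 phi h'0.
have S1 : 0 < sn h' phi + 1 by rewrite ltr_wpDl.
have [k fk Hk] := Hh _ (divr_gt0 e0 S1).
have := Hk phi 0; rewrite K0 // subr0 => /(_ erefl) b; apply: le_trans b _.
by rewrite mulrAC ler_pdivrMr //; apply: ler_wpM2l; [exact: ltW|rewrite lerDl].
Qed.

(** K phi is a finite combination of functions in S_(1/2). *)
Lemma Shalf_dense phi (A : set Sig) : nbhs phi A -> exists2 psi, A psi & Shalf psi.
Proof.
move=> /nbhs_SigmaP[h [e [h0 e0 HA]]]; have [h' h'0 Hh] := finite_rank_approx_sn h0.
have S0 := sn_ge0 phi h'0; have S1 : 0 < sn h' phi + 1 by rewrite ltr_wpDl.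
have [k fk Hk] := Hh _ (divr_gt0 e0 S1).
have Sk := Shalf_Kop fk (Sigma_SWB phi).
exists (MkSig (Shalf_SWB hs Sk)) => //; apply: HA.
rewrite snB //.
apply: (@le_lt_trans _ _ (e / (sn h' phi + 1) * sn h' phi)); first exact: Hk.
by rewrite mulrAC ltr_pdivrMr //; rewrite ltr_pM2l // ltrDl.
Qed.

(** Both values at f are close to the common value at some psi in S_(1/2), and a single seminorm
    separates points. *)
Lemma continuous_eq_Sigma (T T' : Sig -> Sig) : continuous T -> continuous T' ->
  (forall f, Shalf f -> T' f = T f) -> T' =1 T.
Proof.
move=> cT cT' E f; apply/eqP; rewrite -subr_eq0; apply/eqP.
apply: (sn_lt_eq0 ltr01) => e e0; have e20 : 0 < e / 2 by exact: divr_gt0.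
pose B g : set Sig := [set y | sn 1 (y - g) < e / 2].
have NB g : nbhs g (B g).
  by apply/nbhs_SigmaP; exists 1, (e / 2); split=> //; exact: ltr01.
have N1 := continuous_nbhs cT (NB (T f)); have N2 := continuous_nbhs cT' (NB (T' f)).
have [psi [b b'] Sp] := Shalf_dense (filterI N1 N2).
rewrite /preimage/= in b b'.
have -> : T' f - T f = (T' f - T' psi) + (T psi - T f) by rewrite (E _ Sp) addrA subrK.
apply: le_trans (snD _ _ ltr01) _; rewrite (snB (T' f)) //.
by apply: ltW; apply: lt_le_trans (ltrD b' b) _; rewrite -splitr.
Qed.

End Sigma_seminorms.

(** * Strong duals and adjoints *)

Section strong_dual.
Variables (R : realType) (E : preTopologicalLmodType R[i]).
Implicit Types (u v : dual E) (B : set E).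

Lemma dual_lin u c x y : u (c *: x + y) = c * u x + u y.
Proof. by have /asboolP[lu _] := valP u; exact: lu. Qed.

Lemma dual_continuous u : continuous (u : E -> R[i]).
Proof. by have /asboolP[] := valP u. Qed.

Lemma dual_B u x y : u (x - y) = u x - u y.
Proof. by rewrite addrC -scaleN1r dual_lin mulN1r addrC. Qed.

Lemma dual_0 u : u 0 = 0.
Proof. by have := dual_B u 0 0; rewrite !subrr. Qed.

Lemma normc_ltE (z : R[i]) (e : R) : (`|z| < e%:C%C) = (Normc.normc z < e).
Proof. by case: z => a b; rewrite ltcE /= eqxx. Qed.

(** Radii of balls live in R[i]; a positive one has no imaginary part, so it may be replaced by a
    real number. *)
Lemma nbhs_ballc (z : R[i]) (P : set R[i]) : nbhs z P <->
  exists2 e : R, 0 < e & forall w, Normc.normc (w - z) < e -> P w.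
Proof.
split=> [/nbhs_ballP[e /= e0 He]|[e e0 He]].
  move: e e0 He => [e ei] e0 He; move: (e0); rewrite ltcE /= => /andP[/eqP ei0 er0].
  exists e => // w we; apply: He; rewrite -ball_normE /= distrC ei0.
  by rewrite normc_ltE.
apply/nbhs_ballP; exists (e%:C%C) => /=; first by rewrite ltcR.
by move=> w; rewrite -ball_normE /= distrC normc_ltE; exact: He.
Qed.

Lemma dual_nbhs u x e : 0 < e -> nbhs x [set y | Normc.normc (u y - u x) < e].
Proof.
move=> e0; have N : nbhs (u x) [set w : R[i] | Normc.normc (w - u x) < e].
  by apply/nbhs_ballc; exists e.
by have := @dual_continuous u x => /(_ _ N).
Qed.

Lemma nbhs_dual_of u B (e : R) : vn_bounded B -> 0 < e ->
  nbhs u [set v : dual E | forall y, B y -> Normc.normc (v y - u y) < e].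
Proof.
move=> bB e0; pose Ent : set (R[i] * R[i]) := [set p | Normc.normc (p.2 - p.1) < e].
have eE : entourage Ent.
  rewrite -entourage_ballE; exists (e%:C%C) => /=; first by rewrite ltcR.
  by move=> [z w] /=; rewrite -ball_normE /= distrC normc_ltE.
pose Fam := {family (@vn_bounded R E), E -> R[i]}.
have N : nbhs (dual_fun u : Fam) [set g : Fam | forall y, B y -> Ent (u y, g y)].
  exact: (@fam_nbhs _ _ _ B Ent (dual_fun u : Fam) eE bB).
by have := @initial_continuous _ Fam (@dual_fun R E : dual E -> Fam) u => /(_ _ N).
Qed.

Lemma nbhs_dualP u (A : set (dual E)) : nbhs u A ->
  exists2 W : set {family (@vn_bounded R E), E -> R[i]},
    nbhs (dual_fun u : {family (@vn_bounded R E), E -> R[i]}) W & forall v, W (dual_fun v) -> A v.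
Proof.
move=> [U [/= [W oW <-]] Wu WA]; exists W => [|v Wv]; last exact: WA.
exact: open_nbhs_nbhs.
Qed.

(** The strong topology is initial for the inclusion into the maps with uniform convergence on
    bounded sets, so uniform convergence on each bounded set suffices. *)
Lemma family_cvg_dual T (F : set_system T) {FF : Filter F} (w : T -> dual E) u :
  (forall B (e : R), vn_bounded B -> 0 < e ->
     F [set t | forall y, B y -> Normc.normc (w t y - u y) < e]) ->
  forall A, nbhs u A -> F (w @^-1` A).
Proof.
move=> H A /nbhs_dualP[W NW WA].
have C : {family (@vn_bounded R E), ((@dual_fun R E) \o w) @ F --> dual_fun u}.
  apply/fam_cvgP => B bB P /uniform_nbhs[Ent [eE EP]].
  move: eE; rewrite -entourage_ballE => -[e /= e0 He].
  move: e e0 He => [e ei] e0 He; move: (e0); rewrite ltcE /= => /andP[/eqP ei0 er0].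
  apply: (filterS _ (H B e bB er0)) => t Ht /=; apply: EP => y By.
  by apply: He => /=; rewrite -ball_normE /= distrC ei0 normc_ltE; exact: Ht.
have CW : F (w @^-1` [set v | W (dual_fun v)]) := C W NW.
by apply: filterS CW => t; exact: WA.
Qed.

Variable T : {linear E -> E}.
Hypothesis cT : continuous T.

Lemma vn_bounded_image B : vn_bounded B -> vn_bounded (T @` B).
Proof.
move=> bB U U0; have N : nbhs (T 0) U by rewrite linear0.
have N' : nbhs 0 (T @^-1` U) by have := @cT 0 => /(_ U N).
have [r r0 H] := bB _ N'; exists r => // c rc _ [x Bx <-].
have [y /= Uy <-] := H c rc x Bx; exists (T y) => //.
by rewrite linearZ.
Qed.

Lemma transpose_subproof u : (u \o T) \in @cont_functional R E.
Proof.
apply/asboolP; split=> [c x y|x]; first by rewrite /= linearP dual_lin.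
by apply: continuous_comp; [exact: cT|exact: dual_continuous].
Qed.

Definition transpose u : dual E := MkDual (transpose_subproof u).

Lemma transpose_linear : linear transpose.
Proof. by move=> c u v; apply/val_inj/funext => x. Qed.

HB.instance Definition _ := GRing.isLinear.Build R[i] (dual E) (dual E) *:%R transpose transpose_linear.

Definition transpose_map : {linear dual E -> dual E} := transpose.

(** Closeness of functionals on T(B) is closeness of their adjoint images on B, and T(B) is
    bounded. *)
Lemma transpose_continuous : continuous transpose_map.
Proof.
move=> u A; apply: (@family_cvg_dual _ (nbhs u) _ transpose (transpose u)) => B e bB e0.
apply: (filterS _ (nbhs_dual_of u (vn_bounded_image bB) e0)) => v Hv y By /=.
by apply: Hv; exists y.
Qed.

End strong_dual.

(** * Density and uniqueness in the dual of Sigma_s *)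

Section Sigma_dual.
Variables (R : realType) (s : R) (d : nat).
Hypothesis hs : 2^-1 < s.
Local Notation Sig := (SigmaType s d).
Local Notation normc := (@Normc.normc R).
Implicit Types (f g phi psi : Sig) (h : R) (u v : dual Sig).

Let s0 : 0 < s. Proof. by apply: lt_trans hs; rewrite invr_gt0. Qed.

Lemma nbhs0_Sigma h e : 0 < h -> 0 < e -> nbhs (0 : Sig) [set g : Sig | sn h g < e].
Proof.
move=> h0 e0; apply/nbhs_SigmaP; exists h, e; split=> // g.
by rewrite subr0.
Qed.

Lemma vn_bounded_sn (B : set Sig) h : 0 < h -> vn_bounded B ->
  exists2 M, 0 <= M & forall g, B g -> sn h g <= M.
Proof.
move=> h0 bB; have [r r0 H] := bB _ (nbhs0_Sigma h0 ltr01).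
exists r => [|g Bg]; first exact: ltW.
have rr : r <= normc (r%:C%C) by rewrite normcR ler_norm.
have [y /= yr <-] := H _ rr g Bg.
apply: le_trans (snZ hs _ _ h0) _; rewrite normcR ger0_norm ?(ltW r0) //.
by rewrite ler_piMr ?(ltW r0) // ltW.
Qed.

(** Strong neighbourhoods therefore control the values at single points. *)
Lemma vn_bounded_set1 phi : vn_bounded [set phi].
Proof.
move=> U /nbhs_SigmaP[h [e [h0 e0 HU]]]; have S0 := sn_ge0 phi h0.
have S1 : 0 < sn h phi + 1 by rewrite ltr_wpDl.
exists ((sn h phi + 1) / e) => [|c]; first exact: divr_gt0.
rewrite ler_pdivrMr // => Hc _ ->.
have nc : 0 < normc c.
  by rewrite -(pmulr_lgt0 _ e0); exact: lt_le_trans S1 Hc.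
have c0 : c != 0 by apply/eqP => c0; move: nc; rewrite c0 Normc.normc0 ltxx.
exists (c^-1 *: phi); last by rewrite scalerA divff // scale1r.
apply: HU; rewrite subr0; apply: le_lt_trans (snZ hs _ _ h0) _.
have -> : normc c^-1 = (normc c)^-1.
  apply: (mulfI (lt0r_neq0 nc)); rewrite divff ?lt0r_neq0 // -Normc.normcM divff //.
  exact: Normc.normc1.
rewrite mulrC ltr_pdivrMr // mulrC; apply: lt_le_trans Hc.
by rewrite ltrDl.
Qed.

(** Continuity at 0 bounds u on a ball of one seminorm, and homogeneity extends the bound. *)
Lemma dual_bound u : exists h C, [/\ 0 < h, 0 <= C & forall phi, normc (u phi) <= C * sn h phi].
Proof.
have /nbhs_SigmaP[h [e [h0 e0 H]]] := dual_nbhs u 0 ltr01.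
have H1 phi : sn h phi < e -> normc (u phi) < 1.
  by move=> pe; have := H phi; rewrite subr0 /= dual_0 subr0; exact.
exists h, (2 / e); split=> // [|phi]; first by rewrite ltW // divr_gt0.
have S0 := sn_ge0 phi h0.
(* The seminorm of phi may be 0, so phi is rescaled by means of the slightly larger number m, and
   the excess t is arbitrary. *)
apply/ler_addgt0Pr => t t0; pose m := sn h phi + t * e / 2.
have m0 : 0 < m by rewrite ltr_wpDl // !mulr_gt0.
have -> : 2 / e * sn h phi + t = 2 / e * m by rewrite /m; field; exact: lt0r_neq0.
pose r := 2 / e * m; have r0 : 0 < r by rewrite mulr_gt0 // divr_gt0.
have c0 : r%:C%C != 0 :> R[i] by rewrite -(rmorph0 (real_complex R)) (inj_eq (@complexI R)) gt_eqF.
have -> : phi = r%:C%C *: (r^-1%:C%C *: phi).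
  by rewrite scalerA -rmorphM divff ?gt_eqF // scale1r.
rewrite -[X in u X]addr0 dual_lin dual_0 addr0 Normc.normcM normcR (gtr0_norm r0).
rewrite -/r -[X in _ <= X]mulr1; apply: ler_wpM2l; first exact: ltW.
apply/ltW/H1; apply: le_lt_trans (snZ hs _ _ h0) _.
rewrite normcR ger0_norm ?invr_ge0 ?(ltW r0) // mulrC ltr_pdivrMr //.
have -> : e * r = 2 * m by rewrite /r; field; exact: lt0r_neq0.
rewrite mulrDl mul1r /m; apply: (@lt_le_trans _ _ (sn h phi + t * e / 2)).
  by rewrite ltrDl !mulr_gt0.
by rewrite lerDl ltW.
Qed.

Lemma dual_eq u v : (forall psi, Shalf psi -> u psi = v psi) -> u = v.
Proof.
move=> E; apply/val_inj/funext => phi; apply/eqP; rewrite -subr_eq0; apply/eqP/Normc.eq0_normc.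
apply/eqP; rewrite eq_le normc_ge0 andbT; apply/ler_addgt0Pl => e e0; rewrite addr0.
have e20 : 0 < e / 2 by exact: divr_gt0.
have [psi [/= b b'] Sp] :=
  Shalf_dense hs (filterI (dual_nbhs u phi e20) (dual_nbhs v phi e20)).
have -> : u phi - v phi = - (u psi - u phi) + (v psi - v phi).
  by rewrite (E _ Sp) opprB addrA subrK.
apply: le_trans (le_normcD _ _) _; rewrite normcN; apply/ltW.
by rewrite [e]splitr; exact: ltrD.
Qed.

Lemma SWB_pairing_CD (F : 'rV[R]_d -> R[i]) phi : SWB s F -> CD (fun x => F x * phi x).
Proof.
move=> HF; have [K K0 HK] := sn_bounded d hs ltr01.
exact: (SWB_bounded_CD hs HF (Sigma_smooth hs phi) (HK phi)).
Qed.

Lemma pairing_bound (F : 'rV[R]_d -> R[i]) : SWB s F -> exists2 C, 0 <= C &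
  forall phi, normc (pairing F phi) <= C * sn 1 phi.
Proof.
move=> HF; have [K K0 HK] := sn_bounded d hs ltr01.
have [C1 C10 HC1] := SWB_decay s0 ler01 HF; have [C2 C20 HC2] := expR_wt_dd d s0.
pose C := C1 * C2; have C0 : 0 <= C by exact: mulr_ge0.
have HC x : normc (F x) <= C * dd x.
  apply: le_trans (HC1 x) _; rewrite mul1r /C -mulrA; exact: ler_wpM2l.
exists (2 * (C * K) * Dn R d) => [|phi]; first by rewrite !mulr_ge0 // Dn_ge0.
have := @cint_le R d _ (C * (K * sn 1 phi)) (SWB_pairing_CD phi HF).
have -> : 2 * (C * (K * sn 1 phi)) * Dn R d = 2 * (C * K) * Dn R d * sn 1 phi by ring.
apply=> x; rewrite Normc.normcM mulrAC; apply: ler_pM; rewrite ?normc_ge0 //.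
Qed.

Lemma pairing_lin (F : 'rV[R]_d -> R[i]) c phi psi : SWB s F ->
  pairing F (c *: phi + psi) = c * pairing F phi + pairing F psi.
Proof.
move=> HF; have c1 := SWB_pairing_CD phi HF; have c2 := SWB_pairing_CD psi HF.
rewrite /pairing -cint_Z // -cint_D //; last exact: CD_Z.
apply: eq_cint => x; transitivity (F x * (c * phi x + psi x)); first by [].
by move: (F x) (phi x) (psi x) => a b e; ring.
Qed.

Lemma pairing_dual_subproof (F : 'rV[R]_d -> R[i]) : SWB s F ->
  (fun phi : Sig => pairing F phi) \in @cont_functional R Sig.
Proof.
move=> HF; apply/asboolP; split=> [c phi psi|phi]; first exact: pairing_lin.
have [C C0 HC] := pairing_bound HF; move=> P /nbhs_ballc[e e0 He].
have C1 : 0 < C + 1 by rewrite ltr_wpDl.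
apply/nbhs_SigmaP; exists 1, (e / (C + 1)); split=> [|| psi]; [exact: ltr01|exact: divr_gt0|].
rewrite ltr_pdivlMr // => Hp.
suff : normc (pairing F psi - pairing F phi) < e by exact: He.
have -> : pairing F psi - pairing F phi = pairing F (psi - phi).
  rewrite [in RHS]addrC; have := pairing_lin (-1) phi psi HF.
  by rewrite scaleN1r mulN1r => ->; exact: addrC.
apply: le_lt_trans (HC (psi - phi)) _; apply: le_lt_trans Hp.
by rewrite mulrC; apply: ler_wpM2l; [apply: sn_ge0; exact: ltr01|rewrite lerDl].
Qed.

(** As K phi is the sum of <l_i, phi> psi_i, the functional u o K is given by the function with
    terms u(psi_i) l_i. *)
Lemma finite_rank_dual u k : finite_rank k -> exists2 F, Shalf F &
  forall phi psi, Sigma_fun psi = Kop k phi -> u psi = pairing F phi.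
Proof.
elim=> [|p l k0 sp sl fk [F sF IH]].
  exists 0; first exact: Shalf_0.
  move=> phi psi; rewrite (Kop_0 hs (Sigma_SWB hs phi)) => E.
  have -> : psi = 0 by exact: val_inj.
  rewrite dual_0 pairingC.
  have := pairing_lin (-1) 0 0 (Sigma_SWB hs phi).
  by rewrite scaler0 addr0 mulN1r addNr => <-.
exists ((fun=> u (MkSig hs (Shalf_SWB hs sp))) * l + F).
  by apply: Shalf_D => //; exact: Shalf_Z.
move=> phi psi E; have [C C0 bp] := Sigma_SWB hs phi ltr01.
move: E; rewrite (Kop_add hs (SWB_tensor s0 (Shalf_SWB hs sp) (Shalf_SWB hs sl)) (finite_rank_SWB hs fk) bp).
rewrite (Kop_tensor hs p sl bp) => E.
pose psi1 := MkSig hs (Shalf_SWB hs sp).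
pose psi2 := MkSig hs (Shalf_SWB hs (Shalf_Kop hs fk (Sigma_SWB hs phi))).
have -> : psi = pairing l phi *: psi1 + psi2 by exact/val_inj.
rewrite dual_lin (IH phi psi2) // /pairing.
have c1 := SWB_pairing_CD phi (Shalf_SWB hs sl); have c2 := SWB_pairing_CD phi (Shalf_SWB hs sF).
rewrite mulrC -cint_Z // -cint_D //; last exact: CD_Z.
apply: eq_cint => x; transitivity ((u psi1 * l x + F x) * phi x); last by [].
by rewrite mulrDl mulrA.
Qed.

(** Finite-rank operators with error 1/(n+1) give functionals u o K that tend to u uniformly on
    bounded sets, because the seminorm at h' is bounded there and h' does not depend on n. *)
Lemma Shalf_dense_dual u (A : set (dual Sig)) : nbhs u A ->
  exists v F, [/\ A v, Shalf F & forall phi, v phi = pairing F phi].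
Proof.
have [h [C [h0 C0 HC]]] := dual_bound u; have [h' h'0 Hh] := finite_rank_approx_sn d hs h0.
have C1 : 0 < C + 1 by rewrite ltr_wpDl.
have P n : exists v : dual Sig, (exists2 F, Shalf F & forall phi, v phi = pairing F phi) /\
    forall phi, normc (v phi - u phi) <= n.+1%:R^-1 * sn h' phi.
  have e0 : 0 < n.+1%:R^-1 / (C + 1) by rewrite divr_gt0 // invr_gt0 ltr0n.
  have [k fk Hk] := Hh _ e0; have [F sF HF] := finite_rank_dual u fk.
  exists (MkDual (pairing_dual_subproof (Shalf_SWB hs sF))); split; first by exists F.
  move=> phi /=; pose psi := MkSig hs (Shalf_SWB hs (Shalf_Kop hs fk (Sigma_SWB hs phi))).
  rewrite -(HF phi psi) // -dual_B; apply: le_trans (HC _) _; rewrite snB //.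
  apply: le_trans (ler_wpM2l C0 (Hk phi psi erefl)) _.
  rewrite mulrA; apply: ler_wpM2r; first exact: sn_ge0.
  rewrite mulrA ler_pdivrMr // mulrC; apply: ler_wpM2l; first by rewrite invr_ge0.
  by rewrite lerDl.
have [v_ Hv] := choice P => NA.
have : \forall n \near \oo, A (v_ n).
  apply: (@family_cvg_dual R Sig _ \oo _ v_ u) NA => B e bB e0.
  have [M M0 HM] := vn_bounded_sn h'0 bB.
  exists (Num.truncn (M / e)) => // n /= Hn y By.
  have [_ Hn2] := Hv n; apply: le_lt_trans (Hn2 y) _.
  apply: le_lt_trans (ler_wpM2l _ (HM y By)) _; first by rewrite invr_ge0.
  rewrite mulrC ltr_pdivrMr ?ltr0n // mulrC -ltr_pdivrMr //.
  by apply: lt_le_trans (truncnS_gt _) _; rewrite ler_nat.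
move=> [N _ HN]; have [[F sF HF] _] := Hv N; exists (v_ N), F; split=> //.
by apply: HN => /=.
Qed.

(** The maps agree on a dense set, and evaluation at a point is strongly continuous. *)
Lemma continuous_eq_dual (T T' : dual Sig -> dual Sig) : continuous T -> continuous T' ->
  (forall v F, Shalf F -> (forall phi, v phi = pairing F phi) -> T' v = T v) -> T' =1 T.
Proof.
move=> cT cT' E u; apply: dual_eq => phi _; apply/eqP; rewrite -subr_eq0; apply/eqP/Normc.eq0_normc.
apply/eqP; rewrite eq_le normc_ge0 andbT; apply/ler_addgt0Pl => e e0; rewrite addr0.
have e20 : 0 < e / 2 by exact: divr_gt0.
have N (S : dual Sig -> dual Sig) : continuous S -> nbhs u (S @^-1` [set v : dual Sig | forall y : Sig, [set phi] y ->
    normc (v y - S u y) < e / 2]).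
  by move=> cS; have := cS u => /(_ _ (nbhs_dual_of (S u) (vn_bounded_set1 phi) e20)).
have [v [F [[b b'] sF vF]]] := Shalf_dense_dual (filterI (N T cT) (N T' cT')).
have b1 := b phi erefl; have b2 := b' phi erefl.
have -> : T' u phi - T u phi = - (T' v phi - T' u phi) + (T v phi - T u phi).
  by rewrite (E v F) // opprB addrA subrK.
apply: le_trans (le_normcD _ _) _; rewrite normcN; apply/ltW.
by rewrite [e]splitr; exact: ltrD.
Qed.

End Sigma_dual.

(** * Extension to the spaces and conclusion *)

Section lift.
Variables (R : realType) (s : R) (d : nat) (Phi : ('rV[R]_d -> R[i]) -> 'rV[R]_d -> R[i]).
Local Notation Sig := (SigmaType s d).
Local Notation WBs := (WB xpredT s (fun=> 1)).
Hypothesis hs : 2^-1 < s.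
Hypothesis tP : tame WBs WBs Phi.
Hypothesis linP : forall f g c, SWB s f -> SWB s g ->
  Phi ((fun=> c) * f + g) = (fun=> c) * Phi f + Phi g.

Lemma tame_SWB f : SWB s f -> SWB s (Phi f).
Proof.
move=> Hf h h0; have [h' [K [h'0 K0 HK]]] := tP h0; have [C C0 HC] := Hf h' h'0.
by exists (K * C); [exact: mulr_ge0|exact: HK].
Qed.

Definition Sigma_lift (f : Sig) : Sig := MkSig hs (tame_SWB (Sigma_SWB hs f)).

Lemma Sigma_lift_linear : linear Sigma_lift.
Proof. by move=> c f g; apply/val_inj; exact: linP (Sigma_SWB hs f) (Sigma_SWB hs g). Qed.

HB.instance Definition _ := GRing.isLinear.Build R[i] Sig Sig *:%R Sigma_lift Sigma_lift_linear.

Definition Sigma_map : {linear Sig -> Sig} := Sigma_lift.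

Lemma Sigma_map_continuous : continuous Sigma_map.
Proof.
apply: (@sn_continuous R s d Sigma_map); first exact: linearB.
exact: (tame_sn hs tP).
Qed.

End lift.

Theorem theorem4p10 (R : realType) (d : nat) (A : 'M[R]_d) (s : R)
    (a : 'rV[R]_(d + d) -> R[i]) (hs : 2^-1 < s) (ha : Gamma0_infty s a) :
  continuous_on_Sigma s (Op A (pairing a)) /\
  continuous_on_Sigma_dual s (Op A (pairing a)).
Proof.
have s0 : 0 < s by apply: lt_trans hs; rewrite invr_gt0.
have SG f : GS 2^-1 f -> SWB s f.
  by move=> /(GS_half_Sigma hs) Hf h h0; exact: Sigma_WB hs Hf h0.
have n1 : - 1 * - 1 = 1 :> R by rewrite mulrNN mulr1.
have [q q0 Hb] := Op_symbol_bounds A s0 ha; have [q' q'0 Hb'] := Op_transpose_bounds A s0 ha.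
have tO := tame_op_full (pi_factor R d * pi_factor R d) s0 q0 (mulr1 1) Hb.
have tT := tame_op_full (pi_factor R d * pi_factor R d) s0 q'0 n1 Hb'.
have lO := op_full_lin (pi_factor R d * pi_factor R d) s0 q0 (mulr1 1) Hb.
have lT := op_full_lin (pi_factor R d * pi_factor R d) s0 q'0 n1 Hb'.
split.
  exists (Sigma_map hs tO lO); split; first exact: Sigma_map_continuous.
    by move=> f Sf g Sg; rewrite (Op_funE A s0 ha (SG _ _ Sf) (SG _ _ Sg)).
  move=> T' cT' eT'; apply: (continuous_eq_Sigma hs _ cT'); first exact: Sigma_map_continuous.
  (* The extension property fixes only pairings with functions in S_(1/2), and these separate
     points. *)
  move=> f Sf; apply/eqP; rewrite -subr_eq0; apply/eqP/(pairing_separates hs) => g Sg.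
  have Sf' := Shalf_GS Sf; have Sg' := Shalf_GS Sg.
  have E := eT' f Sf' g Sg'; rewrite (Op_funE A s0 ha (SG _ _ Sf') (SG _ _ Sg')) in E.
  have P := pairing_lin hs (-1) (Sigma_map hs tO lO f) (T' f) (SG _ _ Sg').
  rewrite addrC -scaleN1r P mulN1r (pairingC g (T' f)) E pairingC addrC.
  exact: subrr.
have cL : continuous (Sigma_map hs tT lT) by exact: Sigma_map_continuous.
exists (transpose_map cL); split; first exact: transpose_continuous.
  (* By the transposition identity, the pairing of Op f with g is the value at the transposed image
     of g of the functional given by f. *)
  move=> f Sf u Hu g Sg; rewrite (Op_funE A s0 ha (SG _ _ Sf) (SG _ _ Sg)).
  rewrite (Op_transposeE A s0 ha (SG _ _ Sf) (SG _ _ Sg)) pairingC.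
  exact: Hu.
move=> T' cT' eT'; apply: (continuous_eq_dual hs _ cT'); first exact: transpose_continuous.
(* Both sides are continuous functionals on Sigma_s, so it is enough to test them on S_(1/2). *)
move=> v F sF vF; apply: (dual_eq hs) => psi sp.
rewrite (eT' F (Shalf_GS sF) v vF psi (Shalf_GS sp)).
rewrite (Op_funE A s0 ha (Shalf_SWB hs sF) (Shalf_SWB hs sp)).
rewrite (Op_transposeE A s0 ha (Shalf_SWB hs sF) (Shalf_SWB hs sp)) pairingC.
by rewrite [RHS]vF.
Qed.
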